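(* Let $\tau\in\mathbb H$, $p\in E_\tau\setminus E_\tau[2]$ and fix $k\in\{0,1,2,3\}$. Then $\frac{\omega_k}2$ is a degenerate critical point of $G_p(z)$ if and only if $\wp(p)\in\partial\mathcal B_k$.
   Context: $\mathbb H=\{\tau\in\mathbb C:\operatorname{Im}\tau>0\}$. For $\tau\in\mathbb H$: $\Lambda_\tau=\mathbb Z+\mathbb Z\tau$, $E_\tau=\mathbb C/\Lambda_\tau$ is the flat torus of area $|E_\tau|=\operatorname{Im}\tau$, $\omega_0=0,\omega_1=1,\omega_2=\tau,\omega_3=1+\tau$, and $E_\tau[2]=\{\omega_k/2: k=0,1,2,3\}+\Lambda_\tau$. With $z=x+iy$, $\Delta=\partial_x^2+\partial_y^2$. The Green function $G(z;\tau)$ is the unique function with $-\Delta G=\delta_0-\frac1{|E_\tau|}$ on $E_\tau$ and $\int_{E_\tau}G\,dx\,dy=0$, where $\delta_0$ is the Dirac measure at $0$. Put $G_p(z)=\frac12\big(G(z-p;\tau)+G(z+p;\tau)\big)$; being even, it always has the critical points $\omega_k/2$, $k=0,1,2,3$. A critical point is degenerate if the Hessian determinant $\det D^2G_p$ in the real variables $(x,y)$ vanishes there. $\wp(z)=\wp(z;\tau)$ is the Weierstrass function with periods $\Lambda_\tau$, $\wp'^2=4\wp^3-g_2\wp-g_3$, $e_k=\wp(\frac{\omega_k}2)$ for $k=1,2,3$; $\zeta$ is the (odd) Weierstrass zeta function, $\zeta'=-\wp$, and $\eta_1=2\zeta(\frac12;\tau)$. The sets $\mathcal B_k=\mathcal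 B_k(\tau)\subset\mathbb C$: $\mathcal B_0=\{z\in\mathbb C:|z-(\frac{\pi}{\operatorname{Im}\tau}-\eta_1)|<\frac{\pi}{\operatorname{Im}\tau}\}$, and for $k\in\{1,2,3\}$, with $$\alpha_k=\frac{\frac{\pi}{\operatorname{Im}\tau}-(\eta_1+e_k)}{3e_k^2-\frac{g_2}4},\qquad \beta_k=\frac{\pi}{|3e_k^2-\frac{g_2}4|\operatorname{Im}\tau}>0,$$ $\mathcal B_k=\Big\{z\in\mathbb C:\Big|z-e_k-\frac{\overline{\alpha_k}}{|\alpha_k|^2-\beta_k^2}\Big|<\frac{\beta_k}{||\alpha_k|^2-\beta_k^2|}\Big\}$ if $|\alpha_k|\ne\beta_k$, and $\mathcal B_k=\{z\in\mathbb C:\operatorname{Re}(\alpha_k(z-e_k))>\frac12\}$ if $|\alpha_k|=\beta_k$. $\partial\mathcal B_k$ is the boundary in $\mathbb C$. *)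

(* Defs.v *)
From HB Require Import structures.
From mathcomp Require Import all_boot all_order all_algebra.
From mathcomp Require Import all_classical all_reals all_analysis.
From mathcomp Require Import complex.

Set Implicit Arguments.
Unset Strict Implicit.
Unset Printing Implicit Defensive.

Import Order.TTheory GRing.Theory Num.Theory.
Import numFieldNormedType.Exports.

Local Open Scope classical_set_scope.
Local Open Scope ring_scope.
Local Open Scope complex_scope.

(* Points of the torus E_tau = C / Lambda_tau are given by complex
   representatives, and functions on E_tau are Lambda_tau-periodic functions
   on C. *)

Section Lattice.
Variable R : realType.
Implicit Types (tau z : R[i]) (k : 'I_4).

Definition lattice_point tau (m n : int) : R[i] := m%:~R + n%:~R * tau.

Definition lattice tau : set R[i] :=
  [set z | exists m n : int, z = lattice_point tau m n].

Definition omega tau k : R[i] := nth 0 [:: 0; 1; tau; 1 + tau] k.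

Definition half_period tau k : R[i] := omega tau k / 2.

Definition two_torsion tau : set R[i] :=
  [set z | exists k, lattice tau (z - half_period tau k)].

Definition lattice_periodic T tau (f : R[i] -> T) : Prop :=
  forall w z, lattice tau w -> f (z + w) = f z.

(* All the series below converge absolutely, so their sum over the nonzero
   lattice points is the limit of the sums over the squares
   |m| <= N, |n| <= N.  The topology of C is the one of R[i]^o. *)
Definition lattice_sum tau (f : R[i] -> R[i]) : R[i] :=
  lim ((fun N : nat =>
    \sum_(i < N.*2.+1) \sum_(j < N.*2.+1
        | lattice_point tau (i%:Z - N%:Z) (j%:Z - N%:Z) != 0)
      f (lattice_point tau (i%:Z - N%:Z) (j%:Z - N%:Z))) @ \oo
    : set_system R[i]^o).

Definition wp tau z : R[i] :=
  z ^- 2 + lattice_sum tau (fun w => (z - w) ^- 2 - w ^- 2).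

Definition wzeta tau z : R[i] :=
  z^-1 + lattice_sum tau (fun w => (z - w)^-1 + w^-1 + z / w ^+ 2).

Definition g2 tau : R[i] := 60 * lattice_sum tau (fun w => w ^- 4).

Definition eta1 tau : R[i] := 2 * wzeta tau (1 / 2).

(* Only meaningful for k <> 0, since wp has a pole at omega_0 / 2 = 0. *)
Definition e_ tau k : R[i] := wp tau (half_period tau k).

End Lattice.

Section Plane.
Variable R : realType.
Implicit Types (f : R * R -> R) (F : R[i] -> R) (u : R * R).

Definition to_complex u : R[i] := u.1 +i* u.2.

Definition of_complex (z : R[i]) : R * R := (complex.Re z, complex.Im z).

Definition on_plane F : R * R -> R := F \o to_complex.

Definition partial (i : 'I_2) f : R * R -> R :=
  'D_((if i == 0 then (1, 0) else (0, 1)) : R * R) f.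

Definition laplacian f u : R := \sum_(i < 2) partial i (partial i f) u.

Definition hessian f u : 'M[R]_2 :=
  \matrix_(i < 2, j < 2) partial i (partial j f) u.

Fixpoint Cn (n : nat) f : Prop :=
  if n is m.+1 then (forall u, differentiable f u) /\
                    (forall i, Cn m (partial i f))
  else continuous f.

Definition smooth f : Prop := forall n, Cn n f.

Definition critical_point f u : Prop :=
  differentiable f u /\ forall i, partial i f u = 0.

Definition degenerate_critical_point F (z : R[i]) : Prop :=
  critical_point (on_plane F) (of_complex z) /\
  \det (hessian (on_plane F) (of_complex z)) = 0.

Definition plane_measure := (@lebesgue_measure R \x @lebesgue_measure R)%E.

Definition fundamental_domain (tau : R[i]) : set (R * R) :=
  [set u | exists s t : R, [/\ 0 <= s < 1, 0 <= t < 1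
                             & to_complex u = s%:C + t%:C * tau]].

Definition torus_integral (tau : R[i]) F : R :=
  \int[plane_measure]_(u in fundamental_domain tau) on_plane F u.

(* - Delta G = delta_0 - 1 / |E_tau| holds in the sense of distributions on
   the torus.  Among the functions equal to G almost everywhere, continuity
   outside the lattice selects the one that has pointwise derivatives; its
   value at the lattice points is irrelevant. *)
Record is_green (tau : R[i]) (G : R[i] -> R) : Prop := IsGreen {
  green_periodic : lattice_periodic tau G ;
  green_continuous : forall u, ~ lattice tau (to_complex u) ->
    {for u, continuous (on_plane G)} ;
  green_integrable : plane_measure.-integrable (fundamental_domain tau)
    (EFin \o on_plane G) ;
  green_laplacian : forall phi : R[i] -> R,
    lattice_periodic tau phi -> smooth (on_plane phi) ->
    - torus_integral tau
        (fun z => G z * laplacian (on_plane phi) (of_complex z)) =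
    phi 0 - (complex.Im tau)^-1 * torus_integral tau phi ;
  green_mean0 : torus_integral tau G = 0
}.

Definition green_pair (G : R[i] -> R) (p z : R[i]) : R :=
  (G (z - p) + G (z + p)) / 2.

End Plane.

Section Regions.
Variable R : realType.
Implicit Types (tau : R[i]) (k : 'I_4).

Definition pi_over_area tau : R[i] := (pi / complex.Im tau)%:C.

Definition alpha tau k : R[i] :=
  (pi_over_area tau - (eta1 tau + e_ tau k)) /
  (3 * e_ tau k ^+ 2 - g2 tau / 4).

Definition beta tau k : R[i] :=
  pi_over_area tau / `|3 * e_ tau k ^+ 2 - g2 tau / 4|.

(* Moduli and radii are real elements of R[i], where the order of R[i]
   restricts to the usual one. *)
Definition region tau k : set R[i] :=
  if k == 0 then
    [set z | `|z - (pi_over_area tau - eta1 tau)| < pi_over_area tau]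
  else
    let a := alpha tau k in let b := beta tau k in let e := e_ tau k in
    if `|a| == b then [set z | complex.Re (a * (z - e)) > 1 / 2]
    else [set z | `|z - e - a^* / (`|a| ^+ 2 - b ^+ 2)|
                  < b / `| `|a| ^+ 2 - b ^+ 2 | ].

Definition boundary (A : set R[i]) : set R[i] :=
  closure (A : set R[i]^o) `\` interior (A : set R[i]^o).

End Regions.

(* Submission.v *)
Require Import Defs.
From HB Require Import structures.
From mathcomp Require Import all_boot all_order all_algebra.
From mathcomp Require Import all_classical all_reals all_analysis.
From mathcomp Require Import complex measurable_realfun.
From mathcomp Require Import zify ring lra.

(* Up to the factor -1/(2 pi), G_x - i G_y is the function
   Z(z) = zeta(z) - eta1 z + 2 pi i (Im z)/(Im tau), which is periodic by
   Legendre's relation.  This is checked on Fourier coefficients: those of G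
   follow from the distributional equation tested on characters, those of Z
   from integrating along rows and the residue of zeta at 0, and a Fejer-like
   kernel turns the equality of coefficients into a first-order Taylor
   expansion of G off the lattice.  Hence the Hessian of G_p at w = omega_k/2
   is determined by W = wp(p + w) + eta1, and its determinant vanishes iff
   |W - pi/Im tau| = pi/Im tau.  For k = 0 this is the boundary of a disc.  For
   k <> 0, (wp(z + w) - e_k) (wp(z) - e_k) = 3 e_k^2 - g2/4 <> 0 expresses
   wp(p + w) as a Moebius function of wp(p), and the condition becomes an
   Apollonius circle (or a line) for wp(p).  The elliptic identities rest on a
   Liouville theorem, again obtained from Fourier coefficients. *)

Set Implicit Arguments.
Unset Strict Implicit.
Unset Printing Implicit Defensive.

Import Order.TTheory GRing.Theory Num.Theory.
Import numFieldNormedType.Exports.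
Import ComplexField.Normc.

Local Open Scope classical_set_scope.
Local Open Scope complex_scope.
Local Open Scope ring_scope.

(** The obstacle is regularity: the distributional equation yields only integrals of G against
    smooth periodic functions, while pointwise second derivatives of G_p are wanted. Characters
    suffice as test functions because a smoothing of G is a trigonometric polynomial whose gradient
    comes from the same smoothing of Z, and the mean value theorem for it survives the limit. The
    kernel is a power of cosines: its mass is at least a multiple of (N+1)^-2 while it decays
    geometrically off the lattice, so integrability of G and of Z, whose pole is of order one,
    controls the error. Complex analysis rests on one notion, differentiability with a quadratic
    remainder. It passes to lattice series term by term and makes the integral over a horizontal row
    locally constant in its height, which plays the role of Cauchy's theorem. The constant 3 e_k^2 -
    g2/4 is wp''(omega_k/2)/2. That it is nonzero comes not from counting zeros but from the
    differential equation wp'' = 6 wp^2 - g2/2 on the segment from the half-period to the pole. *)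

(** * Real-valued modulus on the complex numbers *)

Section Modulus.
Variable R : realType.
Implicit Types (z w : R[i]) (r x y : R).

Lemma normc_normr z : `|z| = (normc z)%:C.
Proof. by rewrite normc_def; case: z. Qed.

Lemma normcE z : normc z = Num.sqrt (complex.Re z ^+ 2 + complex.Im z ^+ 2).
Proof. by case: z. Qed.

Lemma normc_ge0 z : 0 <= normc z.
Proof. by rewrite normcE sqrtr_ge0. Qed.

Lemma sqr_normcE z : normc z ^+ 2 = complex.Re z ^+ 2 + complex.Im z ^+ 2.
Proof. by rewrite normcE sqr_sqrtr // addr_ge0 ?sqr_ge0. Qed.

Lemma normc_eq0 z : (normc z == 0) = (z == 0).
Proof. by apply/eqP/eqP => [/eq0_normc//|->]; rewrite normc0. Qed.

Lemma normc_gt0 z : (0 < normc z) = (z != 0).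
Proof. by rewrite lt0r normc_eq0 normc_ge0 andbT. Qed.

Lemma normcX z n : normc (z ^+ n) = normc z ^+ n.
Proof.
elim: n => [|n IH]; first by rewrite !expr0 normc1.
by rewrite !exprS normcM IH.
Qed.

Lemma le_normcB z w : normc (z - w) <= normc z + normc w.
Proof. by rewrite (le_trans (le_normcD _ _))// normcN. Qed.

Lemma lerB_normc z w : normc z - normc w <= normc (z - w).
Proof. by rewrite lerBlDr -{1}(subrK w z) le_normcD. Qed.

Lemma normc_distC z w : normc (z - w) = normc (w - z).
Proof. by rewrite -normcN opprB. Qed.

Lemma normcR r : normc r%:C = `|r|.
Proof. by rewrite normcE /= expr0n addr0 sqrtr_sqr. Qed.

Lemma normc_nat n : normc (n%:R : R[i]) = n%:R.
Proof. by rewrite -(rmorph_nat (real_complex R)) normcR normr_nat. Qed.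

Lemma ler_normRe z : `|complex.Re z| <= normc z.
Proof. by rewrite normcE -sqrtr_sqr ler_wsqrtr // lerDl sqr_ge0. Qed.

Lemma ler_normIm z : `|complex.Im z| <= normc z.
Proof. by rewrite normcE -sqrtr_sqr ler_wsqrtr // lerDr sqr_ge0. Qed.

Lemma normc_le_ReIm z : normc z <= `|complex.Re z| + `|complex.Im z|.
Proof.
rewrite normcE -[leRHS]ger0_norm ?addr_ge0// -sqrtr_sqr ler_wsqrtr //.
rewrite sqrrD !real_normK ?num_real// -addrA lerD2l lerDr.
by rewrite mulrn_wge0 // mulr_ge0.
Qed.

Lemma cReD z w : complex.Re (z + w) = complex.Re z + complex.Re w.
Proof. by case: z w => ? ? []. Qed.
Lemma cImD z w : complex.Im (z + w) = complex.Im z + complex.Im w.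
Proof. by case: z w => ? ? []. Qed.
Lemma cReN z : complex.Re (- z) = - complex.Re z.
Proof. by case: z. Qed.
Lemma cImN z : complex.Im (- z) = - complex.Im z.
Proof. by case: z. Qed.
Lemma cReM z w : complex.Re (z * w) =
  complex.Re z * complex.Re w - complex.Im z * complex.Im w.
Proof. by case: z w => ? ? []. Qed.
Lemma cImM z w : complex.Im (z * w) =
  complex.Re z * complex.Im w + complex.Im z * complex.Re w.
Proof. by case: z w => ? ? []. Qed.
Lemma complex_eqP z w :
  complex.Re z = complex.Re w -> complex.Im z = complex.Im w -> z = w.
Proof. by case: z w => ? ? [? ?] /= -> ->. Qed.

Lemma Re_nat n : complex.Re (n%:R : R[i]) = n%:R.
Proof. by rewrite -(rmorph_nat (real_complex R)). Qed.
Lemma Im_nat n : complex.Im (n%:R : R[i]) = 0.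
Proof. by rewrite -(rmorph_nat (real_complex R)). Qed.
Lemma Re_int (n : int) : complex.Re (n%:~R : R[i]) = n%:~R.
Proof. by rewrite -(rmorph_int (real_complex R)). Qed.
Lemma Im_int (n : int) : complex.Im (n%:~R : R[i]) = 0.
Proof. by rewrite -(rmorph_int (real_complex R)). Qed.

Lemma cvg_complex (u : nat -> R[i]) (a : R[i]) :
  (fun N => complex.Re (u N)) @ \oo --> complex.Re a ->
  (fun N => complex.Im (u N)) @ \oo --> complex.Im a ->
  (u : nat -> R[i]^o) @ \oo --> (a : R[i]^o).
Proof.
move=> uRe uIm; apply/cvgrPdist_lt => e.
rewrite ltcE /= => /andP[/eqP ei e0].
have e2 : 0 < complex.Re e / 2 by rewrite divr_gt0.
move/cvgrPdist_lt/(_ _ e2) : uRe => uRe.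
move/cvgrPdist_lt/(_ _ e2) : uIm => uIm.
near=> N.
have hr : `|complex.Re a - complex.Re (u N)| < complex.Re e / 2 by near: N.
have hi : `|complex.Im a - complex.Im (u N)| < complex.Re e / 2 by near: N.
rewrite normc_normr ltcE /= ei eqxx/=.
apply: le_lt_trans (normc_le_ReIm _) _.
rewrite cReD cReN cImD cImN [ltRHS](splitr (complex.Re e)).
exact: ltrD.
Unshelve. all: by end_near. Qed.

Lemma lim_complex (u : nat -> R[i]) (a : R[i]) :
  (fun N => complex.Re (u N)) @ \oo --> complex.Re a ->
  (fun N => complex.Im (u N)) @ \oo --> complex.Im a ->
  lim (u @ \oo : set_system R[i]^o) = a.
Proof.
by move=> ur ui; apply/(@cvg_lim R[i]^o) => //; exact: cvg_complex.
Qed.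

End Modulus.

(** * Limits of complex sequences *)

Section ComplexSequences.
Variable R : realType.
Implicit Types (u v : nat -> R[i]) (a b : R[i]).

(** Convergence with real epsilons; [ctends_lim] translates it into the [lim] of [R[i]^o] that
    [lattice_sum] uses. *)
Definition ctends u a := forall e : R, 0 < e ->
  exists N0, forall N, (N0 <= N)%N -> normc (u N - a) < e.

Lemma ctends_cst a : ctends (fun=> a) a.
Proof. by move=> e e0; exists 0%N => N _; rewrite subrr normc0. Qed.

Lemma ctendsD u v a b : ctends u a -> ctends v b ->
  ctends (fun N => u N + v N) (a + b).
Proof.
move=> ua vb e e0.
have e2 : 0 < e / 2 by rewrite divr_gt0.
have [N1 h1] := ua _ e2; have [N2 h2] := vb _ e2.
exists (maxn N1 N2) => N; rewrite geq_max => /andP[/h1 {}h1 /h2 {}h2].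
rewrite opprD addrACA (le_lt_trans (le_normcD _ _))//.
by rewrite [ltRHS](splitr e) ltrD.
Qed.

Lemma ctendsZ c u a : ctends u a -> ctends (fun N => c * u N) (c * a).
Proof.
move=> ua e e0.
have c1 : 0 < normc c + 1 by rewrite ltr_wpDl ?normc_ge0.
have [N1 h1] := ua _ (divr_gt0 e0 c1).
exists N1 => N /h1; rewrite -mulrBr normcM ltr_pdivlMr// => /(le_lt_trans _); apply.
by rewrite mulrC ler_wpM2l ?normc_ge0// lerDl.
Qed.

Lemma ctendsN u a : ctends u a -> ctends (fun N => - u N) (- a).
Proof.
move=> /(ctendsZ (-1)); rewrite mulN1r.
by under [X in ctends X _]eq_fun do rewrite mulN1r.
Qed.

Lemma ctendsB u v a b : ctends u a -> ctends v b ->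
  ctends (fun N => u N - v N) (a - b).
Proof. by move=> ua vb; apply: ctendsD => //; exact: ctendsN. Qed.

Lemma ctends_bound u a (M : R) : (forall N, normc (u N) <= M) -> ctends u a ->
  normc a <= M.
Proof.
move=> uM ua; apply/ler_addgt0Pr => e e0.
have [N1 /(_ _ (leqnn N1)) h1] := ua _ e0.
rewrite -(subrK (u N1) a) addrC (le_trans (le_normcD _ _))// lerD//.
by rewrite normc_distC ltW.
Qed.

Lemma ctends_small u a b : ctends u a ->
  (forall e : R, 0 < e -> exists N, forall k, (N <= k)%N -> normc (u k - b) < e) ->
  a = b.
Proof.
move=> ua ub; apply/eqP; rewrite -subr_eq0 -normc_eq0 eq_le normc_ge0 andbT.
apply/ler_addgt0Pr => e e0; rewrite add0r.
have e2 : 0 < e / 2 by rewrite divr_gt0.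
have [N1 h1] := ua _ e2; have [N2 h2] := ub _ e2.
have := h1 _ (leq_maxl N1 N2); have := h2 _ (leq_maxr N1 N2).
move=> x1 x2; rewrite -(subrK (u (maxn N1 N2)) a) -addrA.
apply: le_trans (le_normcD _ _) _.
by rewrite [leRHS](splitr e); apply: lerD; rewrite 1?normc_distC ltW// normc_distC.
Qed.

Lemma ctends_unique u a b : ctends u a -> ctends u b -> a = b.
Proof. by move=> ua ub; exact: (ctends_small ua). Qed.

Lemma ctends_inv (C : R) e : 0 < e -> exists N0, forall N, (N0 <= N)%N ->
  C / N.+1%:R < e.
Proof.
move=> e0.
exists (Num.bound (`|C| / e)) => N0 hN0.
rewrite ltr_pdivrMr// (le_lt_trans (ler_norm C))//.
have := archi_boundP (divr_ge0 (normr_ge0 C) (ltW e0)).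
rewrite ltr_pdivrMr// mulrC => /lt_le_trans; apply.
by rewrite ler_wpM2l ?ltW// ltr_nat ltnS.
Qed.

Lemma ctends_lim u a : ctends u a -> lim (u @ \oo : set_system R[i]^o) = a.
Proof.
move=> ua; apply: lim_complex; apply/cvgrPdist_lt => e /ua[N0 hN].
- exists N0 => // N /hN; rewrite distrC; apply: le_lt_trans.
  by rewrite -cReN -cReD ler_normRe.
- exists N0 => // N /hN; rewrite distrC; apply: le_lt_trans.
  by rewrite -cImN -cImD ler_normIm.
Qed.

Lemma ctends_ReIm u (x y : R) : (fun N => complex.Re (u N)) @ \oo --> x ->
  (fun N => complex.Im (u N)) @ \oo --> y -> ctends u (x +i* y).
Proof.
move=> ur ui e e0.
have e2 : 0 < e / 2 by rewrite divr_gt0.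
move/cvgrPdist_lt/(_ _ e2) : ur => [N1 _ h1].
move/cvgrPdist_lt/(_ _ e2) : ui => [N2 _ h2].
exists (maxn N1 N2) => N; rewrite geq_max => /andP[/h1 {}h1 /h2 {}h2].
rewrite (le_lt_trans (normc_le_ReIm _))// cReD cReN cImD cImN.
by rewrite [ltRHS](splitr e) ltrD// distrC.
Qed.

End ComplexSequences.

(** * Sums over symmetric intervals and squares of integers *)

Section SquareSums.
Variable V : zmodType.

Definition symsum N (g : int -> V) : V := \sum_(i < N.*2.+1) g (i%:Z - N%:Z).

Definition sqsum N (F : int -> int -> V) : V :=
  symsum N (fun m => symsum N (F m)).

Lemma symsumS N g : symsum N.+1 g = g (- N.+1%:Z) + symsum N g + g N.+1%:Z.
Proof.
rewrite /symsum doubleS big_ord_recl big_ord_recr/= sub0r -addrA.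
congr (_ + (_ + g _)); last first.
  by rewrite /bump/= add1n -addnn; lia.
by apply: eq_bigr => i _; congr g; rewrite /bump/=; lia.
Qed.

Lemma eq_symsum N (g g' : int -> V) : g =1 g' -> symsum N g = symsum N g'.
Proof. by move=> gg; apply: eq_bigr. Qed.

Lemma symsumD N g g' : symsum N (fun m => g m + g' m) = symsum N g + symsum N g'.
Proof. exact: big_split. Qed.

Lemma symsumB N g g' : symsum N (fun m => g m - g' m) = symsum N g - symsum N g'.
Proof. exact: sumrB. Qed.

Lemma symsum_opp N g : symsum N (fun m => g (- m)) = symsum N g.
Proof.
rewrite /symsum (reindex_inj rev_ord_inj)/=; apply: eq_bigr => i _; congr g.
by move: (nat_of_ord i) (ltn_ord i) => k /=; lia.
Qed.

(** Telescoping: a shift of the window changes only its two end terms. Applied to whole rows of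
    lattice points, this reduces the quasi-periodicity of zeta to a boundary estimate. *)
Lemma symsum_shift N g :
  symsum N (fun m => g (m - 1)) - symsum N g = g (- N.+1%:Z) - g N%:Z.
Proof.
elim: N => [|N IH].
  by rewrite /symsum !big_ord_recl !big_ord0/= !addr0.
rewrite !symsumS.
have -> : - N.+1%:Z - 1 = - N.+2%:Z by lia.
have -> : N.+1%:Z - 1 = N%:Z by lia.
set A := symsum N _ in IH *; set B := symsum N g in IH *.
have -> : A = g (- N.+1%:Z) - g N%:Z + B by rewrite -IH subrK.
have aux (a b c d e : V) : a + (b - c + d) + c - (b + d + e) = a - e.
  have -> : a + (b - c + d) + c = a + (b + d) by rewrite -addrA addrAC subrK.
  by rewrite opprD addrA addrK.
exact: aux.
Qed.

Lemma eq_sqsum N (F G : int -> int -> V) : (forall m n, F m n = G m n) ->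
  sqsum N F = sqsum N G.
Proof. by move=> FG; do 2 apply: eq_symsum => ?. Qed.

Lemma sqsumD N F G : sqsum N (fun m n => F m n + G m n) = sqsum N F + sqsum N G.
Proof. by rewrite -symsumD; apply: eq_symsum => m; rewrite symsumD. Qed.

Lemma sqsum_opp N F : sqsum N (fun m n => F (- m) (- n)) = sqsum N F.
Proof.
rewrite -[RHS](symsum_opp N); apply: eq_symsum => m.
by rewrite -[RHS](symsum_opp N).
Qed.

Lemma sqsum_tr N F : sqsum N (fun m n => F n m) = sqsum N F.
Proof. exact: exchange_big. Qed.

(** The square grows by a frame: two full sides and two sides without their corners, so that no
    corner counts twice. *)
Lemma sqsumS N F : sqsum N.+1 F = sqsum N F +
  (symsum N.+1 (F (- N.+1%:Z)) + symsum N.+1 (F N.+1%:Z) +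
   symsum N (fun m => F m (- N.+1%:Z)) + symsum N (fun m => F m N.+1%:Z)).
Proof.
rewrite /sqsum symsumS.
under [X in _ + symsum N X + _]eq_fun do rewrite symsumS.
rewrite !symsumD.
set a := symsum N.+1 _; set b := symsum N.+1 _; set c := symsum N _.
set d := symsum N _; set e := symsum N _.
by rewrite (addrC c) -!addrA addrCA; do 2 congr (_ + _); rewrite addrA addrC.
Qed.

End SquareSums.

(** * Modulus bounds for finite sums *)

Section NormSums.
Variable R : realType.

Lemma normc_sum (I : Type) (s : seq I) (P : pred I) (F : I -> R[i]) :
  normc (\sum_(i <- s | P i) F i) <= \sum_(i <- s | P i) normc (F i).
Proof.
elim/big_rec2 : _ => [|i y x _ h]; first by rewrite normc0.
by rewrite (le_trans (le_normcD _ _))// lerD2l.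
Qed.

Lemma normc_symsum N (g : int -> R[i]) :
  normc (symsum N g) <= symsum N (fun m => normc (g m)).
Proof. exact: normc_sum. Qed.

Lemma ler_symsum N (g g' : int -> R) : (forall m, g m <= g' m) ->
  symsum N g <= symsum N g'.
Proof. by move=> gg; apply: ler_sum. Qed.

Lemma symsum_cst N (c : R) : symsum N (fun=> c) = N.*2.+1%:R * c.
Proof. by rewrite /symsum sumr_const card_ord mulr_natl. Qed.

Lemma symsum_le_cst N (g : int -> R) c : (forall m, g m <= c) ->
  symsum N g <= N.*2.+1%:R * c.
Proof. by move=> gc; rewrite -symsum_cst; exact: ler_symsum. Qed.

Lemma normc_symsum_le N (g : int -> R[i]) c : (forall m, normc (g m) <= c) ->
  normc (symsum N g) <= N.*2.+1%:R * c.
Proof. by move=> gc; apply: le_trans (normc_symsum _ _) (symsum_le_cst _ _). Qed.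

Lemma symsum_ge0 N (g : int -> R) : (forall m, 0 <= g m) -> 0 <= symsum N g.
Proof. by move=> g0; apply: sumr_ge0. Qed.

End NormSums.

(** * Absolutely convergent sums over the nonzero lattice points *)

Section LatticeSums.
Variables (R : realType) (tau : R[i]).
Hypothesis htau : 0 < complex.Im tau.
Local Notation h := (complex.Im tau).
Local Notation lp := (lattice_point tau).
Implicit Types (m n : int) (f g : R[i] -> R[i]).

Lemma Im_lp m n : complex.Im (lp m n) = n%:~R * h.
Proof. by rewrite cImD cImM Re_int !Im_int; ring. Qed.

Lemma Re_lp m n : complex.Re (lp m n) = m%:~R + n%:~R * complex.Re tau.
Proof. by rewrite cReD cReM !Re_int !Im_int; ring. Qed.

Lemma lp_opp m n : lp (- m) (- n) = - lp m n.
Proof. by rewrite /lattice_point !rmorphN/=; ring. Qed.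

Lemma lp_add m n m' n' : lp m n + lp m' n' = lp (m + m') (n + n').
Proof. by rewrite /lattice_point !rmorphD/=; ring. Qed.

Lemma lp_eq0 m n : (lp m n == 0) = (m == 0) && (n == 0).
Proof.
apply/eqP/andP => [l0|[/eqP-> /eqP->]]; last first.
  by rewrite /lattice_point mul0r addr0.
have : complex.Im (lp m n) = 0 by rewrite l0.
rewrite Im_lp => /eqP; rewrite mulf_eq0 (gt_eqF htau) orbF intr_eq0 => /eqP n0.
have : complex.Re (lp m n) = 0 by rewrite l0.
by rewrite Re_lp n0 mul0r addr0 => /eqP; rewrite intr_eq0 eqxx => ->.
Qed.

(** Comparison of the indices with w = m + n tau: |n| <= |w|/h by the imaginary part, then |m| <=
    |w| + |n||tau|. The constant dominates both bounds. *)
Definition lpK : R := 1 + (1 + normc tau) / h.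

Lemma lpK_gt0 : 0 < lpK.
Proof. by rewrite ltr_wpDr// divr_ge0// ?addr_ge0 ?normc_ge0 ?ltW. Qed.

Lemma lp_ge_n m n : `|n%:~R| <= lpK * normc (lp m n).
Proof.
have := ler_normIm (lp m n); rewrite Im_lp normrM (gtr0_norm htau) => le.
rewrite -(ler_pM2r htau) (le_trans le)//.
have -> : lpK * normc (lp m n) * h = (h + 1 + normc tau) * normc (lp m n).
  by rewrite /lpK; field; exact: lt0r_neq0.
rewrite ler_peMl ?normc_ge0//; move: htau (normc_ge0 tau) => h0; lra.
Qed.

Lemma lp_ge_m m n : `|m%:~R| <= lpK * normc (lp m n).
Proof.
have := ler_normIm (lp m n); rewrite Im_lp normrM (gtr0_norm htau) => le.
have := ler_normRe (lp m n); rewrite Re_lp => le2.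
have le3 : `|m%:~R : R| <= normc (lp m n) + `|n%:~R| * normc tau.
  rewrite -(addrK (n%:~R * complex.Re tau) m%:~R) (le_trans (ler_normB _ _))//.
  by rewrite lerD// normrM ler_wpM2l// ler_normRe.
rewrite (le_trans le3)//.
have -> : lpK * normc (lp m n) =
    normc (lp m n) + normc (lp m n) / h * (1 + normc tau).
  by rewrite /lpK; field; exact: lt0r_neq0.
rewrite lerD2l; apply: ler_pM; rewrite ?normc_ge0//.
  by rewrite ler_pdivlMr.
by rewrite lerDr.
Qed.

Lemma lp_lb m n : lp m n != 0 -> 1 <= lpK * normc (lp m n).
Proof.
have i1 (k : int) : k != 0 -> 1 <= `|k%:~R : R|.
  by move=> k0; rewrite -intr_norm -[1]/(1%:~R) ler_int; lia.
rewrite lp_eq0 negb_and => /orP[m0|n0].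
  exact: le_trans (i1 _ m0) (lp_ge_m _ _).
exact: le_trans (i1 _ n0) (lp_ge_n _ _).
Qed.

(** Extension by 0 at the origin, which turns the conditional sum in [lattice_sum] into a plain
    square sum. *)
Definition nz (V : zmodType) (f : R[i] -> V) m n : V :=
  if lp m n != 0 then f (lp m n) else 0.

Definition cubic w : R := (normc w) ^- 3.

Lemma nz_cubic_ge0 m n : 0 <= nz cubic m n.
Proof. by rewrite /nz; case: ifP => // _; rewrite invr_ge0 exprn_ge0// normc_ge0. Qed.

Lemma le_cubic (N : nat) w : N.+1%:R <= lpK * normc w ->
  cubic w <= lpK ^+ 3 / N.+1%:R ^+ 3.
Proof.
move=> le.
have w0 : 0 < normc w.
  by have := lt_le_trans (ltr0Sn R N) le; rewrite pmulr_rgt0// lpK_gt0.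
rewrite /cubic ler_pdivlMr ?exprn_gt0// mulrC ler_pdivrMr ?exprn_gt0//.
rewrite -exprMn lerXn2r// nnegrE ?ler0n ?mulr_ge0 ?normc_ge0 ?(ltW lpK_gt0)//.
Qed.

Lemma nz_cubic_le_m N m n : `|m| = N.+1 :> int -> nz cubic m n <= lpK ^+ 3 / N.+1%:R ^+ 3.
Proof.
move=> mN; rewrite /nz; case: ifP => [_|_].
  apply: le_cubic; rewrite (le_trans _ (lp_ge_m m n))//.
  by rewrite -intr_norm mN.
by rewrite divr_ge0 ?exprn_ge0// ltW ?lpK_gt0.
Qed.

Lemma nz_cubic_le_n N m n : `|n| = N.+1 :> int -> nz cubic m n <= lpK ^+ 3 / N.+1%:R ^+ 3.
Proof.
move=> mN; rewrite /nz; case: ifP => [_|_].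
  apply: le_cubic; rewrite (le_trans _ (lp_ge_n m n))//.
  by rewrite -intr_norm mN.
by rewrite divr_ge0 ?exprn_ge0// ltW ?lpK_gt0.
Qed.

Definition cubic_bound : R := 16 * lpK ^+ 3.

(** The frame of index N+1 has 8(N+1) points with terms at most K^3/(N+1)^3, and 8/(N+1)^2 <= 16
    (1/(N+1) - 1/(N+2)). The subtracted 1/(N+1) lets the induction telescope. *)
Lemma sqsum_cubic N : sqsum N (nz cubic) <= cubic_bound * (1 - N.+1%:R^-1).
Proof.
elim: N => [|N IH].
  rewrite /sqsum /symsum big_ord1 big_ord1/= /nz.
  have -> : lp (0%:Z - 0%:Z) (0%:Z - 0%:Z) = 0 by apply/eqP; rewrite lp_eq0.
  by rewrite eqxx/= invr1 subrr mulr0.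
rewrite sqsumS.
set c : R := lpK ^+ 3 / N.+1%:R ^+ 3.
have h1 : symsum N.+1 (nz cubic (- N.+1%:Z)) <= N.+1.*2.+1%:R * c.
  by apply: symsum_le_cst => n; apply: nz_cubic_le_m; rewrite normrN.
have h2 : symsum N.+1 (nz cubic (N.+1%:Z)) <= N.+1.*2.+1%:R * c.
  by apply: symsum_le_cst => n; apply: nz_cubic_le_m.
have h3 : symsum N (fun m => nz cubic m (- N.+1%:Z)) <= N.*2.+1%:R * c.
  by apply: symsum_le_cst => n; apply: nz_cubic_le_n; rewrite normrN.
have h4 : symsum N (fun m => nz cubic m (N.+1%:Z)) <= N.*2.+1%:R * c.
  by apply: symsum_le_cst => n; apply: nz_cubic_le_n.
have : sqsum N.+1 (nz cubic) <= cubic_bound * (1 - N.+1%:R^-1) +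
   (N.+1.*2.+1%:R * c + N.+1.*2.+1%:R * c + N.*2.+1%:R * c + N.*2.+1%:R * c).
  by rewrite sqsumS; do !apply: lerD.
rewrite -sqsumS => /le_trans; apply.
rewrite /c /cubic_bound.
have e1 : N.+1.*2.+1%:R = 2 * (N%:R : R) + 3.
  by rewrite -natr1 -mul2n natrM -natr1; ring.
have e2 : N.*2.+1%:R = 2 * (N%:R : R) + 1.
  by rewrite -natr1 -mul2n natrM; ring.
rewrite e1 e2 -[in N.+2%:R]natr1 -[in N.+1%:R]natr1.
have : 0 <= (N%:R : R) by rewrite ler0n.
move: (N%:R : R) => x x0.
have K3 : 0 <= lpK ^+ 3 by rewrite exprn_ge0// ltW ?lpK_gt0.
rewrite -subr_ge0.
rewrite [leRHS](_ : _ = 8 * lpK ^+ 3 * (x / ((x + 1) ^+ 2 * (x + 1 + 1)))).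
  apply: mulr_ge0; first by rewrite mulr_ge0.
  by apply: divr_ge0 => //; apply: mulr_ge0; rewrite ?exprn_ge0//; move: x0; lra.
by field; apply/andP; split; apply: lt0r_neq0; move: x0; lra.
Qed.

Lemma sqsum_cubic_le N : sqsum N (nz cubic) <= cubic_bound.
Proof.
apply: le_trans (sqsum_cubic N) _; rewrite ler_piMr//.
by rewrite mulr_ge0// exprn_ge0// ltW ?lpK_gt0.
Qed.

Lemma sqsum_le_subring N (F G : int -> int -> R) : (forall m n, F m n <= G m n) ->
  sqsum N F <= sqsum N G.
Proof. by move=> FG; do 2 apply: ler_symsum => ?. Qed.

Lemma sqsum_cvg_ge0 (F : int -> int -> R) M : (forall m n, 0 <= F m n) ->
  (forall N, sqsum N F <= M) -> cvgn (fun N => sqsum N F).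
Proof.
move=> F0 FM; apply: nondecreasing_is_cvgn.
  apply/nondecreasing_seqP => N; rewrite sqsumS lerDl !addr_ge0//;
  exact: symsum_ge0.
by exists M => _ [N _ <-].
Qed.

(** Both F + M [cubic] and M [cubic] have nonnegative terms and bounded square sums, hence
    convergent ones; F is their difference. *)
Lemma sqsum_cvg (F : int -> int -> R) M :
  (forall m n, `|F m n| <= M * nz cubic m n) -> cvgn (fun N => sqsum N F).
Proof.
move=> FM.
have M0 m n : 0 <= M * nz cubic m n by exact: le_trans (FM m n).
have -> : (fun N => sqsum N F) = (fun N => sqsum N (fun m n => F m n + M * nz cubic m n)
    - sqsum N (fun m n => M * nz cubic m n)).
  by apply/funext => N; rewrite sqsumD addrK.
have cM N : sqsum N (fun m n => M * nz cubic m n) <= `|M| * cubic_bound.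
  rewrite (@le_trans _ _ (sqsum N (fun m n => `|M| * nz cubic m n)))//.
    by apply: sqsum_le_subring => m n; rewrite ler_wpM2r ?nz_cubic_ge0// ler_norm.
  rewrite /sqsum /symsum; under eq_bigr do rewrite -mulr_sumr.
  by rewrite -mulr_sumr ler_wpM2l//; exact: sqsum_cubic_le.
apply: is_cvgB.
  apply: (@sqsum_cvg_ge0 _ (`|M| * cubic_bound + `|M| * cubic_bound)).
    by move=> m n; have := FM m n; rewrite ler_norml => /andP[]; lra.
  move=> N; rewrite sqsumD lerD// (le_trans _ (cM N))//.
  by apply: sqsum_le_subring => m n; rewrite (le_trans (ler_norm _)).
exact: (@sqsum_cvg_ge0 _ (`|M| * cubic_bound)).
Qed.

Definition lsummable f := exists M, forall m n, lp m n != 0 ->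
  normc (f (lp m n)) <= M * cubic (lp m n).

Lemma Re_sum (I : Type) (s : seq I) (P : pred I) (F : I -> R[i]) :
  complex.Re (\sum_(i <- s | P i) F i) = \sum_(i <- s | P i) complex.Re (F i).
Proof. by elim/big_rec2 : _ => // i y x _ <-; rewrite cReD. Qed.

Lemma Im_sum (I : Type) (s : seq I) (P : pred I) (F : I -> R[i]) :
  complex.Im (\sum_(i <- s | P i) F i) = \sum_(i <- s | P i) complex.Im (F i).
Proof. by elim/big_rec2 : _ => // i y x _ <-; rewrite cImD. Qed.

Lemma lattice_sumE f : lattice_sum tau f =
  lim ((fun N => sqsum N (nz f)) @ \oo : set_system R[i]^o).
Proof.
suff E : (fun N : nat => \sum_(i < N.*2.+1)
    \sum_(j < N.*2.+1 | lp (i%:Z - N%:Z) (j%:Z - N%:Z) != 0)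
      f (lp (i%:Z - N%:Z) (j%:Z - N%:Z))) = (fun N => sqsum N (nz f)).
  by rewrite /lattice_sum E.
apply/funext => N; apply: eq_bigr => i _.
by rewrite big_mkcond.
Qed.

Lemma lattice_sumP f : lsummable f ->
  ctends (fun N => sqsum N (nz f)) (lattice_sum tau f).
Proof.
move=> [M fM].
have nzM m n : normc (nz f m n) <= M * nz cubic m n.
  by rewrite /nz; case: ifP => [/fM//|_]; rewrite normc0 mulr0.
have [x hx] : exists x : R, (fun N => complex.Re (sqsum N (nz f))) @ \oo --> x.
  have /cvg_ex[x hx] := @sqsum_cvg (fun m n => complex.Re (nz f m n)) M
    (fun m n => le_trans (ler_normRe _) (nzM m n)).
  exists x; apply: cvg_trans hx; apply: near_eq_cvg; near=> N.
  by rewrite /sqsum /symsum Re_sum; apply: eq_bigr => i _; rewrite Re_sum.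
have [y hy] : exists x : R, (fun N => complex.Im (sqsum N (nz f))) @ \oo --> x.
  have /cvg_ex[y hy] := @sqsum_cvg (fun m n => complex.Im (nz f m n)) M
    (fun m n => le_trans (ler_normIm _) (nzM m n)).
  exists y; apply: cvg_trans hy; apply: near_eq_cvg; near=> N.
  by rewrite /sqsum /symsum Im_sum; apply: eq_bigr => i _; rewrite Im_sum.
have ct := ctends_ReIm hx hy.
suff -> : lattice_sum tau f = x +i* y by [].
by rewrite -(ctends_lim ct) lattice_sumE.
Unshelve. all: by end_near. Qed.

Lemma lattice_sum_eq f g : (forall m n, lp m n != 0 -> f (lp m n) = g (lp m n)) ->
  lattice_sum tau f = lattice_sum tau g.
Proof.
move=> fg; rewrite !lattice_sumE.
suff -> : (fun N => sqsum N (nz f)) = (fun N => sqsum N (nz g)) by [].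
apply/funext => N; apply: eq_sqsum => m n.
by rewrite /nz; case: ifP => // /fg.
Qed.

Lemma lattice_sum_lim f a : lsummable f ->
  ctends (fun N => sqsum N (nz f)) a -> lattice_sum tau f = a.
Proof. by move=> sf; apply: ctends_unique; exact: lattice_sumP. Qed.

Lemma lsummableD f g : lsummable f -> lsummable g -> lsummable (fun w => f w + g w).
Proof.
move=> [M fM] [M' gM]; exists (M + M') => m n l0.
by rewrite mulrDl (le_trans (le_normcD _ _))// lerD ?fM ?gM.
Qed.

Lemma lsummableZ c f : lsummable f -> lsummable (fun w => c * f w).
Proof.
move=> [M fM]; exists (normc c * M) => m n l0.
by rewrite normcM -mulrA ler_wpM2l ?normc_ge0// fM.
Qed.

Lemma sqsum_nzD N f g :
  sqsum N (nz (fun w => f w + g w)) = sqsum N (nz f) + sqsum N (nz g).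
Proof.
rewrite -sqsumD; apply: eq_sqsum => m n.
by rewrite /nz; case: ifP; rewrite ?addr0.
Qed.

Lemma sqsum_nzZ N c f : sqsum N (nz (fun w => c * f w)) = c * sqsum N (nz f).
Proof.
rewrite /sqsum /symsum mulr_sumr.
apply: eq_bigr => i _; rewrite mulr_sumr; apply: eq_bigr => j _.
by rewrite /nz; case: ifP; rewrite ?mulr0.
Qed.

Lemma lattice_sumD f g : lsummable f -> lsummable g ->
  lattice_sum tau (fun w => f w + g w) = lattice_sum tau f + lattice_sum tau g.
Proof.
move=> sf sg; apply: lattice_sum_lim; first exact: lsummableD.
have := ctendsD (lattice_sumP sf) (lattice_sumP sg).
by congr ctends; apply/funext => N; rewrite sqsum_nzD.
Qed.

Lemma lattice_sumZ c f : lsummable f ->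
  lattice_sum tau (fun w => c * f w) = c * lattice_sum tau f.
Proof.
move=> sf; apply: lattice_sum_lim; first exact: lsummableZ.
have := ctendsZ c (lattice_sumP sf).
by congr ctends; apply/funext => N; rewrite sqsum_nzZ.
Qed.

Lemma lattice_sum_opp f : lsummable f ->
  lattice_sum tau (fun w => f (- w)) = lattice_sum tau f.
Proof.
move=> sf; have [M fM] := sf; apply: lattice_sum_lim.
  exists M => m n l0; rewrite -lp_opp (le_trans (fM _ _ _)) ?lp_opp ?oppr_eq0//.
  by rewrite /cubic normcN.
have := lattice_sumP sf; congr ctends; apply/funext => N.
rewrite -sqsum_opp; apply: eq_sqsum => m n.
by rewrite /nz lp_opp oppr_eq0.
Qed.

Lemma normc_lattice_sum f M : 0 <= M ->
  (forall m n, lp m n != 0 -> normc (f (lp m n)) <= M * cubic (lp m n)) ->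
  normc (lattice_sum tau f) <= M * cubic_bound.
Proof.
move=> M0 fM; apply: ctends_bound (lattice_sumP _); last by exists M.
move=> N; apply: le_trans (normc_sum _ _ _) _.
apply: le_trans (_ : _ <= M * sqsum N (nz cubic)) _; last first.
  by rewrite ler_wpM2l// sqsum_cubic_le.
rewrite /sqsum /symsum mulr_sumr; apply: ler_sum => i _.
rewrite mulr_sumr (le_trans (normc_sum _ _ _))//; apply: ler_sum => j _.
by rewrite /nz; case: ifP => [/fM//|_]; rewrite normc0 mulr0.
Qed.

End LatticeSums.

(** * Complex differentiability with a uniform quadratic remainder *)

Section Holomorphy.
Variable R : realType.
Implicit Types (z w u v : R[i]) (S : set R[i]) (f g d e : R[i] -> R[i]).

Definition away S (r : R) z := forall w, S w -> r <= normc (z - w).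

(* Complex differentiability with a quadratic remainder, uniform on the part of
   a disc that keeps a positive distance from the singular set [S]. *)
Definition hol S f d := forall r B : R, 0 < r -> exists M, forall z,
  normc z <= B -> away S r z ->
  [/\ normc (f z) <= M, normc (d z) <= M &
      forall u, normc u <= r / 2 ->
        normc (f (z + u) - f z - u * d z) <= M * normc u ^+ 2].

Lemma awayW S r r' z : r' <= r -> away S r z -> away S r' z.
Proof. by move=> rr h w /h; exact: le_trans. Qed.

Lemma away_notin S r z : 0 < r -> away S r z -> ~ S z.
Proof. by move=> r0 h /h; rewrite subrr normc0 leNgt r0. Qed.

Lemma away_add S r z u : away S r z -> normc u <= r / 2 -> away S (r / 2) (z + u).
Proof.
move=> h ur w /h rw.
have : normc (z - w) <= normc (z + u - w) + normc u.
  have -> : z - w = z + u - w - u by ring.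
  exact: le_normcB.
by move: rw ur; lra.
Qed.

Lemma hol_ge0 S f d r B : hol S f d -> 0 < r -> exists M, 0 <= M /\ forall z,
  normc z <= B -> away S r z ->
  [/\ normc (f z) <= M, normc (d z) <= M &
      forall u, normc u <= r / 2 ->
        normc (f (z + u) - f z - u * d z) <= M * normc u ^+ 2].
Proof.
move=> h r0; have [M hM] := h _ B r0; exists `|M|; split => // z zB za.
have [h1 h2 h3] := hM _ zB za; have MM := ler_norm M.
split; rewrite ?(le_trans h1)// ?(le_trans h2)// => u /h3 /le_trans; apply.
by rewrite ler_wpM2r// exprn_ge0// normc_ge0.
Qed.

Lemma hol_incl S S' f d : S `<=` S' -> hol S f d -> hol S' f d.
Proof.
move=> SS h r B r0; have [M hM] := h r B r0; exists M => z zB za.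
by apply: hM => // w /SS; exact: za.
Qed.

Lemma hol_ext S f d g e : (forall r z, 0 < r -> away S r z -> f z = g z) ->
  (forall r z, 0 < r -> away S r z -> d z = e z) -> hol S f d -> hol S g e.
Proof.
move=> fg de h r B r0; have [M hM] := h r B r0; exists M => z zB za.
rewrite -(fg r)// -(de r)//; have [h1 h2 h3] := hM _ zB za; split => // u ur.
have r2 : 0 < r / 2 by rewrite divr_gt0.
by rewrite -(fg _ _ r2 (away_add za ur)); exact: h3.
Qed.

Lemma hol_cst S c : hol S (fun=> c) (fun=> 0).
Proof.
move=> r B r0; exists (normc c) => z zB za; split; rewrite ?normc0 ?normc_ge0//.
by move=> u _; rewrite mulr0 subrr subr0 normc0 mulr_ge0// ?exprn_ge0 ?normc_ge0.
Qed.

Lemma hol_id S : hol S id (fun=> 1).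
Proof.
move=> r B r0; exists (`|B| + 1) => z zB za; split; rewrite ?normc1 ?lerDr//.
  by rewrite (le_trans zB)// (le_trans (ler_norm _))// lerDl.
move=> u _; have -> : id (z + u) - id z - u * 1 = 0 by rewrite /=; ring.
by rewrite normc0 mulr_ge0// ?exprn_ge0 ?normc_ge0// addr_ge0.
Qed.

Lemma holD S f d g e : hol S f d -> hol S g e ->
  hol S (fun z => f z + g z) (fun z => d z + e z).
Proof.
move=> hf hg r B r0; have [M hM] := hf r B r0; have [N hN] := hg r B r0.
exists (M + N) => z zB za.
have [h1 h2 h3] := hM _ zB za; have [k1 k2 k3] := hN _ zB za.
split; rewrite ?(le_trans (le_normcD _ _))// ?lerD// => u ur.
have -> : f (z + u) + g (z + u) - (f z + g z) - u * (d z + e z) =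
  (f (z + u) - f z - u * d z) + (g (z + u) - g z - u * e z) by ring.
by rewrite (le_trans (le_normcD _ _))// mulrDl lerD ?h3 ?k3.
Qed.

Lemma holM S f d g e : hol S f d -> hol S g e ->
  hol S (fun z => f z * g z) (fun z => d z * g z + f z * e z).
Proof.
move=> hf hg r B r0; have [M [M0 hM]] := hol_ge0 B hf r0.
have [N [N0 hN]] := hol_ge0 B hg r0.
(* For |u| <= r/2 the expansion of g bounds |g (z + u)| by [N'] and |g (z + u) - g z| by [L] |u|. *)
pose N' := N + r / 2 * N + N * (r / 2) ^+ 2.
pose L := N + N * (r / 2).
have r20 : 0 <= r / 2 by rewrite divr_ge0// ltW.
have N'0 : 0 <= N' by rewrite /N' !addr_ge0// mulr_ge0// exprn_ge0.
have L0 : 0 <= L by rewrite /L addr_ge0// mulr_ge0.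
exists (M * N + M * N + (M * N' + M * N + M * L)) => z zB za.
have [h1 h2 h3] := hM _ zB za; have [k1 k2 k3] := hN _ zB za.
have C0 : 0 <= M * N' + M * N + M * L by rewrite !addr_ge0// mulr_ge0.
have MN0 : 0 <= M * N by rewrite mulr_ge0.
split.
- by rewrite normcM (@le_trans _ _ (M * N))// ?ler_pM ?normc_ge0//; lra.
- rewrite (le_trans (le_normcD _ _))// !normcM -[leLHS]addr0 lerD// lerD//;
    by rewrite ler_pM ?normc_ge0.
move=> u ur.
have -> : f (z + u) * g (z + u) - f z * g z - u * (d z * g z + f z * e z) =
  (f (z + u) - f z - u * d z) * g (z + u) + f z * (g (z + u) - g z - u * e z) +
  u * d z * (g (z + u) - g z) by ring.
have gu : normc (g (z + u) - g z) <= L * normc u.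
  have -> : g (z + u) - g z = (g (z + u) - g z - u * e z) + u * e z by ring.
  rewrite (le_trans (le_normcD _ _))// /L mulrDl addrC normcM lerD//.
    by rewrite mulrC ler_wpM2r ?normc_ge0.
  rewrite (le_trans (k3 _ ur))// expr2 mulrA ler_wpM2r ?normc_ge0//.
  by rewrite ler_wpM2l.
have gzu : normc (g (z + u)) <= N'.
  have -> : g (z + u) = g z + u * e z + (g (z + u) - g z - u * e z) by ring.
  rewrite (le_trans (le_normcD _ _))// lerD//.
    by rewrite (le_trans (le_normcD _ _))// lerD// normcM ler_pM ?normc_ge0.
  by rewrite (le_trans (k3 _ ur))// ler_wpM2l// lerXn2r// ?nnegrE ?normc_ge0.
rewrite (@le_trans _ _ ((M * N' + M * N + M * L) * normc u ^+ 2))//; last first.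
  by rewrite ler_wpM2r ?exprn_ge0 ?normc_ge0// lerDr addr_ge0.
rewrite (le_trans (le_normcD _ _))// [leRHS]mulrDl lerD//.
  rewrite (le_trans (le_normcD _ _))// [leRHS]mulrDl lerD// normcM.
    by rewrite mulrAC ler_pM ?normc_ge0// h3.
  by rewrite -mulrA ler_pM ?normc_ge0// k3.
have -> : M * L * normc u ^+ 2 = normc u * M * (L * normc u) by ring.
by rewrite !normcM ler_pM ?normc_ge0// ?mulr_ge0 ?normc_ge0// ler_wpM2l ?normc_ge0.
Qed.

Lemma holZ S c f d : hol S f d -> hol S (fun z => c * f z) (fun z => c * d z).
Proof.
move=> /(holM (hol_cst S c)); apply: hol_ext => _ z _ _ //.
by rewrite mul0r add0r.
Qed.

Lemma holN S f d : hol S f d -> hol S (fun z => - f z) (fun z => - d z).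
Proof. by move=> /(holZ (-1)); apply: hol_ext => _ z _ _; rewrite mulN1r. Qed.

Lemma holB S f d g e : hol S f d -> hol S g e ->
  hol S (fun z => f z - g z) (fun z => d z - e z).
Proof. by move=> hf /holN; exact: holD. Qed.

Lemma holX S f d n : hol S f d ->
  hol S (fun z => f z ^+ n) (fun z => n%:R * f z ^+ n.-1 * d z).
Proof.
move=> hf; elim: n => [|n IH].
  by apply: hol_ext (hol_cst S 1) => _ z _ _ //; rewrite !mul0r.
apply: hol_ext (holM hf IH) => _ z _ _; first by rewrite exprS.
case: n {IH} => [|n]; first by rewrite /= expr0; ring.
by rewrite /= exprS -[in RHS]natr1; ring.
Qed.

Lemma hol_shift S S' v f d : (forall w, S w -> S' (w - v)) -> hol S f d ->
  hol S' (fun z => f (z + v)) (fun z => d (z + v)).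
Proof.
move=> SS h r B r0; have [M hM] := h r (B + normc v) r0; exists M => z zB za.
have zvB : normc (z + v) <= B + normc v by rewrite (le_trans (le_normcD _ _))// lerD2r.
have zva : away S r (z + v).
  by move=> w /SS /za; have -> : z - (w - v) = z + v - w by ring.
have [h1 h2 h3] := hM _ zvB zva; split => // u ur.
by have := h3 _ ur; rewrite (addrAC z v).
Qed.

Lemma hol_inv : hol [set 0] (fun z => z^-1) (fun z => - z ^- 2).
Proof.
move=> r B r0.
exists (r^-1 + r^-1 ^+ 2 + 2 * r^-1 ^+ 3) => z zB za.
have rz : r <= normc z by have := za 0 erefl; rewrite subr0.
have nz : normc z^-1 <= r^-1.
  by rewrite normcV lef_pV2// posrE (lt_le_trans r0).
have r'0 : 0 <= r^-1 by rewrite invr_ge0 ltW.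
have r2 : 0 <= r^-1 ^+ 2 by rewrite exprn_ge0.
have r3 : 0 <= 2 * r^-1 ^+ 3 by rewrite mulr_ge0// exprn_ge0.
split.
- by rewrite (le_trans nz)//; lra.
- rewrite normcN -exprVn normcX (@le_trans _ _ (r^-1 ^+ 2))//; last by lra.
  by rewrite lerXn2r ?nnegrE ?normc_ge0.
move=> u ur.
have rzu : r / 2 <= normc (z + u).
  by have := away_add za ur erefl; rewrite subr0.
have z0 : z != 0 by rewrite -normc_gt0 (lt_le_trans r0).
have zu0 : z + u != 0 by rewrite -normc_gt0 (lt_le_trans _ rzu)// divr_gt0.
have -> : (z + u)^-1 - z^-1 - u * - z ^- 2 = u ^+ 2 * (z^-1 ^+ 2 * (z + u)^-1).
  by field; rewrite zu0.
rewrite normcM normcX mulrC ler_wpM2r ?exprn_ge0 ?normc_ge0//.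
rewrite normcM normcX (@le_trans _ _ (r^-1 ^+ 2 * (2 * r^-1)))//; last by lra.
rewrite ler_pM ?exprn_ge0 ?normc_ge0 ?lerXn2r ?nnegrE ?normc_ge0//.
rewrite normcV -[2]invrK -invfM lef_pV2 ?posrE ?mulr_gt0// ?invr_gt0// 1?mulrC//.
by rewrite (lt_le_trans _ rzu)// divr_gt0.
Qed.

(** At a small real increment t the two expansions differ by t (d z - e z), which is therefore
    O(t^2). *)
Lemma hol_unique S f d e z r : hol S f d -> hol S f e -> 0 < r -> away S r z ->
  d z = e z.
Proof.
move=> hd he r0 za; have [M [M0 hM]] := hol_ge0 (normc z) hd r0.
have [N [N0 hN]] := hol_ge0 (normc z) he r0.
have [_ _ h3] := hM _ (lexx _) za; have [_ _ k3] := hN _ (lexx _) za.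
apply/eqP; rewrite -subr_eq0 -normc_eq0 eq_le normc_ge0 andbT.
apply/ler_addgt0Pr => x x0; rewrite add0r.
pose t := Num.min (r / 2) (x / (M + N + 1)).
have MN0 : 0 < M + N + 1 by rewrite ltr_wpDl// addr_ge0.
have t0 : 0 < t by rewrite lt_min !divr_gt0.
have nt : normc t%:C = t by rewrite normcR gtr0_norm.
have tr : normc t%:C <= r / 2 by rewrite nt ge_min lexx.
have : normc (t%:C * (d z - e z)) <= (M + N) * t ^+ 2.
  have -> : t%:C * (d z - e z) = (f (z + t%:C) - f z - t%:C * e z) -
     (f (z + t%:C) - f z - t%:C * d z) by ring.
  rewrite (le_trans (le_normcB _ _))// mulrDl addrC lerD//.
    by have := h3 _ tr; rewrite nt.
  by have := k3 _ tr; rewrite nt.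
rewrite normcM nt expr2 mulrA [leRHS]mulrC ler_pM2l// => /le_trans; apply.
rewrite (@le_trans _ _ ((M + N + 1) * t))//.
  by rewrite ler_wpM2r ?ltW// ltrDl.
by rewrite mulrC -ler_pdivlMr// ge_min lexx orbT.
Qed.

Lemma hol_lip S f d r B : hol S f d -> 0 < r -> exists M, 0 <= M /\ forall z,
  normc z <= B -> away S r z -> forall u, normc u <= r / 2 ->
    normc (f (z + u) - f z) <= M * normc u.
Proof.
move=> hf r0; have [M [M0 hM]] := hol_ge0 B hf r0.
exists (M + M * (r / 2)); split; first by rewrite addr_ge0// mulr_ge0// divr_ge0// ltW.
move=> z zB za u ur; have [_ h2 h3] := hM _ zB za.
have -> : f (z + u) - f z = u * d z + (f (z + u) - f z - u * d z) by ring.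
rewrite (le_trans (le_normcD _ _))// mulrDl normcM lerD//.
  by rewrite mulrC ler_wpM2r ?normc_ge0.
rewrite (le_trans (h3 _ ur))// expr2 mulrA ler_wpM2r ?normc_ge0//.
by rewrite ler_wpM2l.
Qed.

End Holomorphy.

(** * The regular parts of the Weierstrass series *)

Section WeierstrassSeries.
Variables (R : realType) (tau : R[i]).
Hypothesis htau : 0 < complex.Im tau.
Local Notation h := (complex.Im tau).
Local Notation lp := (lattice_point tau).
Local Notation K := (lpK tau).
Local Notation L := (lattice_sum tau).
Implicit Types (z u w : R[i]).

(** Singular set of the regular parts [zeta_reg], [wp_reg] and [eis_reg], which are holomorphic at
    0; the polar term at 0 is added separately. *)
Definition lattice0 : set R[i] :=
  [set w | exists m n, w = lp m n /\ w != 0].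

Lemma lattice0_lp m n : lp m n != 0 -> lattice0 (lp m n).
Proof. by move=> l0; exists m, n. Qed.

Lemma lattice0_sub : lattice0 `<=` lattice tau.
Proof. by move=> w [m [n [-> _]]]; exists m, n. Qed.

Lemma lattice0_lb w : lattice0 w -> 1 <= K * normc w.
Proof. by move=> [m [n [-> l0]]]; exact: lp_lb. Qed.

(* [decay r B k f] : [f z u w = O(|w|^-k)] over the nonzero lattice points
   [w], uniformly in [z] and [u]. *)
Definition decay (r B : R) k (f : R[i] -> R[i] -> R[i] -> R[i]) :=
  exists C, 0 <= C /\ forall z u w, normc z <= B -> away lattice0 r z ->
    normc u <= r / 2 -> lattice0 w -> normc (f z u w) <= C * (normc w)^-1 ^+ k.

Section Decay.
Variables (r B : R).
Hypothesis r0 : 0 < r.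
Local Notation decay := (decay r B).

Lemma ninv_ge0 w : 0 <= (normc w)^-1.
Proof. by rewrite invr_ge0 normc_ge0. Qed.

Lemma decayM j k f g : decay j f -> decay k g ->
  decay (j + k) (fun z u w => f z u w * g z u w).
Proof.
move=> [C [C0 hC]] [D [D0 hD]]; exists (C * D); split; first exact: mulr_ge0.
move=> z u w zB za ur wl; rewrite normcM exprD mulrACA.
by rewrite ler_pM ?normc_ge0 ?hC ?hD.
Qed.

Lemma decayD k f g : decay k f -> decay k g ->
  decay k (fun z u w => f z u w + g z u w).
Proof.
move=> [C [C0 hC]] [D [D0 hD]]; exists (C + D); split; first exact: addr_ge0.
move=> z u w zB za ur wl; rewrite mulrDl (le_trans (le_normcD _ _))//.
by rewrite lerD ?hC ?hD.
Qed.

Lemma decay_cst c : decay 0 (fun _ _ _ => c).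
Proof.
exists (normc c); split; first exact: normc_ge0.
by move=> *; rewrite expr0 mulr1.
Qed.

Lemma decayN k f : decay k f -> decay k (fun z u w => - f z u w).
Proof.
by move=> [C [C0 hC]]; exists C; split => // z u w zB za ur wl; rewrite normcN hC.
Qed.

Lemma decayX j n f : decay j f -> decay (n * j) (fun z u w => f z u w ^+ n).
Proof.
move=> hf; elim: n => [|n IH].
  by have [C [C0 hC]] := decay_cst 1; exists C; split => // z u w *; rewrite expr0 hC.
by have [C [C0 hC]] := decayM hf IH; exists C; split => // z u w *; rewrite exprS hC.
Qed.

Lemma decayW j k f : (j <= k)%N -> decay k f -> decay j f.
Proof.
move=> jk [C [C0 hC]]; exists (C * K ^+ (k - j)).
have K0 := ltW (lpK_gt0 htau).
split; first by rewrite mulr_ge0// exprn_ge0.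
move=> z u w zB za ur wl; rewrite (le_trans (hC _ _ _ _ _ _ _))// -mulrA.
rewrite ler_wpM2l// -{1}(subnK jk) exprD ler_wpM2r ?exprn_ge0 ?ninv_ge0//.
rewrite lerXn2r ?nnegrE ?ninv_ge0//.
have w0 : 0 < normc w.
  by case: wl => [m [n [_ w0]]]; rewrite normc_gt0.
by rewrite -[leLHS]mul1r ler_pdivrMr// lattice0_lb.
Qed.

Lemma decay_z : decay 0 (fun z _ _ => z).
Proof.
exists `|B|; split => // z u w zB _ _ _; rewrite expr0 mulr1.
by rewrite (le_trans zB)// ler_norm.
Qed.

Lemma decay_w : decay 1 (fun _ _ w => w^-1).
Proof. by exists 1; split => // z u w _ _ _ _; rewrite mul1r expr1 normcV. Qed.

(** Either |w| >= 2D, and then |v - w| >= |w|/2, or |w| < 2D, and the distance s bounds the inverse.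
    The two summands of the constant belong to these cases. *)
Lemma inv_sub_le (D s : R) v w : 0 < s -> 0 <= D -> normc v <= D -> lattice0 w ->
  s <= normc (v - w) -> normc (v - w)^-1 <= (2 + 2 * D / s) * (normc w)^-1.
Proof.
move=> s0 D0 vD wl sv.
have w0 : 0 < normc w by case: wl => [m [n [_ w0]]]; rewrite normc_gt0.
have vw0 : 0 < normc (v - w) by exact: lt_le_trans sv.
rewrite normcV ler_pdivlMr// ler_pdivrMl// mulrDr.
have tri : normc w <= normc (v - w) + normc v.
  by have := le_normcB v (v - w); rewrite (_ : v - (v - w) = w) 1?addrC//; ring.
have [hw|hw] := leP (2 * D) (normc w).
  have : 0 <= normc (v - w) * (2 * D / s).
    by rewrite !mulr_ge0// ?invr_ge0 ltW.
  by move: tri vD hw; lra.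
rewrite (@le_trans _ _ (2 * D))//; first by move: hw => /ltW.
rewrite (@le_trans _ _ (normc (v - w) * (2 * D / s)))//; last first.
  by rewrite lerDr mulr_ge0// ltW.
have -> : normc (v - w) * (2 * D / s) = 2 * D * (normc (v - w) / s) by ring.
by rewrite ler_peMr ?mulr_ge0// ler_pdivlMr// mul1r.
Qed.

Lemma decay_x : decay 1 (fun z _ w => (z - w)^-1).
Proof.
exists (2 + 2 * `|B| / r); split.
  by rewrite addr_ge0// divr_ge0// ?mulr_ge0// ltW.
move=> z u w zB za _ wl; rewrite expr1; apply: inv_sub_le => //.
  by rewrite (le_trans zB)// ler_norm.
exact: za.
Qed.

Lemma decay_y : decay 1 (fun z u w => (z + u - w)^-1).
Proof.
have r2 : 0 < r / 2 by rewrite divr_gt0.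
exists (2 + 2 * (`|B| + r / 2) / (r / 2)); split.
  by rewrite addr_ge0// divr_ge0// ?mulr_ge0// ?addr_ge0// ltW.
move=> z u w zB za ur wl; rewrite expr1; apply: inv_sub_le => //.
- by rewrite addr_ge0// ltW.
- by rewrite (le_trans (le_normcD _ _))// lerD// (le_trans zB)// ler_norm.
- exact: (away_add za ur).
Qed.

End Decay.

Lemma decay_cubic r B f : decay r B 3 f -> exists C, 0 <= C /\
  forall z u m n, normc z <= B -> away lattice0 r z -> normc u <= r / 2 ->
    lp m n != 0 -> normc (f z u (lp m n)) <= C * cubic (lp m n).
Proof.
move=> [C [C0 hC]]; exists C; split => // z u m n zB za ur l0.
by rewrite /cubic -exprVn hC//; exact: lattice0_lp.
Qed.

Lemma decay_lsummable r B f z u : decay r B 3 f -> normc z <= B ->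
  away lattice0 r z -> normc u <= r / 2 -> lsummable tau (f z u).
Proof.
move=> /decay_cubic[C [C0 hC]] zB za ur; exists C => m n l0; exact: hC.
Qed.

(** Termwise differentiation: each term has an exact second-order expansion whose three coefficients
    are O(|w|^-3) uniformly, so the expansion can be summed as it stands. *)
Lemma hol_lattice_sum (T T' : R[i] -> R[i] -> R[i])
    (Rem : R[i] -> R[i] -> R[i] -> R[i]) :
  (forall r B, 0 < r -> [/\ decay r B 3 (fun z _ w => T z w),
     decay r B 3 (fun z _ w => T' z w) & decay r B 3 Rem]) ->
  (forall r z u w, 0 < r -> away lattice0 r z -> normc u <= r / 2 -> lattice0 w ->
     T (z + u) w = T z w + u * T' z w + u ^+ 2 * Rem z u w) ->
  hol lattice0 (fun z => L (T z)) (fun z => L (T' z)).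
Proof.
move=> hb hT r B r0; have [bT bT' bR] := hb r B r0.
have [C [C0 hC]] := decay_cubic bT; have [C' [C'0 hC']] := decay_cubic bT'.
have [D [D0 hD]] := decay_cubic bR.
have c0 : 0 <= cubic_bound tau.
  by apply: le_trans (sqsum_cubic_le htau 0); do 2 apply: symsum_ge0 => ?; exact: nz_cubic_ge0.
exists ((C + C' + D) * cubic_bound tau) => z zB za.
have n0 : normc (0 : R[i]) <= r / 2 by rewrite normc0 divr_ge0// ltW.
split.
- apply: le_trans (normc_lattice_sum htau C0 _) _.
    by move=> m n l0; exact: (hC z 0).
  by rewrite ler_wpM2r//; lra.
- apply: le_trans (normc_lattice_sum htau C'0 _) _.
    by move=> m n l0; exact: (hC' z 0).
  by rewrite ler_wpM2r//; lra.
move=> u ur.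
have sT : lsummable tau (T z) := decay_lsummable bT zB za n0.
have sT' : lsummable tau (T' z) := decay_lsummable bT' zB za n0.
have sR : lsummable tau (Rem z u) := decay_lsummable bR zB za ur.
have -> : L (T (z + u)) - L (T z) - u * L (T' z) = u ^+ 2 * L (Rem z u).
  have -> : L (T (z + u)) = L (fun w => T z w + u * T' z w + u ^+ 2 * Rem z u w).
    by apply: lattice_sum_eq => m n l0; apply: (hT r) => //; exact: lattice0_lp.
  rewrite !(lattice_sumD, lattice_sumZ)//; first by ring.
  - exact: lsummableZ.
  - by apply: lsummableD => //; exact: lsummableZ.
  - exact: lsummableZ.
rewrite normcM normcX mulrC ler_wpM2r ?exprn_ge0 ?normc_ge0//.
apply: le_trans (normc_lattice_sum htau D0 _) _.
  by move=> m n l0; exact: hD.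
by rewrite ler_wpM2r//; lra.
Qed.

Definition zetaT z w := (z - w)^-1 + w^-1 + z / w ^+ 2.
Definition wpT z w := (z - w) ^- 2 - w ^- 2.
(** Terms of the shifted Eisenstein series E_k, which stand for the derivatives of wp: wp' = -2 E_3
    and wp'' = 6 E_4. *)
Definition eisT k z w := (z - w) ^- k.

Lemma away_neq0 r z u w : 0 < r -> away lattice0 r z -> normc u <= r / 2 ->
  lattice0 w -> [/\ z - w != 0, z + u - w != 0 & w != 0].
Proof.
move=> r0 za ur wl; split.
- by rewrite -normc_gt0 (lt_le_trans r0)// za.
- rewrite -normc_gt0 (@lt_le_trans _ _ (r / 2)) ?divr_gt0//.
  exact: (away_add za ur).
- by case: wl => m [n []].
Qed.

Lemma decay_ext r B k f g : 0 < r -> (forall z u w, z - w != 0 -> z + u - w != 0 -> w != 0 ->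
  f z u w = g z u w) -> decay r B k f -> decay r B k g.
Proof.
move=> r0 fg [C [C0 hC]]; exists C; split => // z u w zB za ur wl.
by have [h1 h2 h3] := away_neq0 r0 za ur wl; rewrite -fg// hC.
Qed.

Lemma decay_eis r B k : 0 < r -> decay r B k (fun z _ w => eisT k z w).
Proof.
move=> r0; have := decayX k (decay_x B r0); rewrite muln1.
by apply: decay_ext => // z u w _ _ _; rewrite /eisT exprVn.
Qed.

Lemma decay_wpT r B : 0 < r -> decay r B 3 (fun z _ w => wpT z w).
Proof.
move=> r0.
have hx := decay_x B r0; have hw := decay_w r B.
(* With x = (z - w)^-1 one has z x w^-1 = x + w^-1, so the product is x^2 - w^-2; its three inverse
   factors give the exponent 3. *)
have := decayM (decayM (decayM (decay_z r B) hx) hw) (decayD hx (decayN hw)).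
by apply: decay_ext => // z u w h1 h2 h3; rewrite /wpT; field; rewrite h3.
Qed.

Lemma decay_zetaT r B : 0 < r -> decay r B 3 (fun z _ w => zetaT z w).
Proof.
move=> r0.
have hx := decay_x B r0; have hw := decay_w r B; have hz := decay_z r B.
have := decayM (decayM (decayX 2 hz) hx) (decayX 2 hw).
by apply: decay_ext => // z u w h1 h2 h3; rewrite /zetaT; field; rewrite h3.
Qed.

Definition zeta_reg z := L (zetaT z).
Definition wp_reg z := L (wpT z).
Definition eis_reg k z := L (eisT k z).

Lemma away0 r : 0 < r -> normc (0 : R[i]) <= r / 2.
Proof. by move=> r0; rewrite normc0 divr_ge0// ltW. Qed.

Lemma lsummable_zetaT r z : 0 < r -> away lattice0 r z -> lsummable tau (zetaT z).
Proof.
move=> r0 za.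
exact: decay_lsummable (decay_zetaT (normc z) r0) (lexx _) za (away0 r0).
Qed.

Lemma lsummable_wpT r z : 0 < r -> away lattice0 r z -> lsummable tau (wpT z).
Proof.
move=> r0 za.
exact: decay_lsummable (decay_wpT (normc z) r0) (lexx _) za (away0 r0).
Qed.

Lemma lsummable_eisT k r z : (3 <= k)%N -> 0 < r -> away lattice0 r z ->
  lsummable tau (eisT k z).
Proof.
move=> k3 r0 za.
exact: decay_lsummable (decayW k3 (decay_eis (normc z) k r0)) (lexx _) za (away0 r0).
Qed.

Lemma lattice_sum_hol_ext (T : R[i] -> R[i] -> R[i]) c :
  (forall r z, 0 < r -> away lattice0 r z -> lsummable tau (T z)) ->
  forall f, hol lattice0 f (fun z => L (fun w => c * T z w)) ->
  hol lattice0 f (fun z => c * L (T z)).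
Proof.
move=> sT f; apply: hol_ext => // r z r0 za.
by rewrite lattice_sumZ//; exact: sT za.
Qed.

Lemma hol_zeta_reg : hol lattice0 zeta_reg (fun z => - wp_reg z).
Proof.
apply: (@hol_ext _ _ zeta_reg (fun z => -1 * wp_reg z)) => //.
  by move=> r z r0 za; rewrite mulN1r.
apply: lattice_sum_hol_ext => //; first exact: lsummable_wpT.
apply: (@hol_lattice_sum zetaT (fun z w => -1 * wpT z w)
  (fun z u w => (z - w)^-1 ^+ 2 * (z + u - w)^-1)).
- move=> r B r0; split; first exact: decay_zetaT.
    exact: (decayM (decay_cst _ _ (-1)) (decay_wpT B r0)).
  exact: (decayM (decayX 2 (decay_x B r0)) (decay_y B r0)).
- move=> r z u w r0 za ur wl; have [h1 h2 h3] := away_neq0 r0 za ur wl.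
  by rewrite /zetaT /wpT; field; rewrite h1 h2 h3.
Qed.

Lemma hol_wp_reg : hol lattice0 wp_reg (fun z => -2 * eis_reg 3 z).
Proof.
apply: lattice_sum_hol_ext => [r z|]; first exact: lsummable_eisT.
apply: (@hol_lattice_sum wpT (fun z w => -2 * eisT 3 z w)
  (fun z u w => (z - w)^-1 ^+ 2 * (z + u - w)^-1 ^+ 2 +
     2 * (z - w)^-1 ^+ 3 * (z + u - w)^-1)).
- move=> r B r0; have hx := decay_x B r0; have hy := decay_y B r0.
  split; first exact: decay_wpT.
    exact: (decayM (decay_cst _ _ (-2)) (decay_eis B 3 r0)).
  apply: (decayW (isT : (3 <= 4)%N)); apply: decayD.
    exact: (decayM (decayX 2 hx) (decayX 2 hy)).
  exact: (decayM (decayM (decay_cst _ _ 2) (decayX 3 hx)) hy).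
- move=> r z u w r0 za ur wl; have [h1 h2 h3] := away_neq0 r0 za ur wl.
  by rewrite /eisT /wpT; field; rewrite h1 h2 h3.
Qed.

Lemma hol_eis3_reg : hol lattice0 (eis_reg 3) (fun z => -3 * eis_reg 4 z).
Proof.
apply: lattice_sum_hol_ext => [r z|]; first exact: lsummable_eisT.
apply: (@hol_lattice_sum (eisT 3) (fun z w => -3 * eisT 4 z w)
  (fun z u w => (z - w)^-1 ^+ 2 * (z + u - w)^-1 ^+ 3 +
     2 * (z - w)^-1 ^+ 3 * (z + u - w)^-1 ^+ 2 +
     3 * (z - w)^-1 ^+ 4 * (z + u - w)^-1)).
- move=> r B r0; have hx := decay_x B r0; have hy := decay_y B r0.
  have hc c := decay_cst r B c.
  split; first exact: decay_eis.
    exact: (decayW (isT : (3 <= 4)%N) (decayM (hc (-3)) (decay_eis B 4 r0))).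
  apply: (decayW (isT : (3 <= 5)%N)); apply: decayD.
    apply: decayD; first exact: (decayM (decayX 2 hx) (decayX 3 hy)).
    exact: (decayM (decayM (hc 2) (decayX 3 hx)) (decayX 2 hy)).
  exact: (decayM (decayM (hc 3) (decayX 4 hx)) hy).
- move=> r z u w r0 za ur wl; have [h1 h2 h3] := away_neq0 r0 za ur wl.
  by rewrite /eisT; field; rewrite h1 h2.
Qed.

Lemma hol_eis4_reg : hol lattice0 (eis_reg 4) (fun z => -4 * eis_reg 5 z).
Proof.
apply: lattice_sum_hol_ext => [r z|]; first exact: lsummable_eisT.
apply: (@hol_lattice_sum (eisT 4) (fun z w => -4 * eisT 5 z w)
  (fun z u w => (z - w)^-1 ^+ 2 * (z + u - w)^-1 ^+ 4 +
     2 * (z - w)^-1 ^+ 3 * (z + u - w)^-1 ^+ 3 +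
     3 * (z - w)^-1 ^+ 4 * (z + u - w)^-1 ^+ 2 +
     4 * (z - w)^-1 ^+ 5 * (z + u - w)^-1)).
- move=> r B r0; have hx := decay_x B r0; have hy := decay_y B r0.
  have hc c := decay_cst r B c.
  split; first exact: (decayW (isT : (3 <= 4)%N) (decay_eis B 4 r0)).
    exact: (decayW (isT : (3 <= 5)%N) (decayM (hc (-4)) (decay_eis B 5 r0))).
  apply: (decayW (isT : (3 <= 6)%N)); apply: decayD; first apply: decayD; first apply: decayD.
  - exact: (decayM (decayX 2 hx) (decayX 4 hy)).
  - exact: (decayM (decayM (hc 2) (decayX 3 hx)) (decayX 3 hy)).
  - exact: (decayM (decayM (hc 3) (decayX 4 hx)) (decayX 2 hy)).
  exact: (decayM (decayM (hc 4) (decayX 5 hx)) hy).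
- move=> r z u w r0 za ur wl; have [h1 h2 h3] := away_neq0 r0 za ur wl.
  by rewrite /eisT; field; rewrite h1 h2.
Qed.

(** One order beyond [hol]: at the pole and at a half-period the linear term vanishes, and
    cancelling a factor v^-2 up to O(|v|) requires the quadratic term explicitly. *)
Lemma wp_reg_taylor r B : 0 < r -> exists M, forall z u, normc z <= B ->
  away lattice0 r z -> normc u <= r / 2 ->
  normc (wp_reg (z + u) - wp_reg z + 2 * u * eis_reg 3 z - 3 * u ^+ 2 * eis_reg 4 z)
    <= M * normc u ^+ 3.
Proof.
move=> r0; pose Rem z u w := -1 * (3 * (z - w)^-1 ^+ 4 * (z + u - w)^-1 +
  (z - w)^-1 ^+ 3 * (z + u - w)^-1 ^+ 2).
have bR : decay r B 3 Rem.
  have hx := decay_x B r0; have hy := decay_y B r0; have hc c := decay_cst r B c.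
  apply: (decayW (isT : (3 <= 5)%N)).
  apply: (decayM (hc (-1))); apply: decayD.
    exact: (decayM (decayM (hc 3) (decayX 4 hx)) hy).
  exact: (decayM (decayX 3 hx) (decayX 2 hy)).
have [D [D0 hD]] := decay_cubic bR.
exists (D * cubic_bound tau) => z u zB za ur.
have r2 : 0 < r / 2 by rewrite divr_gt0.
have s1 : lsummable tau (wpT z) := lsummable_wpT r0 za.
have s3 : lsummable tau (eisT 3 z) := lsummable_eisT (leqnn 3) r0 za.
have s4 : lsummable tau (eisT 4 z) := lsummable_eisT (isT : (3 <= 4)%N) r0 za.
have sR : lsummable tau (Rem z u) := decay_lsummable bR zB za ur.
have -> : wp_reg (z + u) = L (fun w => wpT z w + (-2 * u) * eisT 3 z w +
    (3 * u ^+ 2) * eisT 4 z w + u ^+ 3 * Rem z u w).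
  apply: lattice_sum_eq => m n /lattice0_lp wl.
  have [h1 h2 h3] := away_neq0 r0 za ur wl.
  by rewrite /wpT /eisT /Rem; field; rewrite h1 h2 h3.
have z3 := lsummableZ (-2 * u) s3; have z4 := lsummableZ (3 * u ^+ 2) s4.
have zR := lsummableZ (u ^+ 3) sR.
have d1 := lsummableD s1 z3; have d2 := lsummableD d1 z4.
rewrite (lattice_sumD htau d2 zR) (lattice_sumD htau d1 z4) (lattice_sumD htau s1 z3).
rewrite (lattice_sumZ htau _ s3) (lattice_sumZ htau _ s4) (lattice_sumZ htau _ sR).
rewrite -/(wp_reg z) -/(eis_reg 3 z) -/(eis_reg 4 z).
rewrite (_ : _ - _ = u ^+ 3 * L (Rem z u)); last by ring.
rewrite normcM normcX mulrC ler_wpM2r ?exprn_ge0 ?normc_ge0//.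
apply: le_trans (normc_lattice_sum htau D0 _) _ => //.
by move=> m n l0; exact: hD.
Qed.

End WeierstrassSeries.

(** * Zeta, wp and Eisenstein functions: parity and quasi-periods *)

Section WeierstrassFunctions.
Variables (R : realType) (tau : R[i]).
Hypothesis htau : 0 < complex.Im tau.
Local Notation h := (complex.Im tau).
Local Notation lp := (lattice_point tau).
Local Notation K := (lpK tau).
Local Notation L := (lattice_sum tau).
Local Notation lattice0 := (lattice0 tau).
Implicit Types (z u w : R[i]).

Lemma lattice_lp m n : lattice tau (lp m n).
Proof. by exists m, n. Qed.

Lemma lattice_0 : lattice tau 0.
Proof. by exists 0, 0; rewrite /lattice_point mul0r addr0. Qed.

Lemma latticeD w w' : lattice tau w -> lattice tau w' -> lattice tau (w + w').
Proof. by move=> [m [n ->]] [m' [n' ->]]; rewrite lp_add; exact: lattice_lp. Qed.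

Lemma latticeN w : lattice tau w -> lattice tau (- w).
Proof. by move=> [m [n ->]]; rewrite -lp_opp; exact: lattice_lp. Qed.

Lemma latticeB w w' : lattice tau w -> lattice tau w' -> lattice tau (w - w').
Proof. by move=> hw /latticeN; exact: latticeD. Qed.

Lemma away_lattice0 r z : away (lattice tau) r z -> away lattice0 r z.
Proof. by move=> za w /lattice0_sub; exact: za. Qed.

Lemma away_latticeD r z w : lattice tau w -> away (lattice tau) r z ->
  away (lattice tau) r (z + w).
Proof.
move=> hw za v hv; have := za _ (latticeB hv hw).
by have -> : z - (v - w) = z + w - v by ring.
Qed.

Lemma away_latticeN r z : away (lattice tau) r z -> away (lattice tau) r (- z).
Proof.
move=> za v hv; have := za _ (latticeN hv).
by rewrite -normcN; have -> : - (z - - v) = - z - v by ring.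
Qed.

Lemma lattice0N w : lattice0 w -> lattice0 (- w).
Proof.
by move=> [m [n [-> w0]]]; exists (- m), (- n); rewrite lp_opp oppr_eq0.
Qed.

Lemma away_lattice0N r z : away lattice0 r z -> away lattice0 r (- z).
Proof.
move=> za v hv; have := za _ (lattice0N hv).
by rewrite -normcN; have -> : - (z - - v) = - z - v by ring.
Qed.

Lemma away_seq (s : seq R[i]) z : z \notin s ->
  exists2 r : R, 0 < r & forall w, w \in s -> r <= normc (z - w).
Proof.
elim: s => [_|a s IH]; first by exists 1.
rewrite inE negb_or => /andP[za /IH[r r0 hr]].
exists (Num.min r (normc (z - a))).
  by rewrite lt_min r0 normc_gt0 subr_eq0.
move=> w; rewrite inE => /predU1P[->|/hr rw]; first by rewrite ge_min lexx orbT.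
by rewrite ge_min rw.
Qed.

(** Lattice points farther than 1 from z are harmless; those within distance 1 have indices bounded
    by K (|z| + 1), hence belong to a finite list. *)
Lemma away_ex z : ~ lattice tau z -> exists2 r : R, 0 < r & away (lattice tau) r z.
Proof.
move=> zl.
pose N := Num.bound (K * (normc z + 1)).
pose s := [seq lp (i%:Z - N%:Z) (j%:Z - N%:Z) | i <- iota 0 N.*2.+1, j <- iota 0 N.*2.+1].
have zs : z \notin s.
  by apply/negP => /allpairsP[[i j] /= [_ _ zE]]; apply: zl; rewrite zE; exact: lattice_lp.
have [r r0 hr] := away_seq zs.
exists (Num.min r 1); first by rewrite lt_min r0 ltr01.
move=> w [m [n ->]].
have [le1|/ltW gt1] := leP 1 (normc (z - lp m n)); first by rewrite ge_min le1 orbT.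
have lz : normc (lp m n) <= normc z + 1.
  have -> : lp m n = z - (z - lp m n) by ring.
  by rewrite (le_trans (le_normcB _ _))// lerD2l.
have KK : K * normc (lp m n) <= N%:R.
  rewrite (@le_trans _ _ (K * (normc z + 1)))//.
    by rewrite ler_wpM2l// ltW ?lpK_gt0.
  rewrite ltW// archi_boundP// mulr_ge0 ?ltW ?lpK_gt0//.
  by rewrite ltr_wpDl ?normc_ge0.
have bnd (k : int) : `|k%:~R : R| <= N%:R -> exists2 i, i \in iota 0 N.*2.+1 & k = i%:Z - N%:Z.
  rewrite -intr_norm -[N%:R]/(N%:Z%:~R) ler_int => kN.
  exists (absz (k + N%:Z)); last by lia.
  by rewrite mem_iota; lia.
have [i hi mE] := bnd _ (le_trans (lp_ge_m htau m n) KK).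
have [j hj nE] := bnd _ (le_trans (lp_ge_n htau m n) KK).
by rewrite ge_min hr// mE nE; apply/allpairsP; exists (i, j).
Qed.

Lemma wzetaE z : wzeta tau z = z^-1 + zeta_reg tau z. Proof. by []. Qed.
Lemma wpE z : wp tau z = z ^- 2 + wp_reg tau z. Proof. by []. Qed.
Definition eis k z := z ^- k + eis_reg tau k z.

Lemma hol_inv_lattice : hol (lattice tau) (fun z => z^-1) (fun z => - z ^- 2).
Proof. by apply: hol_incl (@hol_inv R) => _ ->; exact: lattice_0. Qed.

Lemma hol_invX k : hol (lattice tau) (fun z => z ^- k) (fun z => - k%:R * z ^- k.+1).
Proof.
apply: hol_ext (holX k hol_inv_lattice) => r z r0 za; first by rewrite exprVn.
have z0 : z != 0.
  by apply/eqP => z0; apply: (away_notin r0 za); rewrite z0; exact: lattice_0.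
case: k => [|k]; first by rewrite !mul0r oppr0 mul0r.
rewrite /= exprVn mulrN -mulrA -invfM -exprD addn2 mulNr.
by [].
Qed.

Lemma hol_wzeta : hol (lattice tau) (wzeta tau) (fun z => - wp tau z).
Proof.
apply: hol_ext (holD hol_inv_lattice (hol_incl (@lattice0_sub _ tau) (hol_zeta_reg htau))) => //.
by move=> r z _ _; rewrite wpE opprD.
Qed.

Lemma hol_wp : hol (lattice tau) (wp tau) (fun z => -2 * eis 3 z).
Proof.
apply: hol_ext (holD (hol_invX 2) (hol_incl (@lattice0_sub _ tau) (hol_wp_reg htau))) => //.
by move=> r z _ _; rewrite /eis mulrDr.
Qed.

Lemma hol_eis3 : hol (lattice tau) (eis 3) (fun z => -3 * eis 4 z).
Proof.
apply: hol_ext (holD (hol_invX 3) (hol_incl (@lattice0_sub _ tau) (hol_eis3_reg htau))) => //.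
by move=> r z _ _; rewrite /eis mulrDr.
Qed.

Lemma hol_eis4 : hol (lattice tau) (eis 4) (fun z => -4 * eis 5 z).
Proof.
apply: hol_ext (holD (hol_invX 4) (hol_incl (@lattice0_sub _ tau) (hol_eis4_reg htau))) => //.
by move=> r z _ _; rewrite /eis mulrDr.
Qed.

Lemma zeta_regN r z : 0 < r -> away lattice0 r z -> zeta_reg tau (- z) = - zeta_reg tau z.
Proof.
move=> r0 za; rewrite /zeta_reg.
rewrite -(lattice_sum_opp htau (lsummable_zetaT r0 (away_lattice0N za))).
rewrite -[RHS]mulN1r -(lattice_sumZ htau _ (lsummable_zetaT r0 za)).
apply: lattice_sum_eq => m n l0; rewrite /zetaT.
have -> : - z - - lp m n = - (z - lp m n) by ring.
by rewrite !invrN sqrrN; ring.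
Qed.

Lemma wp_regN r z : 0 < r -> away lattice0 r z -> wp_reg tau (- z) = wp_reg tau z.
Proof.
move=> r0 za; rewrite /wp_reg.
rewrite -(lattice_sum_opp htau (lsummable_wpT r0 (away_lattice0N za))).
apply: lattice_sum_eq => m n l0; rewrite /wpT.
have -> : - z - - lp m n = - (z - lp m n) by ring.
by rewrite !sqrrN.
Qed.

Lemma eis3_regN r z : 0 < r -> away lattice0 r z -> eis_reg tau 3 (- z) = - eis_reg tau 3 z.
Proof.
move=> r0 za; rewrite /eis_reg.
have k3 := leqnn 3.
rewrite -(lattice_sum_opp htau (lsummable_eisT htau k3 r0 (away_lattice0N za))).
rewrite -[RHS]mulN1r -(lattice_sumZ htau _ (lsummable_eisT htau k3 r0 za)).
apply: lattice_sum_eq => m n l0; rewrite /eisT.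
have -> : - z - - lp m n = - (z - lp m n) by ring.
by rewrite -!exprVn invrN; ring.
Qed.

Lemma wzetaN r z : 0 < r -> away (lattice tau) r z -> wzeta tau (- z) = - wzeta tau z.
Proof.
by move=> r0 /away_lattice0 za; rewrite !wzetaE (zeta_regN r0 za) invrN opprD.
Qed.

Lemma wpN r z : 0 < r -> away (lattice tau) r z -> wp tau (- z) = wp tau z.
Proof.
by move=> r0 /away_lattice0 za; rewrite !wpE (wp_regN r0 za) sqrrN.
Qed.

Lemma eis3N r z : 0 < r -> away (lattice tau) r z -> eis 3 (- z) = - eis 3 z.
Proof.
move=> r0 /away_lattice0 za; rewrite /eis (eis3_regN r0 za) opprD; congr (_ + _).
by rewrite -!exprVn invrN; ring.
Qed.

Lemma symsum_delta N (a : R[i]) : symsum N (fun m => if m == 0 then a else 0) = a.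
Proof.
elim: N => [|N IH]; first by rewrite /symsum big_ord1.
by rewrite symsumS IH !add0r addr0.
Qed.

Lemma sqsum_nz0 N (F : int -> int -> R[i]) f : (forall m n, lp m n != 0 -> F m n = f (lp m n)) ->
  sqsum N F = F 0 0 + sqsum N (nz tau f).
Proof.
move=> Ff.
rewrite -{1}(symsum_delta N (F 0 0)) /sqsum -symsumD; apply: eq_symsum => m.
have [->|m0] := eqVneq m 0.
  rewrite /= -{1}(symsum_delta N (F 0 0)) -symsumD; apply: eq_symsum => n.
  rewrite /nz; have [->|n0] := eqVneq n 0; first by rewrite lp_eq0//= addr0.
  by rewrite lp_eq0// (negbTE n0) andbF/= add0r Ff// lp_eq0// negb_and n0 orbT.
rewrite add0r; apply: eq_symsum => n.
by rewrite /nz lp_eq0// (negbTE m0)/= Ff// lp_eq0// negb_and m0.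
Qed.

Lemma sqsum_nz_inv N : sqsum N (nz tau (fun w => w^-1)) = 0.
Proof.
have : sqsum N (nz tau (fun w => w^-1)) = - sqsum N (nz tau (fun w => w^-1)).
  rewrite -mulN1r -sqsum_nzZ -[LHS]sqsum_opp; apply: eq_sqsum => m n.
  by rewrite /nz lp_opp oppr_eq0; case: ifP => // _; rewrite invrN mulN1r.
by move/eqP; rewrite -addr_eq0 -mulr2n mulrn_eq0/= => /eqP.
Qed.

(** Partial sums of a series that does not converge absolutely. They are kept at finite N, since
    they cancel in [wzeta_quasi]. *)
Definition inv2_sum N : R[i] := sqsum N (nz tau (fun w => w ^- 2)).

Lemma wzeta_partial r z : 0 < r -> away (lattice tau) r z ->
  ctends (fun N => sqsum N (fun m n => (z - lp m n)^-1) + z * inv2_sum N) (wzeta tau z).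
Proof.
move=> r0 za; have sz := lsummable_zetaT r0 (away_lattice0 za).
have := ctendsD (ctends_cst z^-1) (lattice_sumP htau sz).
congr ctends; apply/funext => N.
rewrite (@sqsum_nz0 _ (fun m n => (z - lp m n)^-1) (fun w => (z - w)^-1))//.
rewrite /= (_ : lp 0 0 = 0); last by apply/eqP; rewrite lp_eq0.
rewrite subr0 -addrA; congr (_ + _).
rewrite /zetaT !sqsum_nzD sqsum_nz_inv addr0; congr (_ + _).
by rewrite /inv2_sum -sqsum_nzZ.
Qed.

Section QuasiPeriod.
Variables (P : int -> int -> R[i]) (v : R[i]).
Hypothesis Pshift : forall m n, P (m - 1) n = P m n - v.
Hypothesis Pge : forall m n, `|m%:~R| <= K * normc (P m n).
Hypothesis Plat : forall m n, lattice tau (P m n).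
Hypothesis Psum : forall N (f : R[i] -> R[i]),
  sqsum N (fun m n => f (P m n)) = sqsum N (fun m n => f (lp m n)).
Hypothesis vlat : lattice tau v.

(** The partial sums at z + v and z telescope along the first index of P to two boundary rows.
    Comparing the base points z and z0 makes each boundary term O(N^-2), so rows of 2N+1 terms
    vanish in the limit. Indexing the lattice by (m, n) or by (n, m) covers v = 1 and v = tau. *)
Lemma wzeta_quasi r z z0 : 0 < r -> away (lattice tau) r z ->
  away (lattice tau) r z0 ->
  wzeta tau (z + v) - wzeta tau z = wzeta tau (z0 + v) - wzeta tau z0.
Proof.
move=> r0 za z0a.
have zva := away_latticeD vlat za; have z0va := away_latticeD vlat z0a.
pose g N y m : R[i] := symsum N (fun n => (y - P m n)^-1).
pose Q N y := sqsum N (fun m n => (y - lp m n)^-1) + y * inv2_sum N.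
have QE N y : Q N (y + v) - Q N y = g N y (- N.+1%:Z) - g N y N%:Z + v * inv2_sum N.
  rewrite -(symsum_shift N (g N y)) /Q.
  rewrite -(Psum N (fun w => (y + v - w)^-1)) -(Psum N (fun w => (y - w)^-1)).
  have -> : sqsum N (fun m n => (y + v - P m n)^-1) = symsum N (fun m => g N y (m - 1)).
    apply: eq_symsum => m; apply: eq_symsum => n; congr (_ ^-1).
    by rewrite Pshift; ring.
  by rewrite -[sqsum _ _]/(symsum N (g N y)); ring.
have := ctendsB (ctendsB (wzeta_partial r0 zva) (wzeta_partial r0 za))
  (ctendsB (wzeta_partial r0 z0va) (wzeta_partial r0 z0a)).
move=> cD.
apply/eqP; rewrite -subr_eq0; apply/eqP; apply: (ctends_small cD) => e e0.
pose B := normc z + normc z0; pose c := 2 + 2 * B / r.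
pose C := normc (z - z0) * c ^+ 2 * (4 * K ^+ 2).
have K0 := lpK_gt0 htau.
have B0 : 0 <= B by rewrite addr_ge0 ?normc_ge0.
have zB : normc z <= B by rewrite /B lerDl normc_ge0.
have z0B : normc z0 <= B by rewrite /B lerDr normc_ge0.
have c0 : 0 <= c by rewrite addr_ge0// divr_ge0 ?mulr_ge0// ltW.
have C0 : 0 <= C by rewrite !mulr_ge0 ?normc_ge0 ?exprn_ge0// ltW.
(* The boundary rows are m = -(N+1) and m = N; the factor 2 accommodates the second one, and N >= 1
   is ensured by the final choice of threshold. *)
have termle (N : nat) m n : N.+1%:R <= 2 * `|m%:~R : R| ->
    normc ((z - P m n)^-1 - (z0 - P m n)^-1) <= C / N.+1%:R ^+ 2.
  move=> Nm; set w := P m n.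
  have N0 : 0 < N.+1%:R :> R by [].
  have Nw : N.+1%:R <= 2 * K * normc w.
    by rewrite (le_trans Nm)// -mulrA ler_wpM2l// Pge.
  have w0 : 0 < normc w.
    by have := lt_le_trans N0 Nw; rewrite pmulr_rgt0// mulr_gt0.
  have wl : lattice0 w.
    by have [m' [n' wE]] := Plat m n; exists m', n'; rewrite -wE -normc_gt0.
  have b1 : normc (z - w)^-1 <= c * (normc w)^-1.
    exact: (inv_sub_le r0 B0 zB wl (za _ (Plat m n))).
  have b2 : normc (z0 - w)^-1 <= c * (normc w)^-1.
    exact: (inv_sub_le r0 B0 z0B wl (z0a _ (Plat m n))).
  have zw : z - w != 0 by rewrite -normc_gt0 (lt_le_trans r0)// za//; exact: Plat.
  have z0w : z0 - w != 0 by rewrite -normc_gt0 (lt_le_trans r0)// z0a//; exact: Plat.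
  have -> : (z - w)^-1 - (z0 - w)^-1 = - (z - z0) * ((z - w)^-1 * (z0 - w)^-1).
    by field; rewrite zw z0w.
  rewrite normcM normcN normcM /C -2!mulrA ler_wpM2l ?normc_ge0//.
  rewrite (@le_trans _ _ ((c * (normc w)^-1) * (c * (normc w)^-1)))//.
    by rewrite ler_pM ?normc_ge0.
  rewrite mulrACA -expr2 ler_wpM2l ?exprn_ge0// -invfM -expr2.
  rewrite ler_pdivlMr ?exprn_gt0// mulrC ler_pdivrMr ?exprn_gt0//.
  have -> : 4 * K ^+ 2 * normc w ^+ 2 = (2 * K * normc w) ^+ 2 by ring.
  by rewrite lerXn2r ?nnegrE// mulr_ge0 ?normc_ge0// mulr_ge0// ltW.
have gle (N : nat) m : N.+1%:R <= 2 * `|m%:~R : R| ->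
    normc (g N z m - g N z0 m) <= 2 * C / N.+1%:R.
  move=> Nm; rewrite /g -symsumB.
  rewrite (@le_trans _ _ (N.*2.+1%:R * (C / N.+1%:R ^+ 2)))//.
    by apply: normc_symsum_le => n; exact: termle.
  have -> : 2 * C / N.+1%:R = N.+1.*2%:R * (C / N.+1%:R ^+ 2).
    by rewrite -mul2n natrM; field; rewrite lt0r_neq0.
  by rewrite ler_wpM2r ?divr_ge0 ?exprn_ge0// ler_nat; lia.
have [N1 hN1] := ctends_inv (4 * C) e0.
exists N1.+1 => N hN.
rewrite subr0 -/(Q N (z + v)) -/(Q N z) -/(Q N (z0 + v)) -/(Q N z0) !QE.
set a := g N z _; set b := g N z _; set a' := g N z0 _; set b' := g N z0 _.
have -> : a - b + v * inv2_sum N - (a' - b' + v * inv2_sum N) = (a - a') - (b - b') by ring.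
have leN : 2 * C / N.+1%:R + 2 * C / N.+1%:R < e.
  by rewrite -mulrDl -mulrDl (_ : 2 + 2 = 4)// ?hN1 1?ltnW//; ring.
apply: le_lt_trans leN; rewrite (le_trans (le_normcB _ _))// lerD//; apply: gle.
  rewrite rmorphN normrN; change (N.+1%:R <= 2 * `|N.+1%:R : R|); rewrite ger0_norm//.
  by rewrite ler_peMl// ler1n.
change (N.+1%:R <= 2 * `|N%:R : R|); rewrite ger0_norm// -natrM ler_nat.
by rewrite mul2n -addnn -{1}add1n leq_add2r; exact: leq_ltn_trans hN.
Qed.

End QuasiPeriod.

Lemma Psum_tr N (f : R[i] -> R[i]) :
  sqsum N (fun m n => f (lp n m)) = sqsum N (fun m n => f (lp m n)).
Proof. by rewrite -[RHS]sqsum_tr. Qed.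

Lemma lp10 : lp 1 0 = 1. Proof. by rewrite /lattice_point mul0r addr0. Qed.
Lemma lp01 : lp 0 1 = tau. Proof. by rewrite /lattice_point mul1r add0r. Qed.

Lemma lattice_1 : lattice tau 1. Proof. by rewrite -lp10; exact: lattice_lp. Qed.
Lemma lattice_tau : lattice tau tau. Proof. by rewrite -{2}lp01; exact: lattice_lp. Qed.

Lemma wzeta_quasi1 r z z0 : 0 < r -> away (lattice tau) r z -> away (lattice tau) r z0 ->
  wzeta tau (z + 1) - wzeta tau z = wzeta tau (z0 + 1) - wzeta tau z0.
Proof.
apply: (@wzeta_quasi lp) => //.
- by move=> m n; rewrite /lattice_point rmorphB/=; ring.
- exact: lp_ge_m.
- exact: lattice_lp.
- exact: lattice_1.
Qed.

Lemma wzeta_quasi_tau r z z0 : 0 < r -> away (lattice tau) r z -> away (lattice tau) r z0 ->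
  wzeta tau (z + tau) - wzeta tau z = wzeta tau (z0 + tau) - wzeta tau z0.
Proof.
apply: (@wzeta_quasi (fun m n => lp n m)) => //.
- by move=> m n; rewrite /lattice_point rmorphB/=; ring.
- by move=> m n; exact: lp_ge_n.
- by move=> m n; exact: lattice_lp.
- exact: Psum_tr.
- exact: lattice_tau.
Qed.

End WeierstrassFunctions.

(** * Periodicity, half-periods and local expansions *)

Section Periodicity.
Variables (R : realType) (tau : R[i]).
Hypothesis htau : 0 < complex.Im tau.
Local Notation h := (complex.Im tau).
Local Notation lp := (lattice_point tau).
Local Notation L := (lattice_sum tau).
Local Notation lattice0 := (lattice0 tau).
Local Notation Lam := (lattice tau).
Local Notation eis := (eis tau).
Implicit Types (z u w v : R[i]).

Lemma notlatticeD z w : Lam w -> ~ Lam z -> ~ Lam (z + w).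
Proof. by move=> hw hz /latticeB /(_ hw); rewrite addrK. Qed.

Lemma notlatticeN z : ~ Lam z -> ~ Lam (- z).
Proof. by move=> hz /latticeN; rewrite opprK. Qed.

Lemma away_ex2 z z' : ~ Lam z -> ~ Lam z' ->
  exists2 r : R, 0 < r & away Lam r z /\ away Lam r z'.
Proof.
move=> /(away_ex htau)[r r0 zr] /(away_ex htau)[s s0 zs].
exists (Num.min r s); first by rewrite lt_min r0.
by split; [apply: awayW zr|apply: awayW zs]; rewrite ge_min lexx ?orbT.
Qed.

Lemma lp_inj m n m' n' : lp m n = lp m' n' -> m = m' /\ n = n'.
Proof.
move/eqP; rewrite -subr_eq0 -lp_opp lp_add lp_eq0// => /andP[].
by rewrite !subr_eq0 => /eqP-> /eqP->.
Qed.

Lemma lattice_half a b : Lam (lp a b / 2) ->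
  exists m n, a = 2 * m /\ b = 2 * n.
Proof.
move=> [m [n E]]; exists m, n; apply: lp_inj.
rewrite -[LHS](@divfK _ 2) ?pnatr_eq0// E /lattice_point !rmorphM/=; ring.
Qed.

Lemma half_periodE (k : 'I_4) : half_period tau k =
  lp (nth 0 [:: 0; 1; 0; 1] k) (nth 0 [:: 0; 0; 1; 1] k) / 2.
Proof.
rewrite /half_period /omega /lattice_point.
by case: k => [[|[|[|[|k]]]] /= hk] //; congr (_ / _); rewrite ?mul1r ?mul0r ?addr0 ?add0r.
Qed.

Lemma half_period_notin (k : 'I_4) : k != 0 -> ~ Lam (half_period tau k).
Proof.
rewrite half_periodE => k0 /lattice_half[m [n []]].
by move: k0; case: k => [[|[|[|[|k]]]] /= hk] // _; lia.
Qed.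

Lemma lattice_double_half (k : 'I_4) : Lam (half_period tau k + half_period tau k).
Proof.
rewrite half_periodE -splitr; exact: lattice_lp.
Qed.

(** The increment does not depend on the base point; at -1/2 oddness turns it into 2 zeta(1/2). *)
Lemma wzeta_1 z : ~ Lam z -> wzeta tau (z + 1) = wzeta tau z + eta1 tau.
Proof.
move=> zl.
have hl : ~ Lam (1 / 2).
  have := @half_period_notin 1; rewrite /half_period /omega/=; exact.
have [r r0 [za ha]] := away_ex2 zl (notlatticeN hl).
have := wzeta_quasi1 htau r0 za ha.
have -> : - (1 / 2) + 1 = 1 / 2 :> R[i] by field.
rewrite (wzetaN htau r0) ?opprK; last first.
  by rewrite -(opprK (1 / 2)); exact: away_latticeN.
by rewrite /eta1 => E; rewrite -[LHS](subrK (wzeta tau z)) E; ring.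
Qed.

(** This is eta_2 - eta_1 tau, with the quasi-period eta_2 along tau read off at the base point (1 -
    tau)/2. Legendre's relation gives it the value -2 pi i. *)
Definition kappa := wzeta tau ((1 + tau) / 2) - wzeta tau ((1 - tau) / 2) - eta1 tau * tau.

(** The linear term makes zeta 1-periodic, so that Fourier coefficients along horizontal rows make
    sense; the defect of periodicity is confined to [kappa] along tau. *)
Definition psi z := wzeta tau z - eta1 tau * z.

Lemma psi_1 z : ~ Lam z -> psi (z + 1) = psi z.
Proof. by move=> zl; rewrite /psi wzeta_1//; ring. Qed.

Lemma psi_tau z : ~ Lam z -> psi (z + tau) = psi z + kappa.
Proof.
move=> zl.
have hl : ~ Lam ((1 - tau) / 2).
  have -> : 1 - tau = lp 1 (-1) by rewrite /lattice_point mulN1r.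
  by move=> /lattice_half[m [n []]]; lia.
have [r r0 [za ha]] := away_ex2 zl hl.
have := wzeta_quasi_tau htau r0 za ha.
have -> : (1 - tau) / 2 + tau = (1 + tau) / 2 by field.
rewrite /psi /kappa => E.
have -> : wzeta tau (z + tau) = wzeta tau (z + tau) - wzeta tau z + wzeta tau z by rewrite subrK.
by rewrite E; ring.
Qed.

Lemma hol_lattice_shift v f d : Lam v -> hol Lam f d ->
  hol Lam (fun z => f (z + v)) (fun z => d (z + v)).
Proof. by move=> hv; apply: hol_shift => w hw; exact: latticeB. Qed.

(** The function f (z + v) - f z is constant off the lattice and its derivative is unique. *)
Lemma hol_quasi_periodic v f d c : Lam v -> hol Lam f d ->
  (forall z, ~ Lam z -> f (z + v) = f z + c) ->
  forall z, ~ Lam z -> d (z + v) = d z.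
Proof.
move=> hv hf fc z zl; have [r r0 za] := away_ex htau zl.
apply/eqP; rewrite -subr_eq0; apply/eqP.
have h1 := holB (hol_lattice_shift hv hf) hf.
have h2 : hol Lam (fun=> c) (fun z => d (z + v) - d z).
  apply: hol_ext h1 => // s y s0 ya; rewrite fc; last exact: away_notin ya.
  by rewrite addrAC subrr add0r.
exact: (hol_unique h2 (hol_cst _ c) r0 za).
Qed.

Lemma hol_psi : hol Lam psi (fun z => - wp tau z - eta1 tau).
Proof.
apply: hol_ext (holB (hol_wzeta htau) (holZ (eta1 tau) (hol_id _))) => //.
by move=> r z _ _; rewrite mulr1.
Qed.

Lemma nat_mul_shift T (f : R[i] -> T) v : Lam v ->
  (forall z, ~ Lam z -> f (z + v) = f z) ->
  forall (n : nat) z, ~ Lam z -> f (z + n%:R * v) = f z.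
Proof.
move=> hv fv; elim=> [|n IH] z zl; first by rewrite mul0r addr0.
rewrite -natr1 mulrDl mul1r addrA fv ?IH//.
apply: notlatticeD => //; elim: n {IH} => [|n IH]; first by rewrite mul0r; exact: lattice_0.
by rewrite -natr1 mulrDl mul1r; exact: latticeD.
Qed.

Lemma lattice_mul v (n : nat) : Lam v -> Lam (n%:R * v).
Proof.
move=> hv; elim: n => [|n IH]; first by rewrite mul0r; exact: lattice_0.
by rewrite -natr1 mulrDl mul1r; exact: latticeD.
Qed.

Lemma int_mul_shift T (f : R[i] -> T) v : Lam v ->
  (forall z, ~ Lam z -> f (z + v) = f z) ->
  forall (n : int) z, ~ Lam z -> f (z + n%:~R * v) = f z.
Proof.
move=> hv fv [n|n] z zl; first exact: nat_mul_shift.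
rewrite NegzE rmorphN/= mulNr.
have hnv : Lam (- (n.+1%:R * v)) by apply/latticeN/lattice_mul.
by rewrite -(nat_mul_shift hv fv n.+1 (notlatticeD hnv zl)) subrK.
Qed.

Lemma lattice_shift T (f : R[i] -> T) : (forall z, ~ Lam z -> f (z + 1) = f z) ->
  (forall z, ~ Lam z -> f (z + tau) = f z) ->
  forall w z, Lam w -> ~ Lam z -> f (z + w) = f z.
Proof.
move=> f1 ft _ z [m [n ->]] zl; rewrite /lattice_point addrA.
have hm : Lam (m%:~R).
  by rewrite -[m%:~R]addr0 -(mul0r tau) -[0](mulr0z 1); exists m, 0.
rewrite (int_mul_shift (lattice_tau _) ft); last exact: notlatticeD.
by rewrite -(mulr1 m%:~R) (int_mul_shift (lattice_1 _) f1).
Qed.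

Lemma wp_periodic w z : Lam w -> ~ Lam z -> wp tau (z + w) = wp tau z.
Proof.
have aux v c : Lam v -> (forall y, ~ Lam y -> psi (y + v) = psi y + c) ->
    forall y, ~ Lam y -> wp tau (y + v) = wp tau y.
  move=> hv hp y yl; have := hol_quasi_periodic hv hol_psi hp yl.
  by move=> /(addIr (- eta1 tau)) /oppr_inj.
apply: lattice_shift.
  by apply: (@aux 1 0) => [|y yl]; [exact: lattice_1|rewrite psi_1// addr0].
by apply: (@aux tau kappa) => [|y]; [exact: lattice_tau|exact: psi_tau].
Qed.

Lemma eis3_periodic w z : Lam w -> ~ Lam z -> eis 3 (z + w) = eis 3 z.
Proof.
move=> hw zl; apply: (@mulfI _ (-2)); first by rewrite oppr_eq0 pnatr_eq0.
apply: (hol_quasi_periodic (c := 0) hw (hol_wp htau) _ zl) => // y yl.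
by rewrite wp_periodic// addr0.
Qed.

Lemma eis4_periodic w z : Lam w -> ~ Lam z -> eis 4 (z + w) = eis 4 z.
Proof.
move=> hw zl; apply: (@mulfI _ (-3)); first by rewrite oppr_eq0 pnatr_eq0.
apply: (hol_quasi_periodic (c := 0) hw (hol_eis3 htau) _ zl) => // y yl.
by rewrite eis3_periodic// addr0.
Qed.

Lemma wp_even z : ~ Lam z -> wp tau (- z) = wp tau z.
Proof. by move=> /(away_ex htau)[r r0]; exact: wpN. Qed.

Lemma eis3_half (k : 'I_4) : k != 0 -> eis 3 (half_period tau k) = 0.
Proof.
move=> /half_period_notin; set w := half_period _ _ => wl.
have [r r0 wa] := away_ex htau wl.
have E : eis 3 w = - eis 3 w.
  rewrite -(eis3N htau r0 wa) -(eis3_periodic (lattice_double_half k) (notlatticeN wl)).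
  by rewrite addKr.
by move/eqP: E; rewrite -addr_eq0 -mulr2n mulrn_eq0/= => /eqP.
Qed.

Lemma wp_taylor z : ~ Lam z -> exists2 r : R, 0 < r & exists M, forall u,
  normc u <= r -> ~ Lam (z + u) /\
  normc (wp tau (z + u) - wp tau z + 2 * u * eis 3 z - 3 * u ^+ 2 * eis 4 z)
    <= M * normc u ^+ 3.
Proof.
move=> /(away_ex htau)[s s0 za].
have [M hM] := wp_reg_taylor htau (normc z) s0.
have s2 : 0 < s / 2 by rewrite divr_gt0.
exists (s / 2) => //.
exists (3 * s^-1 ^+ 4 * (s / 2)^-1 + s^-1 ^+ 3 * (s / 2)^-1 ^+ 2 + M) => u us.
have zua := away_add za us.
split; first exact: away_notin zua.
have z0 : s <= normc z by have := za _ (lattice_0 _); rewrite subr0.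
have zu0 : s / 2 <= normc (z + u) by have := zua _ (lattice_0 _); rewrite subr0.
have nz : z != 0 by rewrite -normc_gt0 (lt_le_trans s0).
have nzu : z + u != 0 by rewrite -normc_gt0 (lt_le_trans s2).
rewrite !wpE /Submission.eis.
set A := wp_reg tau (z + u); set B := wp_reg tau z; set C := eis_reg tau 3 z; set D := eis_reg tau 4 z.
have -> : (z + u) ^- 2 + A - (z ^- 2 + B) + 2 * u * (z ^- 3 + C) - 3 * u ^+ 2 * (z ^- 4 + D) =
  (A - B + 2 * u * C - 3 * u ^+ 2 * D) -
  u ^+ 3 * (3 * z^-1 ^+ 4 * (z + u)^-1 + z^-1 ^+ 3 * (z + u)^-1 ^+ 2).
  by field; rewrite nz nzu.
rewrite (le_trans (le_normcB _ _))// [leLHS]addrC [leRHS]mulrDl lerD//; last exact: (hM _ _ (lexx _) (away_lattice0 za) us).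
rewrite normcM normcX mulrC ler_wpM2r ?exprn_ge0 ?normc_ge0//.
have x1 : normc z^-1 <= s^-1 by rewrite normcV lef_pV2// posrE (lt_le_trans s0).
have y1 : normc (z + u)^-1 <= (s / 2)^-1 by rewrite normcV lef_pV2// posrE (lt_le_trans s2).
have si : 0 <= s^-1 by rewrite invr_ge0 ltW.
have s2i : 0 <= (s / 2)^-1 by rewrite invr_ge0 ltW.
rewrite (le_trans (le_normcD _ _))// lerD// !normcM ?normcX ?normc_nat.
  apply: ler_pM => //; rewrite ?mulr_ge0 ?exprn_ge0 ?normc_ge0//.
  apply: ler_wpM2l => //; change (normc z^-1 ^+ 4 <= s^-1 ^+ 4).
  by rewrite lerXn2r ?nnegrE ?normc_ge0.
change (normc z^-1 ^+ 3 * normc (z + u)^-1 ^+ 2 <= s^-1 ^+ 3 * (s / 2)^-1 ^+ 2).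
by apply: ler_pM; rewrite ?exprn_ge0 ?normc_ge0// lerXn2r ?nnegrE ?normc_ge0.
Qed.

Lemma away_lattice0_0 : away lattice0 (lpK tau)^-1 0.
Proof.
move=> w /(lattice0_lb htau) hw; rewrite sub0r normcN -[leLHS]mul1r ler_pdivrMr ?lpK_gt0//.
by rewrite mulrC.
Qed.

Lemma lpKV_gt0 : 0 < (lpK tau)^-1.
Proof. by rewrite invr_gt0 lpK_gt0. Qed.

Lemma eis_reg3_0 : eis_reg tau 3 0 = 0.
Proof.
have := eis3_regN htau lpKV_gt0 away_lattice0_0; rewrite oppr0 => /eqP.
by rewrite -addr_eq0 -mulr2n mulrn_eq0/= => /eqP.
Qed.

Lemma wp_reg_0 : wp_reg tau 0 = 0.
Proof.
have s3 := lsummable_eisT htau (leqnn 3) lpKV_gt0 away_lattice0_0.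
rewrite -[RHS](mul0r (L (eisT 3 0))) -(lattice_sumZ htau _ s3).
by apply: lattice_sum_eq => m n _; rewrite /wpT sub0r sqrrN subrr mul0r.
Qed.

Lemma eis_reg4_0 : eis_reg tau 4 0 = g2 tau / 60.
Proof.
rewrite /g2 mulrC mulKf ?pnatr_eq0// /eis_reg; apply: lattice_sum_eq => m n _.
by rewrite /eisT sub0r -[4%N]/(2 * 2)%N !exprM sqrrN.
Qed.

End Periodicity.

(** * From quadratic remainders to real derivatives and back *)

Section QuadraticDerivatives.
Variable R : realType.

Lemma is_derive_quad (V : normedModType R) (f : V -> R) (x v : V) (d M e : R) : 0 < e ->
  (forall t : R, `|t| < e -> `|f (x + t *: v) - f x - t * d| <= M * t ^+ 2) ->
  is_derive x v f d.
Proof.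
move=> e0 H.
have C : (fun t : R => t^-1 *: (f (t *: v + x) - f x)) @ 0^' --> d.
  apply/cvgrPdist_lt => eps eps0.
  have M1 : 0 < `|M| + 1 by rewrite ltr_wpDl.
  exists (Num.min e (eps / (`|M| + 1))); first by rewrite /= lt_min e0 divr_gt0.
  move=> t /=; rewrite sub0r normrN lt_min => /andP[te tM] t0.
  rewrite /GRing.scale/= distrC.
  have -> : t^-1 * (f (t *: v + x) - f x) - d = t^-1 * (f (x + t *: v) - f x - t * d).
    by rewrite [RHS]mulrBr mulKf// (addrC x).
  rewrite normrM normfV mulrC ltr_pdivrMr ?normr_gt0//.
  rewrite (le_lt_trans (H _ te))// -(real_normK (num_real t)) expr2 mulrA.
  rewrite ltr_pM2r ?normr_gt0// (@le_lt_trans _ _ ((`|M| + 1) * `|t|))//.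
    by rewrite ler_wpM2r// (le_trans (ler_norm M))// lerDl.
  by rewrite mulrC -ltr_pdivlMr.
by apply: DeriveDef; [apply/cvg_ex; exists d|exact/cvg_lim].
Qed.

Lemma taylor2_bound (f f' f'' : R -> R) (M v : R) :
  (forall x : R, is_derive x 1 f (f' x)) -> (forall x : R, is_derive x 1 f' (f'' x)) ->
  (forall x : R, `|x| <= `|v| -> `|f'' x| <= M) -> `|f v - f 0 - v * f' 0| <= M * v ^+ 2.
Proof.
move=> df df' f''M.
have cf : continuous f.
  by move=> x; apply/differentiable_continuous/derivable1_diffP; case: (df x).
have cf' : continuous f'.
  by move=> x; apply/differentiable_continuous/derivable1_diffP; case: (df' x).
have mvt (g g' : R -> R) w : continuous g -> (forall x : R, is_derive x 1 g (g' x)) ->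
    exists2 c, `|c| <= `|w| & g w - g 0 = g' c * w.
  move=> cg dg; have [w0|/ltW w0] := leP 0 w.
    have [c] := @MVT_segment R g g' 0 w w0 (fun x _ => dg x) (continuous_subspaceT cg).
    by rewrite in_itv/= subr0 => /andP[c0 cw] E; exists c => //; rewrite !ger0_norm.
  have [c] := @MVT_segment R g g' w 0 w0 (fun x _ => dg x) (continuous_subspaceT cg).
  rewrite in_itv/= sub0r => /andP[c0 cw] E; exists c; first by rewrite !ler0_norm// lerN2.
  by rewrite -opprB E mulrN opprK.
have [c cv ->] := mvt f f' v cf df.
rewrite (mulrC v) -mulrBl; have [c' cc' ->] := mvt f' f'' c cf' df'.
rewrite !normrM -(real_normK (num_real v)) expr2 mulrA ler_wpM2r//.
by rewrite ler_pM// f''M// (le_trans cc').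
Qed.

Lemma derive0_const (f : R -> R) (a b : R) :
  (forall x : R, a < x < b -> is_derive x 1 f 0) ->
  forall x y, a < x < b -> a < y < b -> f x = f y.
Proof.
move=> df.
suff W x y : x <= y -> a < x < b -> a < y < b -> f x = f y.
  by move=> x y xI yI; have [xy|/ltW yx] := leP x y; [exact: W|exact/esym/W].
move=> xy /andP[ax xb] /andP[ay yb].
have dI z : z \in `[x, y] -> is_derive z 1 f 0.
  by rewrite in_itv/= => /andP[xz zy]; apply: df; rewrite (lt_le_trans ax)//= (le_lt_trans zy).
have dz z : z \in `]x, y[ -> is_derive z 1 f ((fun=> 0) z).
  by move=> /subset_itv_oo_cc; exact: dI.
have cf : {within `[x, y], continuous f}.
  apply: continuous_in_subspaceT => z; rewrite inE => /dI [dz' _].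
  exact/differentiable_continuous/derivable1_diffP.
have [c _] := MVT_segment xy dz cf.
by rewrite mul0r => /eqP; rewrite subr_eq0 => /eqP.
Qed.

(** A quadratic increment forces the derivative 0. This is the form in which a row integral is shown
    not to depend on its height. *)
Lemma quad_const (f : R -> R) (a b : R) :
  (forall y, a < y < b -> exists M e, 0 < e /\ forall t : R, `|t| < e ->
     `|f (y + t) - f y| <= M * t ^+ 2) ->
  forall x y, a < x < b -> a < y < b -> f x = f y.
Proof.
move=> H; apply: derive0_const => x /H[M [e [e0 hM]]].
apply: (@is_derive_quad _ f x 1 0 M e) => // t te.
by rewrite mulr0 subr0 /GRing.scale/= mulr1; exact: hM.
Qed.

End QuadraticDerivatives.

(** * The complex exponential *)

Section ComplexExponential.
Variable R : realType.
Implicit Types (z u : R[i]) (x y : R).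

Definition cis x : R[i] := cos x +i* sin x.

Definition cexp z : R[i] := (expR (complex.Re z))%:C * cis (complex.Im z).

Lemma cisD x y : cis (x + y) = cis x * cis y.
Proof. by apply: complex_eqP; rewrite ?cReM ?cImM/= ?cosD ?sinD//; ring. Qed.

Lemma cis0 : cis 0 = 1. Proof. by rewrite /cis cos0 sin0. Qed.

Lemma normc_cis x : normc (cis x) = 1.
Proof. by rewrite normcE/= cos2Dsin2 sqrtr1. Qed.

Lemma cisN x : cis (- x) = (cis x)^*.
Proof. by rewrite /cis cosN sinN. Qed.

Lemma cis2pi : cis (2 * pi) = 1.
Proof. by rewrite /cis mulr_natl cos2pi sin2pi. Qed.

Lemma cisMn x n : cis (n%:R * x) = cis x ^+ n.
Proof.
elim: n => [|n IH]; first by rewrite mul0r cis0.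
by rewrite -natr1 mulrDl mul1r cisD IH exprSr.
Qed.

Lemma cis_int (m : int) : cis (2 * pi * m%:~R) = 1.
Proof.
case: m => n; first by rewrite mulrC -[_%:~R]/(n%:R) cisMn cis2pi expr1n.
rewrite NegzE rmorphN/= mulrN cisN mulrC -[_%:~R]/(n.+1%:R) cisMn cis2pi expr1n.
exact: conjc1.
Qed.

Lemma cexpD z u : cexp (z + u) = cexp z * cexp u.
Proof. by rewrite /cexp cReD cImD expRD cisD rmorphM/=; ring. Qed.

Lemma cexp0 : cexp 0 = 1.
Proof. by rewrite /cexp/= expR0 cis0 mulr1. Qed.

Lemma normc_cexp z : normc (cexp z) = expR (complex.Re z).
Proof. by rewrite /cexp normcM normcR normc_cis mulr1 ger0_norm// expR_ge0. Qed.

Lemma cexp_i x : cexp ('i * x%:C) = cis x.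
Proof.
have e1 : complex.Re ('i * x%:C) = 0 by rewrite cReM/=; ring.
have e2 : complex.Im ('i * x%:C) = x by rewrite cImM/=; ring.
by rewrite /cexp e1 e2 expR0 mul1r.
Qed.

Lemma cexp_sub1 (r : R) : exists C, forall u, normc u <= r ->
  normc (cexp u - 1 - u) <= C * normc u ^+ 2.
Proof.
have dexp x : is_derive x 1 (@expR R) (expR x) by exact: is_derive_expR.
have dcos x : is_derive x 1 (@cos R) (- sin x) by exact: is_derive_cos.
have dsin x : is_derive x 1 (@sin R) (cos x) by exact: is_derive_sin.
have dNsin x : is_derive x 1 (fun x => - @sin R x) (- cos x) by exact: is_deriveN.
exists (expR r + (2 + (2 * r + 1))) => u ur.
have r0 : 0 <= r := le_trans (normc_ge0 u) ur.
set a := complex.Re u; set b := complex.Im u.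
have ar : `|a| <= normc u by exact: ler_normRe.
have br : `|b| <= normc u by exact: ler_normIm.
have a2 : a ^+ 2 <= normc u ^+ 2.
  by rewrite -(real_normK (num_real a)) lerXn2r// nnegrE normc_ge0.
have b2 : b ^+ 2 <= normc u ^+ 2.
  by rewrite -(real_normK (num_real b)) lerXn2r// nnegrE normc_ge0.
have h1 : `|expR a - 1 - a| <= expR r * normc u ^+ 2.
  have := @taylor2_bound _ expR expR expR (expR r) a dexp dexp.
  rewrite expR0 mulr1 => H; rewrite (le_trans (H _))//.
    by move=> x xa; rewrite ger0_norm ?expR_ge0// ler_expR (le_trans (ler_norm x))// (le_trans xa)// (le_trans ar).
  by rewrite ler_wpM2l// expR_ge0.
have h2 : `|cos b - 1| <= normc u ^+ 2.
  have := @taylor2_bound _ cos (fun x => - sin x) (fun x => - cos x) 1 b dcos dNsin.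
  rewrite cos0 sin0 oppr0 mulr0 subr0 mul1r => H; rewrite (le_trans (H _))//.
  by move=> x _; rewrite normrN cos_max.
have h3 : `|sin b - b| <= normc u ^+ 2.
  have := @taylor2_bound _ sin cos (fun x => - sin x) 1 b dsin dcos.
  rewrite cos0 sin0 subr0 mulr1 mul1r => H; rewrite (le_trans (H _))//.
  by move=> x _; rewrite normrN sin_max.
(* With u = a + ib: the remainder of the real exponential, the remainder of cos and sin, and the
   mixed term a (cis b - 1). Each of them is quadratic in |u|. *)
have -> : cexp u - 1 - u = (expR a - 1 - a)%:C * cis b +
   (((cos b - 1) +i* (sin b - b)) + a%:C * (cis b - 1)).
  by apply: complex_eqP; rewrite ?(cReD, cImD, cReM, cImM, cReN, cImN)/= -/a -/b; ring.
set n := normc u in ur ar br a2 b2 h1 h2 h3 *.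
have n0 : 0 <= n := normc_ge0 u.
have h4 : normc (cis b - 1) <= (2 * r + 1) * n.
  rewrite (le_trans (normc_le_ReIm _))//= subr0.
  have := ler_normD (sin b - b) b; rewrite subrK => h5.
  rewrite mulrDl mul1r.
  have : n ^+ 2 <= r * n by rewrite expr2 ler_wpM2r.
  by move: h2 h3 h5 br; lra.
rewrite (le_trans (le_normcD _ _))// [leRHS]mulrDl lerD//.
  by rewrite normcM normc_cis mulr1 normcR.
rewrite (le_trans (le_normcD _ _))// [leRHS]mulrDl lerD//.
  by rewrite (le_trans (normc_le_ReIm _))//=; move: h2 h3; lra.
by rewrite normcM normcR expr2 mulrA mulrC ler_pM ?normc_ge0.
Qed.

Lemma hol_cexp (S : set R[i]) c : hol S (fun z => cexp (c * z)) (fun z => c * cexp (c * z)).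
Proof.
move=> r B r0; have [C hC] := cexp_sub1 (normc c * (r / 2)).
pose E := expR (normc c * B).
have E0 : 0 <= E by exact: expR_ge0.
exists (E * (1 + normc c + `|C| * normc c ^+ 2)) => z zB za.
have nc := normc_ge0 c.
have C2 : 0 <= `|C| * normc c ^+ 2 by rewrite mulr_ge0// exprn_ge0.
have eB : normc (cexp (c * z)) <= E.
  rewrite normc_cexp ler_expR (le_trans (ler_norm _))// (le_trans (ler_normRe _))//.
  by rewrite normcM ler_wpM2l.
split.
- by rewrite (le_trans eB)// ler_peMr//; lra.
- by rewrite normcM mulrC ler_pM ?normc_ge0//; lra.
move=> u ur.
rewrite mulrDr cexpD.
rewrite (_ : _ - _ - _ = cexp (c * z) * (cexp (c * u) - 1 - c * u)); last by ring.
have cur : normc (c * u) <= normc c * (r / 2) by rewrite normcM ler_wpM2l.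
rewrite normcM -mulrA ler_pM ?normc_ge0// (le_trans (hC _ cur))//.
rewrite normcM exprMn mulrA ler_wpM2r ?exprn_ge0 ?normc_ge0//.
rewrite (@le_trans _ _ (`|C| * normc c ^+ 2))//; last by lra.
by rewrite ler_wpM2r ?exprn_ge0// ler_norm.
Qed.

End ComplexExponential.

(** * Componentwise integrals of complex functions on segments *)

Section IntervalIntegrals.
Variable R : realType.
Local Notation mu := (@lebesgue_measure R).
Implicit Types (f g : R -> R[i]) (a b x : R).

Definition ccont g := continuous (fun x => complex.Re (g x)) /\
  continuous (fun x => complex.Im (g x)).

Definition cderiv g x (d : R[i]) := is_derive x 1 (fun x => complex.Re (g x)) (complex.Re d) /\
  is_derive x 1 (fun x => complex.Im (g x)) (complex.Im d).

Definition Cint a b g : R[i] :=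
  (\int[mu]_(x in `[a, b]) complex.Re (g x)) +i*
  (\int[mu]_(x in `[a, b]) complex.Im (g x)).

Lemma ccont_eps g : (forall x (e : R), 0 < e -> exists2 d : R, 0 < d &
    forall t, `|t| < d -> normc (g (x + t) - g x) < e) -> ccont g.
Proof.
move=> H; split=> x; apply/cvgrPdist_lt => e /(H x)[d d0 hd]; exists d => // y /=;
  rewrite distrC => /hd; rewrite (addrC x) subrK distrC; apply: le_lt_trans.
  by rewrite -cReN -cReD ler_normRe.
by rewrite -cImN -cImD ler_normIm.
Qed.

Lemma ccontD f g : ccont f -> ccont g -> ccont (fun x => f x + g x).
Proof.
move=> [fr fi] [gr gi]; split.
  rewrite (_ : (fun x => _) = fun x => complex.Re (f x) + complex.Re (g x)).
    by move=> x; apply: cvgD; [exact: fr|exact: gr].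
  by apply/funext => x; rewrite cReD.
rewrite (_ : (fun x => _) = fun x => complex.Im (f x) + complex.Im (g x)).
  by move=> x; apply: cvgD; [exact: fi|exact: gi].
by apply/funext => x; rewrite cImD.
Qed.

Lemma ccontM f g : ccont f -> ccont g -> ccont (fun x => f x * g x).
Proof.
move=> [fr fi] [gr gi]; split.
  rewrite (_ : (fun x => _) = fun x => complex.Re (f x) * complex.Re (g x) -
      complex.Im (f x) * complex.Im (g x)); last by apply/funext => x; rewrite cReM.
  by move=> x; apply: cvgB; apply: cvgM; [exact: fr|exact: gr|exact: fi|exact: gi].
rewrite (_ : (fun x => _) = fun x => complex.Re (f x) * complex.Im (g x) +
    complex.Im (f x) * complex.Re (g x)); last by apply/funext => x; rewrite cImM.
by move=> x; apply: cvgD; apply: cvgM; [exact: fr|exact: gi|exact: fi|exact: gr].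
Qed.

Lemma ccont_cst c : ccont (fun=> c).
Proof. by split => x; exact: cvg_cst. Qed.

Lemma ccontZ c g : ccont g -> ccont (fun x => c * g x).
Proof. by apply: ccontM; exact: ccont_cst. Qed.

Lemma ccontB f g : ccont f -> ccont g -> ccont (fun x => f x - g x).
Proof.
move=> cf cg; have -> : (fun x => f x - g x) = (fun x => f x + -1 * g x).
  by apply/funext => x; rewrite mulN1r.
by apply: ccontD => //; exact: ccontZ.
Qed.

Lemma continuous_integrable (g : R -> R) a b : continuous g ->
  mu.-integrable `[a, b] (EFin \o g).
Proof.
move=> cg; apply: continuous_compact_integrable; first exact: segment_compact.
exact: continuous_subspaceT.
Qed.

Lemma CintD a b f g : ccont f -> ccont g ->
  Cint a b (fun x => f x + g x) = Cint a b f + Cint a b g.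
Proof.
move=> [fr fi] [gr gi]; rewrite /Cint; apply: complex_eqP; rewrite ?cReD ?cImD/=.
  rewrite -RintegralD//; try exact: continuous_integrable.
  by apply: eq_Rintegral => x _; rewrite cReD.
rewrite -RintegralD//; try exact: continuous_integrable.
by apply: eq_Rintegral => x _; rewrite cImD.
Qed.

Lemma CintZ a b c g : ccont g -> Cint a b (fun x => c * g x) = c * Cint a b g.
Proof.
move=> [gr gi]; rewrite /Cint; apply: complex_eqP; rewrite ?cReM ?cImM/=.
  rewrite -!RintegralZl//; try exact: continuous_integrable.
  rewrite -RintegralB//; last first.
  - apply: continuous_integrable => x; apply: cvgM; [exact: cvg_cst|exact: gi].
  - apply: continuous_integrable => x; apply: cvgM; [exact: cvg_cst|exact: gr].
  by apply: eq_Rintegral => x _; rewrite cReM.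
rewrite -!RintegralZl//; try exact: continuous_integrable.
rewrite -RintegralD//; last first.
- apply: continuous_integrable => x; apply: cvgM; [exact: cvg_cst|exact: gr].
- apply: continuous_integrable => x; apply: cvgM; [exact: cvg_cst|exact: gi].
by apply: eq_Rintegral => x _; rewrite cImM.
Qed.

Lemma CintB a b f g : ccont f -> ccont g ->
  Cint a b (fun x => f x - g x) = Cint a b f - Cint a b g.
Proof.
move=> cf cg; rewrite -(mulN1r (Cint a b g)) -CintZ// -CintD//; last exact: ccontZ.
by congr Cint; apply/funext => x; rewrite mulN1r.
Qed.

Lemma eq_Cint a b f g : (forall x, a <= x <= b -> f x = g x) -> Cint a b f = Cint a b g.
Proof.
move=> fg; rewrite /Cint; congr (_ +i* _); apply: eq_Rintegral => x;
  by rewrite inE/= in_itv/= => /fg ->.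
Qed.

Lemma Rint_le (g : R -> R) a b M : a <= b -> continuous g ->
  (forall x, a <= x <= b -> `|g x| <= M) ->
  `|\int[mu]_(x in `[a, b]) g x| <= M * (b - a).
Proof.
move=> ab cg gM.
rewrite (le_trans (le_normr_Rintegral _ (continuous_integrable _ _ cg)))//.
have -> : M * (b - a) = \int[mu]_(x in `[a, b]) M.
  by rewrite Rintegral_cst//= lebesgue_measure_itv/= lte_fin; case: ltgtP ab => // ->; rewrite subrr.
have ci : mu.-integrable `[a, b] (EFin \o (fun x => `|g x|)).
  apply: continuous_integrable => x.
  by apply: continuous_comp; [exact: cg|exact: norm_continuous].
have Mi : mu.-integrable `[a, b] (EFin \o (fun=> M)).
  by apply: continuous_integrable => x; exact: cvg_cst.
by apply: le_Rintegral => // x; rewrite /= in_itv/= => /gM.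
Qed.

(** The factor 2 is the price of estimating real and imaginary parts separately. *)
Lemma normc_Cint_le g a b M : a <= b -> ccont g ->
  (forall x, a <= x <= b -> normc (g x) <= M) -> normc (Cint a b g) <= 2 * M * (b - a).
Proof.
move=> ab [gr gi] gM; rewrite (le_trans (normc_le_ReIm _))//= -mulrA mulr_natl mulr2n.
by rewrite lerD// Rint_le// => x /gM; apply: le_trans; rewrite ?ler_normRe ?ler_normIm.
Qed.

Lemma Rint_FTC (F f : R -> R) a b : a < b -> (forall x : R, is_derive x 1 F (f x)) ->
  continuous f -> \int[mu]_(x in `[a, b]) f x = F b - F a.
Proof.
move=> ab dF cf.
have cF : continuous F.
  by move=> x; apply/differentiable_continuous/derivable1_diffP; case: (dF x).
rewrite /Rintegral (@continuous_FTC2 _ f F)//.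
- exact: continuous_subspaceT.
- split.
  + by move=> x _; case: (dF x).
  + exact/cvg_at_right_filter/cF.
  + exact/cvg_at_left_filter/cF.
- by move=> x _; rewrite derive1E; case: (dF x).
Qed.

Lemma Cint_FTC g (d : R -> R[i]) a b : a < b -> (forall x, cderiv g x (d x)) -> ccont d ->
  Cint a b d = g b - g a.
Proof.
move=> ab dg [dr di]; rewrite /Cint.
have hr (x : R) : is_derive x 1 (fun x => complex.Re (g x)) (complex.Re (d x)).
  by case: (dg x).
have hi (x : R) : is_derive x 1 (fun x => complex.Im (g x)) (complex.Im (d x)).
  by case: (dg x).
by rewrite (Rint_FTC ab hr dr) (Rint_FTC ab hi di); case: (g b) (g a) => ? ? [].
Qed.

Lemma cderiv_quad g x d M e : 0 < e ->
  (forall t : R, `|t| < e -> normc (g (x + t) - g x - t%:C * d) <= M * t ^+ 2) ->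
  cderiv g x d.
Proof.
move=> e0 H; split; apply: (is_derive_quad e0) => t /H; apply: le_trans;
  rewrite /GRing.scale/= mulr1.
  apply: le_trans (ler_normRe _); rewrite !(cReD, cReN, cReM)/= mul0r subr0 //.
apply: le_trans (ler_normIm _); rewrite !(cImD, cImN, cImM)/= mul0r addr0 //.
Qed.

(** For a primitive F of g, the window integral F (x + 1) - F x has derivative g (x + 1) - g x = 0.
    The bound [B] puts both windows inside the interval where F is a primitive. *)
Lemma Rint_periodic (g : R -> R) c d : continuous g -> (forall x, g (x + 1) = g x) ->
  \int[mu]_(x in `[c, c + 1]) g x = \int[mu]_(x in `[d, d + 1]) g x.
Proof.
move=> cg gp.
pose B : R := `|c| + `|d| + 3.
pose F x := \int[mu]_(t in `[(- B), x]) g t.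
have dF x : - B < x < B -> is_derive x 1 F (g x).
  move=> /andP[Bx xB].
  have [h1 h2] := continuous_FTC1_closed xB (continuous_integrable _ _ cg) Bx (cg x).
  by apply: DeriveDef; [exact: h1|rewrite -derive1E; exact: h2].
pose H x := F (x + 1) - F x.
have dH x : - B < x < B - 1 -> is_derive x 1 H 0.
  move=> /andP[Bx xB].
  have -> : 0 = g (x + 1) - g x by rewrite gp subrr.
  have d1 : is_derive x 1 F (g x) by apply: dF; rewrite Bx/=; lra.
  have d2 : is_derive (x + 1) 1 F (g (x + 1)) by apply: dF; apply/andP; split; lra.
  have d3 : is_derive x 1 (fun x => F (x + 1)) (g (x + 1)).
    have := @is_derive1_comp _ F (shift 1) x _ _ d2 (is_derive_shift x 1 1).
    by rewrite /GRing.scale/= mulr1.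
  exact: is_deriveB.
have FE x : - B < x < B - 1 -> \int[mu]_(t in `[x, x + 1]) g t = H x.
  move=> /andP[Bx xB]; rewrite /H /F.
  rewrite (@Rintegral_itvB _ g (BLeft (- B)) (BRight (x + 1)) x)//.
  - rewrite Rintegral_itv_obnd_cbnd//.
    by apply: (integrableS _ _ _ (continuous_integrable x (x + 1) cg)) => //; exact: subset_itv_oc_cc.
  - exact: continuous_integrable.
  - by rewrite bnd_simp ltW.
  - by rewrite bnd_simp lerDl.
have cc := ler_norm c; have cc' := ler_norm (- c); rewrite normrN in cc'.
have dd := ler_norm d; have dd' := ler_norm (- d); rewrite normrN in dd'.
have c0 := normr_ge0 c; have d0 := normr_ge0 d.
have cI : - B < c < B - 1 by apply/andP; split; rewrite /B; lra.
have dI : - B < d < B - 1 by apply/andP; split; rewrite /B; lra.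
by rewrite !FE//; exact: (derive0_const dH).
Qed.

Lemma Cint_periodic g c d : ccont g -> (forall x, g (x + 1) = g x) ->
  Cint c (c + 1) g = Cint d (d + 1) g.
Proof.
move=> [gr gi] gp; rewrite /Cint; congr (_ +i* _).
  by apply: Rint_periodic => // x; rewrite gp.
by apply: Rint_periodic => // x; rewrite gp.
Qed.

End IntervalIntegrals.

(** * Translation and reflection of integrals; the mass of the Poisson kernel *)

Section Translations.
Variable R : realType.
Local Notation mu := (@lebesgue_measure R).
Implicit Types (a b c x : R).

Lemma Rint_FTC_in (F f : R -> R) a b B : a < b -> - B < a -> b < B ->
  (forall x : R, - B < x < B -> is_derive x 1 F (f x)) ->
  continuous f -> \int[mu]_(x in `[a, b]) f x = F b - F a.
Proof.
move=> ab Ba bB dF cf.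
have cF (x : R) : - B < x < B -> {for x, continuous F}.
  by move=> /dF dFx; apply/differentiable_continuous/derivable1_diffP; case: dFx.
have xI (x : R) : x \in `]a, b[ -> - B < x < B.
  by rewrite in_itv/= => /andP[ax xb]; rewrite (lt_trans Ba)//= (lt_trans xb).
have aI : - B < a < B by rewrite Ba (lt_trans ab).
have bI : - B < b < B by rewrite bB (lt_trans Ba).
rewrite /Rintegral (@continuous_FTC2 _ f F)//.
- exact: continuous_subspaceT.
- split.
  + by move=> x /xI /dF [].
  + exact/cvg_at_right_filter/cF.
  + exact/cvg_at_left_filter/cF.
- by move=> x /xI /dF dFx; rewrite derive1E; case: dFx.
Qed.

Lemma primitive_ex (g : R -> R) B : continuous g ->
  exists F : R -> R, forall x : R, - B < x < B -> is_derive x 1 F (g x).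
Proof.
move=> cg; exists (fun x => \int[mu]_(t in `[(- B), x]) g t) => x /andP[Bx xB].
have [h1 h2] := continuous_FTC1_closed xB (continuous_integrable _ _ cg) Bx (cg x).
by apply: DeriveDef; [exact: h1|rewrite -derive1E; exact: h2].
Qed.

Lemma is_derive_shift_comp (F : R -> R) c x d : is_derive (x + c) 1 F d ->
  is_derive x 1 (fun x => F (x + c)) d.
Proof.
move=> dF; have := @is_derive1_comp _ F (shift c) x _ _ dF (is_derive_shift x 1 c).
by rewrite /GRing.scale/= mulr1.
Qed.

Lemma Rint_translate (g : R -> R) a b c : a < b -> continuous g ->
  \int[mu]_(x in `[a + c, b + c]) g x = \int[mu]_(x in `[a, b]) g (x + c).
Proof.
move=> ab cg; pose B : R := `|a| + `|b| + `|c| + 1.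
have [F dF] := primitive_ex (B + `|c|) cg.
have la := ler_norm a; have la' := ler_norm (- a); rewrite normrN in la'.
have lb := ler_norm b; have lb' := ler_norm (- b); rewrite normrN in lb'.
have lc := ler_norm c; have lc' := ler_norm (- c); rewrite normrN in lc'.
have [a0 b0 c0] := And3 (normr_ge0 a) (normr_ge0 b) (normr_ge0 c).
have dF2 (x : R) : - B < x < B -> is_derive x 1 (fun x => F (x + c)) (g (x + c)).
  move=> /andP[Bx xB]; apply: is_derive_shift_comp; apply: dF.
  by apply/andP; split; lra.
have cg2 : continuous (fun x => g (x + c)).
  move=> x; apply: continuous_comp; last exact: cg.
  by apply: cvgD; [exact: cvg_id|exact: cvg_cst].
have h1 : - B < a by rewrite /B; lra.
have h2 : b < B by rewrite /B; lra.
have h3 : - (B + `|c|) < a + c by lra.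
have h4 : b + c < B + `|c| by lra.
have h5 : a + c < b + c by rewrite ltrD2r.
by rewrite (Rint_FTC_in h5 h3 h4 dF cg) (Rint_FTC_in ab h1 h2 dF2 cg2).
Qed.

Lemma Rint_reflect (g : R -> R) a : 0 < a -> continuous g ->
  \int[mu]_(x in `[(- a), a]) g (- x) = \int[mu]_(x in `[(- a), a]) g x.
Proof.
move=> a0 cg; have [F dF] := primitive_ex (a + 1) cg.
have aa : - a < a by lra.
have h1 : - (a + 1) < - a by lra.
have h2 : a < a + 1 by lra.
have dF2 (x : R) : - (a + 1) < x < a + 1 -> is_derive x 1 (fun x => - F (- x)) (g (- x)).
  move=> /andP[x1 x2].
  have dFx : is_derive (- x) 1 F (g (- x)) by apply: dF; apply/andP; split; lra.
  have d := @is_derive1_comp _ F -%R x _ _ dFx (is_deriveNid x 1).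
  have := is_deriveN d; rewrite mulrN1 opprK.
  by [].
have cg2 : continuous (fun x => g (- x)).
  by move=> x; apply: continuous_comp; [exact: opp_continuous|exact: cg].
by rewrite (Rint_FTC_in aa h1 h2 dF2 cg2) (Rint_FTC_in aa h1 h2 dF cg) !opprK addrC.
Qed.

Lemma Rint_odd (g : R -> R) a : 0 < a -> continuous g -> (forall x, g (- x) = - g x) ->
  \int[mu]_(x in `[(- a), a]) g x = 0.
Proof.
move=> a0 cg go; have := Rint_reflect a0 cg.
have -> : \int[mu]_(x in `[(- a), a]) g (- x) = \int[mu]_(x in `[(- a), a]) (-1 * g x).
  by apply: eq_Rintegral => x _; rewrite go mulN1r.
by rewrite RintegralZl//; [lra|exact: continuous_integrable].
Qed.

Lemma Cint_translate (g : R -> R[i]) a b c : a < b -> ccont g ->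
  Cint (a + c) (b + c) g = Cint a b (fun x => g (x + c)).
Proof.
move=> ab [gr gi]; rewrite /Cint; congr (_ +i* _); exact: Rint_translate.
Qed.

Lemma Cint_periodic_shift (g : R -> R[i]) c : ccont g -> (forall x, g (x + 1) = g x) ->
  Cint (-1/2) (1/2) (fun x => g (x + c)) = Cint (-1/2) (1/2) g.
Proof.
move=> cg gp; rewrite -Cint_translate//; last by lra.
have -> : 1/2 + c = (-1/2 + c) + 1 by lra.
have -> : (1/2 : R) = -1/2 + 1 by lra.
exact: Cint_periodic.
Qed.

Lemma Cint_reflect (g : R -> R[i]) : ccont g ->
  Cint (-1/2) (1/2) (fun x => g (- x)) = Cint (-1/2) (1/2) g.
Proof.
move=> [gr gi]; rewrite /Cint (_ : (-1/2 : R) = - (1/2)); last by lra.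
have half : 0 < (1/2 : R) by lra.
by rewrite (Rint_reflect half gr) (Rint_reflect half gi).
Qed.

Lemma Rint_poisson (y : R) : 0 < y ->
  \int[mu]_(x in `[(-1/2), (1/2)]) (y / (x ^+ 2 + y ^+ 2)) = 2 * atan (1 / (2 * y)).
Proof.
move=> y0.
have p0 (x : R) : 0 < x ^+ 2 + y ^+ 2 by rewrite ltr_wpDl ?sqr_ge0// exprn_gt0.
have dA (x : R) : is_derive x 1 (fun x => atan (x / y)) (y / (x ^+ 2 + y ^+ 2)).
  have d1 : is_derive x 1 (fun x : R => x / y) (y^-1).
    have := @is_deriveM _ _ id (cst y^-1) x 1 1 0 (is_derive_id x 1) (is_derive_cst y^-1 x 1).
    by rewrite /GRing.scale/= mulr0 mulr1 add0r.
  have d2 := @is_derive1_comp _ atan (fun x => x / y) x _ _ (is_derive1_atan (x / y)) d1.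
  apply: is_derive_eq d2 _.
  by field; rewrite (lt0r_neq0 (p0 x)) lt0r_neq0.
have cP : continuous (fun x : R => y / (x ^+ 2 + y ^+ 2)).
  move=> x; apply: cvgM; first exact: cvg_cst.
  apply: cvgV; first by rewrite lt0r_neq0.
  by apply: cvgD; [exact: exprn_continuous|exact: cvg_cst].
have half : (-1/2 : R) < 1/2 by lra.
rewrite (Rint_FTC half dA cP).
have -> : -1 / 2 / y = - (1 / (2 * y)) by field; exact: lt0r_neq0.
have -> : 1 / 2 / y = 1 / (2 * y) by field; exact: lt0r_neq0.
by rewrite atanN opprK [RHS]mulr_natl [RHS]mulr2n.
Qed.

End Translations.

(** * Row integrals of holomorphic functions in a strip *)

Section Strips.
Variable R : realType.
Implicit Types (z u v : R[i]) (S : set R[i]) (f d : R[i] -> R[i]).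

(** The difference quotient of f with a fixed real step t approximates d at z and at z + v up to M
    t, and it varies little with v since f is Lipschitz; so t is fixed first and v afterwards. *)
Lemma hol_deriv_cont S f d r z (e : R) : hol S f d -> 0 < r -> away S r z -> 0 < e ->
  exists2 s : R, 0 < s & forall v, normc v < s -> normc (d (z + v) - d z) < e.
Proof.
move=> hf r0 za e0; pose B := normc z + r.
have r2 : 0 < r / 2 by rewrite divr_gt0.
have r4 : 0 < r / 2 / 2 by rewrite divr_gt0.
have [M [M0 hM]] := hol_ge0 B hf r2.
have [L [L0 hL]] := hol_lip B hf r4.
pose t := Num.min (r / 2 / 2) (e / (4 * M + 1)).
have M1 : 0 < 4 * M + 1 by lra.
have t0 : 0 < t by rewrite lt_min r4 divr_gt0.
have tr : t <= r / 2 / 2 by rewrite ge_min lexx.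
have te : 4 * M * t < e.
  apply: (@lt_le_trans _ _ ((4 * M + 1) * t)); first by rewrite ltr_pM2r// ltrDl.
  by rewrite mulrC -ler_pdivlMr// ge_min lexx orbT.
have nt : normc t%:C = t by rewrite normcR gtr0_norm.
pose s := Num.min (r / 2 / 2 / 2) (t * e / (4 * L + 1)).
have L1 : 0 < 4 * L + 1 by lra.
have s0 : 0 < s by rewrite lt_min !divr_gt0// mulr_gt0.
exists s => // v vs.
have vr : normc v <= r / 2 / 2 / 2 by rewrite (le_trans (ltW vs))// ge_min lexx.
have vL : (4 * L + 1) * normc v <= t * e.
  by rewrite mulrC -ler_pdivlMr// (le_trans (ltW vs))// ge_min lexx orbT.
have zB : normc z <= B by rewrite lerDl ltW.
have zvB : normc (z + v) <= B by rewrite (le_trans (le_normcD _ _))// lerD2l; move: vr r0; lra.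
have ztB : normc (z + t%:C) <= B by rewrite (le_trans (le_normcD _ _))// lerD2l nt; move: tr r0; lra.
have ztr : normc t%:C <= r / 2 by rewrite nt; move: tr r0; lra.
have za2 : away S (r / 2) z by apply: awayW za; move: r0; lra.
have zva : away S (r / 2) (z + v) by apply: (away_add za); move: vr r0; lra.
have za4 : away S (r / 2 / 2) z by apply: awayW za; move: r0; lra.
have zta4 : away S (r / 2 / 2) (z + t%:C).
  by apply: awayW (away_add za ztr); move: r0; lra.
have [_ _ h1] := hM _ zB za2; have [_ _ h2] := hM _ zvB zva.
have tr2 : normc t%:C <= r / 2 / 2 by rewrite nt.
have {}h1 := h1 _ tr2; have {}h2 := h2 _ tr2.
have h3 := hL _ zB za4 _ vr; have h4 := hL _ ztB zta4 _ vr.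
rewrite -(ltr_pM2l t0) -{1}nt -normcM.
have -> : t%:C * (d (z + v) - d z) = (f (z + t%:C + v) - f (z + t%:C)) - (f (z + v) - f z)
   - (f (z + v + t%:C) - f (z + v) - t%:C * d (z + v)) + (f (z + t%:C) - f z - t%:C * d z).
  by rewrite (addrAC z v); ring.
move: h1 h2; rewrite nt => h1 h2.
have e1 := le_normcD ((f (z + t%:C + v) - f (z + t%:C)) - (f (z + v) - f z)
   - (f (z + v + t%:C) - f (z + v) - t%:C * d (z + v))) (f (z + t%:C) - f z - t%:C * d z).
have e2 := le_normcB ((f (z + t%:C + v) - f (z + t%:C)) - (f (z + v) - f z))
   (f (z + v + t%:C) - f (z + v) - t%:C * d (z + v)).
have e3 := le_normcB (f (z + t%:C + v) - f (z + t%:C)) (f (z + v) - f z).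
have te2 : 4 * (M * t ^+ 2) < t * e.
  by rewrite expr2 !mulrA (mulrC t e) ltr_pM2r.
have nv := normc_ge0 v.
move: e1 e2 e3 h1 h2 h3 h4 te2 vL; lra.
Qed.

Definition line_away S (y : R) := exists2 r : R, 0 < r & forall x : R, away S r (x +i* y).

Lemma shiftx (x y t : R) : (x + t) +i* y = (x +i* y) + t%:C.
Proof. by apply: complex_eqP; rewrite ?cReD ?cImD/= ?addr0. Qed.

Lemma shifty (x y t : R) : x +i* (y + t) = (x +i* y) + 'i * t%:C.
Proof. by apply: complex_eqP; rewrite ?cReD ?cImD ?cReM ?cImM/=; ring. Qed.

Section Strip.
Variables (S : set R[i]) (F F' : R[i] -> R[i]).
Hypothesis hF : hol S F F'.

Lemma line_cderiv y x : line_away S y ->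
  cderiv (fun x => F (x +i* y)) x (F' (x +i* y)).
Proof.
move=> [r r0 ra]; have [M [M0 hM]] := hol_ge0 (normc (x +i* y)) hF r0.
have r2 : 0 < r / 2 by rewrite divr_gt0.
apply: (@cderiv_quad _ _ _ _ M (r / 2)) => // t tr.
have [_ _ h] := hM _ (lexx _) (ra x).
rewrite shiftx -(real_normK (num_real t)) -normcR.
by apply: h; rewrite normcR ltW.
Qed.

Lemma line_ccont y : line_away S y -> ccont (fun x => F (x +i* y)).
Proof.
move=> ya; split => x; have [h1 h2] := line_cderiv x ya;
  apply/differentiable_continuous/derivable1_diffP.
  by case: h1.
by case: h2.
Qed.

Lemma line_ccont_deriv y : line_away S y -> ccont (fun x => F' (x +i* y)).
Proof.
move=> [r r0 ra]; apply: ccont_eps => x e e0.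
have [s s0 hs] := hol_deriv_cont hF r0 (ra x) e0.
by exists s => // t ts; rewrite shiftx; apply: hs; rewrite normcR.
Qed.

Variables (y1 y2 : R).
Hypothesis Fline : forall y, y1 < y < y2 -> line_away S y.
Hypothesis Fper : forall x y, y1 < y < y2 -> F ((x + 1) +i* y) = F (x +i* y).

(** Cauchy's theorem for a periodic function: the derivative of the row integral in y is i times the
    integral of F' over a period, which vanishes. The remainder is quadratic, so [quad_const]
    applies. *)
Lemma strip_const y y' : y1 < y < y2 -> y1 < y' < y2 ->
  Cint (-1/2) (1/2) (fun x => F (x +i* y)) = Cint (-1/2) (1/2) (fun x => F (x +i* y')).
Proof.
pose A y := Cint (-1/2) (1/2) (fun x => F (x +i* y)).
suff Q y0 : y1 < y0 < y2 -> exists M e : R, 0 < e /\ forall t : R, `|t| < e ->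
    normc (A (y0 + t) - A y0) <= M * t ^+ 2.
  move=> yI y'I; rewrite -/(A y) -/(A y'); apply: complex_eqP.
    apply: (@quad_const _ (fun y => complex.Re (A y)) y1 y2) => // x /Q[M [e [e0 hM]]].
    exists M, e; split => // t /hM; apply: le_trans.
    by rewrite -cReN -cReD ler_normRe.
  apply: (@quad_const _ (fun y => complex.Im (A y)) y1 y2) => // x /Q[M [e [e0 hM]]].
  exists M, e; split => // t /hM; apply: le_trans.
  by rewrite -cImN -cImD ler_normIm.
move=> yI; have [r r0 ra] := Fline yI.
have [M [M0 hM]] := hol_ge0 (1 + `|y0|) hF r0.
move: (yI) => /andP[yI1 yI2].
exists (2 * M * (1/2 - (-1/2))), (Num.min (r / 2) (Num.min (y0 - y1) (y2 - y0))).
split; first by rewrite !lt_min divr_gt0// !subr_gt0 yI1.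
move=> t; rewrite !lt_min => /andP[tr /andP[t1 t2]].
have ytI : y1 < y0 + t < y2.
  by move: t1 t2; rewrite !ltr_norml => /andP[? ?] /andP[? ?]; apply/andP; split; lra.
have cF := line_ccont (Fline yI); have cFt := line_ccont (Fline ytI).
have cF' := line_ccont_deriv (Fline yI).
have half : (-1/2 : R) < 1/2 by lra.
have I0 : Cint (-1/2) (1/2) (fun x => ('i * t%:C) * F' (x +i* y0)) = 0.
  rewrite CintZ// (Cint_FTC half (fun x => line_cderiv x (Fline yI)) cF').
  have -> : (1/2 : R) = -1/2 + 1 by lra.
  by rewrite Fper// subrr mulr0.
rewrite /A -CintB// -[Cint _ _ _]subr0 -{1}I0 -CintB//; [|exact: ccontB|exact: ccontZ].
have -> : 2 * M * (1/2 - -1/2) * t ^+ 2 = 2 * (M * t ^+ 2) * (1/2 - -1/2) by ring.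
apply: normc_Cint_le; first exact: ltW.
  by apply: ccontB; [exact: ccontB|exact: ccontZ].
move=> x /andP[x1 x2]; rewrite shifty.
have xB : normc (x +i* y0) <= 1 + `|y0|.
  by rewrite (le_trans (normc_le_ReIm _))//= lerD2r ler_norml; apply/andP; split; lra.
have [_ _ h] := hM _ xB (ra x).
have nit : normc ('i * t%:C) = `|t|.
  by rewrite normcM normcR normcE/= expr0n expr1n add0r sqrtr1 mul1r.
by rewrite -(real_normK (num_real t)) -nit; apply: h; rewrite nit ltW.
Qed.

End Strip.
End Strips.

(** * Fourier coefficients along horizontal rows *)

Section RowFourier.
Variables (R : realType) (tau : R[i]).
Hypothesis htau : 0 < complex.Im tau.
Local Notation h := (complex.Im tau).
Local Notation Lam := (lattice tau).
Implicit Types (x y : R) (z : R[i]) (f d : R[i] -> R[i]) (m : int).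

(** With this exponent [em m z] is exp(-2 pi i m z). Taking the character holomorphic in z, not only
    in x, makes the row coefficients of a holomorphic function independent of the height. *)
Definition cm m : R[i] := 0 +i* (- (2 * pi * m%:~R)).
Definition em m z : R[i] := cexp (cm m * z).
Definition rowcoef f m y : R[i] :=
  Cint (-1/2) (1/2) (fun x => f (x +i* y) * em m (x +i* y)).

Lemma emD m z w : em m (z + w) = em m z * em m w.
Proof. by rewrite /em mulrDr cexpD. Qed.

Lemma em1 m : em m 1 = 1.
Proof.
rewrite /em mulr1 /cexp /cm/= expR0 mul1r cisN cis_int.
exact: conjc1.
Qed.

Lemma emE m x y : em m (x +i* y) = (expR (2 * pi * m%:~R * y))%:C * cis (- (2 * pi * m%:~R * x)).
Proof.
rewrite /em /cexp.
have -> : complex.Re (cm m * (x +i* y)) = 2 * pi * m%:~R * y by rewrite cReM/=; ring.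
have -> : complex.Im (cm m * (x +i* y)) = - (2 * pi * m%:~R * x) by rewrite cImM/=; ring.
by [].
Qed.

Lemma em_periodic m x y : em m ((x + 1) +i* y) = em m (x +i* y).
Proof. by rewrite shiftx emD em1 mulr1. Qed.

Lemma line_ccont_em m y : ccont (fun x => em m (x +i* y)).
Proof.
apply: (@line_ccont _ set0 _ _ (hol_cexp _ (cm m))).
by exists 1 => // x w.
Qed.

Lemma cm_neq0 m : m != 0 -> cm m != 0.
Proof.
move=> m0; apply/eqP => /(congr1 (@complex.Im R)) /= /eqP.
by rewrite oppr_eq0 !mulf_eq0 pnatr_eq0/= (gt_eqF (pi_gt0 R)) intr_eq0 (negbTE m0).
Qed.

Lemma halves : (-1/2 : R) < 1/2. Proof. by lra. Qed.

Lemma Cint_em m y : Cint (-1/2) (1/2) (fun x => em m (x +i* y)) = (m == 0)%:R.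
Proof.
have cderiv_em m' x : cderiv (fun x => em m' (x +i* y)) x (cm m' * em m' (x +i* y)).
  apply: (@line_cderiv _ set0 _ _ (hol_cexp _ (cm m'))).
  by exists 1 => // ? w.
have [->|m0] := eqVneq m 0.
  have e0 z : em 0 z = 1.
    by rewrite /em /cm mulr0 oppr0 (_ : 0 +i* 0 = 0)// mul0r cexp0.
  rewrite (@eq_Cint _ _ _ _ (fun=> 1)) ?/Cint//; apply: complex_eqP => /=.
    rewrite Rintegral_cst//= lebesgue_measure_itv/= lte_fin halves/= mul1r.
    by lra.
  by rewrite Rintegral_cst// mul0r.
apply: (mulfI (cm_neq0 m0)); rewrite mulr0 -CintZ; last exact: line_ccont_em.
rewrite (Cint_FTC halves (cderiv_em m)); last exact/ccontZ/line_ccont_em.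
have -> : (1/2 : R) = -1/2 + 1 by lra.
by rewrite em_periodic subrr.
Qed.

Lemma line_away_lattice y : 0 < `|y| < h -> line_away Lam y.
Proof.
move=> /andP[y0 yh]; exists (Num.min `|y| (h - `|y|)).
  by rewrite lt_min y0 subr_gt0.
move=> x w [m [n ->]]; rewrite (le_trans _ (ler_normIm _))// cImD cImN Im_lp/=.
have [->|n0] := eqVneq n 0; first by rewrite mul0r subr0 ge_min lexx.
rewrite ge_min; apply/orP; right.
have n1 : 1 <= `|n%:~R : R| by rewrite -intr_norm -[1]/(1%:~R) ler_int; lia.
have : `|n%:~R * h| - `|y| <= `|y - n%:~R * h| by rewrite distrC lerB_dist.
apply: le_trans; rewrite lerD2r normrM (gtr0_norm htau).
by rewrite -[leLHS]mul1r ler_pM2r.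
Qed.

Lemma rowcoef_const S f d m y1 y2 y y' : hol S f d ->
  (forall y, y1 < y < y2 -> line_away S y) ->
  (forall x y, y1 < y < y2 -> f ((x + 1) +i* y) = f (x +i* y)) ->
  y1 < y < y2 -> y1 < y' < y2 -> rowcoef f m y = rowcoef f m y'.
Proof.
move=> hf Sl fp; apply: (strip_const (holM hf (hol_cexp S (cm m)))) => // x y'' yI.
by rewrite fp//; congr (_ * _); exact: em_periodic.
Qed.

Lemma rowcoef_tau f kap m y :
  ccont (fun x => f (x +i* y)) -> ccont (fun x => f (x +i* (y + h))) ->
  (forall x, f ((x + 1) +i* (y + h)) = f (x +i* (y + h))) ->
  (forall x, f ((x +i* y) + tau) = f (x +i* y) + kap) ->
  rowcoef f m (y + h) = em m tau * (rowcoef f m y + kap * (m == 0)%:R).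
Proof.
move=> cf cfh fp ft; rewrite /rowcoef.
rewrite -(@Cint_periodic_shift _ _ (complex.Re tau)); first last.
- by move=> x; rewrite fp em_periodic.
- by apply: ccontM => //; exact: line_ccont_em.
have xt x : (x + complex.Re tau) +i* (y + h) = (x +i* y) + tau.
  by apply: complex_eqP; rewrite ?cReD ?cImD.
rewrite (@eq_Cint _ _ _ _ (fun x => em m tau * (f (x +i* y) * em m (x +i* y) +
    kap * em m (x +i* y)))); last first.
  by move=> x _; rewrite xt ft emD; ring.
have ce := line_ccont_em m y.
rewrite CintZ; last by apply: ccontD; [exact: ccontM|exact: ccontZ].
rewrite CintD; [|exact: ccontM|exact: ccontZ].
by rewrite CintZ// Cint_em.
Qed.

End RowFourier.

(** * Row coefficients of psi, the residue at 0 and Legendre's relation *)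

Section ZetaJump.
Variables (R : realType) (tau : R[i]).
Hypothesis htau : 0 < complex.Im tau.
Local Notation h := (complex.Im tau).
Local Notation Lam := (lattice tau).
Local Notation psi := (psi tau).
Local Notation kappa := (kappa tau).
Local Notation em := (@em R).
Implicit Types (x y : R) (z : R[i]) (m : int).

Lemma psi_line_notin x y : 0 < `|y| < h -> ~ Lam (x +i* y).
Proof.
by move=> /(line_away_lattice htau)[r r0 ra]; exact: away_notin (ra x).
Qed.

Lemma psi_per x y : 0 < `|y| < h -> psi ((x + 1) +i* y) = psi (x +i* y).
Proof.
by move=> yh; rewrite shiftx psi_1//; exact: psi_line_notin.
Qed.

Lemma psi_ccont y : 0 < `|y| < h -> ccont (fun x => psi (x +i* y)).
Proof. by move=> yh; exact: (line_ccont (hol_psi htau) (line_away_lattice htau yh)). Qed.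

(** [Apos] and [Aneg] are the constant values of the row coefficients above and below the row of
    poles y = 0; they differ by the residue. *)
Definition Apos m := rowcoef psi m (h / 2).
Definition Aneg m := rowcoef psi m (- (h / 2)).

Lemma rowcoef_pos m y : 0 < y < h -> rowcoef psi m y = Apos m.
Proof.
move=> yh; apply: (rowcoef_const m (hol_psi htau) (y1 := 0) (y2 := h)) => //.
- by move=> y' /andP[a b]; apply: line_away_lattice => //; rewrite gtr0_norm// a.
- by move=> x y' /andP[a b]; apply: psi_per; rewrite gtr0_norm// a.
- by rewrite divr_gt0//= ltr_pdivrMr// mulr_natr mulr2n ltrDl.
Qed.

Lemma rowcoef_neg m y : - h < y < 0 -> rowcoef psi m y = Aneg m.
Proof.
move=> yh; apply: (rowcoef_const m (hol_psi htau) (y1 := - h) (y2 := 0)) => //.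
- by move=> y' /andP[a b]; apply: line_away_lattice => //; rewrite ltr0_norm// oppr_gt0 b ltrNl.
- by move=> x y' /andP[a b]; apply: psi_per; rewrite ltr0_norm// oppr_gt0 b ltrNl.
- by rewrite ltrN2 oppr_lt0 divr_gt0//= ltr_pdivrMr// mulr_natr mulr2n ltrDl htau.
Qed.

Lemma Apos_tau m : Apos m = em m tau * (Aneg m + kappa * (m == 0)%:R).
Proof.
have h2 : 0 < h / 2 by rewrite divr_gt0.
have h2h : h / 2 < h by rewrite ltr_pdivrMr// mulr_natr mulr2n ltrDl.
have a1 : 0 < `|- (h / 2)| < h by rewrite normrN gtr0_norm// h2.
have a2 : 0 < `|- (h / 2) + h| < h.
  have -> : - (h / 2) + h = h / 2 by rewrite {2}(splitr h) addKr.
  by rewrite gtr0_norm// h2.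
rewrite /Aneg -rowcoef_tau.
- have -> : - (h / 2) + h = h / 2 by rewrite {2}(splitr h) addKr.
  by [].
- exact: psi_ccont.
- exact: psi_ccont.
- by move=> x; exact: psi_per.
- by move=> x; apply: psi_tau => //; exact: psi_line_notin.
Qed.

Definition zrho z := zeta_reg tau z - eta1 tau * z.

Lemma psi_zrho z : psi z = z^-1 + zrho z.
Proof. by rewrite /Submission.psi wzetaE /zrho addrA. Qed.

Lemma zrho_jump : exists L r1 : R, [/\ 0 <= L, 0 < r1 & forall x y, `|x| <= 1/2 -> `|y| <= r1 ->
  normc (zrho (x +i* y) - zrho (x +i* (- y))) <= L * `|y| ].
Proof.
have hrho : hol (lattice0 tau) zrho (fun z => - wp_reg tau z - eta1 tau * 1).
  exact: (holB (hol_zeta_reg htau) (holZ (eta1 tau) (hol_id _))).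
(* A point of the real segment |x| <= 1/2 is at distance at least 1/2 from the nonzero integers and
   at least h from the other rows of the lattice. *)
pose r := Num.min (1/2) h.
have r0 : 0 < r by rewrite lt_min htau; lra.
have [L [L0 hL]] := hol_lip 2 hrho r0.
exists (2 * L), (r / 2); split; [by rewrite mulr_ge0|by rewrite divr_gt0|].
move=> x y xh yr.
have xa : away (lattice0 tau) r (x +i* 0).
  move=> w [m [n [-> w0]]]; rewrite ge_min; apply/orP.
  have [n0|n0] := eqVneq n 0.
    left; rewrite (le_trans _ (ler_normRe _))// cReD cReN Re_lp/= n0 mul0r addr0.
    have m1 : 1 <= `|m%:~R : R|.
      move: w0; rewrite lp_eq0// n0 eqxx andbT => m0.
      by rewrite -intr_norm -[1]/(1%:~R) ler_int; lia.
    by have := lerB_dist (m%:~R) x; rewrite distrC; move: xh m1; lra.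
  right; rewrite (le_trans _ (ler_normIm _))// cImD cImN Im_lp/= sub0r normrN normrM.
  rewrite (gtr0_norm htau) -[leLHS]mul1r ler_pM2r// -intr_norm -[1]/(1%:~R) ler_int.
  by lia.
have xB : normc (x +i* 0) <= 2.
  by rewrite (le_trans (normc_le_ReIm _))//= normr0 addr0; move: xh; lra.
have nit (t : R) : normc ('i * t%:C) = `|t|.
  by rewrite normcM normcR normcE/= expr0n expr1n add0r sqrtr1 mul1r.
have e t : x +i* t = (x +i* 0) + 'i * t%:C by rewrite -shifty add0r.
have h1 : normc ('i * y%:C) <= r / 2 by rewrite nit.
have h2 : normc ('i * (- y)%:C) <= r / 2 by rewrite nit normrN.
have := hL _ xB xa _ h1; have := hL _ xB xa _ h2; rewrite !nit normrN -!e.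
set a := zrho _; set b := zrho _; set c := zrho _ => i1 i2.
have -> : c - a = (c - b) - (a - b) by ring.
by rewrite (le_trans (le_normcB _ _))//; move: i1 i2; lra.
Qed.

(** The Poisson kernel without its factor 1/pi. The values of 1/z at x + iy and x - iy differ by -2i
    times it. *)
Definition poisson y x : R := y / (x ^+ 2 + y ^+ 2).

Lemma poisson_den x y : 0 < y -> 0 < x ^+ 2 + y ^+ 2.
Proof. by move=> y0; rewrite ltr_wpDl ?sqr_ge0// exprn_gt0. Qed.

Lemma continuous_poisson y : 0 < y -> continuous (poisson y).
Proof.
move=> y0 x; apply: cvgM; first exact: cvg_cst.
apply: cvgV; first by rewrite lt0r_neq0// poisson_den.
by apply: cvgD; [exact: exprn_continuous|exact: cvg_cst].
Qed.

Lemma continuous_cosM (a : R) : continuous (fun x => cos (a * x)).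
Proof.
move=> x; apply: continuous_comp; last exact: continuous_cos.
by apply: cvgM; [exact: cvg_cst|exact: cvg_id].
Qed.

Lemma continuous_RM (f g : R -> R) : continuous f -> continuous g ->
  continuous (fun x => f x * g x).
Proof. by move=> cf cg x; apply: cvgM; [exact: cf|exact: cg]. Qed.

Lemma cos_sub1 (t : R) : `|1 - cos t| <= t ^+ 2.
Proof.
have dcos x : is_derive x 1 (@cos R) (- sin x) by exact: is_derive_cos.
have dNsin x : is_derive x 1 (fun x => - @sin R x) (- cos x) by exact: is_deriveN.
have := @taylor2_bound _ cos (fun x => - sin x) (fun x => - cos x) 1 t dcos dNsin.
rewrite cos0 sin0 oppr0 mulr0 subr0 mul1r distrC; apply.
by move=> x _; rewrite normrN cos_max.
Qed.

(** The mass on the segment is 2 atan(1/(2y)), which tends to pi. Replacing the cosine by 1 costs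
    a^2 y, because 1 - cos t <= t^2 and y x^2/(x^2 + y^2) <= y. *)
Lemma poisson_cos y (a : R) : 0 < y ->
  `|\int[@lebesgue_measure R]_(x in `[(-1/2), (1/2)]) (poisson y x * cos (a * x)) - pi| <=
  a ^+ 2 * y + `|2 * atan (1 / (2 * y)) - pi|.
Proof.
move=> y0; set mu := @lebesgue_measure R.
have cP := continuous_poisson y0.
have cC : continuous (fun x => poisson y x * (1 - cos (a * x))).
  apply: continuous_RM => // x; apply: cvgB; first exact: cvg_cst.
  exact: continuous_cosM.
have -> : \int[mu]_(x in `[(-1/2), (1/2)]) (poisson y x * cos (a * x)) =
  \int[mu]_(x in `[(-1/2), (1/2)]) poisson y x -
  \int[mu]_(x in `[(-1/2), (1/2)]) (poisson y x * (1 - cos (a * x))).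
  rewrite -RintegralB//; try exact: continuous_integrable.
  by apply: eq_Rintegral => x _; rewrite mulrBr mulr1 opprB addrCA subrr addr0.
rewrite /poisson Rint_poisson// addrAC.
rewrite addrC (le_trans (ler_normD _ _))// lerD2r normrN.
have -> : a ^+ 2 * y = a ^+ 2 * y * (1/2 - -1/2) by lra.
apply: Rint_le => //; first exact/ltW/halves.
move=> x _; have p0 := poisson_den x y0.
have P0 : 0 <= y / (x ^+ 2 + y ^+ 2) by rewrite divr_ge0// ltW.
rewrite normrM (ger0_norm P0).
rewrite (@le_trans _ _ (y / (x ^+ 2 + y ^+ 2) * (a * x) ^+ 2))//.
  by rewrite ler_wpM2l ?cos_sub1.
rewrite mulrAC ler_pdivrMr// exprMn mulrCA mulrA ler_wpM2l//.
  by rewrite mulr_ge0 ?sqr_ge0// ltW.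
by rewrite lerDl sqr_ge0.
Qed.

Lemma rowcoef_norm m y : 0 < `|y| < h ->
  (expR (- (2 * pi * m%:~R * y)))%:C * rowcoef psi m y =
  Cint (-1/2) (1/2) (fun x => psi (x +i* y) * cis (- (2 * pi * m%:~R * x))).
Proof.
move=> yh; rewrite -CintZ; last first.
  by apply: ccontM; [exact: psi_ccont|exact: line_ccont_em].
apply: eq_Cint => x _; rewrite emE mulrCA; congr (_ * _).
by rewrite mulrA -rmorphM/= -expRD addNr expR0 mul1r.
Qed.

Lemma ccont_cisN (a : R) : ccont (fun x => cis (- (a * x))).
Proof.
split => /= x.
  apply: continuous_comp; last exact: continuous_cos.
  by apply: cvgN; apply: cvgM; [exact: cvg_cst|exact: cvg_id].
apply: continuous_comp; last exact: continuous_sin.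
by apply: cvgN; apply: cvgM; [exact: cvg_cst|exact: cvg_id].
Qed.

(** The residue is computed without contours: between the heights y and -y the polar part changes by
    a multiple of the Poisson kernel, of total mass close to -2 pi i, and the regular part [zrho]
    contributes O(y). *)
Lemma jump_estimate m : exists C r1 : R, [/\ 0 <= C, 0 < r1 & forall y, 0 < y < r1 ->
  normc ((expR (- (2 * pi * m%:~R * y)))%:C * Apos m -
         (expR (2 * pi * m%:~R * y))%:C * Aneg m + (0 +i* (2 * pi))) <=
  C * y + 2 * `|2 * atan (1 / (2 * y)) - pi| ].
Proof.
have [L [r1 [L0 r10 hL]]] := zrho_jump.
pose a : R := 2 * pi * m%:~R.
exists (2 * a ^+ 2 + 2 * L), (Num.min h r1); split.
- by rewrite addr_ge0// mulr_ge0// sqr_ge0.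
- by rewrite lt_min htau.
move=> y /andP[y0]; rewrite lt_min => /andP[yh yr].
have y1 : 0 < `|y| < h by rewrite gtr0_norm// y0.
have y2 : 0 < `|- y| < h by rewrite normrN gtr0_norm// y0.
rewrite -(@rowcoef_pos m y); last by rewrite y0.
rewrite -(@rowcoef_neg m (- y)); last by rewrite ltrN2 yh oppr_lt0.
rewrite (rowcoef_norm m y1).
have -> : 2 * pi * m%:~R * y = - (2 * pi * m%:~R * - y) by rewrite mulrN opprK.
rewrite (rowcoef_norm m y2).
have cc := ccont_cisN a.
have c1 := ccontM (psi_ccont y1) cc; have c2 := ccontM (psi_ccont y2) cc.
rewrite -(CintB _ _ c1 c2).
pose Q x : R[i] := 0 +i* (- 2 * poisson y x).
have cP := continuous_poisson y0.
have cQ : ccont Q.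
  split => /= x; first exact: cvg_cst.
  by apply: cvgM; [exact: cvg_cst|exact: cP].
pose D x := psi (x +i* y) - psi (x +i* (- y)) - Q x.
have cD : ccont D.
  by apply: ccontB => //; apply: ccontB; exact: psi_ccont.
rewrite (@eq_Cint _ _ _ _ (fun x => Q x * cis (- (a * x)) + D x * cis (- (a * x)))); last first.
  by move=> x _; rewrite /D /a; ring.
have cQc := ccontM cQ cc; have cDc := ccontM cD cc.
rewrite (CintD _ _ cQc cDc).
have DL x : -1/2 <= x <= 1/2 -> normc (D x * cis (- (a * x))) <= L * y.
  move=> /andP[x1 x2]; rewrite normcM normc_cis mulr1.
  have -> : D x = zrho (x +i* y) - zrho (x +i* (- y)).
    rewrite /D !psi_zrho.
    have p0 := poisson_den x y0.
    have -> : Q x = (x +i* y)^-1 - (x +i* (- y))^-1.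
      rewrite /Q /poisson; apply: complex_eqP; rewrite ?cReD ?cImD ?cReN ?cImN /= sqrrN.
        by rewrite subrr.
      by field; rewrite lt0r_neq0.
    by ring.
  have := hL x y; rewrite (gtr0_norm y0); apply; last exact: ltW.
  by rewrite ler_norml; apply/andP; split; lra.
have I2 := normc_Cint_le (ltW (halves R)) cDc DL.
have I1 : normc (Cint (-1/2) (1/2) (fun x => Q x * cis (- (a * x))) + (0 +i* (2 * pi))) <=
    2 * a ^+ 2 * y + 2 * `|2 * atan (1 / (2 * y)) - pi|.
  have -> : Cint (-1/2) (1/2) (fun x => Q x * cis (- (a * x))) = 0 +i*
     (- 2 * \int[@lebesgue_measure R]_(x in `[(-1/2), (1/2)]) (poisson y x * cos (a * x))).
    rewrite /Cint; congr (_ +i* _).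
      have -> : (-1/2 : R) = - (1/2) by lra.
      apply: Rint_odd; [by lra|by case: cQc|].
      move=> x; rewrite !cReM/= /poisson sqrrN !mulrN opprK sinN; ring.
    rewrite -RintegralZl//; last first.
      by apply: continuous_integrable; apply: continuous_RM => //; exact: continuous_cosM.
    by apply: eq_Rintegral => x _; rewrite cImM/= cosN mul0r add0r mulrA.
  rewrite normcE/= addr0 expr0n add0r sqrtr_sqr.
  set I := \int[_]_(x in _) _.
  have -> : - 2 * I + 2 * pi = - 2 * (I - pi) by ring.
  rewrite normrM normrN normr_nat -mulrA -mulrDr ler_wpM2l//.
  exact: poisson_cos.
set A := Cint _ _ _; set A2 := Cint _ _ _; rewrite -/A -/A2 in I1 I2 *.
have -> : A + A2 + (0 +i* (2 * pi)) = A + (0 +i* (2 * pi)) + A2 by ring.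
rewrite (le_trans (le_normcD _ _))//.
by move: I1 I2; lra.
Qed.

Lemma zeta_jump m : Apos m - Aneg m = 0 +i* (- (2 * pi)).
Proof.
have [C [r1 [C0 r10 hC]]] := jump_estimate m.
move: (Apos m) (Aneg m) hC => B N hC.
suff X e : 0 < e -> normc (B - N + (0 +i* (2 * pi))) <= e.
  have /eq0_normc/eqP : normc (B - N + (0 +i* (2 * pi))) = 0.
    apply/eqP; rewrite eq_le normc_ge0 andbT; apply/ler_addgt0Pr => e e0.
    by rewrite add0r; exact: X.
  rewrite addr_eq0 => /eqP ->.
  by apply: complex_eqP => /=; rewrite ?oppr0.
move=> e0.
(* The exponential factors cost e' (|B| + |N|), and the right-hand side of [jump_estimate] will be
   at most 5 e'. *)
pose k := normc B + normc N + 6.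
have k0 : 0 < k by rewrite ltr_wpDl// addr_ge0 ?normc_ge0.
pose e' := e / k; have e'0 : 0 < e' by rewrite divr_gt0.
have ce : {for 0, continuous (@expR R)} by exact: continuous_expR.
move/cvgrPdist_lt/(_ _ e'0) : ce => -[d /= d0 hd].
have /cvgrPdist_lt/(_ _ e'0) [X0 [_ hX]] := @cvgy_atan R.
pose a : R := 2 * pi * m%:~R.
have a1 : 0 < `|a| + 1 by rewrite ltr_wpDl.
have X1 : 0 < `|X0| + 1 by rewrite ltr_wpDl.
have C1 : 0 < C + 1 by rewrite ltr_wpDl.
pose y := Num.min (r1 / 2) (Num.min (d / 2 / (`|a| + 1)) (Num.min (1 / (2 * (`|X0| + 1))) (e' / (C + 1)))).
have y0 : 0 < y by rewrite !lt_min !divr_gt0// mulr_gt0.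
have y1 : y < r1.
  by have : y <= r1 / 2; [rewrite /y ge_min lexx|move: r10; lra].
have y2 : `|a * y| < d.
  rewrite normrM (gtr0_norm y0) (@le_lt_trans _ _ ((`|a| + 1) * y))//.
    by rewrite ler_wpM2r ?ltW// ltrDl.
  have yd : y <= d / 2 / (`|a| + 1) by rewrite /y !ge_min lexx orbT.
  rewrite mulrC -ltr_pdivlMr// (le_lt_trans yd)//.
  by rewrite ltr_pM2r ?invr_gt0//; move: d0; lra.
have y3 : X0 < 1 / (2 * y).
  rewrite (@lt_le_trans _ _ (`|X0| + 1))//.
    by rewrite (le_lt_trans (ler_norm _))// ltrDl.
  have yX : y <= 1 / (2 * (`|X0| + 1)) by rewrite /y !ge_min lexx !orbT.
  rewrite ler_pdivlMr ?mulr_gt0//; move: yX; rewrite ler_pdivlMr ?mulr_gt0//; lra.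
have y4 : C * y <= e'.
  rewrite (@le_trans _ _ ((C + 1) * y))//; first by rewrite ler_wpM2r ?ltW// ltrDl.
  have yC : y <= e' / (C + 1) by rewrite /y !ge_min lexx !orbT.
  by rewrite mulrC -ler_pdivlMr.
have H := hC y; rewrite y0 y1 in H; have {}H := H isT.
have E1 : `|1 - expR (- (a * y))| <= e'.
  by rewrite ltW// -expR0 hd//= sub0r opprK.
have E2 : `|1 - expR (a * y)| <= e'.
  by rewrite ltW// -expR0 hd//= sub0r normrN.
have E3 : `|2 * atan (1 / (2 * y)) - pi| <= 2 * e'.
  have := ltW (hX _ y3); rewrite distrC.
  have -> : 2 * atan (1 / (2 * y)) - pi = 2 * (atan (1 / (2 * y)) - pi / 2) by field.
  by rewrite normrM normr_nat => E; rewrite ler_wpM2l.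
rewrite -/a in H.
have -> : B - N + (0 +i* (2 * pi)) = (1 - expR (- (a * y)))%:C * B - (1 - expR (a * y))%:C * N +
   ((expR (- (a * y)))%:C * B - (expR (a * y))%:C * N + (0 +i* (2 * pi))).
  by rewrite !rmorphB/=; ring.
have T1 : normc ((1 - expR (- (a * y)))%:C * B) <= e' * normc B.
  by rewrite normcM normcR ler_wpM2r ?normc_ge0.
have T2 : normc ((1 - expR (a * y))%:C * N) <= e' * normc N.
  by rewrite normcM normcR ler_wpM2r ?normc_ge0.
have -> : e = e' * normc B + e' * normc N + 6 * e'.
  have {1}<- : e' * k = e by rewrite /e' divfK// lt0r_neq0.
  by rewrite /k; ring.
rewrite (le_trans (le_normcD _ _))// lerD//.
  by rewrite (le_trans (le_normcB _ _))// lerD.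
by rewrite (le_trans H)//; move: y4 E3; lra.
Qed.

(** For m = 0 the passage from the row -h/2 to the row h/2 is computed twice: by translation along
    tau and by crossing the pole. *)
Lemma legendre : kappa = 0 +i* (- (2 * pi)).
Proof.
have := Apos_tau 0; have := zeta_jump 0.
rewrite eqxx mulr1 /em /cm mulr0 oppr0 (_ : 0 +i* 0 = 0)// mul0r cexp0 mul1r => <- ->.
by ring.
Qed.

(** Translation by tau and crossing the pole are two relations between [Apos] and [Aneg]; together
    they determine [Apos] when m is not 0. *)
Lemma Apos_neq0 m : m != 0 -> Apos m * (1 - em m tau) = (0 +i* (2 * pi)) * em m tau.
Proof.
move=> m0; have := Apos_tau m; rewrite (negbTE m0) mulr0 addr0.
have -> : Aneg m = Apos m - (0 +i* (- (2 * pi))) by rewrite -(zeta_jump m); ring.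
have -> : 0 +i* (- (2 * pi)) = - (0 +i* (2 * pi)) :> R[i].
  by apply: complex_eqP; rewrite /= ?oppr0.
by rewrite opprK => E; rewrite mulrBr mulr1 {1}E; ring.
Qed.

(** For m = 0 the two relations only yield [kappa]; the oddness of psi supplies the missing equation
    [Aneg 0] = - [Apos 0]. *)
Lemma Apos_0 : Apos 0 = 0 +i* (- pi).
Proof.
have e0 z : em 0 z = 1.
  by rewrite /Submission.em /cm mulr0 oppr0 (_ : 0 +i* 0 = 0)// mul0r cexp0.
have h2 : 0 < h / 2 by rewrite divr_gt0.
have yh : 0 < `|h / 2| < h.
  by rewrite gtr0_norm// h2 ltr_pdivrMr// mulr_natr mulr2n ltrDl.
have E : Aneg 0 = - Apos 0.
  rewrite -mulN1r /Apos /rowcoef -CintZ; last first.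
    by apply: ccontM; [exact: psi_ccont|exact: line_ccont_em].
  have yhN : 0 < `|- (h / 2)| < h by rewrite normrN.
  rewrite /Aneg /rowcoef -(Cint_reflect (ccontM (psi_ccont yhN) (line_ccont_em 0 _))).
  apply: eq_Cint => x _; rewrite !e0 !mulr1.
  have -> : (- x) +i* (- (h / 2)) = - (x +i* (h / 2)) by [].
  have [r r0 ra] := line_away_lattice htau yh.
  by rewrite /Submission.psi (wzetaN htau r0 (ra x)); ring.
have := zeta_jump 0; rewrite E opprK => E2.
have {}E2 : 2 * Apos 0 = 2 * (0 +i* (- pi)).
  rewrite mulr_natl mulr2n E2; apply: complex_eqP; rewrite ?cReM ?cImM ?Re_nat ?Im_nat/=; ring.
by apply: mulfI E2; rewrite pnatr_eq0.
Qed.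

End ZetaJump.

(** * Measurability in the plane and the fundamental parallelogram *)

Section PlaneMeasure.
Variable R : realType.
Local Notation mu := (@lebesgue_measure R).
Local Notation T := (measurableTypeR R).
Local Notation pm := (@plane_measure R).

(** An open set is a countable union of boxes with rational centre and radius, and boxes are
    measurable in the product. *)
Lemma open_measurable2 (U : set (R * R)) : open U -> measurable (U : set (T * T)).
Proof.
move=> oU.
pose box (p : rat * rat * rat) : set (T * T) :=
  ball (ratr p.1.1 : R) (ratr p.2 : R) `*` ball (ratr p.1.2 : R) (ratr p.2 : R).
have mbox p : measurable (box p) by apply: measurableX; exact: measurable_ball.
pose F p := if `[< box p `<=` U >] then box p else set0.
rewrite (_ : U = \bigcup_p F p); last first.
  apply/seteqP; split => [[x y] Uxy|u [p _]]; last first.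
    by rewrite /F; case: asboolP => // h /h.
  have /nbhs_ballP[e /= e0 eU] : nbhs (x, y) U by exact: open_nbhs_nbhs.
  have e4 : 0 < e / 4 by rewrite divr_gt0.
  have e42 : e / 4 < e / 2 by lra.
  have [q] := rat_in_itvoo e42; rewrite in_itv/= => /andP[q1 q2].
  have q0 : 0 < (ratr q : R) by exact: lt_trans q1.
  have xq : x - ratr q < x + ratr q by lra.
  have yq : y - ratr q < y + ratr q by lra.
  have [a] := rat_in_itvoo xq; rewrite in_itv/= => /andP[a1 a2].
  have [b] := rat_in_itvoo yq; rewrite in_itv/= => /andP[b1 b2].
  have bU : box (a, b, q) `<=` U.
    move=> [x' y'] [/=]; rewrite /ball/= => bx by'.
    apply: eU; rewrite /ball/=; split; rewrite /ball/=.
      move: bx; rewrite !ltr_norml => /andP[? ?]; apply/andP; split; lra.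
    move: by'; rewrite !ltr_norml => /andP[? ?]; apply/andP; split; lra.
  exists (a, b, q) => //; rewrite /F; case: asboolP => // _.
  by split; rewrite /ball/= ltr_norml; apply/andP; split; lra.
apply: countable_bigcupT_measurable => // p.
by rewrite /F; case: asboolP.
Qed.

Lemma open_measurable_fun2 (U : set (R * R)) (f : R * R -> R) : open U ->
  (forall u, U u -> {for u, continuous f}) -> measurable_fun (U : set (T * T)) (f : T * T -> R).
Proof.
move=> oU cf; apply: (measurability _ (RGenOpens.measurableE R)).
move=> _ [_ [a [b ->] <-]]; apply: open_measurable2.
rewrite openE => u [Uu fu].
have [h1 h2] : nbhs u U /\ nbhs u (f @^-1` `]a, b[%classic).
  split; first exact: open_nbhs_nbhs.
  by apply: cf => //; apply: open_nbhs_nbhs; split; [exact: interval_open|].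
exact: filterI.
Qed.

Lemma plane_measureX (A B : set T) : measurable A -> measurable B ->
  pm (A `*` B) = (mu A * mu B)%E.
Proof. by move=> mA mB; exact: product_measure1E. Qed.

Section FundamentalDomain.
Variable tau : R[i].
Hypothesis htau : 0 < complex.Im tau.
Local Notation h := (complex.Im tau).
Local Notation D := (fundamental_domain tau).

(** Horizontal drift of the parallelogram per unit of height: its row at height y is the unit
    interval starting at [slope] y. *)
Definition slope : R := complex.Re tau / h.

Lemma fundamental_domainE u : D u <->
  (0 <= u.2 < h) /\ (slope * u.2 <= u.1 < slope * u.2 + 1).
Proof.
have h0 := lt0r_neq0 htau.
split=> [[s [t [/andP[s0 s1] /andP[t0 t1]]]]|].
  case: u => x y /= E.
  have -> : x = s + t * complex.Re tau by have /(congr1 (@complex.Re R)) := E; rewrite /= cReD cReM/= mul0r subr0.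
  have -> : y = t * h by have /(congr1 (@complex.Im R)) := E; rewrite /= cImD cImM/= mul0r addr0 add0r.
  have -> : slope * (t * h) = t * complex.Re tau by rewrite /slope; field.
  split; first by rewrite mulr_ge0// ?ltW//= -[ltRHS]mul1r ltr_pM2r.
  by apply/andP; split; lra.
case: u => x y /= [/andP[y0 y1] /andP[x0 x1]].
exists (x - slope * y), (y / h); split.
- by apply/andP; split; lra.
- by apply/andP; split; [apply: divr_ge0 => //; exact: ltW|rewrite ltr_pdivrMr// mul1r].
- apply: complex_eqP; rewrite ?cReD ?cImD ?cReM ?cImM/= ?mul0r ?subr0 ?addr0 ?add0r.
    by rewrite /slope; field.
  by rewrite divfK.
Qed.

Lemma measurable_snd2 : measurable_fun setT (fun u : T * T => u.2 : R).
Proof. exact: measurable_snd. Qed.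
Lemma measurable_fst2 : measurable_fun setT (fun u : T * T => u.1 : R).
Proof. exact: measurable_fst. Qed.

Lemma measurable_fundamental : measurable (D : set (T * T)).
Proof.
rewrite (_ : D = ((fun u : T * T => u.2) @^-1` `[0, h[%classic) `&`
    ((fun u : T * T => u.1 - slope * u.2) @^-1` `[0, 1[%classic)).
  apply: measurableI.
    rewrite -[X in measurable X]setTI; apply: measurable_snd2 => //.
  rewrite -[X in measurable X]setTI.
  have mf : measurable_fun setT (fun u : T * T => (u.1 - slope * u.2 : R)).
    apply: measurable_funB; first exact: measurable_fst2.
    by apply: measurable_funM; [exact: measurable_cst|exact: measurable_snd2].
  exact: mf.
apply/seteqP; split => u.
  move=> /fundamental_domainE[h1 /andP[h2 h3]]; split; rewrite /= in_itv/=//.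
  by apply/andP; split; lra.
move=> [] /=; rewrite !in_itv/= => h1 /andP[h2 h3]; apply/fundamental_domainE; split => //.
by apply/andP; split; lra.
Qed.

Lemma fundamental_bounded u : D u -> normc (to_complex u) <= 1 + normc tau.
Proof.
move=> [s [t [/andP[s0 s1] /andP[t0 t1] ->]]].
rewrite (le_trans (le_normcD _ _))// normcM !normcR !ger0_norm//.
by apply: lerD; [exact: ltW|apply: ler_piMl; [exact: normc_ge0|exact: ltW]].
Qed.

Lemma fundamental_finite : (pm D < +oo)%E.
Proof.
pose B := 1 + normc tau.
have DB : D `<=` (`[(- B), B]%classic `*` `[(- B), B]%classic).
  move=> u /fundamental_bounded uB; split => /=; rewrite in_itv/= -ler_norml.
    by rewrite (le_trans (ler_normRe (to_complex u))).
  by rewrite (le_trans (ler_normIm (to_complex u))).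
have mX : measurable (`[(- B), B]%classic `*` `[(- B), B]%classic : set (T * T)).
  by apply: measurableX.
apply: (@le_lt_trans _ _ (pm (`[(- B), B]%classic `*` `[(- B), B]%classic))).
  by apply: le_measure => //; rewrite inE//; exact: measurable_fundamental.
rewrite plane_measureX//= lebesgue_measure_itv/=.
by case: ifP => _; rewrite ?mule0// -EFinM ltry.
Qed.

End FundamentalDomain.
End PlaneMeasure.

(** * Integration over the torus row by row *)

Section TorusRows.
Variables (R : realType) (tau : R[i]).
Hypothesis htau : 0 < complex.Im tau.
Local Notation h := (complex.Im tau).
Local Notation D := (fundamental_domain tau).
Local Notation mu := (@lebesgue_measure R).
Local Notation T := (measurableTypeR R).
Local Notation pm := (@plane_measure R).

Definition tintegrable (f : R[i] -> R) := pm.-integrable D (EFin \o on_plane f).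

(** Fubini over the rows of the parallelogram; each is a unit interval, which periodicity moves to
    [-1/2, 1/2]. The row y = 0, which may meet a singularity, is a null set. *)
Lemma torus_rows (f : R[i] -> R) (e : R -> R) : tintegrable f ->
  (forall y, 0 < y < h -> continuous (fun x => f (x +i* y))) ->
  (forall x y, 0 < y < h -> f ((x + 1) +i* y) = f (x +i* y)) ->
  (forall y, 0 < y < h -> \int[mu]_(x in `[(-1/2), (1/2)]) f (x +i* y) = e y) ->
  continuous e ->
  torus_integral tau f = \int[mu]_(y in `[0, h]) e y.
Proof.
move=> fi fc fp fe ce.
have mD := measurable_fundamental htau.
pose F : T * T -> \bar R := (EFin \o on_plane f) \_ D.
have Fi : pm.-integrable setT F by apply/(integrable_mkcond _ mD).
pose G y := (\int[mu]_x F (x, y))%E.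
have mG : measurable_fun setT G by exact: (@measurable_fubini_G _ _ _ _ _ mu mu F Fi).
pose E : R -> \bar R := (EFin \o e) \_ `]0, h[.
have ei : mu.-integrable `]0, h[ (EFin \o e).
  by apply: (integrableS _ _ _ (continuous_integrable 0 h ce)) => //; exact: subset_itv_oo_cc.
have mI : measurable (`]0, h[%classic : set T) by exact: measurable_itv.
have Ei : mu.-integrable setT E by apply/(integrable_mkcond _ mI).
have GE y : y != 0 -> G y = E y.
  move=> y0; rewrite /G /E patchE; case: ifPn => [|yn].
    rewrite inE/= in_itv/= => yI.
    have -> : (\int[mu]_x F (x, y) = \int[mu]_(x in `[(slope tau * y)%R, (slope tau * y + 1)%R[) (f (x +i* y)%C)%:E)%E.
      rewrite [RHS]integral_mkcond; apply: eq_integral => x _.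
      rewrite /F !patchE; congr (if _ then _ else _).
      apply/idP/idP; rewrite !inE/= in_itv/=; first by move=> /(fundamental_domainE htau)[].
      move=> xI; apply/(fundamental_domainE htau); split => //=.
      by case/andP: yI => /ltW -> ->.
    have ci := continuous_integrable (slope tau * y) (slope tau * y + 1) (fc _ yI).
    have coi : mu.-integrable `[slope tau * y, slope tau * y + 1[ (EFin \o (fun x => f (x +i* y))).
      by apply: (integrableS _ _ _ ci) => //; exact: subset_itv_co_cc.
    rewrite -[LHS]fineK ?integrable_fin_num//; congr EFin.
    rewrite -/(Rintegral _ _ _) Rintegral_itv_bndo_bndc//.
    rewrite -(fe _ yI) (_ : (1/2 : R) = -1/2 + 1); last by lra.
    by apply: Rint_periodic => [|x]; [exact: fc|exact: fp].
  apply: integral0_eq => x _; rewrite /F patchE; case: ifPn => //.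
  rewrite inE => /(fundamental_domainE htau)[/= /andP[a b] _].
  by move: yn; rewrite notin_setE/= in_itv/= b lt0r y0 a.
have m0 : measurable ([set 0] : set T) by exact: measurable_set1.
have mu0 : mu [set 0] = 0%E by exact: lebesgue_measure_set1.
rewrite /torus_integral /Rintegral integral_mkcond.
have -> : (\int[pm]_x F x = \int[mu]_y G y)%E by rewrite /G (integral21_prod_meas1 Fi).
rewrite (@ae_eq_integral _ _ _ mu setT E)//; last 2 first.
- exact: measurable_int Ei.
- exists [set 0]; split => // y /= yn; apply/eqP/negPn/negP => y0; apply: yn => _.
  exact: GE.
rewrite -integral_mkcond.
have E1 : mu.-integrable `]0, h] (EFin \o e).
  by apply: (integrableS _ _ _ (continuous_integrable 0 h ce)) => //; exact: subset_itv_oc_cc.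
exact: etrans (Rintegral_itv_bndo_bndc ei) (Rintegral_itv_obnd_cbnd E1).
Qed.

End TorusRows.

(** * Real and complex integrals over the torus *)

Section TorusIntegral.
Variables (R : realType) (tau : R[i]).
Hypothesis htau : 0 < complex.Im tau.
Local Notation h := (complex.Im tau).
Local Notation D := (fundamental_domain tau).
Local Notation mu := (@lebesgue_measure R).
Local Notation T := (measurableTypeR R).
Local Notation pm := (@plane_measure R).
Local Notation tint := (torus_integral tau).
Local Notation tintegrable := (tintegrable tau).
Implicit Types (f g : R[i] -> R) (F G : R[i] -> R[i]).

Let mD : measurable (D : set (T * T)) := measurable_fundamental htau.

Lemma tintegrableD f g : tintegrable f -> tintegrable g -> tintegrable (fun z => f z + g z).
Proof. by move=> fi gi; exact: (integrableD mD fi gi). Qed.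

Lemma tintegrableZ c f : tintegrable f -> tintegrable (fun z => c * f z).
Proof. by move=> fi; exact: (integrableZl mD c fi). Qed.

Lemma tintegrableB f g : tintegrable f -> tintegrable g -> tintegrable (fun z => f z - g z).
Proof.
by move=> fi gi; exact: (integrableB mD fi gi).
Qed.

Lemma eq_tintegrable f g : f =1 g -> tintegrable f -> tintegrable g.
Proof. by move=> fg; rewrite (funext fg). Qed.

Lemma tintegrable_abs f : tintegrable f -> tintegrable (fun z => `|f z|).
Proof. by move=> fi; exact: (integrable_norm fi). Qed.

Lemma tintD f g : tintegrable f -> tintegrable g ->
  tint (fun z => f z + g z) = tint f + tint g.
Proof. by move=> fi gi; rewrite /torus_integral -RintegralD. Qed.

Lemma tintB f g : tintegrable f -> tintegrable g ->
  tint (fun z => f z - g z) = tint f - tint g.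
Proof. by move=> fi gi; rewrite /torus_integral -RintegralB. Qed.

Lemma tintZ c f : tintegrable f -> tint (fun z => c * f z) = c * tint f.
Proof. by move=> fi; rewrite /torus_integral -RintegralZl. Qed.

Lemma le_tint f g : tintegrable f -> tintegrable g -> (forall z, f z <= g z) ->
  tint f <= tint g.
Proof. by move=> fi gi fg; apply: le_Rintegral => // u _; exact: fg. Qed.

Lemma le_abs_tint f : tintegrable f -> `|tint f| <= tint (fun z => `|f z|).
Proof. by move=> fi; exact: le_normr_Rintegral. Qed.

Definition pmeasurable f := measurable_fun (D : set (T * T)) (on_plane f : T * T -> R).

Definition pbounded f := exists M, forall z, normc z <= 1 + normc tau -> `|f z| <= M.

Lemma pbounded_set f : pbounded f -> [bounded on_plane f x | x in D].
Proof.
move=> [M hM]; exists M; split; first exact: num_real.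
move=> M' MM u Du; apply: (le_trans _ (ltW MM)); apply: hM.
exact: fundamental_bounded.
Qed.

Lemma tintegrable_bounded f : pmeasurable f -> pbounded f -> tintegrable f.
Proof.
move=> mf bf; apply: measurable_bounded_integrable => //.
  exact: fundamental_finite.
exact: pbounded_set.
Qed.

Lemma tintegrableM f g : tintegrable f -> pmeasurable g -> pbounded g ->
  tintegrable (fun z => f z * g z).
Proof. by move=> fi mg bg; exact: (integrableMl mD fi mg (pbounded_set bg)). Qed.

Lemma tintegrable_cst c : tintegrable (fun=> c).
Proof.
apply: tintegrable_bounded; first exact: measurable_cst.
by exists `|c| => z _.
Qed.

Lemma plane_continuous f z :
  (forall e, 0 < e -> exists2 d : R, 0 < d & forall v, normc v < d -> `|f (z + v) - f z| < e) ->
  {for of_complex z, continuous (on_plane f)}.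
Proof.
move=> H; apply/cvgrPdist_lt => e /H[d d0 hd].
suff : nbhs (of_complex z) [set u | `|on_plane f (of_complex z) - on_plane f u| < e] by [].
apply/nbhs_ballP; exists (d / 2); first by rewrite /= divr_gt0.
move=> [x y] [/= bx by']; rewrite /ball/= in bx by'.
rewrite /on_plane/= distrC.
have zE : to_complex (complex.Re z, complex.Im z) = z by case: (z).
rewrite zE.
have -> : to_complex (x, y) = z + ((x - complex.Re z) +i* (y - complex.Im z)).
  by apply: complex_eqP; rewrite ?cReD ?cImD/= addrC subrK.
apply: hd; rewrite (le_lt_trans (normc_le_ReIm _))//= (splitr d).
by rewrite ltrD// distrC.
Qed.

Lemma plane_continuousV f z : {for of_complex z, continuous (on_plane f)} ->
  forall e, 0 < e -> exists2 d : R, 0 < d & forall v, normc v < d -> `|f (z + v) - f z| < e.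
Proof.
move=> /cvgrPdist_lt H e /H /nbhs_ballP[d /= d0 hd]; exists d => // v vd.
have := hd (of_complex (z + v)).
have zE y : to_complex (complex.Re y, complex.Im y) = y by case: y.
rewrite /on_plane/= !zE distrC; apply; split; rewrite /ball/=.
  by rewrite cReD opprD addNKr normrN (le_lt_trans (ler_normRe v)).
by rewrite cImD opprD addNKr normrN (le_lt_trans (ler_normIm v)).
Qed.

Lemma pmeasurable_continuous f :
  (forall z e, 0 < e -> exists2 d : R, 0 < d & forall v, normc v < d -> `|f (z + v) - f z| < e) ->
  pmeasurable f.
Proof.
move=> H; apply: (@measurable_funS _ _ _ _ setT) => //.
apply: open_measurable_fun2; first exact: openT.
move=> [x y] _; exact: (@plane_continuous f (x +i* y) (H (x +i* y))).
Qed.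

Definition cintegrable F := tintegrable (fun z => complex.Re (F z)) /\
  tintegrable (fun z => complex.Im (F z)).

Definition cti F : R[i] := tint (fun z => complex.Re (F z)) +i* tint (fun z => complex.Im (F z)).

Lemma cintegrableD F G : cintegrable F -> cintegrable G -> cintegrable (fun z => F z + G z).
Proof.
move=> [fr fi] [gr gi]; split.
  by apply: eq_tintegrable (tintegrableD fr gr) => z; rewrite cReD.
by apply: eq_tintegrable (tintegrableD fi gi) => z; rewrite cImD.
Qed.

Lemma cintegrableZ c F : cintegrable F -> cintegrable (fun z => c * F z).
Proof.
move=> [fr fi]; split.
  apply: eq_tintegrable (tintegrableB (tintegrableZ (complex.Re c) fr) (tintegrableZ (complex.Im c) fi)) => z.
  by rewrite cReM.
apply: eq_tintegrable (tintegrableD (tintegrableZ (complex.Re c) fi) (tintegrableZ (complex.Im c) fr)) => z.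
by rewrite cImM.
Qed.

Definition cmeasurable F := pmeasurable (fun z => complex.Re (F z)) /\
  pmeasurable (fun z => complex.Im (F z)).

Definition cbounded F := exists M, forall z, normc z <= 1 + normc tau -> normc (F z) <= M.

Lemma cintegrableM F G : cintegrable F -> cmeasurable G -> cbounded G ->
  cintegrable (fun z => F z * G z).
Proof.
move=> [fr fi] [mr mi] [M hM].
have br : pbounded (fun z => complex.Re (G z)).
  by exists M => z /hM; apply: le_trans; exact: ler_normRe.
have bi : pbounded (fun z => complex.Im (G z)).
  by exists M => z /hM; apply: le_trans; exact: ler_normIm.
split.
  apply: eq_tintegrable (tintegrableB (tintegrableM fr mr br) (tintegrableM fi mi bi)) => z.
  by rewrite cReM.
apply: eq_tintegrable (tintegrableD (tintegrableM fr mi bi) (tintegrableM fi mr br)) => z.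
by rewrite cImM.
Qed.

Lemma ctiD F G : cintegrable F -> cintegrable G -> cti (fun z => F z + G z) = cti F + cti G.
Proof.
move=> [fr fi] [gr gi]; apply: complex_eqP; rewrite ?cReD ?cImD/=.
  by rewrite -tintD//; congr torus_integral; apply/funext => z; rewrite cReD.
by rewrite -tintD//; congr torus_integral; apply/funext => z; rewrite cImD.
Qed.

Lemma ctiZ c F : cintegrable F -> cti (fun z => c * F z) = c * cti F.
Proof.
move=> [fr fi]; apply: complex_eqP; rewrite ?cReM ?cImM/=.
  rewrite -!tintZ// -tintB//; try exact: tintegrableZ.
  by congr torus_integral; apply/funext => z; rewrite cReM.
rewrite -!tintZ// -tintD//; try exact: tintegrableZ.
by congr torus_integral; apply/funext => z; rewrite cImM.
Qed.

Lemma cintegrable0 : cintegrable (fun=> 0).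
Proof. by split; exact: tintegrable_cst. Qed.

Lemma cti0 : cti (fun=> 0) = 0.
Proof.
have -> : (fun _ : R[i] => 0 : R[i]) = (fun=> 0 * 0) by apply/funext => z; rewrite mul0r.
by rewrite (ctiZ 0 cintegrable0) mul0r.
Qed.

Lemma cti_sum (I : Type) (s : seq I) (F : I -> R[i] -> R[i]) :
  (forall i, cintegrable (F i)) ->
  cintegrable (fun z => \sum_(i <- s) F i z) /\
  cti (fun z => \sum_(i <- s) F i z) = \sum_(i <- s) cti (F i).
Proof.
move=> Fi; elim: s => [|i s [IH1 IH2]].
  have -> : (fun z => \sum_(i <- [::]) F i z) = (fun=> 0).
    by apply/funext => z; rewrite big_nil.
  by rewrite big_nil; split; [exact: cintegrable0|exact: cti0].
have -> : (fun z => \sum_(i <- i :: s) F i z) = (fun z => F i z + \sum_(i <- s) F i z).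
  by apply/funext => z; rewrite big_cons.
by rewrite big_cons ctiD// IH2; split => //; exact: cintegrableD.
Qed.

Lemma cti_rows F (E : R -> R[i]) : cintegrable F ->
  (forall y, 0 < y < h -> ccont (fun x => F (x +i* y))) ->
  (forall x y, 0 < y < h -> F ((x + 1) +i* y) = F (x +i* y)) ->
  (forall y, 0 < y < h -> Cint (-1/2) (1/2) (fun x => F (x +i* y)) = E y) ->
  ccont E -> cti F = Cint 0 h E.
Proof.
move=> [fr fi] cF pF FE [er ei]; rewrite /cti /Cint; congr (_ +i* _).
  apply: torus_rows => //.
  - by move=> y /cF[].
  - by move=> x y /pF ->.
  - by move=> y /FE <-.
apply: torus_rows => //.
- by move=> y /cF[].
- by move=> x y /pF ->.
- by move=> y /FE <-.
Qed.

(** Estimate for an approximate identity, kept unnormalized. A point congruent to one within d of z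
    sees the oscillation e; at any other point the kernel is at most rho, which is paid with the L^1
    norm of f. *)
Lemma approx_kernel f (K : R[i] -> R) z (e d rho : R) :
  tintegrable f -> (forall w u, lattice tau w -> f (u + w) = f u) ->
  0 <= e -> 0 <= rho ->
  (forall v, normc v < d -> `|f (z + v) - f z| <= e) ->
  (forall v, 0 <= K v) -> pmeasurable (fun u => K (z - u)) -> pbounded (fun u => K (z - u)) ->
  (forall v, (forall w, lattice tau w -> d <= normc (v - w)) -> K v <= rho) ->
  `|tint (fun u => f u * K (z - u)) - f z * tint (fun u => K (z - u))| <=
    e * tint (fun u => K (z - u)) + rho * (tint (fun u => `|f u|) + `|f z| * tint (fun=> 1)).
Proof.
move=> fi fp e0 rho0 fe K0 mK bK Kfar.
have Ki := tintegrable_bounded mK bK.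
have fKi := tintegrableM fi mK bK.
have ai := tintegrable_abs fi.
have oi := tintegrable_cst 1.
rewrite -tintZ// -tintB//; last exact: tintegrableZ.
have Bi := tintegrableB fKi (tintegrableZ (f z) Ki).
rewrite (le_trans (le_abs_tint Bi))//.
rewrite -(tintZ (`|f z|) oi) -tintD//; last exact: tintegrableZ.
have Si := tintegrableD ai (tintegrableZ `|f z| oi).
rewrite -(tintZ rho Si) -(tintZ e Ki) -tintD; [|exact: tintegrableZ|exact: tintegrableZ].
apply: le_tint; first exact: tintegrable_abs.
  by apply: tintegrableD; exact: tintegrableZ.
move=> u; rewrite -mulrBl normrM (ger0_norm (K0 _)).
have [[w wl wd]|far] := pselect (exists2 w, lattice tau w & normc (u - z - w) < d).
  rewrite (@le_trans _ _ (e * K (z - u)))//.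
    rewrite ler_wpM2r//; have := fe _ wd.
    have -> : z + (u - z - w) = u + - w by ring.
    by rewrite fp//; exact: latticeN.
  by rewrite lerDl mulr_ge0// addr_ge0// mulr1.
rewrite (@le_trans _ _ (`|f u - f z| * rho))//.
  rewrite ler_wpM2l// Kfar// => w wl; rewrite leNgt; apply/negP => lt.
  apply: far; exists (- w); first exact: latticeN.
  by rewrite -normcN (_ : - (u - z - - w) = z - u - w)//; ring.
rewrite mulr1 mulrC -[leLHS]add0r lerD//; first by rewrite mulr_ge0.
by rewrite ler_wpM2l// ler_normB.
Qed.

End TorusIntegral.

(** * Characters and Fourier coefficients of the torus *)

Section Kernel.
Variables (R : realType) (tau : R[i]).
Hypothesis htau : 0 < complex.Im tau.
Local Notation h := (complex.Im tau).
Local Notation lp := (lattice_point tau).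
Local Notation tint := (torus_integral tau).
Local Notation tintegrable := (tintegrable tau).
Local Notation cintegrable := (cintegrable tau).
Local Notation cti := (cti tau).
Implicit Types (m n : int) (z u w v : R[i]) (F : R[i] -> R[i]).

(** Together with [tcoord], the real coordinates of z in the basis (1, tau). *)
Definition scoord z : R := complex.Re z - slope tau * complex.Im z.
Definition tcoord z : R := complex.Im z / h.
Definition chi m n z : R[i] := cis (2 * pi * (m%:~R * scoord z + n%:~R * tcoord z)).

Lemma scoordD z w : scoord (z + w) = scoord z + scoord w.
Proof. by rewrite /scoord cReD cImD; ring. Qed.
Lemma tcoordD z w : tcoord (z + w) = tcoord z + tcoord w.
Proof. by rewrite /tcoord cImD mulrDl. Qed.
Lemma scoordN z : scoord (- z) = - scoord z.
Proof. by rewrite /scoord cReN cImN; ring. Qed.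
Lemma tcoordN z : tcoord (- z) = - tcoord z.
Proof. by rewrite /tcoord cImN mulNr. Qed.

Lemma scoord_lp m n : scoord (lp m n) = m%:~R.
Proof.
by rewrite /scoord Re_lp Im_lp /slope; field; exact: lt0r_neq0.
Qed.
Lemma tcoord_lp m n : tcoord (lp m n) = n%:~R.
Proof. by rewrite /tcoord Im_lp mulfK// lt0r_neq0. Qed.

Lemma coordE z : z = (scoord z)%:C + (tcoord z)%:C * tau.
Proof.
have h0 := lt0r_neq0 htau.
apply: complex_eqP; rewrite ?cReD ?cImD ?cReM ?cImM/= /scoord /tcoord /slope.
  by field.
by field.
Qed.

Lemma chiD m n z w : chi m n (z + w) = chi m n z * chi m n w.
Proof. by rewrite /chi scoordD tcoordD -cisD; congr cis; ring. Qed.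

Lemma chi0 m n : chi m n 0 = 1.
Proof. by rewrite /chi /scoord /tcoord/= mul0r !mulr0 subrr mulr0 addr0 mulr0 cis0. Qed.

Lemma chi_lattice m n w : lattice tau w -> chi m n w = 1.
Proof.
move=> [a [b ->]]; rewrite /chi scoord_lp tcoord_lp -!intrM -intrD; exact: cis_int.
Qed.

Lemma chi_periodic m n z w : lattice tau w -> chi m n (z + w) = chi m n z.
Proof. by move=> wl; rewrite chiD (chi_lattice _ _ wl) mulr1. Qed.

Lemma normc_chi m n z : normc (chi m n z) = 1.
Proof. exact: normc_cis. Qed.

Lemma chi00 z : chi 0 0 z = 1.
Proof. by rewrite /chi !mul0r addr0 mulr0 cis0. Qed.

(* The vertical frequency of [chi m n] in the coordinates [(x, y)]. *)
Definition kap m n : R := (n%:~R - m%:~R * complex.Re tau) / h.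

Lemma chi_xy m n x y : chi m n (x +i* y) = cis (2 * pi * (m%:~R * x + kap m n * y)).
Proof.
rewrite /chi /scoord /tcoord /kap /slope/=; congr cis; field; exact: lt0r_neq0.
Qed.

Lemma chi_lip m n : exists L : R, 0 <= L /\ forall z v,
  normc (chi m n (z + v) - chi m n z) <= L * normc v.
Proof.
have L0 : exists C : R, 0 <= C /\ forall t : R, normc (cis t - 1) <= C * `|t|.
  exists 2; split => // t; rewrite (le_trans (normc_le_ReIm _))//= subr0.
  have mvt (g g' : R -> R) : (forall x : R, is_derive x 1 g (g' x)) -> (forall x, `|g' x| <= 1) ->
      `|g t - g 0| <= `|t|.
    move=> dg g1.
    have cg : continuous g.
      by move=> x; apply/differentiable_continuous/derivable1_diffP; case: (dg x).
    have [t0|/ltW t0] := leP 0 t.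
      have [c _ ->] := @MVT_segment R g g' 0 t t0 (fun x _ => dg x) (continuous_subspaceT cg).
      by rewrite subr0 normrM ler_piMl.
    have [c _ E] := @MVT_segment R g g' t 0 t0 (fun x _ => dg x) (continuous_subspaceT cg).
    by rewrite distrC E sub0r normrM normrN ler_piMl.
  have h1 : `|cos t - 1| <= `|t|.
    have dcos (x : R) : is_derive x 1 cos (- sin x) by exact: is_derive_cos.
    have := mvt cos (fun x => - sin x) dcos; rewrite cos0; apply => x.
    by rewrite normrN sin_max.
  have h2 : `|sin t| <= `|t|.
    have dsin (x : R) : is_derive x 1 sin (cos x) by exact: is_derive_sin.
    have := mvt sin cos dsin; rewrite sin0 subr0; apply => x.
    exact: cos_max.
  by move: h1 h2; lra.
have [C [C0 hC]] := L0.
exists (C * (2 * pi * (`|m%:~R| * (1 + `|slope tau|) + `|n%:~R| * h^-1))).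
have hi : 0 <= h^-1 by rewrite invr_ge0 ltW.
have pi0 := pi_ge0 R.
split; first by rewrite !mulr_ge0// ?addr_ge0// ?mulr_ge0// ?addr_ge0.
move=> z v; rewrite chiD -{2}(mulr1 (chi m n z)) -mulrBr normcM normc_chi mul1r.
rewrite (le_trans (hC _))// -[leRHS]mulrA ler_wpM2l// normrM ger0_norm ?mulr_ge0//.
rewrite -[leRHS]mulrA ler_wpM2l ?mulr_ge0// mulrDl (le_trans (ler_normD _ _))// lerD//.
  rewrite normrM -mulrA ler_wpM2l// /scoord (le_trans (ler_normB _ _))// mulrDl mul1r lerD//.
    exact: ler_normRe.
  by rewrite normrM ler_wpM2l// ler_normIm.
rewrite normrM -mulrA ler_wpM2l// /tcoord normrM mulrC normfV (gtr0_norm htau).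
by rewrite ler_wpM2l// ler_normIm.
Qed.

Lemma cmeasurable_lip F L : 0 <= L -> (forall z v, normc (F (z + v) - F z) <= L * normc v) ->
  cmeasurable tau F.
Proof.
move=> L0 FL.
have L1 : 0 < L + 1 by rewrite ltr_wpDl.
have H (e : R) z : 0 < e -> exists2 d : R, 0 < d & forall v, normc v < d -> normc (F (z + v) - F z) < e.
  move=> e0; exists (e / (L + 1)); first by rewrite divr_gt0.
  move=> v; rewrite ltr_pdivlMr// => hv; rewrite (le_lt_trans (FL _ _))// (le_lt_trans _ hv)//.
  by rewrite mulrC ler_wpM2l ?normc_ge0// lerDl.
split; apply: pmeasurable_continuous => // z e e0; have [d d0 hd] := H e z e0;
  exists d => // v /hd; apply: le_lt_trans.
  by rewrite -cReN -cReD ler_normRe.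
by rewrite -cImN -cImD ler_normIm.
Qed.

Lemma cmeasurable_chiN m n : cmeasurable tau (fun u => chi m n (- u)).
Proof.
have [L [L0 hL]] := chi_lip m n; apply: (cmeasurable_lip L0) => z v.
by rewrite opprD (le_trans (hL _ _))// normcN.
Qed.

Lemma cbounded_chiN m n : cbounded tau (fun u => chi m n (- u)).
Proof. by exists 1 => z _; rewrite normc_chi. Qed.

Lemma cintegrable_chi F m n : cintegrable F -> cintegrable (fun u => F u * chi m n (- u)).
Proof. by move=> Fi; apply: cintegrableM => //; [exact: cmeasurable_chiN|exact: cbounded_chiN]. Qed.

(** The Fourier coefficient is not divided by the area, whence the factor h in [hat_cst]. *)
Definition hat F m n : R[i] := cti (fun u => F u * chi m n (- u)).

(** The exponent in chi(-(x + iy)) = exp([freq] y) em(x + iy), which reduces torus coefficients to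
    row coefficients. Its squared modulus is the eigenvalue of minus the Laplacian on the
    character. *)
Definition freq m n : R[i] := (- (2 * pi * m%:~R)) +i* (- (2 * pi * kap m n)).

Lemma hat_rows F (E : R -> R[i]) m n : cintegrable F ->
  (forall y, 0 < y < h -> ccont (fun x => F (x +i* y))) ->
  (forall x y, 0 < y < h -> F ((x + 1) +i* y) = F (x +i* y)) ->
  (forall y, 0 < y < h -> rowcoef F m y = E y) -> ccont E ->
  hat F m n = Cint 0 h (fun y => cexp (freq m n * y%:C) * E y).
Proof.
move=> Fi cF pF FE cE.
have cchi y : ccont (fun x => chi m n (- (x +i* y))).
  have -> : (fun x => chi m n (- (x +i* y))) = (fun x => cis (- (2 * pi * m%:~R * x)) * cis (- (2 * pi * kap m n * y))).
    apply/funext => x; rewrite -[- (x +i* y)]/((- x) +i* (- y)) chi_xy -cisD; congr cis; ring.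
  by apply: ccontM; [exact: ccont_cisN|exact: ccont_cst].
apply: cti_rows => //.
- exact: cintegrable_chi.
- by move=> y yI; apply: ccontM => //; exact: cF.
- move=> x y yI; rewrite pF//; congr (_ * _).
  rewrite shiftx opprD chi_periodic//; apply/latticeN; exact: lattice_1.
- move=> y yI; rewrite -FE// /rowcoef -CintZ; last first.
    by apply: ccontM; [exact: cF|exact: line_ccont_em].
  apply: eq_Cint => x _; rewrite mulrCA; congr (_ * _).
  rewrite -[- (x +i* y)]/((- x) +i* (- y)) chi_xy /em -cexpD.
  rewrite -(cexp_i (2 * pi * _)); congr cexp.
  by apply: complex_eqP; rewrite ?cReD ?cImD ?cReM ?cImM/= ?cReM ?cImM/=; ring.
- apply: ccontM => //.
  have -> : (fun y : R => cexp (freq m n * y%:C)) = (fun y => cexp (freq m n * (y +i* 0))) by [].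
  by apply: (@line_ccont _ set0 _ _ (hol_cexp _ (freq m n))); exists 1 => // x w.
Qed.

(** This is chi(-tau) = 1, written through the factorization of chi on rows. *)
Lemma freq_h m n : cexp (freq m n * h%:C) * em m tau = 1.
Proof.
rewrite /em -cexpD -(cis_int R (- n)) -cexp_i; congr cexp.
have h0 := lt0r_neq0 htau.
apply: complex_eqP; rewrite ?cReD ?cImD ?cReM ?cImM/= ?cReM ?cImM/= /kap ?rmorphN/=; field; by [].
Qed.

Lemma Cint_cexp (c : R[i]) (b : R) : 0 < b -> c != 0 ->
  Cint 0 b (fun y => cexp (c * y%:C)) = (cexp (c * b%:C) - 1) / c.
Proof.
move=> b0 c0.
have la : @line_away R set0 0 by exists 1 => // x w.
have cd x := @line_cderiv _ set0 _ _ (hol_cexp _ c) 0 x la.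
have cc := @line_ccont _ set0 _ _ (hol_cexp _ c) 0 la.
apply: (mulfI c0); rewrite -CintZ// mulrCA mulfV// mulr1.
by rewrite (Cint_FTC b0 cd); [rewrite -[0 +i* 0]/(0 : R[i]) mulr0 cexp0|exact: ccontZ].
Qed.

Lemma cintegrable_cst c : cintegrable (fun=> c).
Proof. by split; exact: tintegrable_cst. Qed.

Lemma rowcoef_cst (c : R[i]) m (y : R) : rowcoef (fun=> c) m y = c * (m == 0)%:R.
Proof. by rewrite /rowcoef CintZ ?Cint_em//; exact: line_ccont_em. Qed.

Lemma freq_neq0 m n : (m != 0) || (n != 0) -> freq m n != 0.
Proof.
move=> mn; apply/eqP => E.
have p2 : 2 * pi != 0 :> R by rewrite mulf_neq0 ?pnatr_eq0// gt_eqF ?pi_gt0.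
have /eqP : complex.Re (freq m n) = 0 by rewrite E.
rewrite /= oppr_eq0 mulf_eq0 (negbTE p2)/= intr_eq0 => /eqP m0.
have /eqP : complex.Im (freq m n) = 0 by rewrite E.
rewrite /= oppr_eq0 mulf_eq0 (negbTE p2)/= /kap m0 mul0r subr0.
rewrite mulf_eq0 invr_eq0 (gt_eqF htau) orbF intr_eq0 => n0.
by move: mn; rewrite m0 n0.
Qed.

Lemma hat_cst c m n : hat (fun=> c) m n = c * ((m == 0) && (n == 0))%:R * h%:C.
Proof.
rewrite (@hat_rows _ (fun=> c * (m == 0)%:R) m n (cintegrable_cst c))//; last 3 first.
- by move=> y _; exact: ccont_cst.
- by move=> y _; exact: rowcoef_cst.
- exact: ccont_cst.
have la : @line_away R set0 0 by exists 1 => // x w.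
have cc := @line_ccont _ set0 _ _ (hol_cexp _ (freq m n)) 0 la.
have -> : (fun y : R => cexp (freq m n * y%:C) * (c * (m == 0)%:R)) =
  (fun y => (c * (m == 0)%:R) * cexp (freq m n * y%:C)) by apply/funext => y; rewrite mulrC.
rewrite CintZ//; have [->|m0] := eqVneq m 0; last by rewrite !mulr0 !mul0r.
have [->|n0] := eqVneq n 0; rewrite /= !mulr1.
  congr (_ * _).
  have f0 : freq 0 0 = 0 by rewrite /freq /kap !(mulr0, mul0r) subrr mul0r mulr0 oppr0.
  rewrite (@eq_Cint _ _ _ _ (fun=> 1)); last by move=> y _; rewrite f0 mul0r cexp0.
  rewrite /Cint; apply: complex_eqP => /=.
    rewrite Rintegral_cst//= lebesgue_measure_itv/= lte_fin htau/= mul1r oppr0 addr0.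
    by [].
  by rewrite Rintegral_cst// mul0r.
rewrite Cint_cexp//; last by apply: freq_neq0; rewrite n0 orbT.
have := freq_h 0 n; rewrite /em /cm mulr0 oppr0 (_ : 0 +i* 0 = 0)// mul0r cexp0 mulr1 => ->.
by rewrite subrr mul0r !mulr0 mul0r.
Qed.

End Kernel.

(** * Polynomial factors against geometric decay *)

Section ExponentialDecay.
Variable R : realType.

Lemma bernoulli_ineq (b : R) N : 0 <= b -> 1 + N%:R * b <= (1 + b) ^+ N.
Proof.
move=> b0; elim: N => [|N IH]; first by rewrite mul0r addr0 expr0.
rewrite exprS (@le_trans _ _ ((1 + b) * (1 + N%:R * b)))//.
  rewrite -natr1 -subr_ge0 (_ : _ - _ = N%:R * b * b); first by rewrite !mulr_ge0.
  by ring.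
by rewrite ler_wpM2l// addr_ge0.
Qed.

(** Write q^-1 = 1 + b with b > 0; Bernoulli's inequality leaves (N + 1)/(1 + N b) <= 1 + 1/b. The
    case q = 0 is apart. *)
Lemma linear_decay (q : R) : 0 <= q < 1 -> exists2 C : R, 0 <= C &
  forall N, N.+1%:R * q ^+ N <= C.
Proof.
move=> /andP[q0 q1]; have [->|qn] := eqVneq q 0.
  exists 1 => // -[|N]; first by rewrite expr0 mulr1.
  by rewrite expr0n/= mulr0.
have {}q0 : 0 < q by rewrite lt0r qn.
pose b := q^-1 - 1.
have b0 : 0 < b by rewrite subr_gt0 invf_gt1.
exists (1 + b^-1); first by rewrite addr_ge0// invr_ge0 ltW.
move=> N.
have E : q ^+ N = ((1 + b) ^+ N)^-1 by rewrite /b addrC subrK exprVn invrK.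
have Nb : 0 < 1 + N%:R * b by rewrite ltr_pwDl// mulr_ge0// ltW.
have pN : 0 < (1 + b) ^+ N by rewrite exprn_gt0// addr_gt0.
rewrite E ler_pdivrMr// (@le_trans _ _ ((1 + b^-1) * (1 + N%:R * b)))//; last first.
  apply: ler_wpM2l; last exact/bernoulli_ineq/ltW.
  by rewrite addr_ge0// invr_ge0 ltW.
rewrite -natr1 -subr_ge0 (_ : _ - _ = N%:R * b + b^-1).
  by apply: addr_ge0; [apply: mulr_ge0 => //; exact: ltW|rewrite invr_ge0 ltW].
by field; exact: lt0r_neq0.
Qed.

(** With q the fourth root of r, (N+1)^3 r^N is at most ((N+1) q^N)^4, which [linear_decay] bounds.
    The power spared becomes the rate 1/(N+1). *)
Lemma square_decay (r : R) : 0 <= r < 1 -> exists2 C : R, 0 <= C &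
  forall N, N.+1%:R ^+ 2 * r ^+ N <= C / N.+1%:R.
Proof.
move=> /andP[r0 r1]; pose q := Num.sqrt (Num.sqrt r).
have q4 : q ^+ 4 = r.
  by rewrite -[4%N]/(2 * 2)%N exprM !sqr_sqrtr ?sqrtr_ge0.
have q0 : 0 <= q by exact: sqrtr_ge0.
have q1 : q < 1 by rewrite -(@expr_lt1 _ 4)// q4.
have [|C C0 hC] := @linear_decay q; first by rewrite q0.
exists (C ^+ 4); first by rewrite exprn_ge0.
move=> N; rewrite ler_pdivlMr// -q4 -exprM mulnC exprM.
have hN : 0 <= q ^+ N by rewrite exprn_ge0.
have N0 : 0 <= N.+1%:R :> R by [].
rewrite (@le_trans _ _ ((N.+1%:R * q ^+ N) ^+ 4))//.
  have -> : (N.+1%:R * q ^+ N) ^+ 4 = N.+1%:R ^+ 2 * (q ^+ N) ^+ 4 * N.+1%:R ^+ 2 by ring.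
  rewrite ler_wpM2l ?mulr_ge0 ?exprn_ge0//.
  by rewrite expr2 ler_peMr// ler1n.
by rewrite lerXn2r ?nnegrE// mulr_ge0.
Qed.

End ExponentialDecay.

(** * A positive trigonometric kernel concentrated at the lattice *)

Section FejerKernel.
Variables (R : realType) (tau : R[i]).
Hypothesis htau : 0 < complex.Im tau.
Local Notation h := (complex.Im tau).
Local Notation lp := (lattice_point tau).
Local Notation tint := (torus_integral tau).
Local Notation tintegrable := (tintegrable tau).
Local Notation cintegrable := (cintegrable tau).
Local Notation cti := (cti tau).
Local Notation chi := (chi tau).
Local Notation hat := (hat tau).
Implicit Types (m n : int) (z u w v : R[i]) (F : R[i] -> R[i]).

(** The Fourier coefficients of cos^(2N): index i belongs to the frequency i - N, so [bw N N] is the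
    constant one. *)
Definition bw N i : R := 'C(N.*2, i)%:R / 4 ^+ N.

(** A nonnegative trigonometric polynomial equal to 1 at the lattice and smaller elsewhere; powers
    of cosines have explicit coefficients and an explicit decay. *)
Definition KN N z : R := (cos (pi * scoord tau z) ^+ 2 * cos (pi * tcoord tau z) ^+ 2) ^+ N.

Lemma cos_pow N (t : R) : (cos t ^+ 2 ^+ N)%:C =
  \sum_(i < N.*2.+1) (bw N i)%:C * cis (2 * (i%:Z - N%:Z)%:~R * t).
Proof.
have c2 : (cos t)%:C = (cis (- t) + cis t) / 2.
  apply: (mulIf (_ : 2 != 0)); first by rewrite pnatr_eq0.
  rewrite divfK ?pnatr_eq0// mulr_natr mulr2n.
  by apply: complex_eqP; rewrite ?cReD ?cImD/= ?cosN ?sinN//; ring.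
rewrite -exprM mul2n rmorphXn/= c2 expr_div_n exprDn mulr_suml.
apply: eq_bigr => i _.
rewrite /bw -mulr_natl.
have -> : 2 ^+ N.*2 = (4 ^+ N)%:C :> R[i].
  by rewrite -mul2n exprM rmorphXn/= rmorph_nat; congr (_ ^+ _); ring.
rewrite rmorphM/= rmorph_nat fmorphV/= mulrAC; congr (_ / _ * _).
rewrite -!cisMn -cisD; congr cis.
have iN : (i <= N.*2)%N by rewrite -ltnS.
have e : (N.*2)%:R = 2 * N%:R :> R by rewrite -mul2n natrM.
rewrite natrB// e rmorphB/= -[(i%:Z)%:~R]/(i%:R) -[(N%:Z)%:~R]/(N%:R); ring.
Qed.

Lemma KN_chi N z : (KN N z)%:C = \sum_(i < N.*2.+1) \sum_(j < N.*2.+1)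
  (bw N i * bw N j)%:C * chi (i%:Z - N%:Z) (j%:Z - N%:Z) z.
Proof.
rewrite /KN exprMn rmorphM/= !cos_pow mulr_suml; apply: eq_bigr => i _.
rewrite mulr_sumr; apply: eq_bigr => j _.
rewrite mulrACA -rmorphM/=; congr (_ * _).
by rewrite /Submission.chi -cisD; congr cis; ring.
Qed.

Lemma KN_ge0 N z : 0 <= KN N z.
Proof. by rewrite /KN exprn_ge0// mulr_ge0// sqr_ge0. Qed.

Lemma cos2_le1 (t : R) : cos t ^+ 2 <= 1.
Proof. by rewrite cos2sin2 lerBlDr lerDl sqr_ge0. Qed.

Lemma KN_le1 N z : KN N z <= 1.
Proof.
apply: exprn_ile1; first by rewrite mulr_ge0 ?sqr_ge0.
by apply: mulr_ile1; rewrite ?sqr_ge0 ?cos2_le1.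
Qed.

Lemma cos_intpi (t : R) (a : int) : cos (pi * (t - a%:~R)) ^+ 2 = cos (pi * t) ^+ 2.
Proof.
have e (x : R) : cos x ^+ 2 = (1 + complex.Re (cis (2 * x))) / 2.
  by rewrite /cis/= mulr_natl cos_mulr2n; field.
rewrite !e; congr ((1 + complex.Re _) / _).
have -> : 2 * (pi * (t - a%:~R)) = 2 * (pi * t) + 2 * pi * (- a)%:~R by rewrite rmorphN; ring.
by rewrite cisD cis_int mulr1.
Qed.

Lemma cos2_far (eta t : R) : 0 <= eta <= 1/2 -> eta <= `|t| <= 1/2 ->
  cos (pi * t) ^+ 2 <= cos (pi * eta) ^+ 2.
Proof.
move=> /andP[e0 e1] /andP[te t1].
have p0 := pi_gt0 R.
rewrite -(cos_norm (pi * t)) normrM (gtr0_norm p0).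
have ph x : 0 <= x <= 1/2 -> 0 <= cos (pi * x :> R).
  move=> /andP[x0 x1]; apply: cos_ge0_pihalf; apply/andP; split.
    by have := mulr_ge0 (ltW p0) x0; move: p0; lra.
  by apply: ler_wpM2l; [exact: ltW|move: x1; lra].
have t0 : 0 <= `|t| <= 1/2 by rewrite normr_ge0.
rewrite lerXn2r ?nnegrE ?ph// ?e0//.
have pin x : 0 <= x <= 1/2 -> pi * x \in `[0, pi : R].
  move=> /andP[x0 x1]; rewrite in_itv/= (mulr_ge0 (ltW p0) x0)/=.
  by rewrite -[leRHS]mulr1; apply: ler_wpM2l; [exact: ltW|move: x1; lra].
have [->|ne] := eqVneq `|t| eta; first by [].
have eI : 0 <= eta <= 1/2 by rewrite e0.
rewrite ltW// (ltr_cos (pin _ eI) (pin _ t0)).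
by rewrite ltr_pM2l// lt_neqAle te eq_sym ne.
Qed.

(** The mass of [KN] over the torus, given by its constant coefficient; see [tint_KN]. *)
Definition cN N : R := bw N N ^+ 2 * h.

Lemma near_int (s : R) : exists a : int, `|s - a%:~R| <= 1/2.
Proof.
exists (Num.floor (s + 1/2)).
have := Num.Theory.floor_le (s + 1/2); have := Num.Theory.lt_succ_floor (s + 1/2).
rewrite intrD; move=> h1 h2; rewrite ler_norml; apply/andP; split; lra.
Qed.

(** Reduce both coordinates modulo 1 to at most 1/2. If both were below [eta], the distance to the
    lattice would be below eta (1 + |tau|) <= d; hence one cosine factor is at most cos(pi eta)^2 <
    1. *)
Lemma KN_far (d : R) : 0 < d -> exists2 r : R, 0 <= r < 1 & forall N v,
  (forall w, lattice tau w -> d <= normc (v - w)) -> KN N v <= r ^+ N.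
Proof.
move=> d0; pose eta := Num.min (1/2) (d / (1 + normc tau)).
have tn := normc_ge0 tau.
have t1 : 0 < 1 + normc tau by rewrite ltr_pwDl.
have e0 : 0 < eta by rewrite lt_min !divr_gt0.
have eh : eta <= 1/2 by rewrite ge_min lexx.
have p0 := pi_gt0 R.
exists (cos (pi * eta) ^+ 2).
  rewrite sqr_ge0/= cos2sin2 ltrBlDr ltrDl exprn_gt0// sin_gt0_pi//.
  rewrite mulr_gt0//= -[ltRHS]mulr1 ltr_pM2l//; lra.
move=> N v far.
have [a sa] := near_int (scoord tau v); have [b tb] := near_int (tcoord tau v).
have := far _ (lattice_lp tau a b).
have -> : v - lp a b = (scoord tau v - a%:~R)%:C + (tcoord tau v - b%:~R)%:C * tau.
  rewrite [in LHS](coordE htau v) /lattice_point !rmorphB/= !rmorph_int; ring.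
set s := scoord tau v - _ in sa *; set t := tcoord tau v - _ in tb *.
move=> dd.
have {dd} dst : d <= `|s| + `|t| * normc tau.
  by rewrite (le_trans dd)// (le_trans (le_normcD _ _))// normcM !normcR.
have KE : KN N v = (cos (pi * s) ^+ 2 * cos (pi * t) ^+ 2) ^+ N.
  by rewrite /KN /s /t !cos_intpi.
have eI : 0 <= eta <= 1/2 by rewrite ltW.
have pw (x y : R) : 0 <= x -> x <= y -> x ^+ N <= y ^+ N.
  by move=> x0 xy; rewrite lerXn2r// nnegrE (le_trans x0).
rewrite KE; set A := cos (pi * s) ^+ 2; set B := cos (pi * t) ^+ 2.
have A0 : 0 <= A by exact: sqr_ge0.
have B0 : 0 <= B by exact: sqr_ge0.
have A1 : A <= 1 by exact: cos2_le1.
have B1 : B <= 1 by exact: cos2_le1.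
have [es|es] := leP eta `|s|.
  apply: pw; first exact: mulr_ge0.
  have : A <= cos (pi * eta) ^+ 2 by apply: cos2_far => //; rewrite es.
  by apply: le_trans; exact: ler_piMr.
have [et|et] := leP eta `|t|.
  apply: pw; first exact: mulr_ge0.
  have : B <= cos (pi * eta) ^+ 2 by apply: cos2_far => //; rewrite et.
  by apply: le_trans; exact: ler_piMl.
exfalso.
have : d < eta * (1 + normc tau).
  rewrite (le_lt_trans dst)// mulrDr mulr1 ltr_leD//.
  by rewrite ler_wpM2r// ltW.
rewrite ltNge -ler_pdivlMr// => /negP; apply.
by rewrite /eta ge_min lexx orbT.
Qed.

(** Induction on the ratio (2N+1)/(2N+2) of consecutive central weights. The bound is crude, but
    polynomial, and it only has to beat the geometric decay in [KN_far]. *)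
Lemma bw_lb N : N.+1%:R^-1 <= bw N N.
Proof.
elim: N => [|N IH]; first by rewrite /bw bin0 expr0 divr1 invr1.
have E : bw N.+1 N.+1 = bw N N * ((2 * N%:R + 1) / (2 * N%:R + 2)).
  rewrite /bw doubleS.
  have e1 : 'C(N.*2.+2, N.+1) = (2 * 'C(N.*2.+1, N))%N.
    have e0 : 'C(N.*2.+1, N.+1) = 'C(N.*2.+1, N).
      by rewrite -[RHS]bin_sub; [congr binomial; lia|lia].
    by rewrite binS e0 mul2n addnn.
  have e2 : (N.*2.+1 * 'C(N.*2, N) = N.+1 * 'C(N.*2.+1, N))%N.
    have := mul_bin_down N.*2.+1 N => /=; rewrite -addnn => ->.
    by congr (_ * _)%N; lia.
  have {}e2 : (2 * N%:R + 1) * 'C(N.*2, N)%:R = (N%:R + 1) * 'C(N.*2.+1, N)%:R :> R.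
    have -> : (N%:R + 1) * 'C(N.*2.+1, N)%:R = (N.+1 * 'C(N.*2.+1, N))%:R :> R.
      by rewrite natr1 natrM.
    rewrite -e2 natrM; congr (_ * _).
    by rewrite -[N.*2.+1%:R]natr1 -mul2n natrM.
  have N1 : N%:R + 1 != 0 :> R by rewrite natr1 pnatr_eq0.
  have -> : 'C(N.*2.+2, N.+1)%:R = 2 * ((2 * N%:R + 1) * 'C(N.*2, N)%:R / (N%:R + 1)) :> R.
    by rewrite e1 natrM e2; field.
  rewrite exprS; field.
  by rewrite expf_neq0//= (_ : 2 * N%:R + 2 = 2 * (N%:R + 1)) ?mulf_neq0 ?N1//; ring.
rewrite E.
have N0 : 0 <= N%:R :> R by [].
have h1 : 0 <= (2 * N%:R + 1) / (2 * N%:R + 2) :> R.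
  by apply: divr_ge0; lra.
apply: le_trans (ler_wpM2r h1 IH).
rewrite -[N.+2%:R]natr1 -[N.+1%:R]natr1.
move: (N%:R : R) N0 => x x0.
rewrite -subr_ge0 (_ : _ - _ = x / ((x + 1) * (2 * x + 2) * (x + 1 + 1))).
  by apply: divr_ge0 => //; rewrite !mulr_ge0//; lra.
field; apply/and3P; split; apply: lt0r_neq0; lra.
Qed.

End FejerKernel.

(** * Smoothing by the kernel *)

Section Convolution.
Variables (R : realType) (tau : R[i]).
Hypothesis htau : 0 < complex.Im tau.
Local Notation h := (complex.Im tau).
Local Notation T := (measurableTypeR R).
Local Notation tint := (torus_integral tau).
Local Notation tintegrable := (tintegrable tau).
Local Notation cintegrable := (cintegrable tau).
Local Notation cti := (cti tau).
Local Notation chi := (chi tau).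
Local Notation hat := (hat tau).
Local Notation KN := (KN tau).
Local Notation bw := (@bw R).
Local Notation cN := (cN tau).
Implicit Types (m n : int) (z u w v : R[i]) (F : R[i] -> R[i]).

Lemma pmeasurable_KN N z : pmeasurable tau (fun u => KN N (z - u)).
Proof.
have mcos : measurable_fun setT (@cos R).
  exact: continuous_measurable_fun (@continuous_cos R).
have maff (a b c : R) : measurable_fun setT (fun u : T * T => (cos (a + b * u.1 + c * u.2) : R)).
  apply: (measurableT_comp mcos).
  apply: measurable_funD; last by apply: measurable_funM; [exact: measurable_cst|exact: measurable_snd2].
  apply: measurable_funD; first exact: measurable_cst.
  by apply: measurable_funM; [exact: measurable_cst|exact: measurable_fst2].
apply: (@measurable_funS _ _ _ _ setT) => //.
have e1 (u : T * T) : cos (pi * scoord tau (z - to_complex u)) =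
  cos (pi * scoord tau z + (- pi) * u.1 + (pi * slope tau) * u.2).
  by congr cos; rewrite /scoord cReD cReN cImD cImN/=; ring.
have e2 (u : T * T) : cos (pi * tcoord tau (z - to_complex u)) =
  cos (pi * tcoord tau z + 0 * u.1 + (- pi / h) * u.2).
  by congr cos; rewrite /tcoord cImD cImN/=; ring.
rewrite /on_plane /Submission.KN.
rewrite (_ : _ \o _ = fun u : T * T => ((cos (pi * scoord tau z + (- pi) * u.1 + (pi * slope tau) * u.2)) ^+ 2 *
   (cos (pi * tcoord tau z + 0 * u.1 + (- pi / h) * u.2)) ^+ 2) ^+ N); last first.
  by apply/funext => u; rewrite /= e1 e2.
by apply: measurable_funX; apply: measurable_funM; apply: measurable_funX; exact: maff.
Qed.

Lemma pbounded_KN N z : pbounded tau (fun u => KN N (z - u)).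
Proof. by exists 1 => u _; rewrite ger0_norm ?KN_ge0// KN_le1. Qed.

Definition conv N F z := cti (fun u => F u * (KN N (z - u))%:C).

(** The Fourier series with coefficients [a], cut off by the weights of the kernel. For a = hat F it
    is the convolution, by [conv_hat]. *)
Definition trigsum N (a : int -> int -> R[i]) z : R[i] :=
  \sum_(i < N.*2.+1) \sum_(j < N.*2.+1)
    (bw N i * bw N j)%:C * (a (i%:Z - N%:Z) (j%:Z - N%:Z) * chi (i%:Z - N%:Z) (j%:Z - N%:Z) z).

Lemma conv_hat N F z : cintegrable F -> conv N F z = trigsum N (hat F) z.
Proof.
move=> Fi.
pose c (i j : 'I_N.*2.+1) : R[i] := (bw N i * bw N j)%:C * chi (i%:Z - N%:Z) (j%:Z - N%:Z) z.
pose G (i j : 'I_N.*2.+1) u := c i j * (F u * chi (i%:Z - N%:Z) (j%:Z - N%:Z) (- u)).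
have Gi i j : cintegrable (G i j) by apply: cintegrableZ => //; exact: cintegrable_chi.
have G1 i := cti_sum htau (index_enum 'I_N.*2.+1) (Gi i).
have Gi' i : cintegrable (fun u => \sum_(j <- index_enum 'I_N.*2.+1) G i j u) by case: (G1 i).
have [_ E] := cti_sum htau (index_enum 'I_N.*2.+1) Gi'.
rewrite /conv (_ : (fun u => _) = (fun u => \sum_(i <- index_enum 'I_N.*2.+1)
    \sum_(j <- index_enum 'I_N.*2.+1) G i j u)).
  rewrite E; apply: eq_bigr => i _; case: (G1 i) => _ ->; apply: eq_bigr => j _.
  by rewrite /G (ctiZ htau); [rewrite /c /Submission.hat; ring|exact: cintegrable_chi].
apply/funext => u; rewrite KN_chi mulr_sumr; apply: eq_bigr => i _.
by rewrite mulr_sumr; apply: eq_bigr => j _; rewrite /G /c chiD; ring.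
Qed.

Lemma tint_KN N z : tint (fun u => KN N (z - u)) = cN N.
Proof.
have C1 : cintegrable (fun=> 1) by exact: cintegrable_cst.
have := conv_hat N z C1; rewrite /conv /trigsum.
have lN : (N < N.*2.+1)%N by rewrite ltnS -addnn leq_addr.
rewrite (bigD1 (Ordinal lN))//= (bigD1 (Ordinal lN))//= subrr !big1; last 2 first.
- move=> i iN; rewrite big1// => j _; rewrite hat_cst//.
  rewrite (_ : (i%:Z - N%:Z == 0) = false)/= ?mulr0 ?mul0r ?mulr0//.
  by apply: contraNF iN; rewrite subr_eq0 => /eqP[] iN; apply/eqP/val_inj.
- move=> i iN; rewrite hat_cst//.
  rewrite (_ : (i%:Z - N%:Z == 0) = false)/= ?andbF ?mulr0 ?mul0r ?mulr0//.
  by apply: contraNF iN; rewrite subr_eq0 => /eqP[] iN; apply/eqP/val_inj.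
rewrite !addr0 hat_cst// chi00 eqxx/= !mulr1 mul1r -rmorphM/= => /(congr1 (@complex.Re R))/=.
rewrite /cN -expr2 => <-; congr torus_integral; apply/funext => u.
by rewrite /= ?mul1r ?mul0r ?subr0.
Qed.

Lemma cN_gt0 N : 0 < cN N.
Proof.
by rewrite /Submission.cN mulr_gt0// exprn_gt0// (lt_le_trans _ (bw_lb htau N))// invr_gt0.
Qed.

Definition convn N F z := conv N F z / (cN N)%:C.

(* Quantitative approximate identity: the error only depends on the modulus of
   continuity of [F] at [z], on [|F z|] and on the norm of [F] in [L^1]. *)
Lemma convn_approx F (d : R) : cintegrable F ->
  (forall w u, lattice tau w -> F (u + w) = F u) -> 0 < d ->
  exists2 C : R, 0 <= C & forall z (e : R), 0 <= e ->
    (forall v, normc v < d -> normc (F (z + v) - F z) <= e) ->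
    forall N, normc (convn N F z - F z) <= 2 * e + C * (1 + normc (F z)) / N.+1%:R.
Proof.
move=> [Fr Fi] Fp d0.
have [r r01 far] := KN_far htau d0.
have [C C0 hC] := square_decay r01.
pose A := tint (fun u => `|complex.Re (F u)|) + tint (fun u => `|complex.Im (F u)|) + 2 * `|tint (fun=> 1)|.
have tint_ge0 (f : R[i] -> R) : (forall z, 0 <= f z) -> 0 <= tint f.
  by move=> f0; apply: Rintegral_ge0 => u _; exact: f0.
have t1 : 0 <= tint (fun u => `|complex.Re (F u)|) by exact: tint_ge0.
have t2 : 0 <= tint (fun u => `|complex.Im (F u)|) by exact: tint_ge0.
have t3 : 0 <= tint (fun=> 1) by exact: tint_ge0.
have A0 : 0 <= A by rewrite /A !addr_ge0.
exists (C / h * A); first by rewrite mulr_ge0// divr_ge0// ltW.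
move=> z e e0 Fe N.
have rN0 : 0 <= r ^+ N by rewrite exprn_ge0//; case/andP: r01.
have cN0 := cN_gt0 N.
have bound (f : R[i] -> R) : tintegrable f -> (forall w u, lattice tau w -> f (u + w) = f u) ->
    (forall v, normc v < d -> `|f (z + v) - f z| <= e) ->
    `|tint (fun u => f u * KN N (z - u)) / cN N - f z| <=
      e + r ^+ N / cN N * (tint (fun u => `|f u|) + `|f z| * tint (fun=> 1)).
  move=> fi fp fe.
  have := approx_kernel htau (K := KN N) (e := e) (d := d) (rho := r ^+ N) (z := z) fi fp e0 rN0 fe
    (KN_ge0 tau N) (pmeasurable_KN N z) (pbounded_KN N z) (far N).
  rewrite tint_KN => H.
  rewrite (_ : _ / _ - _ = (tint (fun u => f u * KN N (z - u)) - f z * cN N) / cN N); last first.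
    by rewrite mulrBl mulfK ?lt0r_neq0.
  rewrite normrM normfV (gtr0_norm cN0) ler_pdivrMr// (le_trans H)//.
  by rewrite mulrDl lerD2l [leRHS]mulrAC divfK ?lt0r_neq0.
have fr v : normc v < d -> `|complex.Re (F (z + v)) - complex.Re (F z)| <= e.
  by move=> vd; rewrite -cReN -cReD (le_trans (ler_normRe _))// Fe.
have fi v : normc v < d -> `|complex.Im (F (z + v)) - complex.Im (F z)| <= e.
  by move=> vd; rewrite -cImN -cImD (le_trans (ler_normIm _))// Fe.
have b1 := bound _ Fr (fun w u wl => congr1 (@complex.Re R) (Fp w u wl)) fr.
have b2 := bound _ Fi (fun w u wl => congr1 (@complex.Im R) (Fp w u wl)) fi.
have cE : convn N F z = (tint (fun u => complex.Re (F u) * KN N (z - u)) / cN N) +i*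
   (tint (fun u => complex.Im (F u) * KN N (z - u)) / cN N).
  rewrite /convn /conv -fmorphV/=.
  apply: complex_eqP; rewrite ?cReM ?cImM/= ?mulr0 ?subr0 ?add0r.
    congr (torus_integral _ _ / _); apply/funext => u.
    by rewrite cReM/= mulr0 subr0.
  congr (torus_integral _ _ / _); apply/funext => u.
  by rewrite cImM/= mulr0 add0r.
(* The mass is at least h/(N+1)^2, so [square_decay] leaves the rate 1/(N+1). *)
have rc : r ^+ N / cN N <= C / h / N.+1%:R.
  have n0 : 0 < N.+1%:R :> R by rewrite ltr0n.
  have b0 : 0 < N.+1%:R^-1 :> R by rewrite invr_gt0.
  rewrite ler_pdivrMr// /Submission.cN.
  have hb : N.+1%:R^-1 ^+ 2 <= bw N N ^+ 2.
    by rewrite ler_pXn2r ?nnegrE ?(ltW b0)// ?(le_trans (ltW b0))// (bw_lb htau).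
  have rE : r ^+ N <= C / N.+1%:R * N.+1%:R^-1 ^+ 2.
    by rewrite exprVn ler_pdivlMr ?exprn_gt0// mulrC hC.
  apply: (le_trans rE); rewrite (_ : _ * (_ * h) = C / N.+1%:R * bw N N ^+ 2).
    by rewrite ler_wpM2l// divr_ge0// ltW.
  move: (lt0r_neq0 n0) (lt0r_neq0 htau); move: (N.+1%:R) h => k h0 k0 h00; field.
  by apply/andP.
rewrite cE (le_trans (normc_le_ReIm _))// cReD cImD cReN cImN/=.
apply: (le_trans (lerD b1 b2)).
set a1 := tint _ in t1 *; set a2 := tint (fun u => `|complex.Im (F u)|) in t2 *.
set a3 := tint (fun=> 1) in t3 *.
have nF := normc_ge0 (F z); have nr := ler_normRe (F z); have ni := ler_normIm (F z).
have H : a1 + `|complex.Re (F z)| * a3 + (a2 + `|complex.Im (F z)| * a3) <= A * (1 + normc (F z)).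
  have g1 : `|complex.Re (F z)| * a3 <= normc (F z) * a3 by rewrite ler_wpM2r.
  have g2 : `|complex.Im (F z)| * a3 <= normc (F z) * a3 by rewrite ler_wpM2r.
  have g3 : 0 <= a1 * normc (F z) by rewrite mulr_ge0.
  have g4 : 0 <= a2 * normc (F z) by rewrite mulr_ge0.
  rewrite /A -/a1 -/a2 -/a3 (ger0_norm t3); nra.
have rc0 : 0 <= r ^+ N / cN N by rewrite divr_ge0// ltW.
have B0 : 0 <= A * (1 + normc (F z)) by rewrite mulr_ge0// addr_ge0.
rewrite addrACA -mulrDr [X in _ <= X + _](_ : 2 * e = e + e) ?lerD2l; last by rewrite mulr2n mulrDl mul1r.
apply: (le_trans (ler_wpM2l rc0 H)).
apply: (le_trans (ler_wpM2r B0 rc)).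
by rewrite le_eqVlt; apply/orP; left; apply/eqP; ring.
Qed.

End Convolution.

(** * Integrability of a simple pole in the plane *)

Section Pole.
Variables (R : realType) (tau : R[i]).
Hypothesis htau : 0 < complex.Im tau.
Local Notation h := (complex.Im tau).
Local Notation T := (measurableTypeR R).
Local Notation D := (fundamental_domain tau).
Local Notation mu := (@lebesgue_measure R).
Local Notation pm := (@plane_measure R).
Local Notation tintegrable := (tintegrable tau).
Implicit Types (z w v : R[i]).

Lemma pmeasurable_off (U : set (R * R)) (a : R * R) f : open U ->
  (forall u, D u -> u <> a -> U u) ->
  (forall u, U u -> {for u, continuous (on_plane f)}) -> pmeasurable tau f.
Proof.
move=> oU DU fU; have mD := measurable_fundamental htau.
have mU : measurable (U : set (T * T)) by exact: open_measurable2.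
have sub : D `\` U `<=` [set a].
  by move=> u [Du nU]; apply: contrapT => ua; apply: nU; exact: DU.
rewrite /pmeasurable (_ : D = (D `&` U) `|` (D `\` U)); last first.
  apply/seteqP; split=> u; last by move=> [] [].
  by have [Uu|nU] := pselect (U u) => Du; [left|right].
apply/(@measurable_funU _ _ (T * T)%type T); [exact: measurableI|exact: measurableD|split].
  apply: (@measurable_funS _ _ (T * T)%type T U) => //.
  exact: open_measurable_fun2.
have [->|->] := subset_set1 sub; first exact: measurable_fun_set0.
exact: measurable_fun_set1.
Qed.

(** Dyadic layers: the powers 2^k below a add up to at least a - 1. *)
Lemma pole_layers (a : R) (b : nat -> R) : (forall k, 0 <= b k) ->
  (forall k, 2 ^+ k < a -> 2 ^+ k <= b k) ->
  forall N, Num.min a (2 ^+ N) <= 1 + \sum_(k < N) b k.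
Proof.
move=> b0 hb; elim=> [|N IH]; first by rewrite big_ord0 addr0 expr0 ge_min lexx orbT.
rewrite big_ord_recr/= addrA; have [aN|aN] := leP a (2 ^+ N).
  move: IH; rewrite (min_idPl aN) => IH.
  by rewrite ge_min (le_trans IH)// lerDl.
move: IH; rewrite (min_idPr (ltW aN)) => IH.
rewrite ge_min; apply/orP; right; rewrite exprS mulr_natl mulr2n lerD// hb//.
Qed.

Local Definition box w k : set (R * R) :=
  `](complex.Re w - 2^-1 ^+ k), (complex.Re w + 2^-1 ^+ k)[%classic `*`
  `](complex.Im w - 2^-1 ^+ k), (complex.Im w + 2^-1 ^+ k)[%classic.

Lemma box_measure w k : pm (box w k) = ((2 * 2^-1 ^+ k) ^+ 2)%:E.
Proof.
have p0 : 0 < 2^-1 ^+ k :> R by rewrite exprn_gt0.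
rewrite /box plane_measureX; [|exact: measurable_itv|exact: measurable_itv].
rewrite !lebesgue_measure_itv/= !lte_fin !ltrBlDr -!addrA !ltrDl addr_gt0//.
by rewrite -!EFinB -EFinM; congr EFin; rewrite expr2; congr (_ * _); lra.
Qed.

(** Domination by 1 plus the sum of 2^k times the indicator of a square of half-side 2^-k about w.
    The squares have area 4 times 4^-k, so the series integrates to at most 8; polar coordinates do
    not enter. *)
Lemma tintegrable_pole w : tintegrable (fun z => (normc (z - w))^-1).
Proof.
have mD := measurable_fundamental htau.
have mbox k : measurable (box w k : set (T * T)).
  by apply: measurableX; exact: measurable_itv.
pose f (u : T * T) : \bar R := ((normc (to_complex u - w))^-1)%:E.
pose g k (u : T * T) : \bar R := ((2 ^+ k)%:E * (\1_(box w k) u)%:E)%E.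
have g0 k u : (0 <= g k u)%E by rewrite /g -EFinM lee_fin mulr_ge0 ?exprn_ge0.
have mg k : measurable_fun D (g k).
  apply: measurable_funeM; apply/measurable_EFinP.
  exact: (@measurable_indic _ (T * T)%type R D (box w k) (mbox k)).
have mf : measurable_fun D f.
  apply/measurable_EFinP.
  apply: (@pmeasurable_off (~` [set of_complex w]) (of_complex w) (fun z => (normc (z - w))^-1)).
  - apply: closed_openC; apply: accessible_closed_set1; apply: hausdorff_accessible; exact: norm_hausdorff.
  - by [].
  - move=> [x y] nw.
    have zw : 0 < normc ((x +i* y) - w).
      rewrite normc_gt0 subr_eq0; apply/eqP => xw; apply: nw.
      by rewrite /= /of_complex -xw.
    apply: (@plane_continuous _ (fun z => (normc (z - w))^-1) (x +i* y)) => e e0.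
    set N := normc _ in zw *.
    exists (Num.min (N / 2) (e * N ^+ 2 / 4)).
      by rewrite lt_min !divr_gt0// mulr_gt0// exprn_gt0.
    move=> v; rewrite lt_min => /andP[v1 v2].
    have := lerB_normc (x +i* y - w) (- v); have := lerB_normc (x +i* y + v - w) v.
    rewrite opprK (_ : x +i* y - w + v = x +i* y + v - w); last by rewrite addrAC.
    rewrite (_ : x +i* y + v - w - v = x +i* y - w); last by rewrite -addrA addrAC addrA subrK addrC.
    rewrite -/N normcN; set N' := normc (_ + _ - _) => n1 n2.
    have N'0 : N / 2 < N' by lra.
    have N'p : 0 < N' by lra.
    rewrite -subr_lt0.
    have -> : N'^-1 - N^-1 = (N - N') / (N * N').
      by field; rewrite !lt0r_neq0.
    rewrite normrM normfV (gtr0_norm (mulr_gt0 zw N'p)) subr_lt0 ltr_pdivrMr ?mulr_gt0//.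
    apply: (@le_lt_trans _ _ (normc v)); first by rewrite ler_norml; apply/andP; split; lra.
    nra.
apply/integrableP; split; first exact: mf.
have fle u : D u -> (`|f u| <= 1 + \sum_(k <oo) g k u)%E.
  move=> _; rewrite /f.
  set a := (normc _)^-1.
  have a0 : 0 <= a by rewrite invr_ge0 normc_ge0.
  pose b k : R := 2 ^+ k * \1_(box w k) u.
  have b0 k : 0 <= b k by rewrite mulr_ge0// exprn_ge0.
  have hb k : 2 ^+ k < a -> 2 ^+ k <= b k.
    move=> ka; rewrite /b indicE mem_set ?mulr1//.
    have k0 : 0 < 2 ^+ k :> R by rewrite exprn_gt0.
    have n0 : 0 < normc (to_complex u - w) by rewrite -invr_gt0 (lt_trans k0).
    have nu : normc (to_complex u - w) < 2^-1 ^+ k.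
      by rewrite exprVn -(invrK (normc _)) ltf_pV2// posrE (lt_trans k0).
    have r1 := le_lt_trans (ler_normRe _) nu; have r2 := le_lt_trans (ler_normIm _) nu.
    rewrite cReD cReN/= ltr_norml in r1; rewrite cImD cImN/= ltr_norml in r2.
    move/andP: r1 => [r1 r1']; move/andP: r2 => [r2 r2'].
    by split => /=; rewrite in_itv/=; apply/andP; split; lra.
  have [N aN] : exists N : nat, a <= 2 ^+ N.
    have [N hN] : exists N : nat, a < N%:R by exists (Num.bound a); exact: archi_boundP.
    exists N; rewrite (le_trans (ltW hN))// -natrX ler_nat ltnW//; exact: ltn_expl.
  have := pole_layers b0 hb N; rewrite (min_idPl aN) => H.
  rewrite gee0_abs ?lee_fin//.
  apply: (@le_trans _ _ (1 + \sum_(0 <= k < N) g k u)%E).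
    rewrite big_mkord.
    under eq_bigr do rewrite /g -EFinM -/(b _).
    by rewrite sumEFin -EFinD lee_fin.
  by apply: leeD2l; apply: nneseries_lim_ge => k _ _.
have ms : measurable_fun D (fun u => (\sum_(k <oo) g k u)%E) by exact: ge0_emeasurable_sum.
have m1 : measurable_fun D (fun u => (1 + \sum_(k <oo) g k u)%E).
  by apply: emeasurable_funD.
apply: (@le_lt_trans _ _ (\int[pm]_(u in D) (1 + \sum_(k <oo) g k u))%E).
  apply: ge0_le_integral => //.
  exact: measurableT_comp.
rewrite ge0_integralD//; last by move=> u _; apply: nneseries_ge0.
rewrite (integral_cst _ mD 1) mul1e lte_add_pinfty//; first exact: fundamental_finite.
rewrite integral_nneseries//.
apply: (@le_lt_trans _ _ 8%:E); last exact: ltry.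
apply: lime_le; first by apply: is_cvg_nneseries => k _ _; apply: integral_ge0 => u _; exact: g0.
apply: nearW => N.
apply: (@le_trans _ _ (\sum_(0 <= k < N) (4 * 2^-1 ^+ k)%:E)%E).
  apply: lee_sum => k _; rewrite /g ge0_integralZl_EFin// ?exprn_ge0//; last first.
  apply/measurable_EFinP; exact: (@measurable_indic _ (T * T)%type R D (box w k) (mbox k)).
  rewrite integral_indic//.
  apply: (@le_trans _ _ ((2 ^+ k)%:E * pm (box w k))%E).
    apply: lee_wpmul2l; first by rewrite lee_fin exprn_ge0.
    by apply: le_measure; rewrite ?inE//; exact: measurableI.
  rewrite box_measure -EFinM lee_fin exprMn expr2.
  have -> : 2 ^+ k * (2 * 2 * 2^-1 ^+ k ^+ 2) = 4 * 2^-1 ^+ k * (2 ^+ k * 2^-1 ^+ k) :> R by ring.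
  by rewrite -exprMn mulfV// expr1n mulr1.
rewrite sumEFin lee_fin -mulr_sumr.
have : \sum_(0 <= k < N) 2^-1 ^+ k <= 2 - 2 * 2^-1 ^+ N :> R.
  elim: N => [|N IH]; first by rewrite big_nil expr0; lra.
  by rewrite big_nat_recr//= exprS; lra.
have : 0 <= 2^-1 ^+ N :> R by rewrite exprn_ge0.
lra.
Qed.

End Pole.

(** * The periodic function Z and its Fourier coefficients *)

Section Zfunction.
Variables (R : realType) (tau : R[i]).
Hypothesis htau : 0 < complex.Im tau.
Local Notation h := (complex.Im tau).
Local Notation Lam := (lattice tau).
Local Notation D := (fundamental_domain tau).
Local Notation lp := (lattice_point tau).
Local Notation psi := (psi tau).
Local Notation hat := (hat tau).
Local Notation freq := (freq tau).
Local Notation tintegrable := (tintegrable tau).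
Local Notation cintegrable := (cintegrable tau).
Implicit Types (z w v : R[i]) (m n : int).

Definition imlin z : R[i] := 0 +i* (2 * pi * complex.Im z / h).

(** The term [imlin] compensates [kappa]. At lattice points the pole is replaced by 0, which keeps
    the function periodic and odd without exception. *)
Definition Zf z : R[i] := if `[< Lam z >] then 0 else psi z + imlin z.

Lemma Zf_off z : ~ Lam z -> Zf z = psi z + imlin z.
Proof. by rewrite /Zf; case: asboolP. Qed.

Lemma Zf_on z : Lam z -> Zf z = 0.
Proof. by rewrite /Zf; case: asboolP. Qed.

Lemma imlinD z w : imlin (z + w) = imlin z + imlin w.
Proof. by apply: complex_eqP; rewrite ?cReD ?cImD/= ?addr0// cImD; ring. Qed.

Lemma imlinN z : imlin (- z) = - imlin z.
Proof. by apply: complex_eqP; rewrite ?cReN ?cImN/= ?oppr0// cImN; ring. Qed.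

Lemma normc_imlin z : normc (imlin z) <= 2 * pi / h * normc z.
Proof.
rewrite (le_trans (normc_le_ReIm _))//= normr0 add0r.
have c0 : 0 <= 2 * pi / h :> R by rewrite divr_ge0 ?(ltW htau)// mulr_ge0// pi_ge0.
rewrite mulrAC normrM (ger0_norm c0) ler_wpM2l//; exact: ler_normIm.
Qed.

Lemma Zf_periodic w z : Lam w -> Zf (z + w) = Zf z.
Proof.
move=> wl; have [zl|zl] := pselect (Lam z).
  by rewrite !Zf_on//; exact: latticeD.
have zwl : ~ Lam (z + w) by exact: notlatticeD.
rewrite !Zf_off//.
apply: (@lattice_shift _ tau _ (fun z => psi z + imlin z) _ _ w z wl zl) => y yl.
  by rewrite imlinD psi_1// /imlin/= mulr0 mul0r addr0.
have jump : kappa tau + imlin tau = 0.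
  rewrite legendre// /imlin mulfK ?lt0r_neq0//.
  by apply: complex_eqP; rewrite ?cReD ?cImD/= ?addr0// addNr.
by rewrite imlinD psi_tau// addrACA jump addr0.
Qed.

Lemma ZfN z : Zf (- z) = - Zf z.
Proof.
have [zl|zl] := pselect (Lam z).
  by rewrite !Zf_on ?oppr0//; exact: latticeN.
rewrite !Zf_off//; last exact: notlatticeN.
rewrite imlinN opprD; congr (_ + _).
have [r r0 za] := away_ex htau zl.
suff : wzeta tau (- z) - eta1 tau * (- z) = - (wzeta tau z - eta1 tau * z) by [].
by rewrite (wzetaN htau r0 za); ring.
Qed.

Lemma Zf_lip r B : 0 < r -> exists M, 0 <= M /\ forall z,
  normc z <= B -> away Lam r z -> forall u, normc u <= r / 2 ->
    normc (Zf (z + u) - Zf z) <= M * normc u.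
Proof.
move=> r0; have [M [M0 hM]] := hol_lip B (hol_psi htau) r0.
have c0 : 0 <= 2 * pi / h :> R by rewrite divr_ge0 ?(ltW htau)// mulr_ge0// pi_ge0.
exists (M + 2 * pi / h); split; first by rewrite addr_ge0.
move=> z zB za u ur; have r2 : 0 < r / 2 by rewrite divr_gt0.
rewrite !Zf_off; [|exact: away_notin r0 za|exact: away_notin r2 (away_add za ur)].
rewrite imlinD (_ : _ - _ = (psi (z + u) - psi z) + imlin u); last by ring.
by rewrite (le_trans (le_normcD _ _))// mulrDl lerD// ?hM// normc_imlin.
Qed.

(** In the cell centred at 0 the coordinate t keeps the rows n <> 0 away, and on the row n = 0 the
    coordinate s does. *)
Lemma away_lattice0_center : exists2 r : R, 0 < r & forall z,
  `|scoord tau z| <= 1/2 -> `|tcoord tau z| <= 1/2 -> away (lattice0 tau) r z.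
Proof.
have sl0 : 0 < 1 + `|slope tau| by rewrite ltr_wpDr.
exists (Num.min (h / 2) (1 / 2 / (1 + `|slope tau|))).
  by rewrite lt_min !divr_gt0.
move=> z sz tz w [m [n [-> w0]]]; rewrite ge_min.
have [n0|n0] := eqVneq n 0; last first.
  apply/orP; left; rewrite (le_trans _ (ler_normIm _))// cImD cImN Im_lp.
  have -> : complex.Im z - n%:~R * h = h * (tcoord tau z - n%:~R).
    by rewrite /tcoord; field; exact: lt0r_neq0.
  rewrite normrM (gtr0_norm htau) ler_wpM2l ?(ltW htau)//.
  have : 1 <= `|n%:~R : R| by rewrite -intr_norm ler1z; lia.
  have := lerB_dist (n%:~R : R) (tcoord tau z); rewrite distrC; lra.
have m0 : m != 0.
  by apply: contraNneq w0 => ->; rewrite n0 /lattice_point mul0r addr0.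
apply/orP; right; rewrite ler_pdivrMr//.
have : `|scoord tau (z - lp m n)| <= normc (z - lp m n) * (1 + `|slope tau|).
  rewrite /scoord (le_trans (ler_normB _ _))// mulrDr mulr1 lerD ?ler_normRe//.
  by rewrite normrM mulrC ler_wpM2r// ler_normIm.
apply: le_trans; rewrite scoordD scoordN scoord_lp//.
have : 1 <= `|m%:~R : R| by rewrite -intr_norm ler1z; lia.
have := lerB_dist (m%:~R : R) (scoord tau z); rewrite distrC; lra.
Qed.

Lemma Zf_center : exists2 M : R, 0 <= M & forall z,
  `|scoord tau z| <= 1/2 -> `|tcoord tau z| <= 1/2 -> normc (Zf z) <= (normc z)^-1 + M.
Proof.
have [r r0 hr] := away_lattice0_center.
have hrho : hol (lattice0 tau) (zrho tau) (fun z => - wp_reg tau z - eta1 tau * 1).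
  exact: (holB (hol_zeta_reg htau) (holZ (eta1 tau) (hol_id _))).
have [M [M0 hM]] := hol_ge0 (1 + normc tau) hrho r0.
have c0 : 0 <= 2 * pi / h :> R by rewrite divr_ge0 ?(ltW htau)// mulr_ge0// pi_ge0.
exists (M + 2 * pi / h * (1 + normc tau)).
  by rewrite addr_ge0// mulr_ge0// addr_ge0// normc_ge0.
move=> z sz tz.
have nz : normc z <= 1 + normc tau.
  rewrite (coordE htau z) (le_trans (le_normcD _ _))// normcM !normcR.
  by have := normc_ge0 tau; nra.
have [zl|zl] := pselect (Lam z).
  rewrite Zf_on// normc0 addr_ge0 ?invr_ge0 ?normc_ge0//.
  by rewrite addr_ge0// mulr_ge0// addr_ge0// normc_ge0.
rewrite Zf_off// psi_zrho -addrA (le_trans (le_normcD _ _))// normcV lerD//.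
have [h1 _ _] := hM z nz (hr z sz tz).
rewrite (le_trans (le_normcD _ _))// lerD// (le_trans (normc_imlin _))//.
by rewrite ler_wpM2l.
Qed.

(** Each point of the parallelogram lies in the centred cell of one of the four corners; subtracting
    that corner brings it to [Zf_center]. The sum of all four poles spares the case distinction in
    the bound. *)
Lemma Zf_bound : exists2 M : R, 0 <= M & forall u : R * R, D u ->
  normc (Zf (to_complex u)) <= (normc (to_complex u - 0))^-1 + (normc (to_complex u - 1))^-1 +
   (normc (to_complex u - tau))^-1 + (normc (to_complex u - (1 + tau)))^-1 + M.
Proof.
have [M M0 hM] := Zf_center; exists M => // u [s [t [/andP[s0 s1] /andP[t0 t1] ->]]].
set z := s%:C + t%:C * tau.
have sz : scoord tau z = s.
  rewrite /z /scoord cReD cImD cReM cImM/= /slope; field; exact: lt0r_neq0.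
have tz : tcoord tau z = t by rewrite /z /tcoord cImD cImM/=; field; exact: lt0r_neq0.
have key a b : `|s - a%:~R| <= 1/2 -> `|t - b%:~R| <= 1/2 ->
    normc (Zf z) <= (normc (z - lp a b))^-1 + M.
  move=> sa tb; rewrite -(Zf_periodic z (latticeN (lattice_lp tau a b))); apply: hM.
    by rewrite scoordD scoordN scoord_lp// sz.
  by rewrite tcoordD tcoordN tcoord_lp// tz.
have i0 w : 0 <= (normc (z - w))^-1 by rewrite invr_ge0 normc_ge0.
have l00 : lp 0 0 = 0 by rewrite /lattice_point mul0r addr0.
have l10 : lp 1 0 = 1 by rewrite /lattice_point mul0r addr0.
have l01 : lp 0 1 = tau by rewrite /lattice_point mul1r add0r.
have l11 : lp 1 1 = 1 + tau by rewrite /lattice_point mul1r.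
have := i0 0; have := i0 1; have := i0 tau; have := i0 (1 + tau).
have near0 (x : R) : 0 <= x -> x <= 1/2 -> `|x - 0%:~R| <= 1/2.
  by move=> x0 x2; rewrite mulr0z subr0 ger0_norm.
have near1 (x : R) : x < 1 -> 1/2 < x -> `|x - 1%:~R| <= 1/2.
  by move=> x0 x2; rewrite mulr1z ler0_norm; lra.
have [s2|s2] := leP s (1/2); have [t2|t2] := leP t (1/2).
- have := key 0 0 (near0 s s0 s2) (near0 t t0 t2); rewrite l00; lra.
- have := key 0 1 (near0 s s0 s2) (near1 t t1 t2); rewrite l01; lra.
- have := key 1 0 (near1 s s1 s2) (near0 t t0 t2); rewrite l10; lra.
- have := key 1 1 (near1 s s1 s2) (near1 t t1 t2); rewrite l11; lra.
Qed.

Lemma fundamental_lattice u : D u -> Lam (to_complex u) -> u = (0, 0).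
Proof.
move=> [s [t [s01 t01 E]]] [m [n E']].
have sE : s = m%:~R.
  rewrite -(scoord_lp htau m n) -E' E /scoord cReD cImD cReM cImM/= /slope.
  by field; exact: lt0r_neq0.
have tE : t = n%:~R.
  rewrite -(tcoord_lp htau m n) -E' E /tcoord cImD cImM/=.
  by field; exact: lt0r_neq0.
have z0 (a : int) : 0 <= (a%:~R : R) < 1 -> a = 0.
  by rewrite ler0z -[1]/(1%:~R) ltr_int; lia.
have m0 : m = 0 by apply: z0; rewrite -sE.
have n0 : n = 0 by apply: z0; rewrite -tE.
move: E'; rewrite m0 n0 /lattice_point mul0r addr0; case: u {E} => x y /eqP.
by rewrite eq_complex/= => /andP[/eqP-> /eqP->].
Qed.

Lemma lattice_open : open [set u : R * R | ~ Lam (to_complex u)].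
Proof.
rewrite openE => u /= ul; have [r r0 ra] := away_ex htau ul.
apply/nbhs_ballP; exists (r / 2); first by rewrite /= divr_gt0.
move=> v [/= v1 v2] vl; have := ra _ vl; apply/negP; rewrite -ltNge.
rewrite /ball/= in v1 v2.
by rewrite (le_lt_trans (normc_le_ReIm _))// cReD cImD cReN cImN/= (splitr r) ltrD.
Qed.

Lemma cintegrable_Zf : cintegrable Zf.
Proof.
have [M M0 hM] := Zf_bound.
have pi1 := tintegrable_pole htau.
have gi := tintegrableD htau (tintegrableD htau (tintegrableD htau (tintegrableD htau (pi1 0) (pi1 1))
  (pi1 tau)) (pi1 (1 + tau))) (tintegrable_cst htau M).
have mD := measurable_fundamental htau.
have aux (p : R[i] -> R) : (forall z w, `|p z - p w| <= normc (z - w)) -> (forall z, `|p z| <= normc z) ->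
    tintegrable (fun z => p (Zf z)).
  move=> p1 p2; apply: (le_integrable mD _ _ gi).
    apply/measurable_EFinP.
    apply: (pmeasurable_off htau (a := (0, 0)) lattice_open).
      move=> u Du u0 ul; apply: u0.
      exact: fundamental_lattice.
    move=> u /= ul.
    have -> : u = of_complex (to_complex u) by case: u {ul}.
    apply: (@plane_continuous _ (fun z => p (Zf z))) => e e0.
    have [r r0 ra] := away_ex htau ul.
    have [N [N0 hN]] := Zf_lip (normc (to_complex u)) r0.
    have N1 : 0 < N + 1 by rewrite ltr_wpDl.
    exists (Num.min (r / 2) (e / (N + 1))); first by rewrite lt_min !divr_gt0.
    move=> v; rewrite lt_min => /andP[v1]; rewrite ltr_pdivlMr// => v2.
    rewrite (le_lt_trans (p1 _ _))// (le_lt_trans (hN (to_complex u) (lexx _) ra v (ltW v1)))//.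
    by rewrite (le_lt_trans _ v2)// mulrC ler_wpM2l ?normc_ge0// lerDl.
  move=> u Du; rewrite /= lee_fin (le_trans (p2 _))// (le_trans (hM u Du))//.
  exact: ler_norm.
split; apply: aux => [z w|z].
- by rewrite -cReN -cReD ler_normRe.
- exact: ler_normRe.
- by rewrite -cImN -cImD ler_normIm.
- exact: ler_normIm.
Qed.

Lemma Zf_row y : 0 < y < h -> (fun x => Zf (x +i* y)) = (fun x => psi (x +i* y) + imlin (0 +i* y)).
Proof.
move=> /andP[y0 yh]; apply/funext => x; rewrite Zf_off//.
by apply: (psi_line_notin htau); rewrite gtr0_norm// y0.
Qed.

(** For m <> 0 the integral in y produces the factor that [Apos_neq0] inverts. For m = 0 the row
    coefficient is affine in y, because of [imlin]. At m = n = 0 both sides are 0, the right one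
    because [freq] vanishes and 0^-1 = 0. *)
Lemma hat_Zf m n : hat Zf m n = (0 +i* (2 * pi)) / freq m n.
Proof.
have h0 := lt0r_neq0 htau.
pose E y : R[i] := Apos tau m + imlin (0 +i* y) * (m == 0)%:R.
pose be : R[i] := 0 +i* (2 * pi / h).
have imE y : imlin (0 +i* y) = be * (y +i* 0).
  by apply: complex_eqP; rewrite ?cReM ?cImM/=; [ring|field].
have la : @line_away R set0 0 by exists 1 => // x w.
have cE : ccont E.
  apply: ccontD; first exact: ccont_cst.
  have -> : (fun y => imlin (0 +i* y) * (m == 0)%:R) = (fun y => (be * (m == 0)%:R) * (y +i* 0)).
    by apply/funext => y; rewrite imE mulrAC.
  apply: ccontZ; exact: (line_ccont (hol_id set0) la).
have hatE : Cint 0 h (fun y => cexp (freq m n * y%:C) * E y) = hat Zf m n.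
  rewrite (@hat_rows _ _ htau Zf E m n cintegrable_Zf)//.
  - move=> y yI; rewrite (Zf_row yI); apply: ccontD; last exact: ccont_cst.
    by case/andP: (yI) => y0 yh; apply: (psi_ccont htau); rewrite gtr0_norm// y0.
  - by move=> x y yI; rewrite shiftx Zf_periodic//; exact: lattice_1.
  - move=> y yI; rewrite /rowcoef.
    case/andP: (yI) => y0 yh; have yy : 0 < `|y| < h by rewrite gtr0_norm// y0.
    rewrite /E -(rowcoef_pos htau m yI) -(rowcoef_cst _ m y) /rowcoef -CintD; last 2 first.
    + by apply: ccontM; [exact: psi_ccont|exact: line_ccont_em].
    + by apply: ccontM; [exact: ccont_cst|exact: line_ccont_em].
    apply: eq_Cint => x _; rewrite -mulrDl; congr (_ * _).
    by have := congr1 (fun f => f x) (Zf_row yI).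
have cc := @line_ccont _ set0 _ _ (hol_cexp _ (freq m n)) 0 la.
have [m0|m0] := eqVneq m 0; last first.
  rewrite -hatE (@eq_Cint _ _ _ _ (fun y => Apos tau m * cexp (freq m n * y%:C))); last first.
    by move=> y _; rewrite /E (negbTE m0) mulr0 addr0 mulrC.
  rewrite CintZ// Cint_cexp//; last by rewrite freq_neq0// m0.
  rewrite mulrA; congr (_ / _).
  have e1 := freq_h htau m n; have A := Apos_neq0 htau m0.
  move: e1 A; set e := em m tau; set c := cexp _ => e1 A.
  have e0 : e != 0 by apply/eqP => e0; move/eqP: e1; rewrite e0 mulr0 eq_sym oner_eq0.
  apply: (mulIf e0); rewrite -A -mulrA; congr (_ * _).
  by rewrite mulrBl e1 mul1r.
pose al := Apos tau 0.
have EE (y : R) : E y = al + be * y%:C by rewrite /E m0 eqxx mulr1 imE.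
have FTC (P : R[i] -> R[i]) : hol set0 P (fun z => cexp (freq 0 n * z) * (al + be * z)) ->
    hat Zf 0 n = P h%:C - P 0.
  move=> hP; rewrite (_ : hat Zf 0 n = Cint 0 h (fun y => cexp (freq 0 n * y%:C) * (al + be * y%:C))).
    by rewrite (Cint_FTC htau (fun x => line_cderiv hP x la) (line_ccont_deriv hP la)).
  have <- : hat Zf m n = hat Zf 0 n by rewrite m0.
  by rewrite -hatE; apply: eq_Cint => y _; rewrite EE m0.
rewrite m0; have [n0|n0] := eqVneq n 0.
  have f0 : freq 0 0 = 0.
    have k0 : kap tau 0 0 = 0 by rewrite /kap mulr0z mul0r subr0 mul0r.
    by apply: complex_eqP; rewrite /Submission.freq /= ?k0 ?mulr0z !mulr0 oppr0.
  have -> : hat Zf 0 n = al * h%:C + be / 2 * h%:C ^+ 2 - (al * 0 + be / 2 * 0 ^+ 2).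
    apply: (FTC (fun z => al * z + be / 2 * z ^+ 2)).
    apply: hol_ext (holD (holZ al (hol_id _)) (holZ (be / 2) (holX 2 (hol_id _)))) => // r z _ _.
    by rewrite n0 f0 mul0r cexp0; field.
  rewrite n0 f0 invr0 mulr0 /al Apos_0// /be.
  by apply: complex_eqP; rewrite ?cReD ?cImD ?cReN ?cImN ?cReM ?cImM/=; [ring|field].
have c0 : freq 0 n != 0 by rewrite freq_neq0// n0 orbT.
have ch : cexp (freq 0 n * h%:C) = 1.
  have := freq_h htau 0 n; rewrite /em /cm mulr0z mulr0 oppr0.
  by rewrite (_ : 0 +i* 0 = 0)// mul0r cexp0 mulr1.
set c := freq 0 n in c0 ch FTC *.
(* An explicit primitive of exp(c z) (al + be z); since exp(c h) = 1, only the term in be z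
   contributes to the difference. *)
rewrite (FTC (fun z => cexp (c * z) * (al / c - be / c ^+ 2 + be / c * z))); last first.
  apply: hol_ext (holM (hol_cexp _ c) (holD (hol_cst _ (al / c - be / c ^+ 2)) (holZ (be / c) (hol_id _)))) => // r z _ _.
  by field.
rewrite ch mulr0 cexp0.
have -> : 0 +i* (2 * pi) = be * h%:C.
  by apply: complex_eqP; rewrite ?cReM ?cImM/=; [ring|field].
by field.
Qed.

End Zfunction.

(** * Differentiability in the plane from a quadratic remainder *)

Section QuadraticDifferentiable.
Variable R : realType.
Implicit Types (f : R * R -> R) (u v : R * R).

Definition plane_linear (p q : R) (v : R * R) : R^o := p * v.1 + q * v.2.

Lemma plane_linear_linear p q : linear (plane_linear p q).
Proof. by move=> a [x y] [z w]; rewrite /plane_linear/= /GRing.scale/=; ring. Qed.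

HB.instance Definition _ p q :=
  GRing.isLinear.Build R (R * R)%type R^o *:%R (plane_linear p q) (plane_linear_linear p q).

Lemma plane_linear_continuous p q : continuous (plane_linear p q : R * R -> R).
Proof.
move=> u; apply: cvgD; apply: cvgM; try exact: cvg_cst.
  exact: cvg_fst.
exact: cvg_snd.
Qed.

Lemma plane_diff f u (p q M e : R) : 0 < e ->
  (forall v, `|v.1| < e -> `|v.2| < e ->
    `|f (u + v) - f u - (p * v.1 + q * v.2)| <= M * (v.1 ^+ 2 + v.2 ^+ 2)) ->
  [/\ differentiable f u, 'D_((1, 0) : R * R) f u = p & 'D_((0, 1) : R * R) f u = q].
Proof.
move=> e0 H.
have cL := @plane_linear_continuous p q.
have key : f \o shift u = cst (f u) + plane_linear p q +o_ (0 : R * R) id.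
  apply/eqaddoP => eps eps0.
  (* The norm of the product space is the maximum norm, so v.1^2 + v.2^2 <= 2 |v|^2; hence the
     factor 2. *)
  have M1 : 0 < 2 * `|M| + 1 by rewrite ltr_wpDl// mulr_ge0.
  set r := Num.min e (eps / (2 * `|M| + 1)).
  have r0 : 0 < r by rewrite lt_min e0 divr_gt0.
  near=> v.
  have vr : `|v| < r by near: v; apply: (@nbhs0_lt R (R * R)%type r r0).
  move: vr; rewrite lt_min ltr_pdivlMr// => /andP[ve vM].
  have n1 : `|v.1| <= `|v| by rewrite prod_normE le_max lexx.
  have n2 : `|v.2| <= `|v| by rewrite prod_normE le_max lexx orbT.
  have := H v (le_lt_trans n1 ve) (le_lt_trans n2 ve).
  rewrite -[(f \o _ - _) v]/(f (v + u) - (f u + plane_linear p q v)) /plane_linear/= => Hv.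
  rewrite opprD addrA (addrC v); apply: (le_trans Hv).
  rewrite -(real_normK (num_real v.1)) -(real_normK (num_real v.2)).
  have a1 := normr_ge0 v.1; have a2 := normr_ge0 v.2; have aM := ler_norm M; have M0 := normr_ge0 M.
  have sq : `|v.1| ^+ 2 + `|v.2| ^+ 2 <= 2 * `|v| ^+ 2 by nra.
  have sq0 : 0 <= `|v.1| ^+ 2 + `|v.2| ^+ 2 by rewrite addr_ge0 ?exprn_ge0.
  apply: (le_trans (ler_wpM2r sq0 aM)); apply: (le_trans (ler_wpM2l M0 sq)).
  have nv := normr_ge0 v; rewrite expr2 !mulrA ler_wpM2r//; nra.
have dE := diff_unique cL key.
have df : differentiable f u.
  by apply/diff_locallyP; rewrite dE.
split; first exact: df.
  by rewrite deriveE// dE -[LHS]/(p * 1 + q * 0) mulr1 mulr0 addr0.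
by rewrite deriveE// dE -[LHS]/(p * 0 + q * 1) mulr1 mulr0 add0r.
Unshelve. all: by end_near.
Qed.

End QuadraticDifferentiable.

(** * Trigonometric test functions *)

Section TrigFunctions.
Variable R : realType.

(** A two-parameter family stable under both partial derivatives, so that smoothness of all orders
    is a single induction. *)
Definition trig (A B a b : R) (u : R * R) : R :=
  A * cos (a * u.1 + b * u.2) + B * sin (a * u.1 + b * u.2).

Lemma trig_taylor (A B th : R) : exists M : R, forall s : R,
  `|A * cos (th + s) + B * sin (th + s) - (A * cos th + B * sin th)
    - s * (B * cos th - A * sin th)| <= M * s ^+ 2.
Proof.
pose f s := A * cos (th + s) + B * sin (th + s).
pose f' s := B * cos (th + s) - A * sin (th + s).
pose f'' s := - A * cos (th + s) - B * sin (th + s).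
have dth (x : R) : is_derive x 1 (fun s => th + s) 1.
  have := is_deriveD (is_derive_cst th x 1) (is_derive_id x 1); rewrite add0r; exact.
have dc (x : R) : is_derive x 1 (fun s => cos (th + s)) (- sin (th + x)).
  have := @is_derive1_comp R cos (fun s => th + s) x _ _ (is_derive_cos (th + x)) (dth x).
  by rewrite mulr1.
have ds (x : R) : is_derive x 1 (fun s => sin (th + s)) (cos (th + x)).
  have := @is_derive1_comp R sin (fun s => th + s) x _ _ (is_derive_sin (th + x)) (dth x).
  by rewrite mulr1.
have lin (C D : R) (x : R) : is_derive x 1 (fun s => C * cos (th + s) + D * sin (th + s))
    (C * - sin (th + x) + D * cos (th + x)).
  by apply: is_deriveD; apply: is_deriveZ.
have df (x : R) : is_derive x 1 f (f' x).
  by apply: is_derive_eq (lin A B x) _; rewrite /f'; ring.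
have df' (x : R) : is_derive x 1 f' (f'' x).
  have -> : f' = (fun s => B * cos (th + s) + (- A) * sin (th + s)).
    by apply/funext => s; rewrite /f'; ring.
  by apply: is_derive_eq (lin B (- A) x) _; rewrite /f''; ring.
exists (`|A| + `|B|) => s.
have := @taylor2_bound R f f' f'' (`|A| + `|B|) s df df'.
rewrite /f /f' !addr0; apply => x _.
rewrite /f'' (le_trans (ler_normB _ _))// !normrM normrN lerD// -[leRHS]mulr1 ler_wpM2l//.
  exact: cos_max.
exact: sin_max.
Qed.

Lemma trig_diff A B a b u : [/\ differentiable (trig A B a b) u,
  'D_((1, 0) : R * R) (trig A B a b) u = trig (B * a) (- A * a) a b u &
  'D_((0, 1) : R * R) (trig A B a b) u = trig (B * b) (- A * b) a b u].
Proof.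
have [M hM] := trig_taylor A B (a * u.1 + b * u.2).
apply: (@plane_diff _ _ _ _ _ (`|M| * 2 * (a ^+ 2 + b ^+ 2)) 1) => // v _ _.
have := hM (a * v.1 + b * v.2).
rewrite (_ : a * u.1 + b * u.2 + (a * v.1 + b * v.2) = a * (u + v).1 + b * (u + v).2); last first.
  by rewrite /=; ring.
rewrite /trig /= => H.
set X := (X in `|X|) in H; set Y := (X in `|X|).
have -> : Y = X by rewrite /X /Y; ring.
apply: (le_trans H); rewrite -!mulrA.
have M1 := ler_norm M; have M0 := normr_ge0 M.
apply: (@le_trans _ _ (`|M| * (a * v.1 + b * v.2) ^+ 2)); first by rewrite ler_wpM2r// sqr_ge0.
rewrite ler_wpM2l//.
have := sqr_ge0 (a * v.1 - b * v.2); have := sqr_ge0 (a * v.2); have := sqr_ge0 (b * v.1).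
rewrite -subr_ge0 => *; nra.
Qed.

Lemma partial_trig i A B a b : partial i (trig A B a b) =
  trig (B * (if i == 0 then a else b)) (- A * (if i == 0 then a else b)) a b.
Proof.
apply/funext => u; rewrite /partial; have [_ d1 d2] := trig_diff A B a b u.
by case: ifP.
Qed.

Lemma smooth_trig A B a b : smooth (trig A B a b).
Proof.
move=> n; elim: n A B => [|n IH] A B /=.
  by move=> u; apply: differentiable_continuous; case: (trig_diff A B a b u).
split=> [u|i]; first by case: (trig_diff A B a b u).
by rewrite partial_trig.
Qed.

Lemma laplacian_trig A B a b u :
  laplacian (trig A B a b) u = - (a ^+ 2 + b ^+ 2) * trig A B a b u.
Proof. by rewrite /laplacian big_ord_recl big_ord1 !partial_trig/= /trig; ring. Qed.

End TrigFunctions.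

(** * Fourier coefficients of the Green function *)

Section GreenGradient.
Variables (R : realType) (tau : R[i]) (G : R[i] -> R).
Hypothesis htau : 0 < complex.Im tau.
Hypothesis hG : is_green tau G.
Local Notation h := (complex.Im tau).
Local Notation Lam := (lattice tau).
Local Notation tint := (torus_integral tau).
Local Notation hat := (hat tau).
Local Notation chi := (chi tau).
Local Notation kap := (kap tau).
Local Notation freq := (freq tau).
Local Notation convn := (convn tau).
Local Notation trigsum := (trigsum tau).
Local Notation Zf := (Zf tau).
Local Notation bw := (@bw R).
Local Notation Gc := (fun z => (G z)%:C).
Implicit Types (z w u v : R[i]) (m n : int).

Lemma cReMr (x : R) w : complex.Re (x%:C * w) = x * complex.Re w.
Proof. by rewrite cReM/= mul0r subr0. Qed.

Lemma cImMr (x : R) w : complex.Im (x%:C * w) = x * complex.Im w.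
Proof. by rewrite cImM/= mul0r addr0. Qed.

Definition eigval m n : R := (2 * pi * m%:~R) ^+ 2 + (2 * pi * kap m n) ^+ 2.

Lemma freq_conj m n : freq m n * (freq m n)^* = (eigval m n)%:C.
Proof. by apply: complex_eqP; rewrite ?cReM ?cImM/= /eigval; ring. Qed.

Lemma cintegrable_Gc : cintegrable tau Gc.
Proof. by split; [exact: green_integrable hG|exact: tintegrable_cst]. Qed.

Lemma Gc_periodic w u : Lam w -> Gc (u + w) = Gc u.
Proof. by move=> wl /=; rewrite (green_periodic hG). Qed.

(** The real part of (A + iB) chi(-z): real test functions that recover a complex coefficient, and
    eigenfunctions of minus the Laplacian for [eigval]. *)
Definition mode m n A B z : R :=
  A * complex.Re (chi m n (- z)) - B * complex.Im (chi m n (- z)).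

Lemma on_plane_mode m n A B : on_plane (mode m n A B) =
  trig A B (2 * pi * m%:~R) (2 * pi * kap m n).
Proof.
apply/funext => -[x y]; rewrite /trig/= -[LHS]/(A * complex.Re (chi m n (- to_complex (x, y))) -
  B * complex.Im (chi m n (- to_complex (x, y)))).
have -> : chi m n (- to_complex (x, y)) = cis (- (2 * pi * m%:~R * x + 2 * pi * kap m n * y)).
  by rewrite -[- to_complex _]/((- x) +i* (- y)) (chi_xy htau); congr cis; ring.
by rewrite /cis/= cosN sinN; ring.
Qed.

Lemma green_mode m n A B :
  eigval m n * tint (fun z => G z * mode m n A B z) = A - h^-1 * tint (mode m n A B).
Proof.
have H := green_laplacian hG (phi := mode m n A B).
have m0 : mode m n A B 0 = A.
  by rewrite /mode oppr0 chi0 (_ : complex.Re 1 = 1)// (_ : complex.Im 1 = 0)// mulr1 mulr0 subr0.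
rewrite m0 in H; rewrite -H; last 2 first.
- by move=> w z wl; rewrite /mode opprD !(chi_periodic htau)//; exact: latticeN.
- by rewrite on_plane_mode; exact: smooth_trig.
have [i1 i2] := cintegrable_chi htau m n cintegrable_Gc.
have gi : tintegrable tau (fun z => G z * mode m n A B z).
  apply: eq_tintegrable (tintegrableB htau (tintegrableZ htau A i1) (tintegrableZ htau B i2)) => z.
  by rewrite cReMr cImMr /mode; ring.
rewrite (_ : (fun z => G z * laplacian _ _) = (fun z => - eigval m n * (G z * mode m n A B z))).
  by rewrite tintZ// mulNr opprK.
apply/funext => z; rewrite on_plane_mode laplacian_trig -on_plane_mode -/(eigval m n).
rewrite /on_plane [in LHS]/comp (_ : to_complex (of_complex z) = z); last by case: z.
ring.
Qed.

(** The modes (1, 0) and (0, -1) give the real and the imaginary part. The Dirac mass contributes 1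
    to every coefficient, the constant background only to the zero mode. *)
Lemma hat_G m n : (eigval m n)%:C * hat Gc m n = 1 - ((m == 0) && (n == 0))%:R.
Proof.
have C := hat_cst htau 1 m n; rewrite mul1r /Submission.hat /Submission.cti in C.
have h0 := lt0r_neq0 htau.
have := green_mode m n 1 0; have := green_mode m n 0 (-1).
have M1 z : mode m n 1 0 z = complex.Re (chi m n (- z)) by rewrite /mode mul1r mul0r subr0.
have M2 z : mode m n 0 (-1) z = complex.Im (chi m n (- z)) by rewrite /mode mul0r mulN1r opprK add0r.
have -> : (fun z => G z * mode m n 1 0 z) = (fun z => complex.Re ((G z)%:C * chi m n (- z))).
  by apply/funext => z; rewrite cReMr M1.
have -> : (fun z => G z * mode m n 0 (-1) z) = (fun z => complex.Im ((G z)%:C * chi m n (- z))).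
  by apply/funext => z; rewrite cImMr M2.
have E1 : mode m n 1 0 = (fun z => complex.Re (1 * chi m n (- z))).
  by apply/funext => z; rewrite mul1r M1.
have E2 : mode m n 0 (-1) = (fun z => complex.Im (1 * chi m n (- z))).
  by apply/funext => z; rewrite mul1r M2.
have d0 : (((m == 0) && (n == 0))%:R : R[i]) = (((m == 0) && (n == 0))%:R : R)%:C by case: (_ && _).
rewrite E1 E2 => e2 e1; rewrite d0 -rmorphM/= in C.
have /(congr1 (@complex.Re R)) /= C1 := C; have /(congr1 (@complex.Im R)) /= C2 := C.
rewrite C1 mulrCA mulVf// mulr1 in e1; rewrite C2 mulr0 subr0 in e2.
rewrite d0 /Submission.hat /Submission.cti.
by apply: complex_eqP; rewrite ?cReM ?cImM ?cReD ?cImD ?cReN ?cImN/= ?mul0r ?mulr0 ?addr0 ?subr0 ?oppr0.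
Qed.

Lemma hat_G00 : hat Gc 0 0 = 0.
Proof.
rewrite /Submission.hat (_ : (fun u => _) = Gc); last by apply/funext => u; rewrite chi00 mulr1.
rewrite /Submission.cti; apply: complex_eqP => /=; first exact: (green_mean0 hG).
by rewrite -[RHS](mul0r (tint (fun=> 1))) -tintZ ?mul0r//; exact: tintegrable_cst.
Qed.

Lemma eigval_neq0 m n : (m != 0) || (n != 0) -> eigval m n != 0.
Proof.
move=> /(freq_neq0 htau) f0; apply/eqP => e0; have /eqP := freq_conj m n.
by rewrite e0 mulf_eq0 (negbTE f0) conjc_eq0 (negbTE f0).
Qed.

(** The zero mode fits in: G has mean zero, and [eigval 0 0] = 0 has inverse 0. *)
Lemma hat_GE m n : hat Gc m n = ((eigval m n)^-1)%:C.
Proof.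
have [mn|mn] := boolP ((m != 0) || (n != 0)).
  have e0 := eigval_neq0 mn; have := hat_G m n.
  rewrite (_ : (m == 0) && (n == 0) = false) ?subr0; last first.
    by apply/negbTE; rewrite negb_and.
  have c0 : (eigval m n)%:C != 0 by rewrite eq_complex/= eqxx andbT.
  by rewrite fmorphV => E; apply: (mulfI c0); rewrite E mulfV.
move: mn; rewrite negb_or !negbK => /andP[/eqP-> /eqP->]; rewrite hat_G00.
by rewrite /eigval /Submission.kap mulr0z mul0r subr0 mul0r !mulr0 expr0n addr0 invr0.
Qed.

(** The conjugate of [freq] is i times the symbol of d/dx - i d/dy, so this is -2 pi (G_x - i G_y) =
    Z at the level of coefficients. *)
Lemma hat_Z_G m n : hat Zf m n = (0 +i* (2 * pi)) * ((freq m n)^* * hat Gc m n).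
Proof.
rewrite hat_Zf// hat_GE fmorphV/= -freq_conj; congr (_ * _).
have [->|f0] := eqVneq (freq m n) 0; first by rewrite mul0r invr0 mulr0.
by rewrite invfM mulrCA mulrV ?mulr1// unitfE conjc_eq0.
Qed.

End GreenGradient.

Lemma hol_sum (R : realType) (S : set R[i]) (I : Type) (s : seq I) (f d : I -> R[i] -> R[i]) :
  (forall i, hol S (f i) (d i)) ->
  hol S (fun z => \sum_(i <- s) f i z) (fun z => \sum_(i <- s) d i z).
Proof.
move=> H; elim: s => [|i s IH].
  by apply: hol_ext (hol_cst S 0) => r z _ _; rewrite big_nil.
by apply: hol_ext (holD (H i) IH) => r z _ _; rewrite big_cons.
Qed.

(** * Derivatives and symmetries of weighted Fourier series *)

Section TrigSums.
Variables (R : realType) (tau : R[i]).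
Hypothesis htau : 0 < complex.Im tau.
Local Notation h := (complex.Im tau).
Local Notation chi := (chi tau).
Local Notation kap := (kap tau).
Local Notation trigsum := (trigsum tau).
Local Notation bw := (@bw R).
Implicit Types (z w u v : R[i]) (m n : int) (a b : int -> int -> R[i]).

(** Speed of the phase of [chi m n] in the direction v. *)
Definition vel v m n : R := 2 * pi * (m%:~R * complex.Re v + kap m n * complex.Im v).

Lemma chi_line m n z v (x : R) :
  chi m n (z + x%:C * v) = chi m n z * cexp ('i * (vel v m n)%:C * x%:C).
Proof.
rewrite chiD; congr (_ * _); rewrite -mulrA -rmorphM/= cexp_i.
have -> : x%:C * v = (x * complex.Re v) +i* (x * complex.Im v).
  by apply: complex_eqP; rewrite ?cReMr ?cImMr.
by rewrite (chi_xy htau) /vel; congr cis; ring.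
Qed.

Lemma trigsum_deriv N a z v (x : R) : cderiv (fun x => trigsum N a (z + x%:C * v)) x
  (trigsum N (fun m n => 'i * (vel v m n)%:C * a m n) (z + x%:C * v)).
Proof.
pose c (i j : 'I_N.*2.+1) := 'i * (vel v (i%:Z - N%:Z) (j%:Z - N%:Z))%:C.
pose b (i j : 'I_N.*2.+1) : R[i] := (bw N i * bw N j)%:C *
  (a (i%:Z - N%:Z) (j%:Z - N%:Z) * chi (i%:Z - N%:Z) (j%:Z - N%:Z) z).
have la : @line_away R set0 0 by exists 1 => // y w.
have H := @line_cderiv _ set0 _ _ (hol_sum (index_enum _) (fun i =>
  hol_sum (index_enum _) (fun j => holZ (b i j) (hol_cexp set0 (c i j))))) 0 x la.
rewrite (_ : (fun x => trigsum N a (z + x%:C * v)) = fun x =>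
  \sum_i \sum_j b i j * cexp (c i j * (x +i* 0))); last first.
  apply/funext => y; apply: eq_bigr => i _; apply: eq_bigr => j _.
  by rewrite chi_line /b /c !mulrA.
rewrite [X in cderiv _ _ X](_ : _ = \sum_i \sum_j b i j * (c i j * cexp (c i j * (x +i* 0)))); last first.
  apply: eq_bigr => i _; apply: eq_bigr => j _.
  rewrite chi_line /b /c -[x +i* 0]/(x%:C); ring.
exact: H.
Qed.

Lemma trigsumD N a b z : trigsum N (fun m n => a m n + b m n) z = trigsum N a z + trigsum N b z.
Proof.
rewrite /Submission.trigsum -big_split; apply: eq_bigr => i _; rewrite -big_split.
by apply: eq_bigr => j _; rewrite mulrDl mulrDr.
Qed.

Lemma trigsumZ N c a z : trigsum N (fun m n => c * a m n) z = c * trigsum N a z.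
Proof.
rewrite /Submission.trigsum mulr_sumr; apply: eq_bigr => i _; rewrite mulr_sumr.
by apply: eq_bigr => j _; ring.
Qed.

Lemma chiN m n z : chi (- m) (- n) z = (chi m n z)^*.
Proof. by rewrite /Submission.chi -cisN; congr cis; rewrite !rmorphN/=; ring. Qed.

Lemma bw_rev N (i : 'I_N.*2.+1) : bw N (rev_ord i) = bw N i.
Proof. by rewrite /Submission.bw /= subSS bin_sub// -ltnS. Qed.

Lemma rev_ordZ N (i : 'I_N.*2.+1) : (rev_ord i)%:Z - N%:Z = - (i%:Z - N%:Z).
Proof. by have := ltn_ord i; rewrite /=; lia. Qed.

(** The weights are symmetric and chi of opposite indices is the conjugate, so odd real coefficients
    give a purely imaginary sum. *)
Lemma trigsum_odd N (b : int -> int -> R) z : (forall m n, b (- m) (- n) = - b m n) ->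
  complex.Re (trigsum N (fun m n => (b m n)%:C) z) = 0.
Proof.
move=> bN; set S := trigsum _ _ _.
have SE : S = - S^*.
  rewrite {1}/S /Submission.trigsum (reindex_inj rev_ord_inj)/=.
  rewrite /S /Submission.trigsum !rmorph_sum -sumrN/=; apply: eq_bigr => i _.
  rewrite (reindex_inj rev_ord_inj)/= rmorph_sum -sumrN; apply: eq_bigr => j _.
  rewrite !bw_rev !rev_ordZ chiN bN.
  move: (bw N i * bw N j) (b _ _) (chi _ _ z) => x y [p q].
  by apply: complex_eqP; rewrite /=; ring.
move/(congr1 (@complex.Re R)): SE; rewrite cReN /=.
have -> : complex.Re S^* = complex.Re S by case: S.
by lra.
Qed.

End TrigSums.

(** * First-order expansion of the Green function off the lattice *)

Section GreenTaylor.
Variables (R : realType) (tau : R[i]) (G : R[i] -> R).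
Hypothesis htau : 0 < complex.Im tau.
Hypothesis hG : is_green tau G.
Local Notation h := (complex.Im tau).
Local Notation Lam := (lattice tau).
Local Notation hat := (hat tau).
Local Notation convn := (convn tau).
Local Notation trigsum := (trigsum tau).
Local Notation Zf := (Zf tau).
Local Notation Gc := (fun z => (G z)%:C).
Implicit Types (z w u v : R[i]) (m n : int).

(** Multiplying hat Z by -v/(2 pi) gives the coefficients of the derivative of G along v plus a real
    odd sequence, which is invisible in the real part. *)
Lemma trigsum_hatZ N z v :
  complex.Re (- (v / (2 * pi)%:C) * trigsum N (hat Zf) z) =
  complex.Re (trigsum N (fun m n => 'i * (vel tau v m n)%:C * hat Gc m n) z).
Proof.
have p0 : 2 * pi != 0 :> R by rewrite mulf_neq0 ?pnatr_eq0// gt_eqF ?pi_gt0.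
pose b m n := 2 * pi * (kap tau m n * complex.Re v - m%:~R * complex.Im v) * (eigval tau m n)^-1.
have bN m n : b (- m) (- n) = - b m n.
  by rewrite /b /eigval /kap !rmorphN/= !(mulrN, mulNr) !sqrrN -opprD !(mulrN, mulNr) sqrrN; ring.
rewrite -trigsumZ.
rewrite [X in trigsum N X z](_ : _ = (fun m n => 'i * (vel tau v m n)%:C * hat Gc m n + (b m n)%:C)).
  by rewrite trigsumD cReD trigsum_odd// addr0.
apply/funext => m; apply/funext => n.
rewrite (hat_Z_G htau hG) (hat_GE htau hG) /b /Submission.freq /vel -fmorphV/=.
move: (_^-1) (pi : R) p0 (kap tau m n) => e p p0 k; case: v b bN => v1 v2 _ _.
by apply: complex_eqP; rewrite ?cReD ?cImD ?cReM ?cImM/=; field; move: p0; rewrite mulf_eq0 negb_or => /andP[].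
Qed.

(** The mean value theorem on the segment from z to z + v, applied to the smoothing of G, which is a
    trigonometric polynomial. *)
Lemma convn_grad N z v : exists2 xi : R, 0 <= xi <= 1 &
  complex.Re (convn N Gc (z + v)) - complex.Re (convn N Gc z) =
  complex.Re (- (v / (2 * pi)%:C) * convn N Zf (z + xi%:C * v)).
Proof.
pose g x := complex.Re (trigsum N (hat Gc) (z + x%:C * v)).
pose g' x := complex.Re (trigsum N (fun m n => 'i * (vel tau v m n)%:C * hat Gc m n) (z + x%:C * v)).
have dg (x : R) : is_derive x 1 g (g' x) by case: (trigsum_deriv htau N (hat Gc) z v x).
have cg : continuous g.
  by move=> x; apply/differentiable_continuous/derivable1_diffP; case: (dg x).
have [xi xi01] := @MVT_segment R g g' 0 1 ler01 (fun x _ => dg x) (continuous_subspaceT cg).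
rewrite subr0 mulr1 => E; exists xi; first by move: xi01; rewrite in_itv.
have CR F y : cintegrable tau F -> convn N F y = ((cN tau N)^-1)%:C * trigsum N (hat F) y.
  by move=> Fi; rewrite /Submission.convn conv_hat// mulrC fmorphV.
rewrite (CR Gc (z + v) (cintegrable_Gc htau hG)) (CR Gc z (cintegrable_Gc htau hG)) (CR Zf _ (cintegrable_Zf htau)).
rewrite mulrCA !cReMr -mulrBr; congr (_ * _).
rewrite trigsum_hatZ -/(g' xi) -E /g mul1r mul0r addr0.
by [].
Qed.

Lemma convn_G_cvg z (e : R) : ~ Lam z -> 0 < e -> exists N0, forall N, (N0 <= N)%N ->
  `|complex.Re (convn N Gc z) - G z| <= e.
Proof.
move=> zl e0.
have zc : ~ Lam (to_complex (of_complex z)) by case: z zl.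
have e3 : 0 < e / 3 by rewrite divr_gt0.
have [d d0 hd] := plane_continuousV (green_continuous hG zc) e3.
have [C C0 hC] := convn_approx htau (cintegrable_Gc htau hG) (Gc_periodic hG) d0.
pose K := C * (1 + normc (Gc z)).
have K0 : 0 <= K by rewrite mulr_ge0// addr_ge0// normc_ge0.
exists (Num.bound (K / (e / 3))) => N hN.
have -> : complex.Re (convn N Gc z) - G z = complex.Re (convn N Gc z - Gc z) by rewrite cReD cReN.
have hd' v : normc v < d -> normc (Gc (z + v) - Gc z) <= e / 3.
  move=> vd; have -> : Gc (z + v) - Gc z = (G (z + v) - G z)%:C by rewrite rmorphB.
  by rewrite normcR ltW// hd.
rewrite (le_trans (ler_normRe _))// (le_trans (hC z (e / 3) (ltW e3) hd' N))//.
have : K / N.+1%:R <= e / 3.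
  rewrite ler_pdivrMr ?ltr0n// mulrC -ler_pdivrMr//.
  rewrite (le_trans (ltW (archi_boundP _)))//; first by rewrite divr_ge0// ltW.
  by rewrite ler_nat (leq_trans hN).
rewrite -[C * _]/K; move: (K / _) => x; lra.
Qed.

(** Uniformity in u matters: the intermediate point of [convn_grad] depends on N. *)
Lemma convn_Z_cvg r z (e : R) : 0 < r -> away Lam r z -> 0 < e ->
  exists N0, forall N, (N0 <= N)%N -> forall u, normc u <= r / 2 ->
  normc (convn N Zf (z + u) - Zf (z + u)) <= e.
Proof.
move=> r0 za e0; have r2 : 0 < r / 2 by rewrite divr_gt0.
have [M [M0 hM]] := Zf_lip htau (normc z + r) r2.
have [M' [M0' hM']] := Zf_lip htau (normc z) r0.
have nz := normc_ge0 z.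
have e3 : 0 < e / 3 by rewrite divr_gt0.
have M1 : 0 < M + 1 by rewrite ltr_wpDl.
pose d := Num.min (r / 2 / 2) (e / 3 / (M + 1)).
have d0 : 0 < d by rewrite lt_min !divr_gt0.
have [C C0 hC] := convn_approx htau (cintegrable_Zf htau) (fun w u => @Zf_periodic _ _ htau w u) d0.
pose K := C * (1 + (normc (Zf z) + M' * (r / 2))).
have K0 : 0 <= K by rewrite mulr_ge0// !addr_ge0// ?normc_ge0// mulr_ge0// ltW.
exists (Num.bound (K / (e / 3))) => N hN u ur.
have zu : normc (z + u) <= normc z + r.
  by rewrite (le_trans (le_normcD _ _))// lerD2l (le_trans ur)// ler_pdivrMr// ler_peMr ?(ltW r0)// ler1n.
have lipu v : normc v < d -> normc (Zf (z + u + v) - Zf (z + u)) <= e / 3.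
  rewrite lt_min => /andP[v1 v2].
  rewrite (le_trans (hM _ zu (away_add za ur) _ (ltW v1)))//.
  rewrite ltr_pdivlMr// in v2; have := normc_ge0 v; nra.
rewrite (le_trans (hC (z + u) (e / 3) (ltW e3) lipu N))//.
have : K / N.+1%:R <= e / 3.
  rewrite ler_pdivrMr ?ltr0n// mulrC -ler_pdivrMr//.
  rewrite (le_trans (ltW (archi_boundP _)))//; first by rewrite divr_ge0// ltW.
  by rewrite ler_nat (leq_trans hN).
have : C * (1 + normc (Zf (z + u))) / N.+1%:R <= K / N.+1%:R.
  rewrite ler_wpM2r ?invr_ge0// ler_wpM2l// lerD2l.
  rewrite -[Zf (z + u)](subrK (Zf z)) addrC (le_trans (le_normcD _ _))// lerD2l.
  by rewrite (le_trans (hM' _ (lexx _) za _ ur))// ler_wpM2l.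
move: (K / _) (_ / N.+1%:R) => x y; lra.
Qed.

(** Let N grow in [convn_grad]. Replacing Z at the intermediate point by Z at z costs a Lipschitz
    term, which the factor v makes quadratic. This is where G acquires pointwise derivatives. *)
Lemma green_taylor r B : 0 < r -> exists M, 0 <= M /\ forall z,
  normc z <= B -> away Lam r z -> forall v, normc v <= r / 2 ->
    `|G (z + v) - G z - complex.Re (- (v / (2 * pi)%:C) * Zf z)| <= M * normc v ^+ 2.
Proof.
move=> r0; have [M [M0 hM]] := Zf_lip htau B r0.
exists M; split=> // z zB za v vr.
have r2 : 0 < r / 2 by rewrite divr_gt0.
have zl := away_notin r0 za; have zvl := away_notin r2 (away_add za vr).
apply/ler_addgt0Pr => e e0.
have nv := normc_ge0 v.
have nv1 : 0 < 2 + normc v by rewrite ltr_wpDr.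
pose e1 := e / (2 + normc v).
have e10 : 0 < e1 by rewrite divr_gt0.
have [N1 h1] := convn_G_cvg zl e10.
have [N2 h2] := convn_G_cvg zvl e10.
have [N3 h3] := convn_Z_cvg r0 za e10.
pose N := maxn N1 (maxn N2 N3).
have {}h1 := h1 N (leq_maxl _ _).
have {}h2 := h2 N (leq_trans (leq_maxl _ _) (leq_maxr _ _)).
have {}h3 := h3 N (leq_trans (leq_maxr _ _) (leq_maxr _ _)).
have [xi /andP[xi0 xi1] E] := convn_grad N z v.
have xv : normc (xi%:C * v) <= normc v by rewrite normcM normcR ger0_norm// ler_piMl.
have {}h3 := h3 _ (le_trans xv vr).
set q := v / (2 * pi)%:C.
have nq : normc (- q) <= normc v.
  rewrite normcN /q normcM normcV normcR ger0_norm ?mulr_ge0 ?pi_ge0//.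
  rewrite ler_piMr// invf_le1 ?mulr_gt0 ?pi_gt0//.
  by have := pi_ge2 R; lra.
have lz := hM z zB za _ (le_trans xv vr).
have R1 : `|complex.Re (- q * convn N Zf (z + xi%:C * v)) - complex.Re (- q * Zf z)| <=
    normc v * (e1 + M * normc v).
  rewrite -cReN -cReD -mulrBr (le_trans (ler_normRe _))// normcM ler_pM ?normc_ge0//.
  rewrite -(subrK (Zf (z + xi%:C * v)) (convn _ _ _)) -addrA (le_trans (le_normcD _ _))// lerD//.
  by rewrite (le_trans lz)// ler_wpM2l.
move: R1 h1 h2; rewrite -E !ler_norml => /andP[a1 a2] /andP[b1 b2] /andP[c1 c2].
have ee : e = e1 * 2 + e1 * normc v by rewrite -mulrDr /e1 divfK// lt0r_neq0.
by rewrite ee expr2; apply/andP; split; nra.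
Qed.

End GreenTaylor.

(** * The Hessian of G_p at a half-period *)

Section Hessian.
Variables (R : realType) (tau : R[i]) (G : R[i] -> R) (p : R[i]).
Hypothesis htau : 0 < complex.Im tau.
Hypothesis hG : is_green tau G.
Hypothesis hp : ~ two_torsion tau p.
Local Notation h := (complex.Im tau).
Local Notation Lam := (lattice tau).
Local Notation Zf := (Zf tau).
Local Notation F := (green_pair G p).
Implicit Types (z w v : R[i]).

Lemma of_complexK z : to_complex (of_complex z) = z.
Proof. by case: z. Qed.

Lemma det2 (A : 'M[R]_2) : \det A = A 0 0 * A 1 1 - A 0 1 * A 1 0.
Proof.
have l01 : lift ord0 ord0 = 1 :> 'I_2 by exact: val_inj.
have o0 : ord0 = 0 :> 'I_2 by exact: val_inj.
have l10 : lift 1 ord0 = 0 :> 'I_2 by exact: val_inj.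
rewrite (expand_det_row _ ord0) big_ord_recl big_ord1 /cofactor !det_mx11 !mxE.
rewrite !l01 !l10 /= !o0; ring.
Qed.

Lemma normc_sqr z : normc z ^+ 2 = complex.Re z ^+ 2 + complex.Im z ^+ 2.
Proof. by rewrite normcE sqr_sqrtr// addr_ge0// sqr_ge0. Qed.

Lemma plane_diffC (f : R[i] -> R) z (d : R[i]) (M e : R) : 0 < e ->
  (forall v, normc v < e ->
    `|f (z + v) - f z - complex.Re (d * v)| <= M * normc v ^+ 2) ->
  [/\ differentiable (on_plane f) (of_complex z),
   partial 0 (on_plane f) (of_complex z) = complex.Re d &
   partial 1 (on_plane f) (of_complex z) = - complex.Im d].
Proof.
move=> e0 H; rewrite /partial/=.
apply: (@plane_diff _ _ _ _ _ M (e / 2)); first by rewrite divr_gt0.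
move=> [v1 v2] /= v1e v2e; pose v := v1 +i* v2.
have := H v; rewrite normc_sqr cReM mulNr.
have -> : on_plane f (of_complex z + (v1, v2)) = f (z + v).
  by rewrite /on_plane/=; congr f; apply: complex_eqP; rewrite ?cReD ?cImD.
have -> : on_plane f (of_complex z) = f z by rewrite /on_plane /comp of_complexK.
by apply; rewrite (le_lt_trans (normc_le_ReIm _))//= (splitr e) ltrD.
Qed.

(** F_x - i F_y for F = G_p; hence the sign in front of the imaginary part in [green_pair_diff]. *)
Definition grad z : R[i] := - ((Zf (z - p) + Zf (z + p)) / 2) / (2 * pi)%:C.

Lemma green_pair_diff z : ~ Lam (z - p) -> ~ Lam (z + p) ->
  [/\ differentiable (on_plane F) (of_complex z),
   partial 0 (on_plane F) (of_complex z) = complex.Re (grad z) &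
   partial 1 (on_plane F) (of_complex z) = - complex.Im (grad z)].
Proof.
move=> zm zp; have [r r0 [am ap]] := away_ex2 htau zm zp.
have [M [M0 hM]] := green_taylor htau hG (normc z + normc p) r0.
have bm : normc (z - p) <= normc z + normc p by exact: le_normcB.
have bp : normc (z + p) <= normc z + normc p by exact: le_normcD.
apply: (@plane_diffC F z (grad z) M (r / 2)); first by rewrite divr_gt0.
move=> v vr; have h1 := hM _ bm am v (ltW vr); have h2 := hM _ bp ap v (ltW vr).
have E : complex.Re (grad z * v) = (complex.Re (- (v / (2 * pi)%:C) * Zf (z - p)) +
    complex.Re (- (v / (2 * pi)%:C) * Zf (z + p))) / 2.
  rewrite -cReD -mulrDr [RHS]mulrC -cReMr; congr complex.Re; rewrite fmorphV rmorph_nat /grad; ring.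
rewrite E /green_pair (_ : z + v - p = z - p + v); last by ring.
rewrite (_ : z + v + p = z + p + v); last by ring.
move: h1 h2; rewrite !ler_norml => /andP[a1 a2] /andP[b1 b2].
by apply/andP; split; lra.
Qed.

Lemma Zf_taylor z : ~ Lam z -> exists r M : R, [/\ 0 < r, 0 <= M & forall v, normc v <= r ->
  ~ Lam (z + v) /\
  normc (Zf (z + v) - Zf z - ((- wp tau z - eta1 tau) * v + imlin tau v)) <= M * normc v ^+ 2].
Proof.
move=> zl; have [r r0 za] := away_ex htau zl.
have [M [M0 hM]] := hol_ge0 (normc z) (hol_psi htau) r0.
have r2 : 0 < r / 2 by rewrite divr_gt0.
exists (r / 2), M; split=> // v vr.
have zvl := away_notin r2 (away_add za vr); split=> //.
have [_ _ H] := hM z (lexx _) za; rewrite !Zf_off// imlinD.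
apply: le_trans (H v vr); rewrite le_eqVlt; apply/orP; left; apply/eqP; congr normc; ring.
Qed.

Section HalfPeriod.
Variable k : 'I_4.
Local Notation w := (half_period tau k).

Lemma half_pD : ~ Lam (p + w).
Proof.
move=> H; apply: hp; exists k.
by rewrite (_ : p - w = p + w - (w + w)); [exact: latticeB (lattice_double_half tau k)|ring].
Qed.

Lemma half_pB : ~ Lam (p - w).
Proof. by move=> H; apply: hp; exists k. Qed.

Lemma grad_half : grad w = 0.
Proof.
have E : Zf (w - p) = - Zf (w + p).
  rewrite -[w - p]opprB ZfN//; congr (- _).
  by rewrite -(Zf_periodic htau (p - w) (lattice_double_half tau k)); congr (Submission.Zf _ _); ring.
by rewrite /grad E addNr mul0r oppr0 mul0r.
Qed.

Lemma wp_half_reflect : wp tau (w - p) = wp tau (w + p).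
Proof.
rewrite -opprB wp_even//; last exact: half_pB.
rewrite -(wp_periodic htau (lattice_double_half tau k) half_pB); congr (wp tau _); ring.
Qed.

Local Notation W := (- wp tau (p + w) - eta1 tau).

(** The two summands of [grad] have the same linear part, since wp takes the same value at w - p and
    w + p. Here W is the derivative of psi at p + w. *)
Lemma grad_taylor : exists r M : R, [/\ 0 < r, 0 <= M & forall v, normc v <= r ->
  [/\ ~ Lam (w + v - p), ~ Lam (w + v + p) &
  normc (grad (w + v) + (W * v + imlin tau v) / (2 * pi)%:C) <= M * normc v ^+ 2]].
Proof.
have l1 : ~ Lam (w - p) by rewrite -opprB; apply: notlatticeN; exact: half_pB.
have l2 : ~ Lam (w + p) by rewrite addrC; exact: half_pD.
have [r [M [r0 M0 hM]]] := Zf_taylor l1; have [s [N [s0 N0 hN]]] := Zf_taylor l2.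
exists (Num.min r s), (M + N); split; rewrite ?lt_min ?r0 ?addr_ge0// => v.
rewrite le_min => /andP[vr vs]; have [m1 m2] := hM v vr; have [n1 n2] := hN v vs.
rewrite (_ : w + v - p = w - p + v); last by ring.
rewrite (_ : w + v + p = w + p + v); last by ring.
split=> //.
have p0 : 0 < 2 * pi :> R by rewrite mulr_gt0 ?pi_gt0.
rewrite /grad (_ : w + v - p = w - p + v); last by ring.
rewrite (_ : w + v + p = w + p + v); last by ring.
rewrite wp_half_reflect in m2; rewrite (addrC p w).
have g0 : Zf (w - p) + Zf (w + p) = 0.
  have /eqP := grad_half; rewrite /grad mulf_eq0 oppr_eq0 mulf_eq0 !invr_eq0 pnatr_eq0 orbF => /orP[/eqP//|].
  by rewrite eq_complex/= (gt_eqF p0).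
set X := Zf (w - p + v) - _ - _ in m2; set Y := Zf (w + p + v) - _ - _ in n2.
have -> : - ((Zf (w - p + v) + Zf (w + p + v)) / 2) / (2 * pi)%:C +
   ((- wp tau (w + p) - eta1 tau) * v + imlin tau v) / (2 * pi)%:C =
   - (X + Y + (Zf (w - p) + Zf (w + p))) / 2 / (2 * pi)%:C by rewrite /X /Y; move: ((2 * pi)%:C^-1) => c; field.
rewrite g0 addr0 -mulrA normcM normcN; set c := _^-1 / _.
have c1 : normc c <= 1.
  have -> : c = ((2 * (2 * pi))^-1)%:C by rewrite fmorphV rmorphM invfM rmorph_nat.
  rewrite normcR ger0_norm ?invr_ge0 ?mulr_ge0 ?pi_ge0// invf_le1 ?mulr_gt0 ?pi_gt0//.
  by have := pi_ge2 R; lra.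
apply: (le_trans (ler_wpM2l (normc_ge0 _) c1)); rewrite mulr1 mulrDl.
by rewrite (le_trans (le_normcD _ _))// lerD.
Qed.

Lemma hessian_half : let f := on_plane F in let u := of_complex w in
  [/\ partial 0 (partial 0 f) u = - (complex.Re W / (2 * pi)),
      partial 1 (partial 0 f) u = complex.Im W / (2 * pi),
      partial 0 (partial 1 f) u = complex.Im W / (2 * pi) &
      partial 1 (partial 1 f) u = (complex.Re W + 2 * pi / h) / (2 * pi)].
Proof.
move=> f u; have [r [M [r0 M0 hM]]] := grad_taylor.
have p0 : 2 * pi != 0 :> R by rewrite mulf_neq0 ?pnatr_eq0// gt_eqF ?pi_gt0.
have h0 := lt0r_neq0 htau.
have fE j : partial j f = on_plane (fun z => partial j f (of_complex z)).
  by apply/funext => -[x y].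
have near v : normc v <= r -> partial 0 f (of_complex (w + v)) = complex.Re (grad (w + v)) /\
    partial 1 f (of_complex (w + v)) = - complex.Im (grad (w + v)).
  by move=> /hM[n1 n2 _]; have [_ -> ->] := green_pair_diff n1 n2.
have near0 : partial 0 f (of_complex w) = 0 /\ partial 1 f (of_complex w) = 0.
  by have := near 0; rewrite normc0 addr0 grad_half oppr0; apply; exact: ltW.
have c2 z : z / (2 * pi)%:C = ((2 * pi)^-1)%:C * z by rewrite mulrC fmorphV.
have d0 v : normc v < r -> `|partial 0 f (of_complex (w + v)) - partial 0 f (of_complex w) -
    complex.Re ((- W / (2 * pi)%:C) * v)| <= M * normc v ^+ 2.
  move=> /ltW vr; have [-> _] := near v vr; have [-> _] := near0; have [_ _ H] := hM v vr.
  apply: le_trans H; apply: le_trans (ler_normRe _).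
  have -> : complex.Re (- W / (2 * pi)%:C * v) = - complex.Re ((W * v + imlin tau v) / (2 * pi)%:C).
    rewrite !c2 -mulrA !cReMr mulNr cReN cReD (_ : complex.Re (imlin _ _) = 0)//.
    by rewrite addr0 mulrN.
  by rewrite subr0 opprK cReD.
(* Multiplication by -i turns the real part into the imaginary part of W v + (2 pi/h) v, whose
   second term has the imaginary part of [imlin]. *)
have d1 v : normc v < r -> `|partial 1 f (of_complex (w + v)) - partial 1 f (of_complex w) -
    complex.Re ((- 'i * (W + (2 * pi / h)%:C) / (2 * pi)%:C) * v)| <= M * normc v ^+ 2.
  move=> /ltW vr; have [_ ->] := near v vr; have [_ ->] := near0; have [_ _ H] := hM v vr.
  apply: le_trans H; apply: le_trans (ler_normIm _).
  have -> : complex.Re (- 'i * (W + (2 * pi / h)%:C) / (2 * pi)%:C * v) =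
      complex.Im ((W * v + imlin tau v) / (2 * pi)%:C).
    rewrite !c2 -(mulrA ((2 * pi)^-1)%:C) cReMr cImMr; congr (_ * _); move: (- wp _ _ - _) => [a b]; case: v {vr} => v1 v2.
    by rewrite /=; field.
  by rewrite subr0 -opprD normrN cImD.
have [_ H00 H10] := @plane_diffC (fun z => partial 0 f (of_complex z)) w _ M r r0 d0.
have [_ H01 H11] := @plane_diffC (fun z => partial 1 f (of_complex z)) w _ M r r0 d1.
rewrite -!fE in H00 H10 H01 H11.
rewrite H00 H10 H01 H11 !c2 !cReMr !cImMr; move: W => [a b]; split.
- by rewrite cReN/=; ring.
- by rewrite cImN/=; ring.
- by rewrite ?cReM/=; ring.
- by rewrite ?cImM/=; ring.
Qed.

(** With W = a + ib, (2 pi)^2 times the determinant is -a (a + 2 pi/h) - b^2. Completing the square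
    gives (pi/h)^2 - |W + pi/h|^2. *)
Lemma hess_iff : degenerate_critical_point F w <->
  normc (wp tau (p + w) + eta1 tau - (pi / h)%:C) = pi / h.
Proof.
have p0 : 2 * pi != 0 :> R by rewrite mulf_neq0 ?pnatr_eq0// gt_eqF ?pi_gt0.
have l1 : ~ Lam (w - p) by rewrite -opprB; apply: notlatticeN; exact: half_pB.
have l2 : ~ Lam (w + p) by rewrite addrC; exact: half_pD.
have [f1 f2 f3] := green_pair_diff l1 l2.
rewrite grad_half oppr0 in f2 f3.
have [H00 H10 H01 H11] := hessian_half.
have p0' : pi != 0 :> R by rewrite gt_eqF ?pi_gt0.
have ph : 0 <= pi / h by rewrite divr_ge0 ?pi_ge0 ?ltW.
have crit : critical_point (on_plane F) (of_complex w).
  split=> [|i]; first exact: f1.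
  have : i = 0 \/ i = 1.
    by case: i => -[|[|//]] hi; [left|right]; apply: val_inj.
  by case=> ->; rewrite ?f2 ?f3 ?oppr0.
have detE : \det (hessian (on_plane F) (of_complex w)) * (2 * pi) ^+ 2 =
    (pi / h) ^+ 2 - normc (wp tau (p + w) + eta1 tau - (pi / h)%:C) ^+ 2.
  rewrite det2 !mxE H00 H10 H01 H11 normc_sqr; move: (wp _ _) (eta1 _) => [a b] [c d] /=.
  move: p0'; move: (pi : R) => q q0; field; rewrite q0 andbT; exact: lt0r_neq0.
split=> [[_ d0]|E].
  move: detE; rewrite d0 mul0r => /esym/eqP; rewrite subr_eq0 => /eqP E.
  by apply/eqP; rewrite -(eqrXn2 (n := 2)) ?normc_ge0// -E.
split=> //; move/eqP: detE; rewrite E subrr mulf_eq0 expf_eq0/= (negbTE p0) orbF => /eqP.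
exact.
Qed.

End HalfPeriod.
End Hessian.

(** * A Liouville theorem for continuous doubly periodic functions *)

Section Liouville.
Variables (R : realType) (tau : R[i]).
Hypothesis htau : 0 < complex.Im tau.
Local Notation h := (complex.Im tau).
Local Notation Lam := (lattice tau).
Local Notation convn := (convn tau).
Local Notation hat := (hat tau).
Implicit Types (z w u v : R[i]) (m n : int) (f d : R[i] -> R[i]).

(** It contains the lattice and its translates by half-periods, hence the poles of both wp(z) and
    wp(z + omega_k/2). *)
Definition half_lattice : set R[i] := [set w | Lam (w + w)].

Definition ccontinuous f := forall z (e : R), 0 < e ->
  exists2 s : R, 0 < s & forall v, normc v < s -> normc (f (z + v) - f z) < e.

Lemma convn_cvg f z (e : R) : cintegrable tau f ->
  (forall w u, Lam w -> f (u + w) = f u) -> ccontinuous f -> 0 < e ->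
  exists N0, forall N, (N0 <= N)%N -> normc (convn N f z - f z) <= e.
Proof.
move=> fi fp fc e0; have e3 : 0 < e / 3 by rewrite divr_gt0.
have [s s0 hs] := fc z _ e3.
have [C C0 hC] := convn_approx htau fi fp s0.
pose K := C * (1 + normc (f z)).
have K0 : 0 <= K by rewrite mulr_ge0// addr_ge0// normc_ge0.
exists (Num.bound (K / (e / 3))) => N hN.
rewrite (le_trans (hC z (e / 3) (ltW e3) (fun v vs => ltW (hs v vs)) N))//.
have : K / N.+1%:R <= e / 3.
  rewrite ler_pdivrMr ?ltr0n// mulrC -ler_pdivrMr//.
  rewrite (le_trans (ltW (archi_boundP _)))//; first by rewrite divr_ge0// ltW.
  by rewrite ler_nat (leq_trans hN).
rewrite -[C * _]/K; move: (K / _) => x; lra.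
Qed.

Lemma ccontinuousM f g : ccontinuous f -> ccontinuous g -> ccontinuous (fun z => f z * g z).
Proof.
move=> fc gc z e e0.
pose A := 1 + normc (f z) + normc (g z).
have nf := normc_ge0 (f z); have ng := normc_ge0 (g z).
have A0 : 0 < A by rewrite /A; lra.
pose e1 := Num.min 1 (e / (2 * A)).
have e10 : 0 < e1 by rewrite lt_min ltr01 divr_gt0// mulr_gt0.
have [s s0 hs] := fc z e1 e10; have [t t0 ht] := gc z e1 e10.
exists (Num.min s t); first by rewrite lt_min s0.
move=> v; rewrite lt_min => /andP[/hs h1 /ht h2].
have -> : f (z + v) * g (z + v) - f z * g z = (f (z + v) - f z) * (g (z + v) - g z) +
  (f (z + v) - f z) * g z + f z * (g (z + v) - g z) by ring.
move: h1 h2; set a := f _ - _; set b := g _ - _; rewrite !lt_min !ltr_pdivlMr ?mulr_gt0//.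
move=> /andP[a1 a2] /andP[b1 b2].
have := le_normcD (a * b + a * g z) (f z * b); have := le_normcD (a * b) (a * g z).
rewrite !normcM; have := normc_ge0 a; have := normc_ge0 b; rewrite /A in a2 b2; nra.
Qed.

Lemma ccontinuous_hol f d : hol set0 f d -> ccontinuous f.
Proof.
move=> hf z e e0; have [M [M0 hM]] := hol_lip (normc z) hf ltr01.
have M1 : 0 < M + 1 by rewrite ltr_wpDl.
exists (Num.min (1 / 2) (e / (M + 1))); first by rewrite lt_min !divr_gt0.
move=> v; rewrite lt_min => /andP[v1]; rewrite ltr_pdivlMr// => v2.
rewrite (le_lt_trans (hM z (lexx _) _ v (ltW v1)))//.
by have := normc_ge0 v; nra.
Qed.

Lemma ccontinuous_row f : ccontinuous f -> forall y, ccont (fun x => f (x +i* y)).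
Proof.
move=> fc y; apply: ccont_eps => x e /(fc (x +i* y))[s s0 hs]; exists s => // t ts.
by rewrite shiftx; apply: hs; rewrite normcR.
Qed.

Lemma rows_uniform f (y0 e : R) : ccontinuous f -> 0 < e ->
  exists2 s : R, 0 < s & forall y, `|y - y0| < s -> forall x, -1/2 <= x <= 1/2 ->
    normc (f (x +i* y) - f (x +i* y0)) <= e.
Proof.
move=> fc e0; have e2 : 0 < e / 2 by rewrite divr_gt0.
have K := @segment_compact R (-1/2) (1/2).
pose P (y x : R) := normc (f (x +i* y) - f (x +i* y0)) <= e.
have := (compact_near_coveringP _).1 K R (nbhs y0) P _.
case=> [x _|s /= s0 hs].
  have [s s0 hs] := fc (x +i* y0) _ e2.
  have s2 : 0 < s / 2 by rewrite divr_gt0.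
  exists (ball x (s / 2), ball y0 (s / 2)).
    by split; apply: nbhsx_ballx.
  move=> [x' y] /= [bx by']; rewrite /ball/= distrC in bx; rewrite /ball/= distrC in by'.
  have c1 : normc ((x' - x) +i* (y - y0)) < s.
    by rewrite (le_lt_trans (normc_le_ReIm _))//= (splitr s) ltrD.
  have c2 : normc ((x' - x) +i* 0) < s.
    by rewrite (le_lt_trans (normc_le_ReIm _))//= normr0 addr0 (lt_le_trans bx)//; lra.
  have := hs _ c1; have := hs _ c2.
  rewrite (_ : x +i* y0 + _ = x' +i* y0); last first.
    by apply: complex_eqP; rewrite ?cReD ?cImD/=; ring.
  rewrite (_ : x +i* y0 + _ = x' +i* y); last first.
    by apply: complex_eqP; rewrite ?cReD ?cImD/=; ring.
  set a := f (x' +i* y0); set b := f (x' +i* y) => h1 h2; rewrite /P -/a -/b.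
  have -> : b - a = (b - f (x +i* y0)) - (a - f (x +i* y0)) by ring.
  by rewrite (le_trans (le_normcB _ _))// ltW// (splitr e) ltrD.
exists s => // y yb x xI; apply: (hs y); first by rewrite /ball/= distrC.
by rewrite /= in_itv.
Qed.

Lemma rowcoef_continuous f m (y0 e : R) : ccontinuous f -> 0 < e ->
  exists2 s : R, 0 < s & forall y, `|y - y0| < s ->
    normc (rowcoef f m y - rowcoef f m y0) <= e.
Proof.
move=> fc e0; have e2 : 0 < e / 2 by rewrite divr_gt0.
have gc := ccontinuousM fc (ccontinuous_hol (hol_cexp set0 (cm R m))).
have [s s0 hs] := rows_uniform y0 gc e2; exists s => // y ys.
have hh := @halves R.
rewrite /rowcoef -CintB; [|exact: (ccontinuous_row gc)|exact: (ccontinuous_row gc)].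
apply: le_trans (normc_Cint_le (M := e / 2) (ltW hh) _ (hs y ys)) _.
  by apply: ccontB; exact: (ccontinuous_row gc).
by lra.
Qed.

Lemma ccontinuous_bounded f (B : R) : ccontinuous f -> exists M, forall z, normc z <= B -> normc (f z) <= M.
Proof.
move=> fc; have K := compact_setX (@segment_compact R (- B) B) (@segment_compact R (- B) B).
pose P (M : R) (u : R * R) := normc (f (to_complex u)) <= M.
have := (compact_near_coveringP _).1 K R +oo P _.
case=> [u _|M [_ hM]].
  have [s s0 hs] := fc (to_complex u) _ ltr01.
  have s2 : 0 < s / 2 by rewrite divr_gt0.
  exists (ball u (s / 2), [set M | normc (f (to_complex u)) + 1 < M]).
    split; first exact: nbhsx_ballx.
    by exists (normc (f (to_complex u)) + 1); split=> //; exact: num_real.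
  move=> [u' M] /= [[b1 b2] hM]; rewrite /ball/= distrC in b1; rewrite /ball/= distrC in b2.
  rewrite /P (le_trans _ (ltW hM))//.
  have := hs ((u'.1 - u.1) +i* (u'.2 - u.2)).
  rewrite (_ : to_complex u + _ = to_complex u'); last first.
    by apply: complex_eqP; rewrite ?cReD ?cImD/=; ring.
  rewrite -[X in normc X <= _](subrK (f (to_complex u))) => H.
  rewrite (le_trans (le_normcD _ _))// addrC lerD2l ltW// H//.
  by rewrite (le_lt_trans (normc_le_ReIm _))//= (splitr s) ltrD.
exists (M + 1) => z zB; have := hM (M + 1); rewrite ltrDl ltr01 => /(_ isT (of_complex z)).
rewrite /P of_complexK; apply; split; rewrite /= in_itv/= -ler_norml.
  exact: le_trans (ler_normRe z) zB.
exact: le_trans (ler_normIm z) zB.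
Qed.

Lemma ccontinuous_integrable f : ccontinuous f -> cintegrable tau f.
Proof.
move=> fc; have [M hM] := ccontinuous_bounded (1 + normc tau) fc.
split; apply: tintegrable_bounded => //.
- apply: pmeasurable_continuous => // z e /(fc z)[s s0 hs]; exists s => // v /hs; apply: le_lt_trans.
  by rewrite -cReN -cReD ler_normRe.
- by exists M => z /hM; apply: le_trans; exact: ler_normRe.
- apply: pmeasurable_continuous => // z e /(fc z)[s s0 hs]; exists s => // v /hs; apply: le_lt_trans.
  by rewrite -cImN -cImD ler_normIm.
- by exists M => z /hM; apply: le_trans; exact: ler_normIm.
Qed.

Section Constant.
Variables f d : R[i] -> R[i].
Hypotheses (fc : ccontinuous f) (fp : forall w u, Lam w -> f (u + w) = f u)
  (fh : hol half_lattice f d).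

(** The points of [half_lattice] lie on the rows whose height is a multiple of h/2. *)
Lemma half_line_away y : 0 < y < h / 2 \/ h / 2 < y < h -> line_away half_lattice y.
Proof.
move=> yI; have [y2 y20 H] : exists2 y2 : R, 0 < y2 & forall n : int, y2 <= `|2 * y - n%:~R * h|.
  have [k kI] : exists k : int, 0 < 2 * y - k%:~R * h /\ 0 < (k + 1)%:~R * h - 2 * y.
    by case: yI => /andP[a b]; [exists 0|exists 1]; rewrite rmorphD ?mulr0z ?mulr1z; split; lra.
  exists (Num.min (2 * y - k%:~R * h) ((k + 1)%:~R * h - 2 * y)); first by rewrite lt_min kI.1 kI.2.
  move=> n; rewrite ge_min; have [nk|nk] := leP n k.
    apply/orP; left; rewrite (le_trans _ (ler_norm _))// lerD2l lerN2 ler_wpM2r ?(ltW htau)//.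
    by rewrite ler_int.
  apply/orP; right; rewrite distrC (le_trans _ (ler_norm _))// lerD2r ler_wpM2r ?(ltW htau)//.
  by rewrite ler_int; lia.
exists (y2 / 2); first by rewrite divr_gt0.
move=> x w [m [n E]]; have := H n.
have -> : n%:~R * h = 2 * complex.Im w by rewrite -(Im_lp tau m n) -E cImD; ring.
rewrite -mulrBr normrM ger0_norm// => H2.
by rewrite ler_pdivrMr// mulrC (le_trans H2)// ler_wpM2l// -[y]/(complex.Im (x +i* y)) -cImN -cImD ler_normIm.
Qed.

(** The coefficients are constant on the two open strips between exceptional rows; continuity of f
    glues the values across the heights 0, h/2 and h. *)
Lemma rowcoef_all m y : 0 <= y <= h -> rowcoef f m y = rowcoef f m 0.
Proof.
have h2 : 0 < h / 2 by rewrite divr_gt0.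
have per x y' : f ((x + 1) +i* y') = f (x +i* y').
  by rewrite shiftx fp//; exact: lattice_1.
pose A := rowcoef f m (h / 4); pose B := rowcoef f m (3 * h / 4).
have AE y' : 0 < y' < h / 2 -> rowcoef f m y' = A.
  move=> yI; apply: (rowcoef_const m fh (y1 := 0) (y2 := h / 2)) => //; last by apply/andP; split; lra.
  by move=> y'' y''I; apply: half_line_away; left.
have BE y' : h / 2 < y' < h -> rowcoef f m y' = B.
  move=> yI; apply: (rowcoef_const m fh (y1 := h / 2) (y2 := h)) => //; last by apply/andP; split; lra.
  by move=> y'' y''I; apply: half_line_away; right.
have lim y0 (C : R[i]) : (forall s : R, 0 < s -> exists2 y', `|y' - y0| < s & rowcoef f m y' = C) ->
    rowcoef f m y0 = C.
  move=> H; apply/eqP; rewrite -subr_eq0 -normc_eq0 eq_le normc_ge0 andbT.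
  apply/ler_addgt0Pr => e e0; rewrite add0r.
  have [s s0 hs] := rowcoef_continuous m y0 fc e0.
  by have [y' ys <-] := H s s0; rewrite normc_distC hs.
have small (s : R) : 0 < s -> exists2 t : R, 0 < t < h / 2 & t < s.
  move=> s0; exists (Num.min s (h / 2) / 2).
    by rewrite divr_gt0 ?lt_min ?s0//= ltr_pdivrMr// gt_min; apply/orP; right; lra.
  by rewrite ltr_pdivrMr// gt_min; apply/orP; left; lra.
have L0 : rowcoef f m 0 = A.
  apply: lim => s /small[t /andP[t0 t1] ts]; exists t; last by rewrite AE// t0.
  by rewrite subr0 gtr0_norm.
have Lm : rowcoef f m (h / 2) = A.
  apply: lim => s /small[t /andP[t0 t1] ts]; exists (h / 2 - t); last by rewrite AE//; apply/andP; split; lra.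
  by rewrite ltr0_norm; lra.
have Lm' : rowcoef f m (h / 2) = B.
  apply: lim => s /small[t /andP[t0 t1] ts]; exists (h / 2 + t); last by rewrite BE//; apply/andP; split; lra.
  by rewrite gtr0_norm; lra.
have Lh : rowcoef f m h = B.
  apply: lim => s /small[t /andP[t0 t1] ts]; exists (h - t); last by rewrite BE//; apply/andP; split; lra.
  by rewrite ltr0_norm; lra.
move=> /andP[y0 yh]; rewrite L0.
have [->|yn0] := eqVneq y 0; first by [].
have [->|ynh] := eqVneq y h; first by rewrite Lh -Lm'.
have [y1|y1|->] := ltgtP y (h / 2); last by [].
  by rewrite AE// y1 lt_neqAle eq_sym yn0 y0.
by rewrite BE -?Lm'// y1 lt_neqAle ynh yh.
Qed.

(** Periodicity along tau multiplies the coefficient by [em m tau], of modulus exp(2 pi m h), which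
    is 1 only for m = 0. *)
Lemma rowcoef_liouville m y : 0 <= y <= h -> rowcoef f m y = rowcoef f 0 0 * (m == 0)%:R.
Proof.
move=> yI; rewrite rowcoef_all//; have [->|m0] := eqVneq m 0; first by rewrite mulr1.
rewrite mulr0; have cf := ccontinuous_row fc.
have per x y' : f ((x + 1) +i* y') = f (x +i* y').
  by rewrite shiftx fp//; exact: lattice_1.
have ft x : f (x +i* 0 + tau) = f (x +i* 0) + 0 by rewrite addr0 fp//; exact: lattice_tau.
have := rowcoef_tau (kap := 0) (y := 0) m (cf 0) (cf (0 + h)) (fun x => per x (0 + h)) ft.
rewrite add0r mul0r addr0 rowcoef_all ?lexx ?(ltW htau)// => /eqP.
rewrite -subr_eq0 -{1}(mul1r (rowcoef f m 0)) -mulrBl mulf_eq0 => /orP[|/eqP//].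
rewrite subr_eq0 => /eqP /(congr1 (@normc R)); rewrite normc1 /em normc_cexp => /eqP.
rewrite eq_sym -expR0 (inj_eq (@expR_inj R)) cReM/= => /eqP E.
have : 2 * pi * m%:~R * h = 0 by move: E; lra.
move/eqP; rewrite !mulf_eq0 pnatr_eq0/= (gt_eqF (pi_gt0 R)) intr_eq0 (negbTE m0).
by rewrite (gt_eqF htau).
Qed.

(** The function and the constant [rowcoef f 0 0] have the same coefficients, hence the same
    smoothings, and these converge to both. *)
Lemma liouville z : f z = f 0.
Proof.
suff H y : f y = rowcoef f 0 0 by rewrite !H.
set a := rowcoef f 0 0; have fi := ccontinuous_integrable fc.
have ac : ccontinuous (fun=> a).
  by move=> x e e0; exists 1 => // v _; rewrite subrr normc0.
have hE m n : hat f m n = hat (fun=> a) m n.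
  rewrite (@hat_rows _ _ htau f (fun=> a * (m == 0)%:R) m n)//; last 4 first.
  - by move=> y' _; exact: ccontinuous_row.
  - by move=> x y' _; rewrite shiftx fp//; exact: lattice_1.
  - by move=> y' /andP[y0 yh]; rewrite rowcoef_liouville// !ltW.
  - exact: ccont_cst.
  rewrite (@hat_rows _ _ htau (fun=> a) (fun=> a * (m == 0)%:R) m n)//.
  - exact: cintegrable_cst.
  - by move=> y' _; exact: ccont_cst.
  - by move=> y' _; exact: rowcoef_cst.
  - exact: ccont_cst.
have cE N : convn N f y = convn N (fun=> a) y.
  rewrite /Submission.convn !conv_hat//; last exact: cintegrable_cst.
  congr (_ / _); apply: eq_bigr => i _; apply: eq_bigr => j _; by rewrite hE.
apply/eqP; rewrite -subr_eq0 -normc_eq0 eq_le normc_ge0 andbT.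
apply/ler_addgt0Pr => e e0; rewrite add0r; have e2 : 0 < e / 2 by rewrite divr_gt0.
have [N1 h1] := convn_cvg y fi fp fc e2.
have [N2 h2] := convn_cvg y (cintegrable_cst htau a) (fun _ _ _ => erefl a) ac e2.
have {}h1 := h1 _ (leq_maxl N1 N2); have {}h2 := h2 _ (leq_maxr N1 N2).
rewrite cE in h1; set c := convn _ _ y in h1 h2.
have -> : f y - a = (c - a) - (c - f y) by ring.
by rewrite (le_trans (le_normcB _ _))// (splitr e) lerD.
Qed.

End Constant.
End Liouville.

(** * The differential equation of wp and its shift by a half-period *)

Section EllipticIdentities.
Variables (R : realType) (tau : R[i]).
Hypothesis htau : 0 < complex.Im tau.
Local Notation h := (complex.Im tau).
Local Notation Lam := (lattice tau).
Local Notation wp := (wp tau).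
Local Notation eis := (eis tau).
Local Notation q := (wp_reg tau).
Implicit Types (z w u v : R[i]) (m n : int) (f d : R[i] -> R[i]).

(** The form in which the Liouville theorem is applied: at a removable singularity the function has
    been given a value, and a Lipschitz estimate there stands for continuity. *)
Lemma elliptic_const (S : set R[i]) f d : S `<=` half_lattice tau -> hol S f d ->
  (forall w u, Lam w -> f (u + w) = f u) ->
  (forall z, ~ S z -> exists2 r : R, 0 < r & away S r z) ->
  (forall z, S z -> exists K r : R, [/\ 0 <= K, 0 < r &
     forall v, normc v < r -> normc (f (z + v) - f z) <= K * normc v]) ->
  forall z, f z = f 0.
Proof.
move=> SS hf fp Sa Sl; apply: (@liouville _ _ htau f d) => //; last exact: hol_incl hf.
suff H z : exists K r : R, [/\ 0 <= K, 0 < r &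
     forall v, normc v < r -> normc (f (z + v) - f z) <= K * normc v].
  move=> z e e0; have [K [r [K0 r0 hK]]] := H z.
  have K1 : 0 < K + 1 by rewrite ltr_wpDl.
  exists (Num.min r (e / (K + 1))); first by rewrite lt_min r0 divr_gt0.
  move=> v; rewrite lt_min ltr_pdivlMr// => /andP[v1 v2].
  by rewrite (le_lt_trans (hK v v1))//; have := normc_ge0 v; nra.
have [/Sl//|zS] := pselect (S z).
have [r r0 za] := Sa z zS; have [M [M0 hM]] := hol_lip (normc z) hf r0.
exists M, (r / 2); split=> //; first by rewrite divr_gt0.
by move=> v /ltW vr; exact: hM.
Qed.

Lemma small_notin v : v != 0 -> normc v < (lpK tau)^-1 -> ~ Lam v.
Proof.
move=> v0 vr [m [n vE]]; have vl0 : lattice0 tau v by exists m, n.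
by have := away_lattice0_0 htau vl0; rewrite sub0r normcN leNgt vr.
Qed.

(** The expansion wp = v^-2 + (g2/20) v^2 + O(v^3) at the pole, with the weaker bounds that
    accompany it when principal parts are cancelled. *)
Lemma q_taylor : exists r M : R, [/\ 0 < r, r <= 1, 0 <= M & forall v, normc v <= r ->
  [/\ v != 0 -> ~ Lam v, normc (q v - 3 * v ^+ 2 * (g2 tau / 60)) <= M * normc v ^+ 3,
   normc (q v) <= M * normc v &
   normc (eis_reg tau 4 v - g2 tau / 60) <= M * normc v]].
Proof.
have l0 := lpKV_gt0 htau; have a0 := away_lattice0_0 htau.
have n0 : normc (0 : R[i]) <= 0 by rewrite normc0.
have [M1 h1] := wp_reg_taylor htau 0 l0.
have [M2 [M20 h2]] := hol_lip 0 (hol_wp_reg htau) l0.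
have [M3 [M30 h3]] := hol_lip 0 (hol_eis4_reg htau) l0.
have x2 : (lpK tau)^-1 / 2 < (lpK tau)^-1 by rewrite ltr_pdivrMr// ltr_pMr// ltr1n.
exists (Num.min 1 ((lpK tau)^-1 / 2)), (`|M1| + M2 + M3); split.
- by rewrite lt_min ltr01 divr_gt0.
- by rewrite ge_min lexx.
- by rewrite !addr_ge0.
move=> v; rewrite le_min => /andP[v1 v2]; have nv := normc_ge0 v.
have H1 := h1 0 v n0 a0 v2; have H2 := h2 0 n0 a0 v v2; have H3 := h3 0 n0 a0 v v2.
rewrite add0r wp_reg_0// eis_reg3_0// eis_reg4_0// mulr0 addr0 subr0 in H1.
rewrite add0r wp_reg_0// subr0 in H2; rewrite add0r eis_reg4_0// in H3.
have M1' := ler_norm M1; have M1'' := normr_ge0 M1.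
split.
- by move=> v0; apply: small_notin => //; exact: le_lt_trans x2.
- apply: (le_trans H1); rewrite ler_wpM2r ?exprn_ge0//; lra.
- apply: (le_trans H2); rewrite ler_wpM2r//; lra.
- apply: (le_trans H3); rewrite ler_wpM2r//; lra.
Qed.

(** This is wp'' = 6 wp^2 - g2/2. The principal parts cancel in wp'' - 6 wp^2, which tends to -g2/2
    at the lattice and is therefore this constant. *)
Lemma eis4_wp z : ~ Lam z -> eis 4 z = wp z ^+ 2 - g2 tau / 12.
Proof.
pose f z := if `[< Lam z >] then - (g2 tau / 2) else 6 * eis 4 z - 6 * wp z ^+ 2.
have fon y : Lam y -> f y = - (g2 tau / 2) by rewrite /f; case: asboolP.
have foff y : ~ Lam y -> f y = 6 * eis 4 y - 6 * wp y ^+ 2 by rewrite /f; case: asboolP.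
have fp w u : Lam w -> f (u + w) = f u.
  move=> wl; have [ul|ul] := pselect (Lam u); first by rewrite !fon//; exact: latticeD.
  by rewrite !foff ?eis4_periodic ?wp_periodic//; exact: notlatticeD.
have [d hf] : exists d, hol Lam f d.
  eexists; apply: hol_ext (holB (holZ 6 (hol_eis4 htau)) (holZ 6 (holX 2 (hol_wp htau)))) => //.
  by move=> r y r0 /(away_notin r0) yl; rewrite foff.
move=> zl; have E : 6 * eis 4 z - 6 * wp z ^+ 2 = - (g2 tau / 2).
  rewrite -foff// -(fon 0); last exact: lattice_0.
  apply: (elliptic_const _ hf fp) => [y yl|y|]; [exact: latticeD|exact: away_ex|].
  move=> y yl; have [r [M [r0 r1 M0 hM]]] := q_taylor.
  exists (18 * M + 6 * M ^+ 2), r; split=> //.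
    by rewrite addr_ge0// mulr_ge0// exprn_ge0.
  move=> v /ltW vr; rewrite (addrC y v) fp// (fon y)//.
  have [->|v0] := eqVneq v 0; first by rewrite fon ?subrr ?normc0 ?mulr0//; exact: lattice_0.
  have [vl H1 H2 H3] := hM v vr; rewrite (foff v (vl v0)) wpE /Submission.eis.
  set E1 := q v - _ in H1; set E2 := eis_reg _ _ _ - _ in H3.
  have -> : 6 * (v ^- 4 + eis_reg tau 4 v) - 6 * (v ^- 2 + q v) ^+ 2 - - (g2 tau / 2) =
     6 * E2 - 12 * (v ^- 2 * E1) - 6 * (q v) ^+ 2 by rewrite /E1 /E2; field.
  have nv : 0 < normc v by rewrite normc_gt0.
  have H1' : normc (v ^- 2 * E1) <= M * normc v.
    rewrite normcM normcV normcX mulrC ler_pdivrMr ?exprn_gt0//.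
    by rewrite (le_trans H1)// exprS -mulrA.
  have H2' : normc (q v ^+ 2) <= M ^+ 2 * normc v.
    rewrite normcX (le_trans (lerXn2r 2 _ _ H2))// ?nnegrE ?normc_ge0 ?mulr_ge0 ?normc_ge0//.
    by rewrite exprMn ler_wpM2l ?exprn_ge0// expr2 ler_piMr// ?(ltW nv)// (le_trans vr).
  rewrite (le_trans (le_normcB _ _))//.
  have B := le_normcB (6 * E2) (12 * (v ^- 2 * E1)).
  have c6 (x : R[i]) : normc (6 * x) = 6 * normc x by rewrite normcM; congr (_ * _); exact: (normc_nat R 6).
  have c12 (x : R[i]) : normc (12 * x) = 12 * normc x by rewrite normcM; congr (_ * _); exact: (normc_nat R 12).
  rewrite c6 c12 in B; rewrite c6; lra.
have -> : eis 4 z = (6 * eis 4 z - 6 * wp z ^+ 2) / 6 + wp z ^+ 2 by field.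
by rewrite E; field.
Qed.

Section HalfPeriod.
Variable k : 'I_4.
Hypothesis k0 : k != 0.
Local Notation om := (half_period tau k).
Local Notation e := (wp om).

(** At the lattice the double pole of one factor meets a double zero of the other, with leading
    coefficient wp''(om)/2 = 3 [eis 4 om]. Translation by om exchanges the factors, so the estimate
    at 0 also covers the poles of wp(z + om). *)
Lemma wp_half_shift z : ~ Lam z -> ~ Lam (z + om) ->
  (wp (z + om) - e) * (wp z - e) = 3 * eis 4 om.
Proof.
have oml : ~ Lam om := half_period_notin htau k0.
have om2 := lattice_double_half tau k.
pose S : set R[i] := [set z | Lam z \/ Lam (z + om)].
pose f z := if `[< S z >] then 3 * eis 4 om else (wp (z + om) - e) * (wp z - e).
have fon y : S y -> f y = 3 * eis 4 om by rewrite /f; case: asboolP.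
have foff y : ~ S y -> f y = (wp (y + om) - e) * (wp y - e) by rewrite /f; case: asboolP.
have Sp w u : Lam w -> S (u + w) <-> S u.
  move=> wl; rewrite /S /= (addrAC u w); split=> -[H|H].
  - by left; rewrite -[u](addrK w); exact: latticeB.
  - by right; rewrite -[u + om](addrK w); exact: latticeB.
  - by left; exact: latticeD.
  - by right; exact: latticeD.
have fp w u : Lam w -> f (u + w) = f u.
  move=> wl; have [uS|uS] := pselect (S u); first by rewrite !fon//; exact/Sp.
  have uS' : ~ S (u + w) by move/Sp => /(_ wl).
  have [u1 u2] : ~ Lam u /\ ~ Lam (u + om) by split=> H; apply: uS; [left|right].
  by rewrite !foff// (addrAC u w) (wp_periodic htau wl u1) (wp_periodic htau wl u2).
have fom y : f (y + om) = f y.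
  have [yS|yS] := pselect (S y).
    rewrite !fon//; case: yS => H; [right|by left].
    by rewrite -addrA; exact: latticeD.
  have yS' : ~ S (y + om).
    move=> [H|H]; apply: yS; [by right|left].
    by rewrite -[y](addrK (om + om)) addrA; exact: latticeB.
  have y1 : ~ Lam y by move=> H; apply: yS; left.
  by rewrite !foff// -(addrA y om om) (wp_periodic htau om2 y1) mulrC.
have S0 : S 0 by left; exact: lattice_0.
have [s [N [s0 N0 hN]]] : exists s N : R, [/\ 0 < s, 0 <= N & forall v, normc v <= s ->
    ~ Lam (v + om) /\ normc (wp (v + om) - e - 3 * v ^+ 2 * eis 4 om) <= N * normc v ^+ 3].
  have [s s0 [N hN]] := wp_taylor htau oml; exists s, `|N|; split=> // v /hN[vl H].
  rewrite addrC; split=> //; rewrite eis3_half// mulr0 addr0 in H.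
  by rewrite (le_trans H)// ler_wpM2r ?exprn_ge0 ?normc_ge0// ler_norm.
have local0 : exists K r : R, [/\ 0 <= K, 0 < r &
     forall v, normc v < r -> normc (f v - f 0) <= K * normc v].
  have [r [M [r0 r1 M0 hM]]] := q_taylor.
  have ne := normc_ge0 e; have n4 := normc_ge0 (eis 4 om).
  exists (N + (3 * normc (eis 4 om) + N) * (M + normc e)), (Num.min r s); split.
  - by rewrite addr_ge0// mulr_ge0// addr_ge0// mulr_ge0.
  - by rewrite lt_min r0.
  move=> v; rewrite lt_min => /andP[/ltW vr /ltW vs].
  have [->|v0] := eqVneq v 0; first by rewrite subrr normc0 mulr0.
  have [vl _ H2 _] := hM v vr; have [vl' H] := hN v vs.
  rewrite (fon 0)// foff; last by case=> //; exact: vl.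
  rewrite [wp v]wpE; set E := wp _ - _ - _ in H.
  have -> : (wp (v + om) - e) * (v ^- 2 + q v - e) - 3 * eis 4 om =
    v ^- 2 * E + (3 * v ^+ 2 * eis 4 om + E) * (q v - e) by rewrite /E; field.
  have nv : 0 < normc v by rewrite normc_gt0.
  have v1 := le_trans vr r1.
  have H1' : normc (v ^- 2 * E) <= N * normc v.
    rewrite normcM normcV normcX mulrC ler_pdivrMr ?exprn_gt0//.
    by rewrite (le_trans H)// exprS -mulrA.
  have v2 : normc v ^+ 2 <= normc v by rewrite expr2 ler_piMr// ltW.
  have v3 : normc v ^+ 3 <= normc v.
    by rewrite exprS ler_piMr ?(ltW nv)// (le_trans v2).
  have D1 : normc (3 * v ^+ 2 * eis 4 om + E) <= (3 * normc (eis 4 om) + N) * normc v.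
    rewrite (le_trans (le_normcD _ _))// (normcM (3 * v ^+ 2)) (normcM 3) (normc_nat R 3) normcX [leRHS]mulrDl lerD//.
      by rewrite mulrAC ler_wpM2l// mulr_ge0.
    by rewrite (le_trans H)// ler_wpM2l.
  have D2 : normc (q v - e) <= M + normc e.
    rewrite (le_trans (le_normcB _ _))// lerD2r (le_trans H2)// ler_piMr//.
  rewrite (le_trans (le_normcD _ _))// [leRHS]mulrDl lerD// normcM [leRHS]mulrAC.
  by rewrite ler_pM ?normc_ge0.
have [d hf] : exists d, hol S f d.
  have h1 : hol S (fun y => wp (y + om)) (fun y => -2 * eis 3 (y + om)).
    by apply: hol_shift (hol_wp htau) => w wl; right; rewrite subrK.
  have h2 : hol S wp (fun y => -2 * eis 3 y) by apply: hol_incl (hol_wp htau) => w wl; left.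
  eexists; apply: hol_ext (holM (holB h1 (hol_cst S e)) (holB h2 (hol_cst S e))) => //.
  by move=> r y r0 /(away_notin r0) yl; rewrite foff.
move=> zl zl'; have zS : ~ S z by case.
rewrite -(foff z)// -(fon 0)//; apply: (elliptic_const _ hf fp).
- move=> y [yl|yl]; first exact: latticeD.
  rewrite /half_lattice /= (_ : y + y = (y + om) + (y + om) - (om + om)); last by ring.
  by apply: latticeB => //; exact: latticeD.
- move=> y yS; have y1 : ~ Lam y by move=> H; apply: yS; left.
  have y2 : ~ Lam (y + om) by move=> H; apply: yS; right.
  have [r r0 [ya yb]] := away_ex2 htau y1 y2; exists r => // w [wl|wl]; first exact: ya.
  by have := yb _ wl; rewrite (_ : y + om - (w + om) = y - w)//; ring.
- move=> y yS; have [K [r [K0 r0 hK]]] := local0; exists K, r; split=> // v vr.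
  have key y' : Lam y' -> normc (f (y' + v) - f y') <= K * normc v.
    by move=> y'l; have := fp _ 0 y'l; rewrite add0r => ->; rewrite (addrC y') fp// hK.
  case: yS => [/key//|yl].
  by rewrite -[f (y + v)]fom -[f y]fom addrAC; exact: key.
Qed.

Lemma eis4_half : 3 * eis 4 om = 3 * e ^+ 2 - g2 tau / 4.
Proof. by rewrite eis4_wp; [field|exact: half_period_notin]. Qed.

End HalfPeriod.
End EllipticIdentities.

(** * The half-periods are simple critical points of wp *)

Section Nonvanishing.
Variables (R : realType) (tau : R[i]).
Hypothesis htau : 0 < complex.Im tau.
Local Notation h := (complex.Im tau).
Local Notation Lam := (lattice tau).
Local Notation wp := (wp tau).
Local Notation eis := (eis tau).
Variable k : 'I_4.
Hypothesis k0 : k != 0.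
Local Notation om := (half_period tau k).
Local Notation e := (wp om).
Implicit Types (z w u v : R[i]) (f d : R[i] -> R[i]) (t : R).

Lemma ray_cderiv f d v t r : hol Lam f d -> 0 < r -> away Lam r (t%:C * v) ->
  cderiv (fun t => f (t%:C * v)) t (v * d (t%:C * v)).
Proof.
move=> hf r0 za; have [M [M0 hM]] := hol_ge0 (normc (t%:C * v)) hf r0.
have [_ _ H] := hM _ (lexx _) za; have nv := normc_ge0 v.
have v1 : 0 < 1 + normc v by rewrite ltr_wpDr.
apply: (@cderiv_quad _ _ _ _ (M * normc v ^+ 2) (r / 2 / (1 + normc v))); first by rewrite !divr_gt0.
move=> s; rewrite ltr_pdivlMr// => sr; rewrite rmorphD/= mulrDl mulrA.
have := H (s%:C * v); rewrite normcM normcR exprMn real_normK ?num_real// mulrA.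
rewrite [M * _ * _]mulrAC; apply; have := normr_ge0 s; nra.
Qed.

Lemma coord_half : `|scoord tau om| <= 1/2 /\ `|tcoord tau om| <= 1/2.
Proof.
pose a : int := nth 0 [:: 0; 1; 0; 1] k; pose b : int := nth 0 [:: 0; 0; 1; 1] k.
have E : om + om = lattice_point tau a b by rewrite half_periodE -splitr.
have sa : scoord tau om + scoord tau om = a%:~R by rewrite -scoordD E scoord_lp.
have tb : tcoord tau om + tcoord tau om = b%:~R by rewrite -tcoordD E tcoord_lp.
have bnd (c : int) (x : R) : c = 0 \/ c = 1 -> x + x = c%:~R -> `|x| <= 1/2.
  by case=> -> E'; rewrite ler_norml; apply/andP; split; move: E'; rewrite ?mulr0z ?mulr1z; lra.
have ha : a = 0 \/ a = 1 by rewrite /a; case: (k) => -[|[|[|[|//]]]] /= _; [left|right|left|right].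
have hb : b = 0 \/ b = 1 by rewrite /b; case: (k) => -[|[|[|[|//]]]] /= _; [left|left|right|right].
by split; [exact: bnd ha sa|exact: bnd hb tb].
Qed.

(** The segment stays in the centred cell, far from the nonzero lattice points; its distance to 0 is
    t0 |om|. *)
Lemma ray_away (t0 : R) : 0 < t0 -> exists2 r : R, 0 < r & forall t, t0 <= t <= 1 ->
  away Lam r (t%:C * om).
Proof.
move=> t00; have [r r0 hr] := away_lattice0_center htau.
have [s2 t2] := coord_half.
have om0 : 0 < normc om.
  rewrite normc_gt0; apply/eqP => E; apply: (half_period_notin htau k0); rewrite E.
  exact: lattice_0.
exists (Num.min r (t0 * normc om)); first by rewrite lt_min r0 mulr_gt0.
move=> t /andP[tt0 t1] w wl; have tge0 : 0 <= t by rewrite (le_trans (ltW t00)).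
rewrite ge_min; have [->|w0] := eqVneq w 0.
  by apply/orP; right; rewrite subr0 (normcM t%:C) normcR ger0_norm// ler_wpM2r// ltW.
apply/orP; left; apply: hr.
- have -> : scoord tau (t%:C * om) = t * scoord tau om by rewrite /scoord cReMr cImMr; ring.
  by rewrite normrM ger0_norm// (le_trans _ s2)// ler_piMl.
- have -> : tcoord tau (t%:C * om) = t * tcoord tau om by rewrite /tcoord cImMr mulrA.
  by rewrite normrM ger0_norm// (le_trans _ t2)// ler_piMl.
by case: wl => m [n wE]; exists m, n.
Qed.

Lemma dot_ge (x y : R[i]) :
  - (normc x * normc y) <= complex.Re x * complex.Re y + complex.Im x * complex.Im y.
Proof.
have nc : normc x^* = normc x by case: x => a b; rewrite !normcE/= sqrrN.
have -> : complex.Re x * complex.Re y + complex.Im x * complex.Im y = complex.Re (x^* * y).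
  by case: x {nc} => a b; case: y => c d /=; ring.
rewrite lerNl (le_trans (ler_norm _))// normrN (le_trans (ler_normRe _))//.
by rewrite normcM nc.
Qed.

(* If [eis 4] vanished at the half period, [wp - e] and [eis 3] would solve a
   linear system along the ray from [om] to the pole [0] with zero data at
   [om], hence vanish there. *)
Lemma ray_gronwall (t0 : R) : eis 4 om = 0 -> 0 < t0 -> t0 <= 1 -> wp (t0%:C * om) = e.
Proof.
move=> e4 t00 t01.
have g2E : g2 tau / 12 = e ^+ 2.
  by have := eis4_wp htau (half_period_notin htau k0); rewrite e4 => /esym/eqP; rewrite subr_eq0 => /eqP.
have [r r0 ra] := ray_away t00.
have [M1 [M10 hM1]] := hol_ge0 (normc om) (hol_wp htau) r0.
pose A t := wp (t%:C * om) - e; pose B t := eis 3 (t%:C * om).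
pose A' t := om * (-2 * B t - 0); pose B' t := om * (-3 * (A t * (wp (t%:C * om) + e))).
have nl t : t0 <= t <= 1 -> ~ Lam (t%:C * om) by move=> /ra; exact: away_notin.
have dA t : t0 <= t <= 1 -> cderiv A t (A' t).
  by move=> tI; exact: (ray_cderiv (holB (hol_wp htau) (hol_cst Lam e)) r0 (ra t tI)).
(* If [eis 4 om] = 0 then g2/12 = e^2, so [eis 4] = (wp - e)(wp + e) and the system is linear in (A,
   B) with bounded coefficients. *)
have dB t : t0 <= t <= 1 -> cderiv B t (B' t).
  move=> tI; have := ray_cderiv (hol_eis3 htau) r0 (ra t tI).
  rewrite (eis4_wp htau (nl t tI)) g2E /B' /A.
  by rewrite (_ : (wp (t%:C * om) - e) * (wp (t%:C * om) + e) = wp (t%:C * om) ^+ 2 - e ^+ 2)//; ring.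
pose N := M1 + normc e.
have N0 : 0 <= N by rewrite addr_ge0// normc_ge0.
have hN t : t0 <= t <= 1 -> normc (wp (t%:C * om) + e) <= N.
  move=> tI; have [|H _ _] := hM1 (t%:C * om) _ (ra t tI).
    have /andP[a b] := tI; rewrite (normcM t%:C) normcR ger0_norm ?(le_trans (ltW t00))//.
    by rewrite ler_piMl// normc_ge0.
  by rewrite (le_trans (le_normcD _ _))// lerD2r.
pose K := normc om * (2 + 3 * N).
pose U t := complex.Re (A t) * complex.Re (A t) + complex.Im (A t) * complex.Im (A t) +
  (complex.Re (B t) * complex.Re (B t) + complex.Im (B t) * complex.Im (B t)).
pose DU t := 2 * (complex.Re (A t) * complex.Re (A' t) + complex.Im (A t) * complex.Im (A' t) +
  (complex.Re (B t) * complex.Re (B' t) + complex.Im (B t) * complex.Im (B' t))).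
(* U = |A|^2 + |B|^2 satisfies U' >= -K U because 2|A||B| <= U. So [phi] is nondecreasing; it
   vanishes at t = 1, which forces U(t0) = 0. *)
pose phi t := U t * expR (K * t); pose dphi t := (DU t + K * U t) * expR (K * t).
have dphiP t : t0 <= t <= 1 -> is_derive t 1 phi (dphi t).
  move=> tI; have [da1 da2] := dA t tI; have [db1 db2] := dB t tI.
  have dK : is_derive t 1 (fun t => K * t) K.
    by have := is_deriveZ K (is_derive_id t (1 : R)); rewrite /GRing.scale/= mulr1; exact.
  have dE := @is_derive1_comp R expR (fun t => K * t) t _ _ (is_derive_expR (K * t)) dK.
  have H := is_deriveM (is_deriveD (is_deriveD (is_deriveM da1 da1) (is_deriveM da2 da2))
    (is_deriveD (is_deriveM db1 db1) (is_deriveM db2 db2))) dE.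
  move: H; set F := (X in is_derive _ _ X _) => H.
  have -> : phi = F by apply/funext => s; rewrite /F /phi /U.
  apply: is_derive_eq H _.
  rewrite /dphi /DU /U !fctE /GRing.scale /=.
  move: (A t) (B t) (A' t) (B' t) (expR (K * t)) => [a1 a2] [b1 b2] [c1 c2] [d1 d2] E /=; ring.
have sq (x : R[i]) : complex.Re x * complex.Re x + complex.Im x * complex.Im x = normc x ^+ 2.
  by rewrite sqr_normcE !expr2.
have dpos t : t0 <= t <= 1 -> 0 <= dphi t.
  move=> tI; rewrite mulr_ge0 ?expR_ge0// /DU /U !sq.
  have h1 := dot_ge (A t) (A' t); have h2 := dot_ge (B t) (B' t).
  have n1 : normc (A' t) = 2 * (normc om * normc (B t)).
    by rewrite /A' subr0 (normcM om) (normcM (-2)) normcN (normc_nat R 2) mulrCA.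
  have n2 : normc (B' t) <= 3 * (normc om * (normc (A t) * N)).
    rewrite /B' (normcM om) (normcM (-3)) normcN (normc_nat R 3) (normcM (A t)) mulrCA ler_wpM2l//.
    by rewrite ler_wpM2l ?normc_ge0// ler_wpM2l ?normc_ge0// hN.
  have a0 := normc_ge0 (A t); have b0 := normc_ge0 (B t); have o0 := normc_ge0 om.
  rewrite n1 in h1.
  have h2' : - (normc (B t) * (3 * (normc om * (normc (A t) * N)))) <=
      complex.Re (B t) * complex.Re (B' t) + complex.Im (B t) * complex.Im (B' t).
    by apply: le_trans h2; rewrite lerN2 ler_wpM2l.
  have cs : 0 <= normc om * (2 + 3 * N) * (normc (A t) - normc (B t)) ^+ 2.
    by rewrite mulr_ge0 ?sqr_ge0// mulr_ge0// addr_ge0// mulr_ge0.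
  move: h1 h2' cs; rewrite /K.
  set X := complex.Re (A t) * _ + _; set Y := complex.Re (B t) * _ + _.
  move: (normc (A t)) (normc (B t)) (normc om) => x y o; lra.
have cphi : {within `[t0, 1], continuous phi}.
  apply: continuous_in_subspaceT => t; rewrite inE/= in_itv/= => tI.
  by apply/differentiable_continuous/derivable1_diffP; case: (dphiP t tI).
have [c cI E] := @MVT_segment R phi dphi t0 1 t01
  (fun t tI => dphiP t (subset_itv_oo_cc tI)) cphi.
have A1 : A 1 = 0 by rewrite /A mul1r subrr.
have B1 : B 1 = 0 by rewrite /B mul1r eis3_half.
have p1 : phi 1 = 0 by rewrite /phi /U A1 B1 !sq normc0 expr0n addr0 mul0r.
have : phi t0 <= 0.
  have Q : 0 <= phi 1 - phi t0.
    rewrite E; apply: mulr_ge0; last by rewrite subr_ge0.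
    by apply: dpos; move: cI; rewrite in_itv.
  by move: Q; rewrite p1 sub0r oppr_ge0.
rewrite /phi pmulr_lle0 ?expR_gt0// /U !sq => H.
have : normc (A t0) ^+ 2 <= 0 by rewrite (le_trans _ H)// lerDl exprn_ge0// normc_ge0.
rewrite exprn_even_le0//= normc_eq0 /A subr_eq0 => /eqP; exact.
Qed.

(** Otherwise wp would keep the value e on the ray from om towards 0, arbitrarily close to its
    pole. *)
Lemma half_const_neq0 : 3 * e ^+ 2 - g2 tau / 4 != 0.
Proof.
rewrite -eis4_half//; apply/eqP => /eqP; rewrite mulf_eq0 pnatr_eq0/= => /eqP e4.
have [r [M [r0 r1 M0 hM]]] := q_taylor htau.
have om0 : 0 < normc om.
  rewrite normc_gt0; apply/eqP => E; apply: (half_period_notin htau k0); rewrite E.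
  exact: lattice_0.
have ne := normc_ge0 e.
have L0 : 0 < normc e + M + 1 by lra.
(* Within this radius |v|^-2 >= |v|^-1 >= |e| + M + 1, whereas wp v = e would give |v|^-2 <= |e| +
   M. *)
pose dl := Num.min r (normc e + M + 1)^-1.
have dl0 : 0 < dl by rewrite lt_min r0 invr_gt0.
pose t0 := Num.min 1 (dl / normc om).
have t00 : 0 < t0 by rewrite lt_min ltr01 divr_gt0.
have t01 : t0 <= 1 by rewrite ge_min lexx.
have E := ray_gronwall e4 t00 t01.
set v := t0%:C * om in E.
have nv : normc v = t0 * normc om by rewrite (normcM t0%:C) normcR gtr0_norm.
have v0 : 0 < normc v by rewrite nv mulr_gt0.
have vd : normc v <= dl by rewrite nv -ler_pdivlMr// ge_min lexx orbT.
have vr : normc v <= r by rewrite (le_trans vd)// ge_min lexx.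
have v1 : normc v <= 1 by rewrite (le_trans vr).
have vL : normc e + M + 1 <= (normc v)^-1.
  by rewrite -[leLHS]invrK lef_pV2 ?posrE ?invr_gt0// (le_trans vd)// ge_min lexx orbT.
have [_ _ H _] := hM v vr.
have : normc (v ^- 2) <= normc e + M.
  rewrite (_ : v ^- 2 = e - wp_reg tau v); last by rewrite -E wpE; ring.
  by rewrite (le_trans (le_normcB _ _))// lerD2l (le_trans H)// ler_piMr.
have : (normc v)^-1 <= normc (v ^- 2).
  by rewrite normcV normcX lef_pV2 ?posrE ?exprn_gt0// expr2 ler_piMr// ltW.
lra.
Qed.

End Nonvanishing.

(** * Boundaries of discs and half-planes, and circles of Apollonius *)

Section Boundary.
Variable R : realType.
Implicit Types (x y c a : R[i]) (A : set R[i]).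

(** A positive element of [R[i]] is real, so neighbourhoods can be described with real radii. *)
Lemma nbhs_normcP x A : nbhs (x : R[i]^o) A <->
  exists2 e : R, 0 < e & forall y, normc (x - y) < e -> A y.
Proof.
split=> [/nbhs_ballP[e /= e0 he]|[e e0 he]].
  have eE : e = (complex.Re e)%:C.
    by move: e0; rewrite ltcE => /andP[/eqP ei _]; apply: complex_eqP.
  exists (complex.Re e); first by move: e0; rewrite eE ltcR.
  by move=> y xy; apply: he; rewrite -ball_normE/= normc_normr eE ltcR.
apply/nbhs_ballP; exists e%:C; first by rewrite /= ltcR.
by move=> y; rewrite -ball_normE/= normc_normr ltcR; exact: he.
Qed.

Lemma boundaryP A x : boundary A x <-> forall e : R, 0 < e ->
  (exists2 y, A y & normc (x - y) < e) /\ (exists2 y, ~ A y & normc (x - y) < e).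
Proof.
split=> [[cA nA] e e0|H].
  split.
    have [|y [Ay yB]] := cA [set y | normc (x - y) < e]; last by exists y.
    by apply/nbhs_normcP; exists e.
  apply: contrapT => ne; apply: nA; apply/nbhs_normcP; exists e => // y xy.
  by apply: contrapT => Ay; apply: ne; exists y.
split=> [B /nbhs_normcP[e e0 he]|/nbhs_normcP[e e0 he]].
  by have [[y Ay xy] _] := H e e0; exists y; split=> //; exact: he.
by have [_ [y Ay xy]] := H e e0; apply: Ay; exact: he.
Qed.

Lemma boundary_disc c (rho : R) x : 0 < rho ->
  boundary [set z | normc (z - c) < rho] x <-> normc (x - c) = rho.
Proof.
move=> rho0; split=> [/boundaryP H|E].
  have tri y : normc (x - c) <= normc (x - y) + normc (y - c) /\
      normc (y - c) <= normc (x - y) + normc (x - c).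
    split; first by rewrite (_ : x - c = (x - y) + (y - c)) ?le_normcD//; ring.
    by rewrite (_ : y - c = (x - c) - (x - y)) ?(addrC (normc (x - y))) ?le_normcB//; ring.
  have [lt|gt|//] := ltgtP (normc (x - c)) rho.
    have [_ [y /= Ay xy]] := H (rho - normc (x - c)) (ltac:(by rewrite subr_gt0)).
    by case: Ay; have [_] := tri y; lra.
  have [[y /= Ay xy] _] := H (normc (x - c) - rho) (ltac:(by rewrite subr_gt0)).
  by have [+ _] := tri y; lra.
apply/boundaryP => e e0; split; last by exists x; rewrite /= ?subrr ?normc0// E ltxx.
pose t := Num.min 1 (e / (2 * rho)).
have t0 : 0 < t by rewrite lt_min ltr01 divr_gt0// mulr_gt0.
have t1 : t <= 1 by rewrite ge_min lexx.
have te : t * rho <= e / 2.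
  rewrite -ler_pdivlMr// (_ : e / 2 / rho = e / (2 * rho)); first by rewrite ge_min lexx orbT.
  by field; rewrite lt0r_neq0.
exists (x - t%:C * (x - c)).
  suff : normc (x - t%:C * (x - c) - c) < rho by [].
  have -> : x - t%:C * (x - c) - c = (1 - t)%:C * (x - c) by rewrite rmorphB/=; ring.
  rewrite normcM normcR E ger0_norm ?subr_ge0//; nra.
rewrite (_ : x - _ = t%:C * (x - c)); last by ring.
by rewrite normcM normcR E gtr0_norm//; lra.
Qed.

Lemma boundary_halfplane a c (m : R) x : a != 0 ->
  boundary [set z | m < complex.Re (a * (z - c))] x <-> complex.Re (a * (x - c)) = m.
Proof.
move=> a0; have na : 0 < normc a by rewrite normc_gt0.
split=> [/boundaryP H|E].
  have lip y : `|complex.Re (a * (x - c)) - complex.Re (a * (y - c))| <= normc a * normc (x - y).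
    rewrite -cReN -cReD -mulrBr (_ : x - c - (y - c) = x - y); last by ring.
    by rewrite -normcM ler_normRe.
  have [lt|gt|//] := ltgtP (complex.Re (a * (x - c))) m.
    have [[y /= Ay xy] _] := H ((m - complex.Re (a * (x - c))) / normc a) (ltac:(by rewrite divr_gt0// subr_gt0)).
    rewrite ltr_pdivlMr// mulrC in xy; have := lip y; rewrite ler_norml => /andP[]; lra.
  have [_ [y /= Ay xy]] := H ((complex.Re (a * (x - c)) - m) / normc a) (ltac:(by rewrite divr_gt0// subr_gt0)).
  rewrite ltr_pdivlMr// mulrC in xy; case: Ay; have := lip y; rewrite ler_norml => /andP[]; lra.
apply/boundaryP => e e0; split; last by exists x; rewrite /= ?subrr ?normc0// E ltxx.
have nc : normc a^* = normc a by case: a {a0 na E} => p q; rewrite !normcE/= sqrrN.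
pose s := e / (2 * normc a); have s0 : 0 < s by rewrite divr_gt0// mulr_gt0.
(* The real part of a z grows fastest in the direction of the conjugate of a. *)
exists (x + s%:C * a^*).
  suff : m < complex.Re (a * (x + s%:C * a^* - c)) by [].
  have -> : a * (x + s%:C * a^* - c) = a * (x - c) + s%:C * (a * a^*) by ring.
  rewrite cReD E ltrDl (_ : a * a^* = (normc a ^+ 2)%:C).
    by rewrite -rmorphM/= mulr_gt0// exprn_gt0.
  by case: (a) => p q; rewrite sqr_normcE; apply: complex_eqP; rewrite /=; ring.
have -> : x - (x + s%:C * a^*) = - (s%:C * a^*) by ring.
have sE : s * normc a = e / 2 by rewrite /s; field; exact: lt0r_neq0.
by rewrite normcN normcM normcR gtr0_norm// nc sE; lra.
Qed.

(* An Apollonius circle or a line in [x]. *)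
Lemma apollonius (al : R[i]) (be : R) x (s := normc al ^+ 2 - be ^+ 2) : 0 < be ->
  normc (1 - al * x) = be * normc x <->
  if normc al == be then complex.Re (al * x) = 1 / 2
  else normc (x - al^* / s%:C) = be / `|s|.
Proof.
move=> be0; have sqE (p q : R) : 0 <= p -> 0 <= q -> p = q <-> p ^+ 2 = q ^+ 2.
  by move=> p0 q0; split=> [->//|/eqP]; rewrite eqrXn2// => /eqP.
have step1 : normc (1 - al * x) = be * normc x <->
    normc (1 - al * x) ^+ 2 = be ^+ 2 * normc x ^+ 2.
  by rewrite -exprMn; apply: sqE; [exact: normc_ge0|rewrite mulr_ge0 ?normc_ge0// ltW].
(* Squared, the condition reads s |x|^2 - 2 Re(al x) + 1 = 0. It is a line if s = 0; otherwise
   completing the square gives the circle, since |al|^2 - s = be^2. *)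
apply: (iff_trans step1); rewrite (sqr_normcE (1 - _)) (sqr_normcE x).
case: eqP => [ab|/eqP ab].
  rewrite -ab sqr_normcE; case: al {s ab step1} => p q; case: x => u v /=; split=> H; lra.
have s0 : s != 0.
  by rewrite /s subr_eq0 eqrXn2// ?normc_ge0 ?(ltW be0).
have step2 : normc (x - al^* / s%:C) = be / `|s| <->
    normc (x - al^* / s%:C) ^+ 2 = be ^+ 2 / s ^+ 2.
  rewrite -(real_normK (num_real s)) -exprVn -exprMn.
  by apply: sqE; [exact: normc_ge0|rewrite divr_ge0// ltW].
apply: (iff_trans _ (iff_sym step2)); clear step1 step2.
rewrite (sqr_normcE (x - _)) -fmorphV; have := erefl s; rewrite {2}/s sqr_normcE.
move: s s0; case: al ab => p q _; case: x => u v /= s s0 sE.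
have b2 : be ^+ 2 = p ^+ 2 + q ^+ 2 - s by rewrite sE; ring.
rewrite b2; split=> H.
  have : (s * (u ^+ 2 + v ^+ 2) - 2 * (p * u - q * v) + 1) / s = 0.
    by rewrite (_ : _ + 1 = 0) ?mul0r//; move: H; lra.
  move=> Z; apply/eqP; rewrite -subr_eq0; apply/eqP; apply: etrans Z; field; exact: s0.
have : (s * (u ^+ 2 + v ^+ 2) - 2 * (p * u - q * v) + 1) / s = 0.
  move/eqP: H; rewrite -subr_eq0 => /eqP Z; apply: etrans Z; field; exact: s0.
move/eqP; rewrite mulf_eq0 invr_eq0 (negbTE s0) orbF => /eqP; lra.
Qed.

End Boundary.

(** * The degeneracy criterion at each half-period *)

Theorem theorem1p9 (R : realType) (tau : R[i]) (G : R[i] -> R) (p : R[i])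
    (k : 'I_4) (htau : 0 < complex.Im tau) (hG : is_green tau G)
    (hp : ~ two_torsion tau p) :
  degenerate_critical_point (green_pair G p) (half_period tau k) <->
  boundary (region tau k) (wp tau p).
Proof.
apply: (iff_trans (hess_iff htau hG hp k)).
have rho0 : 0 < pi / complex.Im tau by rewrite divr_gt0 ?pi_gt0.
have [->|k0] := eqVneq k 0.
  have -> : half_period tau 0 = 0 by rewrite /half_period /omega/= mul0r.
  have -> : region tau 0 = [set z | normc (z - (pi_over_area tau - eta1 tau)) < pi / complex.Im tau].
    by apply/seteqP; split=> z; rewrite /region eqxx /= normc_normr ltcR.
  apply: iff_trans (iff_sym (boundary_disc _ _ rho0)).
  by rewrite addr0 opprB addrA.
have D0 := half_const_neq0 htau k0.
have pl : ~ lattice tau p.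
  move=> pl; apply: hp; exists 0; rewrite (_ : half_period tau 0 = 0) ?subr0//.
  by rewrite /half_period /omega/= mul0r.
have pD := wp_half_shift htau k0 pl (half_pD hp (k := k)).
rewrite eis4_half// in pD.
have X0 : wp tau p - e_ tau k != 0.
  by apply/eqP => X0; move/eqP: pD; rewrite -/(e_ tau k) X0 mulr0 eq_sym (negbTE D0).
set e := e_ tau k in X0; set x := wp tau p - e in X0.
set D := 3 * e ^+ 2 - g2 tau / 4.
have {}D0 : D != 0 by [].
have E : wp tau (p + half_period tau k) = e + D / x.
  have -> : D = (wp tau (p + half_period tau k) - e) * x by exact: (esym pD).
  by rewrite mulfK// [RHS]addrC subrK.
pose al := alpha tau k; pose be := pi / complex.Im tau / normc D.
have nD : 0 < normc D by rewrite normc_gt0.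
have nx : 0 < normc x by rewrite normc_gt0.
have be0 : 0 < be by rewrite divr_gt0.
have alE : al = ((pi / complex.Im tau)%:C - (eta1 tau + e)) / D by [].
have beE : beta tau k = be%:C.
  by rewrite /beta normc_normr -/e -/D /pi_over_area /be -fmorphV -rmorphM.
have field_id (a b c X Y : R[i]) : X != 0 -> Y != 0 ->
    a + Y / X + b - c = Y / X * (1 - (c - (b + a)) / Y * X).
  by move=> hX hY; field; rewrite hX hY.
(* This factorization is the origin of alpha_k. Division by |D/x| then yields beta_k times |x|, with
   x = wp(p) - e_k. *)
rewrite E; have -> : e + D / x + eta1 tau - (pi / complex.Im tau)%:C = D / x * (1 - al * x).
  by rewrite alE; exact: field_id.
have -> : normc (D / x * (1 - al * x)) = pi / complex.Im tau <-> normc (1 - al * x) = be * normc x.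
  rewrite !normcM normcV /be; split=> [<-|->].
    by field; rewrite !lt0r_neq0.
  by field; rewrite !lt0r_neq0.
apply: (iff_trans (apollonius al x be0)).
have condE : (`|alpha tau k| == beta tau k) = (normc al == be).
  by rewrite beE normc_normr (inj_eq (@complexI R)).
rewrite /region (negbTE k0) /= condE -/al beE -/e; case: ifP => [/eqP ab|/negbT ab].
  have al0 : al != 0 by rewrite -normc_gt0 ab.
  by apply: iff_trans (iff_sym (boundary_halfplane e (1 / 2) (wp tau p) al0)).
pose s := normc al ^+ 2 - be ^+ 2.
have s0 : s != 0 by rewrite /s subr_eq0 eqrXn2// ?normc_ge0 ?(ltW be0).
have r0 : 0 < be / `|s| by rewrite divr_gt0// normr_gt0.
have sE : `|al| ^+ 2 - be%:C ^+ 2 = s%:C by rewrite normc_normr -!rmorphXn -rmorphB.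
have sN : normc s%:C = `|s| by rewrite normcR.
have rE : be%:C / `|s%:C| = (be / `|s|)%:C by rewrite normc_normr sN -fmorphV -rmorphM.
have -> : [set z | `|z - e - al^* / (`|al| ^+ 2 - be%:C ^+ 2)| < be%:C / `| `|al| ^+ 2 - be%:C ^+ 2 | ] =
    [set z | normc (z - (e + al^* / s%:C)) < be / `|s|].
  have cE (z : R[i]) : z - (e + al^* / s%:C) = z - e - al^* / s%:C by rewrite opprD addrA.
  by apply/seteqP; split=> z; rewrite /mkset sE rE normc_normr ltcR cE.
apply: iff_trans (iff_sym (boundary_disc _ _ r0)).
by rewrite opprD addrA.
Qed.
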